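(* Let $a>0$, $a\neq 1$, and assume $0<s<\min\{a/4,1/4\}$. Let $\{t_n\}_{n=1}^\infty$ be a decreasing sequence of real numbers with $\lim_{n\to\infty}t_n=0$ and assume that the sequence $\{t_n-t_{n+1}\}_{n=1}^\infty$ is also decreasing. Then the following four statements are equivalent. (a) The sequence $\{t_n\}$ belongs to $\ell^{r(s),\infty}(\mathbb{N})$, where $r(s)=\frac{2s}{a-4s}$. (b) There is a constant $C_1$ such that for all $f\in H^s(\mathbb{R})$ and for all (measurable) sets $B\subset\mathbb{R}$ of diameter at most $1$ we have $$\Big\|\sup_{n\in\mathbb{N}}|S^af(\cdot,t_n)|\Big\|_{L^2(B)}\le C_1\|f\|_{H^s}.$$ (c) There is a constant $C_2$ such that for all $f\in H^s(\mathbb{R})$, for all (measurable) sets $B\subset\mathbb{R}$ of diameter at most $1$, and for all $\alpha>0$, $$\mathrm{meas}\big(\{x\in B:\sup_{n\in\mathbb{N}}|S^af(x,t_n)|>\alpha\}\big)\le C_2\,\alpha^{-2}\|f\|_{H^s}^2.$$ (d) For every $f\in H^s(\mathbb{R})$ we have $\lim_{n\to\infty}S^af(x,t_n)=f(x)$ for almost every $x\in\mathbb{R}$.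
   Context: ''Decreasing'' means nonincreasing. $\mathrm{meas}$ is Lebesgue measure on $\mathbb{R}$. The Fourier transform is $\widehat f(\xi)=\int_{\mathbb{R}}f(x)e^{-ix\xi}\,dx$. The Sobolev space $H^s=H^s(\mathbb{R})$ consists of all distributions $f$ with $\|f\|_{H^s}:=\big(\int(1+|\xi|^2)^s|\widehat f(\xi)|^2\,d\xi\big)^{1/2}<\infty$. For $a>0$ the generalized Schrödinger means are $$S^af(x,t)=\int_{\mathbb{R}}e^{i(x\xi+t|\xi|^a)}\widehat f(\xi)\,\frac{d\xi}{2\pi}$$ for Schwartz functions $f$; for fixed $t$ the operator $f\mapsto S^af(\cdot,t)$ extends to all $f\in H^s$ (as the Fourier multiplier operator with multiplier $e^{it|\xi|^a}$). For $0<r<\infty$, $\{t_n\}\in\ell^{r,\infty}(\mathbb{N})$ means $\sup_{b>0}b^r\,\#\{n\in\mathbb{N}:|t_n|>b\}<\infty$. *)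

(* Defs.v *)
From HB Require Import structures.
From mathcomp Require Import all_boot all_order all_algebra.
From mathcomp Require Import all_classical all_reals all_analysis.
From mathcomp Require Import complex.

Set Implicit Arguments.
Unset Strict Implicit.
Unset Printing Implicit Defensive.

Import Order.TTheory GRing.Theory Num.Theory.
Import numFieldNormedType.Exports.
Import Normc.

Local Open Scope classical_set_scope.
Local Open Scope ring_scope.
Local Open Scope complex_scope.

Definition expi (R : realType) (theta : R) : R[i] := cos theta +i* sin theta.

(* The libraries put no measurable structure on R[i] and define no integral of
   complex-valued functions: both are taken on real and imaginary parts. *)
Definition cmeasurable (R : realType) (f : R -> R[i]) : Prop :=
  measurable_fun [set: R] (fun x => complex.Re (f x)) /\
  measurable_fun [set: R] (fun x => complex.Im (f x)).

Definition cintegrable (R : realType) (f : R -> R[i]) : Prop :=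
  (@lebesgue_measure R).-integrable [set: R]
    (fun x => (complex.Re (f x))%:E) /\
  (@lebesgue_measure R).-integrable [set: R]
    (fun x => (complex.Im (f x))%:E).

Definition cintegral (R : realType) (f : R -> R[i]) : R[i] :=
  Rintegral (@lebesgue_measure R) [set: R] (fun x => complex.Re (f x)) +i*
  Rintegral (@lebesgue_measure R) [set: R] (fun x => complex.Im (f x)).

Definition cderiven (R : realType) (n : nat) (f : R -> R[i]) (x : R) : R[i] :=
  derive1n n (fun y => complex.Re (f y)) x +i*
  derive1n n (fun y => complex.Im (f y)) x.

Definition csmooth (R : realType) (f : R -> R[i]) : Prop :=
  forall (n : nat) (x : R),
    derivable (derive1n n (fun y => complex.Re (f y))) x 1 /\
    derivable (derive1n n (fun y => complex.Im (f y))) x 1.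

Definition schwartz_seminorm (R : realType) (k j : nat) (phi : R -> R[i]) :
    \bar R :=
  ereal_sup (range (fun x : R => (`|x| ^+ k * normc (cderiven j phi x))%:E)).

Definition schwartz (R : realType) (phi : R -> R[i]) : Prop :=
  csmooth phi /\ forall k j : nat, (schwartz_seminorm k j phi < +oo)%E.

Definition fourier (R : realType) (phi : R -> R[i]) (xi : R) : R[i] :=
  cintegral (fun x : R => phi x * expi (- (x * xi))).

Definition ifourier (R : realType) (phi : R -> R[i]) (x : R) : R[i] :=
  cintegral (fun xi : R => expi (x * xi) * phi xi) / (2 * pi)%:C.

(* A distribution is represented by a functional on all functions R -> R[i];
   only its values on Schwartz functions are ever relevant. *)
Definition distribution_on (R : realType) : Type := (R -> R[i]) -> R[i].

(* Continuity with respect to the Schwartz seminorms is stated in its usual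
   finite-order form. *)
Definition tempered (R : realType) (u : distribution_on R) : Prop :=
  (forall (c : R[i]) (phi psi : R -> R[i]), schwartz phi -> schwartz psi ->
     u (fun x => c * phi x + psi x) = c * u phi + u psi) /\
  (exists (N : nat) (C : R), forall phi : R -> R[i], schwartz phi ->
     ((normc (u phi))%:E <=
        C%:E * \sum_(k < N) \sum_(j < N) schwartz_seminorm k j phi)%E).

Definition dist_of_fun (R : realType) (f : R -> R[i]) : distribution_on R :=
  fun phi => cintegral (fun x => f x * phi x).

Definition dist_fourier (R : realType) (u : distribution_on R) :
    distribution_on R := fun phi => u (fourier phi).

Definition dist_ifourier (R : realType) (u : distribution_on R) :
    distribution_on R := fun phi => u (ifourier phi).

Definition represents (R : realType) (f : R -> R[i]) (u : distribution_on R) :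
    Prop :=
  cmeasurable f /\
  forall phi : R -> R[i], schwartz phi ->
    cintegrable (fun x => f x * phi x) /\ u phi = dist_of_fun f phi.

(* A function with which u is identified; it is unique up to a null set when
   it exists, and is 0 by convention otherwise. *)
Definition fun_of_dist (R : realType) (u : distribution_on R) : R -> R[i] :=
  xget (fun=> 0) [set f | represents f u].

Definition sobolev_norm (R : realType) (s : R) (u : distribution_on R) :
    \bar R :=
  ((\int[@lebesgue_measure R]_(xi in [set: R])
     ((1 + `|xi| ^+ 2) `^ s *
      normc (fun_of_dist (dist_fourier u) xi) ^+ 2)%:E) `^ 2^-1)%E.

Definition sobolev (R : realType) (s : R) (u : distribution_on R) : Prop :=
  [/\ tempered u,
      exists g : R -> R[i], represents g (dist_fourier u)
    & (sobolev_norm s u < +oo)%E].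

(* The Fourier multiplier operator with multiplier exp(i t |xi|^a). *)
Definition schrodinger (R : realType) (a : R) (u : distribution_on R)
    (x t : R) : R[i] :=
  fun_of_dist (dist_ifourier (dist_of_fun (fun xi : R =>
    expi (t * `|xi| `^ a) * fun_of_dist (dist_fourier u) xi))) x.

Definition schrodinger_max (R : realType) (a : R) (t : nat -> R)
    (u : distribution_on R) (x : R) : \bar R :=
  ereal_sup (range (fun n : nat => (normc (schrodinger a u x (t n)))%:E)).

Definition weak_ell (R : realType) (r : R) (t : nat -> R) : Prop :=
  (ereal_sup [set ((b `^ r)%:E * counting [set n : nat | (b < `|t n|)%R])%E
             | b in [set b : R | (0 < b)%R]] < +oo)%E.

Definition diam_le1 (R : realType) (B : set R) : Prop :=
  forall x y : R, B x -> B y -> `|x - y| <= 1.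

(* Main.v *)
(* (a) => (b): split the frequencies into dyadic shells |xi| ~ 2^k. On a shell, linearize the
   supremum over times in [0, b] by a measurable choice of n(x) and apply the T T* method: van der
   Corput bounds the kernel, and Schur's test gives the bound 2^(2ks) when b = 2^(-k(a - 4s)). For
   the finitely many t_n > b, weak l^r makes sums over n (with weights) converge.
   (b) => (c) is Chebyshev's inequality, and (c) => (d) holds since convergence is obvious for
   compactly supported fhat.
   (d) => (a): if (a) fails, convexity of t gives arbitrarily small t_n with gaps
   t_n - t_(n+1) << t_n^(1+r). Unit bumps placed in arithmetic progression near a suitable
   frequency l, with b = t_n tuned to l, are in phase at every x in [0, 1] for some time
   in [b / 2, b], so at some t_m too; a gliding hump sums such functions to an f in H^s
   with unbounded means almost everywhere on [0, 1]. *)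
Require Import Defs.
From HB Require Import structures.
From mathcomp Require Import all_boot all_order all_algebra.
From mathcomp Require Import all_classical all_reals all_analysis.
From mathcomp Require Import measurable_realfun complex ring lra.

Set Implicit Arguments.
Unset Strict Implicit.
Unset Printing Implicit Defensive.

Import Order.TTheory GRing.Theory Num.Theory.
Import numFieldNormedType.Exports.

Local Open Scope classical_set_scope.
Local Open Scope ring_scope.

(** Plain Cauchy-Schwarz over the shells would cost their number. The sum over shells is instead
    estimated at each [x] with weights that depend on the selected time through
    [u = tau x * 2^(k (a - 4 s))]. They are chosen so that their reciprocals have a sum bounded
    uniformly in [x]; for [u > 1] they are paid for by the weak [ell^r] bound and Plancherel at each
    fixed time, for [u <= 1] by the gain of the block estimate on shorter time intervals. The
    exponent [r] is the one with [2^((a - 4 s) r) = 2^(2 s)]. Values of the means are those of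
    representatives of distributions, so pointwise identities hold off a null set for each time, and
    countability of the times assembles them. Data are cut to bounded frequencies, where the inverse
    transform is an absolutely convergent integral, and the remainder is treated by the L2 bound.
    Complex amplitudes are split into real and imaginary parts: the T T* kernels are integrals of
    cosines, and the Fourier transform is a pair of cosine and sine transforms. *)

Definition L1 {R : realType} (f : R -> R) :=
  (@lebesgue_measure R).-integrable [set: R] (EFin \o f).
Definition Rint {R : realType} (f : R -> R) : R :=
  Rintegral (@lebesgue_measure R) [set: R] f.

(** * Integrals over the line *)

Section Almost_everywhere.
Context {R : realType}.
Local Notation mu := (@lebesgue_measure R).
Implicit Types P Q : R -> Prop.

Lemma ae_imp P Q : (forall x, P x -> Q x) ->
  {ae mu, forall x, P x} -> {ae mu, forall x, Q x}.
Proof. by move=> PQ; apply: negligibleS => x /= nQ /PQ. Qed.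

Lemma ae_all P : (forall x, P x) -> {ae mu, forall x, P x}.
Proof. by move=> HP; exact: aeW. Qed.

Lemma ae_and P Q : {ae mu, forall x, P x} -> {ae mu, forall x, Q x} ->
  {ae mu, forall x, P x /\ Q x}.
Proof.
move=> aP aQ; have := negligibleU aP aQ; apply: negligibleS => x /= nPQ.
by have [Px|] := pselect (P x); [right => Qx; exact: nPQ|left].
Qed.

Lemma ae_forall (P : nat -> R -> Prop) : (forall n, {ae mu, forall x, P n x}) ->
  {ae mu, forall x, forall n, P n x}.
Proof.
move=> aP; have := negligible_bigcup aP; apply: negligibleS => x /= nP.
by have /existsNP[n nPn] := nP; exists n.
Qed.

End Almost_everywhere.

Section Integral.
Context {R : realType}.
Local Notation mu := (@lebesgue_measure R).
Implicit Types (f g h : R -> R).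

Lemma measurable_EFin f : measurable_fun setT f ->
  measurable_fun [set: g_sigma_algebraType R.-ocitv.-measurable]
    (fun x => (f x)%:E).
Proof. by move=> mf; exact/measurable_EFinP. Qed.

Lemma L1_measurable f : L1 f -> measurable_fun setT f.
Proof. by move=> /integrableP[/measurable_EFinP]. Qed.

Lemma L1_le g f : measurable_fun setT f -> L1 g ->
  (forall x, `|f x| <= g x) -> L1 f.
Proof.
move=> mf ig fg; apply: le_integrable ig => //; first exact/measurable_EFinP.
by move=> x _ /=; rewrite lee_fin (le_trans (fg x))// ler_norm.
Qed.

Lemma L1_fin f : measurable_fun setT f -> (forall x, 0 <= f x) ->
  (\int[mu]_x (f x)%:E < +oo)%E -> L1 f.
Proof.
move=> mf f0 fi; apply/integrableP; split; first exact/measurable_EFinP.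
by under eq_integral do rewrite /= ger0_norm//.
Qed.

Lemma L1_lty f : L1 f -> (\int[mu]_x (`|f x|)%:E < +oo)%E.
Proof. by move=> /integrableP[]. Qed.

Lemma L1D f g : L1 f -> L1 g -> L1 (fun x => f x + g x).
Proof. by move=> *; exact: (@integrableD _ _ _ mu setT measurableT (EFin \o f) (EFin \o g)). Qed.

Lemma L1B f g : L1 f -> L1 g -> L1 (fun x => f x - g x).
Proof. by move=> *; exact: (@integrableB _ _ _ mu setT measurableT (EFin \o f) (EFin \o g)). Qed.

Lemma L1Z c f : L1 f -> L1 (fun x => c * f x).
Proof. by move=> *; exact: (@integrableZl _ _ _ mu setT measurableT c (EFin \o f)). Qed.

Lemma L1Zr c f : L1 f -> L1 (fun x => f x * c).
Proof. by move=> /(L1Z c); under eq_fun do rewrite mulrC. Qed.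

Lemma L1_norm f : L1 f -> L1 (fun x => `|f x|).
Proof. by move=> *; exact: (@integrable_abse _ _ _ mu setT (EFin \o f)). Qed.

Lemma L10 : L1 (fun=> 0 : R).
Proof. exact: integrable0. Qed.

Lemma RintE f : L1 f -> (\int[mu]_x (f x)%:E)%E = (Rint f)%:E.
Proof. by move=> fi; rewrite /Rint /Rintegral fineK//; exact: integrable_fin_num. Qed.

Lemma eq_Rint f g : f =1 g -> Rint f = Rint g.
Proof. by move=> /funext->. Qed.

Lemma RintD f g : L1 f -> L1 g -> Rint (fun x => f x + g x) = Rint f + Rint g.
Proof. by move=> *; exact: RintegralD. Qed.

Lemma RintB f g : L1 f -> L1 g -> Rint (fun x => f x - g x) = Rint f - Rint g.
Proof. by move=> *; exact: RintegralB. Qed.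

Lemma RintZ c f : L1 f -> Rint (fun x => c * f x) = c * Rint f.
Proof. by move=> *; exact: RintegralZl. Qed.

Lemma RintZr c f : L1 f -> Rint (fun x => f x * c) = Rint f * c.
Proof. by move=> *; exact: RintegralZr. Qed.

Lemma RintN f : L1 f -> Rint (fun x => - f x) = - Rint f.
Proof. by move=> fi; rewrite -mulN1r -RintZ//; apply: eq_Rint => x; rewrite mulN1r. Qed.

Lemma Rint0 : Rint (fun=> 0 : R) = 0.
Proof. by rewrite /Rint /Rintegral integral0. Qed.

Lemma le_Rint f g : L1 f -> L1 g -> (forall x, f x <= g x) -> Rint f <= Rint g.
Proof. by move=> *; exact: le_Rintegral. Qed.

Lemma Rint_ge0 f : (forall x, 0 <= f x) -> 0 <= Rint f.
Proof. by move=> f0; exact: Rintegral_ge0. Qed.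

Lemma norm_Rint_le f g : measurable_fun setT f -> L1 g ->
  (forall x, `|f x| <= g x) -> `|Rint f| <= Rint g.
Proof.
move=> mf ig fg; have fi : L1 f by exact: L1_le ig fg.
apply: le_trans (le_normr_Rintegral _ fi) _ => //.
by apply: le_Rint => //; exact: L1_norm.
Qed.

Lemma ae_eq_Rint f g : measurable_fun setT f -> measurable_fun setT g ->
  {ae mu, forall x, f x = g x} -> Rint f = Rint g.
Proof.
move=> mf mg fg; congr fine; apply: ae_eq_integral => //.
- exact/measurable_EFinP.
- exact/measurable_EFinP.
- by apply: ae_imp fg => x -> _.
Qed.

(** Tonelli applies to the positive and the negative part separately, and [fine] keeps the
    difference measurable even where it is infinite. *)
Lemma measurable_Rint d (T : measurableType d) (f : T -> R -> R) :
  measurable_fun setT (fun z : T * R => f z.1 z.2) ->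
  measurable_fun setT (fun x => Rint (f x)).
Proof.
move=> mf; pose F := EFin \o (fun z : T * R => f z.1 z.2).
have mf' : measurable_fun setT F by exact/measurable_EFinP.
have mp := measurable_funepos mf'; have mn := measurable_funeneg mf'.
have Hp := @measurable_fun_fubini_tonelli_F _ _ _ _ _ mu _ mp (fun=> funepos_ge0 _ _).
have Hn := @measurable_fun_fubini_tonelli_F _ _ _ _ _ mu _ mn (fun=> funeneg_ge0 _ _).
have FE : (fun x => \int[mu]_y (f x y)%:E)%E =
    (fubini_F mu F^\+ \- fubini_F mu F^\-)%E.
  apply/funext => x; rewrite [LHS]integralE /fubini_F.
  by congr (_ - _)%E; apply: eq_integral => y _;
    [rewrite -[RHS]/((F^\+ \o pair x) y)%E -funepos_comp
    |rewrite -[RHS]/((F^\- \o pair x) y)%E -funeneg_comp].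
have mI : measurable_fun setT (fun x => \int[mu]_y (f x y)%:E)%E.
  by rewrite FE; exact: emeasurable_funB Hp Hn.
exact: (measurableT_comp (fine_measurable measurableT) mI).
Qed.

Lemma measurable_sec1 (f : R -> R -> R) x :
  measurable_fun setT (fun z : R * R => f z.1 z.2) ->
  measurable_fun setT (f x).
Proof. by move=> mf; apply: (measurableT_comp mf (measurable_pair1 x)). Qed.

Lemma measurable_swap (f : R -> R -> R) :
  measurable_fun setT (fun z : R * R => f z.1 z.2) ->
  measurable_fun setT (fun z : R * R => f z.2 z.1).
Proof.
move=> mf; apply: (measurableT_comp mf (_ : measurable_fun setT (fun z => (z.2, z.1)))).
exact: measurable_fun_pair.
Qed.

(** The kernels whose integrals are exchanged below are dominated by a product of two integrable
    functions; this majorant gives integrability in the parameter here, and on the plane in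
    [swap_Rint]. *)
Lemma L1_Rint (f : R -> R -> R) (a b : R -> R) :
  measurable_fun setT (fun z : R * R => f z.1 z.2) ->
  L1 a -> L1 b -> (forall x y, `|f x y| <= a x * b y) ->
  L1 (fun x => Rint (f x)).
Proof.
move=> mf ia ib fab.
apply: (@L1_le (fun x => a x * Rint b)); [exact: measurable_Rint|exact: L1Zr|].
move=> x; rewrite -RintZ//; apply: norm_Rint_le.
- exact: measurable_sec1.
- exact: L1Z.
- exact: fab.
Qed.

Lemma swap_Rint (f : R -> R -> R) (a b : R -> R) :
  measurable_fun setT (fun z : R * R => f z.1 z.2) ->
  L1 a -> L1 b -> (forall x y, `|f x y| <= a x * b y) ->
  Rint (fun x => Rint (f x)) = Rint (fun y => Rint (fun x => f x y)).
Proof.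
move=> mf ia ib fab.
pose F := EFin \o (fun z : R * R => f z.1 z.2).
have mF : measurable_fun setT F by exact/measurable_EFinP.
have iF : (mu \x mu)%E.-integrable setT F.
  apply/(integrable12ltyP mu mu mF).
  apply: (@le_lt_trans _ _ (\int[mu]_x (`|a x| * Rint (fun y => `|b y|))%:E)%E); last first.
    by rewrite (RintE (L1Zr _ (L1_norm ia))) ltry.
  apply: ge0_le_integral => //.
  - by move=> x _; exact: integral_ge0.
  - have maF : measurable_fun setT (abse \o F) by exact: measurableT_comp.
    exact: (@measurable_fun_fubini_tonelli_F _ _ _ _ _ mu _ maF (fun=> abse_ge0 _)).
  - apply: measurable_EFin; exact: L1_measurable (L1Zr _ (L1_norm ia)).
  - move=> x _; rewrite -RintZ; last exact: L1_norm.
    rewrite -RintE; last by apply: L1Z; exact: L1_norm.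
    apply: ge0_le_integral => //=.
    + have mfx := measurable_sec1 x mf.
      by apply: measurable_EFin; exact: (measurableT_comp (@normr_measurable R setT) mfx).
    + by apply: measurable_EFin; apply: L1_measurable; apply: L1Z; exact: L1_norm.
    + move=> y _; rewrite lee_fin (le_trans (fab x y))//.
      by rewrite -normrM ler_norm.
have := @Fubini _ _ _ _ R mu mu F iF.
have e1 : (\int[mu]_x \int[mu]_y F (x, y) = (Rint (fun x => Rint (f x)))%:E)%E.
  rewrite -(RintE (L1_Rint mf ia ib fab)); apply: eq_integral => x _.
  rewrite -RintE//; apply: (@L1_le (fun y => a x * b y)).
  - exact: measurable_sec1.
  - exact: L1Z.
  - exact: fab.
have fab' x y : `|f y x| <= b x * a y by rewrite mulrC.
rewrite e1.
have -> : (\int[mu]_y \int[mu]_x F (x, y) = (Rint (fun y => Rint (fun x => f x y)))%:E)%E.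
  have mf2 : measurable_fun setT (fun z : R * R => f z.2 z.1) by exact: measurable_swap.
  rewrite -(RintE (@L1_Rint (fun y x => f x y) b a mf2 ib ia fab')).
  apply: eq_integral => x _.
  rewrite -RintE//; apply: (@L1_le (fun y => b x * a y)).
  - exact: (@measurable_sec1 (fun x y => f y x) x mf2).
  - exact: L1Z.
  - exact: fab'.
by move=> -[].
Qed.

Lemma dominated_Rint (f_ : nat -> R -> R) f g :
  (forall n, measurable_fun setT (f_ n)) -> L1 g ->
  (forall n x, `|f_ n x| <= g x) ->
  {ae mu, forall x, f_ n x @[n --> \oo] --> f x} -> measurable_fun setT f ->
  L1 f /\ Rint (f_ n) @[n --> \oo] --> Rint f.
Proof.
move=> mf_ ig fg ff mf.
have [] := @dominated_convergence _ _ _ mu setT measurableT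
  (fun n x => (f_ n x)%:E) (EFin \o f) (EFin \o g).
- by move=> n; exact: measurable_EFin.
- exact: measurable_EFin.
- by apply: ae_imp ff => x cf _; apply: cvg_EFin; [exact: nearW|].
- exact: ig.
- by apply: aeW => x n _; rewrite lee_fin; exact: fg.
move=> fi _ cvI; split=> //.
by move: cvI; rewrite RintE// => /fine_cvg.
Qed.
End Integral.

(** * Affine changes of variable *)

Section Affine_substitution.
Context {R : realType}.
Local Notation mu := (@lebesgue_measure R).

Lemma preimage_affine (c d : R) (c0 : 0 < c) (a b : R) :
  (fun x => c * x + d) @^-1` `]a, b] = `]((a - d) / c), ((b - d) / c)]%classic.
Proof.
apply/seteqP; split => x /=; rewrite !in_itv/= ltr_pdivrMr// ler_pdivlMr//.
  by move=> /andP[ax xb]; rewrite ltrBlDr lerBrDr mulrC ax.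
by rewrite ltrBlDr lerBrDr mulrC.
Qed.

Lemma measurable_affine (c d : R) : measurable_fun setT (fun x : R => c * x + d).
Proof. by apply: measurable_funD => //; exact: measurable_funM. Qed.

(** Lebesgue measure is [c] times its own pushforward under the affine map: the two agree on
    half-open intervals, hence on all measurable sets. *)
Lemma ge0_integral_affine (c d : R) (f : R -> \bar R) : 0 < c ->
  measurable_fun setT f -> (forall x, 0 <= f x)%E ->
  (\int[mu]_x f x = c%:E * \int[mu]_x f (c * x + d)%R)%E.
Proof.
move=> c0 mf f0.
pose T (x : measurableTypeR R) : measurableTypeR R := c * x + d.
have mT : measurable_fun setT T by exact: measurable_affine.
have c0' : 0 <= c by exact: ltW.
pose nu : {measure set (measurableTypeR R) -> \bar R} := mscale (NngNum c0') (pushforward mu T).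
transitivity (\int[nu mT]_x f x)%E.
  apply: eq_measure_integral => A mA _; apply: lebesgue_measure_unique mA => _ [[a b] _ <-] /=.
  rewrite /nu /= /mscale /= /pushforward preimage_affine// !lebesgue_measure_itv/= !lte_fin.
  rewrite ltr_pM2r ?invr_gt0// ltrD2r; case: ifPn => _; last by rewrite mule0.
  rewrite -!EFinB -EFinM -mulrBl mulrCA mulfV ?gt_eqF// mulr1; congr EFin; ring.
rewrite ge0_integral_mscale//; congr (_ * _)%E.
have mf' : measurable_fun [set: measurableTypeR R] f by exact: mf.
have H := @ge0_integral_pushforward _ _ (measurableTypeR R) (measurableTypeR R) R T mT
  mu setT f measurableT mf' (fun y _ => f0 y).
by rewrite H preimage_setT.
Qed.

Lemma ge0_integral_opp (f : R -> \bar R) :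
  measurable_fun setT f -> (forall x, 0 <= f x)%E ->
  (\int[mu]_x f x = \int[mu]_x f (- x)%R)%E.
Proof.
move=> mf f0.
pose T (x : measurableTypeR R) : measurableTypeR R := - x.
have mT : measurable_fun setT T by exact: oppr_measurable.
pose nu : {measure set (measurableTypeR R) -> \bar R} := pushforward mu T.
transitivity (\int[nu mT]_x f x)%E.
  apply: eq_measure_integral => A mA _; apply: lebesgue_measure_unique mA => _ [[a b] _ <-] /=.
  rewrite /nu /= /pushforward.
  have -> : T @^-1` `]a, b] = `[- b, - a[%classic.
    by apply/seteqP; split => x /=; rewrite !in_itv/= /T lerNl ltrNr andbC.
  rewrite !lebesgue_measure_itv/= !lte_fin ltrN2.
  by case: ifPn => // _; rewrite -!EFinB opprK addrC.
have mf' : measurable_fun [set: measurableTypeR R] f by exact: mf.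
have H := @ge0_integral_pushforward _ _ (measurableTypeR R) (measurableTypeR R) R T mT
  mu setT f measurableT mf' (fun y _ => f0 y).
by rewrite H preimage_setT.
Qed.

Lemma measurable_comp_affine (c d : R) (f : R -> R) : measurable_fun setT f ->
  measurable_fun setT (fun x => f (c * x + d)).
Proof. by move=> mf; apply: (measurableT_comp mf); exact: measurable_affine. Qed.

Lemma Rint_affine (c d : R) (f : R -> R) : 0 < c -> measurable_fun setT f ->
  Rint f = c * Rint (fun x => f (c * x + d)).
Proof.
move=> c0 mf; rewrite /Rint /Rintegral.
have mE : measurable_fun setT (EFin \o f) by exact/measurable_EFinP.
rewrite integralE [in RHS]integralE.
have funp (g : R -> R) (x : R) : (EFin \o g)^\+%E x = (maxe (g x)%:E 0) by rewrite funeposE.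
have funn (g : R -> R) (x : R) : (EFin \o g)^\-%E x = (maxe (- (g x)%:E) 0)%E by rewrite funenegE.
rewrite (@ge0_integral_affine c d (EFin \o f)^\+%E)//; last exact: measurable_funepos.
rewrite (@ge0_integral_affine c d (EFin \o f)^\-%E)//; last exact: measurable_funeneg.
have -> : (\int[mu]_x (EFin \o (fun x => f (c * x + d)%R))^\+ x =
    \int[mu]_x (EFin \o f)^\+ (c * x + d)%R)%E.
  by apply: eq_integral => x _; rewrite !funp.
have -> : (\int[mu]_x (EFin \o (fun x => f (c * x + d)%R))^\- x =
    \int[mu]_x (EFin \o f)^\- (c * x + d)%R)%E.
  by apply: eq_integral => x _; rewrite !funn.
set A := (\int[mu]_x _^\+ _)%E; set B := (\int[mu]_x _^\- _)%E.
have A0 : (0 <= A)%E by apply: integral_ge0 => x _; exact: funepos_ge0.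
have B0 : (0 <= B)%E by apply: integral_ge0 => x _; exact: funeneg_ge0.
(* When one of the parts is infinite, [fine] gives 0 on both sides. *)
move: A0 B0; case: A => [u||]; case: B => [v||] // _ _.
- by rewrite -!EFinM -!EFinB /= mulrBr.
- by rewrite gt0_muley ?lte_fin//= mulr0.
- by rewrite gt0_muley ?lte_fin//= mulr0.
- by rewrite gt0_muley ?lte_fin//= mulr0.
Qed.

Lemma Rint_opp (f : R -> R) : measurable_fun setT f -> Rint f = Rint (fun x => f (- x)).
Proof.
move=> mf; rewrite /Rint /Rintegral.
have mE : measurable_fun setT (EFin \o f) by exact/measurable_EFinP.
rewrite integralE [in RHS]integralE.
rewrite ge0_integral_opp//; last exact: measurable_funepos.
rewrite [X in (_ - X)%E]ge0_integral_opp//; last exact: measurable_funeneg.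
by congr (fine (_ - _)%E); apply: eq_integral => x _; rewrite ?funeposE ?funenegE.
Qed.

Lemma L1_affine (c d : R) (f : R -> R) : 0 < c -> L1 f -> L1 (fun x => f (c * x + d)).
Proof.
move=> c0 fi; have mf := L1_measurable fi.
apply/integrableP; split; first by apply/measurable_EFinP; exact: measurable_comp_affine.
have := L1_lty fi; rewrite (@ge0_integral_affine c d)//.
- by move=> H; rewrite ltNge leye_eq; apply/eqP => E; move: H; rewrite E gt0_muley ?lte_fin.
- by apply/measurable_EFinP; exact: measurableT_comp.
Qed.

Lemma L1_opp (f : R -> R) : L1 f -> L1 (fun x => f (- x)).
Proof.
move=> fi; have mf := L1_measurable fi.
apply/integrableP; split.
  by apply/measurable_EFinP; apply: (measurableT_comp mf); exact: oppr_measurable.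
have := L1_lty fi; rewrite ge0_integral_opp//.
by apply/measurable_EFinP; exact: measurableT_comp.
Qed.

End Affine_substitution.

(** * Indicators, truncations and the fundamental theorem of calculus *)

Section Indicator.
Context {R : realType}.
Local Notation mu := (@lebesgue_measure R).
Implicit Types (A B : set R) (f : R -> R).

Lemma measurable_indicM A f : measurable A -> measurable_fun setT f ->
  measurable_fun setT (fun x => \1_A x * f x).
Proof. by move=> mA mf; apply: measurable_funM => //; exact: measurable_indic. Qed.

Lemma indic_ge0' A (x : R) : 0 <= (\1_A x : R).
Proof. by rewrite indicE. Qed.

Lemma indic_le1 A (x : R) : (\1_A x : R) <= 1.
Proof. by rewrite indicE; case: (_ \in _). Qed.

Lemma indic_sqr A (x : R) : (\1_A x : R) ^+ 2 = \1_A x.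
Proof. by rewrite indicE; case: (_ \in _); rewrite ?expr1n ?expr0n. Qed.

Lemma L1_indicM A f : measurable A -> L1 f -> L1 (fun x => \1_A x * f x).
Proof.
move=> mA fi; apply: (@L1_le _ (fun x => `|f x|)); last 2 first.
- exact: L1_norm.
- by move=> x; rewrite normrM ger0_norm ?indic_ge0'// ler_piMl// indic_le1.
- by apply: measurable_indicM => //; exact: L1_measurable.
Qed.

Lemma Rint_indic A f : measurable A -> Rint (fun x => \1_A x * f x) = \int[mu]_(x in A) f x.
Proof.
move=> mA; rewrite [RHS]Rintegral_mkcond; apply: eq_Rint => x.
by rewrite /patch indicE; case: ifPn => xA; rewrite ?xA ?mul1r ?(negbTE xA) ?mul0r.
Qed.

Lemma L1_indicE A f : measurable A -> mu.-integrable A (EFin \o f) -> L1 (fun x => \1_A x * f x).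
Proof.
move=> mA fi; have := (@integrable_mkcond _ _ _ mu A (EFin \o f) mA).1 fi; rewrite /L1.
congr (_ .-integrable _ _); apply/funext => x /=.
by rewrite /patch indicE; case: ifPn => xA; rewrite ?xA ?mul1r ?(negbTE xA) ?mul0r.
Qed.

Lemma L1_indic A : measurable A -> (mu A < +oo)%E -> L1 (\1_A : R -> R).
Proof.
move=> mA Aoo; apply: L1_fin => //.
by rewrite integral_indic// setIT.
Qed.

Lemma Rint_indic1 A : measurable A -> Rint (\1_A : R -> R) = fine (mu A).
Proof.
move=> mA; have := @Rint_indic A (cst 1) mA; rewrite Rintegral_cst// mul1r => <-.
by apply: eq_Rint => x; rewrite mulr1.
Qed.

Lemma continuous_L1_itv (a b : R) f : continuous f -> L1 (fun x => \1_(`[a, b]%classic) x * f x).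
Proof.
move=> cf; apply: L1_indicE => //; apply: continuous_compact_integrable.
  exact: segment_compact.
exact: continuous_subspaceT.
Qed.

Lemma FTC_Rint (a b : R) (F f : R -> R) : a <= b -> continuous f ->
  (forall x : R, is_derive x 1 F (f x)) ->
  Rint (fun x => \1_(`[a, b]%classic) x * f x) = F b - F a.
Proof.
move=> ab cf dF; rewrite Rint_indic//.
have cF : continuous F.
  by move=> x; apply/differentiable_continuous/derivable1_diffP; have [] := dF x.
move: ab; rewrite le_eqVlt => /predU1P[->|ab].
  by rewrite set_itv1 Rintegral_set1 subrr.
rewrite /Rintegral (@continuous_FTC2 _ f F)//.
- exact: continuous_subspaceT.
- split.
  + by move=> x _; have [] := dF x.
  + by apply: cvg_at_right_filter; exact: cF.
  + by apply: cvg_at_left_filter; exact: cF.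
- by move=> x _; rewrite derive1E; have [_] := dF x.
Qed.

Lemma cvg_truncation f (x : R) :
  (fun n : nat => \1_(`[- n%:R, n%:R]%classic) x * f x) @ \oo --> f x.
Proof.
apply: cvg_near_cst; near=> n; rewrite indicE mem_set ?mul1r//= in_itv/= -ler_norml.
by near: n; exact: nbhs_infty_ger.
Unshelve. all: by end_near. Qed.

(** Fatou's lemma for an almost everywhere limit. It carries uniform L2 bounds over to limits for
    which no dominating function is at hand. *)
Lemma integral_limit_le (f_ : nat -> R -> R) f (M : \bar R) :
  (forall n, measurable_fun setT (f_ n)) -> measurable_fun setT f ->
  (forall n x, 0 <= f_ n x) ->
  {ae mu, forall x, f_ n x @[n --> \oo] --> f x} ->
  (forall n, (\int[mu]_x (f_ n x)%:E <= M)%E) -> (\int[mu]_x (f x)%:E <= M)%E.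
Proof.
move=> mf_ mf f0 cf fM.
have -> : (\int[mu]_x (f x)%:E = \int[mu]_x limn_einf (fun n => (f_ n x)%:E))%E.
  apply: ae_eq_integral => //.
  - exact: measurable_EFin.
  (* The lower limit is minus the upper limit of the negatives, whose measurability is known. *)
  - under eq_fun => x.
      rewrite -[X in limn_einf X](_ : -%E \o (fun n => - (f_ n x)%:E)%E = _); last first.
        by apply/funext => n; rewrite /comp oppeK.
      rewrite limn_einfN; over.
    have mN n : measurable_fun [set: g_sigma_algebraType R.-ocitv.-measurable]
        (fun x => (- (f_ n x)%:E)%E).
      by apply: measurableT_comp => //; exact: measurable_EFin.
    have H := measurable_fun_limn_esup mN.
    exact: (measurableT_comp (@oppe_measurable R setT) H).
  - apply: ae_imp cf => x cfx _.
    have cE : (f_ n x)%:E @[n --> \oo] --> (f x)%:E by apply: cvg_EFin; [exact: nearW|].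
    by rewrite (cvg_limn_einf_sup cE).
apply: le_trans (fatou _ _ _ _) _ => //.
- by move=> n; exact: measurable_EFin.
- by move=> n x _; rewrite lee_fin.
rewrite limn_einf_lim; apply: lime_le; first exact: is_cvg_einfs.
apply: nearW => n; apply: le_trans (fM n).
by apply: ereal_inf_lbound; exists n => /=.
Qed.

Lemma FTCy_Rint (F f : R -> R) (l1 l2 : R) : continuous f -> L1 f ->
  (forall x : R, is_derive x 1 F (f x)) ->
  F x @[x --> +oo] --> l1 -> F x @[x --> -oo] --> l2 ->
  Rint f = l1 - l2.
Proof.
move=> cf fi dF F1 F2.
have mf := L1_measurable fi.
have [|||||_ cv] := @dominated_Rint R
  (fun n x => \1_(`[- n%:R, n%:R]%classic) x * f x) f (fun x => `|f x|).
- by move=> n; exact: measurable_indicM.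
- exact: L1_norm.
- by move=> n x; rewrite normrM ger0_norm ?indic_ge0'// ler_piMl// indic_le1.
- by apply: ae_all => x; exact: cvg_truncation.
- by [].
have E n : Rint (fun x => \1_(`[- n%:R, n%:R]%classic) x * f x) = F n%:R - F (- n%:R).
  by apply: FTC_Rint => //; rewrite ge0_cp.
rewrite (eq_cvg _ _ E) in cv.
apply: (cvg_unique (@norm_hausdorff R R) cv).
apply: cvgB.
  exact: (cvg_comp _ _ cvgr_idn F1).
exact: (cvg_comp _ _ cvgr_idn ((cvgNy_compNP F _).1 F2)).
Qed.

(** The integrals over [[-n, n]] are increments of [F]; they converge, hence are bounded, and Fatou
    gives a finite total integral. *)
Lemma FTCy_L1 (F f : R -> R) (l1 l2 : R) : continuous f -> (forall x, 0 <= f x) ->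
  (forall x : R, is_derive x 1 F (f x)) ->
  F x @[x --> +oo] --> l1 -> F x @[x --> -oo] --> l2 ->
  L1 f.
Proof.
move=> cf f0 dF F1 F2.
have mf : measurable_fun setT f by exact: continuous_measurable_fun.
have E n : Rint (fun x => \1_(`[- n%:R, n%:R]%classic) x * f x) = F n%:R - F (- n%:R).
  by apply: FTC_Rint => //; rewrite ge0_cp.
have cv : (fun n : nat => F n%:R - F (- n%:R)) @ \oo --> l1 - l2.
  apply: cvgB.
    exact: (cvg_comp _ _ cvgr_idn F1).
  exact: (cvg_comp _ _ cvgr_idn ((cvgNy_compNP F _).1 F2)).
have /cvg_seq_bounded[M [_ HM]] : cvgn (fun n : nat => F n%:R - F (- n%:R)).
  by apply/cvg_ex; exists (l1 - l2).
apply: L1_fin => //; apply: le_lt_trans (ltry (M + 1)).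
apply: (@integral_limit_le (fun n x => \1_(`[- n%:R, n%:R]%classic) x * f x)) => //.
- by move=> n; exact: measurable_indicM.
- by move=> n x; rewrite mulr_ge0 ?indic_ge0'.
- by apply: ae_all => x; exact: cvg_truncation.
- move=> n; rewrite RintE; last exact: continuous_L1_itv.
  by rewrite E lee_fin (le_trans (ler_norm _))// HM// ltrDl.
Qed.

End Indicator.

(** * Measurability of elementary compositions *)

Section Measurability.
Context {R : realType} {d : measure_display} {T : measurableType d}.
Implicit Types f g : T -> R.

Lemma measurable_cos_comp f : measurable_fun setT f -> measurable_fun setT (fun x => cos (f x)).
Proof.
by move=> mf; apply: (measurableT_comp _ mf); apply: continuous_measurable_fun; exact: continuous_cos.
Qed.

Lemma measurable_sin_comp f : measurable_fun setT f -> measurable_fun setT (fun x => sin (f x)).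
Proof.
by move=> mf; apply: (measurableT_comp _ mf); apply: continuous_measurable_fun; exact: continuous_sin.
Qed.

Lemma measurable_expR_comp f : measurable_fun setT f -> measurable_fun setT (fun x => expR (f x)).
Proof.
by move=> mf; apply: (measurableT_comp _ mf); apply: continuous_measurable_fun; exact: continuous_expR.
Qed.

Lemma measurable_sqr f : measurable_fun setT f -> measurable_fun setT (fun x => f x ^+ 2).
Proof. by move=> mf; exact: measurable_funX. Qed.

Lemma measurable_norm f : measurable_fun setT f -> measurable_fun setT (fun x => `|f x|).
Proof. by move=> mf; exact: measurableT_comp. Qed.

End Measurability.

(** * The T T* method *)

Section Schur.
Context {R : realType}.
Local Notation mu := (@lebesgue_measure R).

Lemma norm_Rint_integral (f : R -> R) : measurable_fun setT f ->
  (`|Rint f|%:E <= \int[mu]_x (`|f x|)%:E)%E.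
Proof.
move=> mf; rewrite /Rint /Rintegral.
have H : (`|\int[mu]_x (f x)%:E| <= \int[mu]_x (`|f x|)%:E)%E.
  exact: le_abse_integral (measurable_EFin mf).
apply: le_trans H; by case: (\int[mu]_x _)%E => [r||] //=; rewrite normr0 leey.
Qed.

(** Schur's test with constant weights. With [q = p^2] the hypothesis on [F] is the
    arithmetic-geometric mean inequality for [p x * p y] times a kernel, and Tonelli integrates [k]
    first in the variable absent from [q]. *)
Lemma schur_bound (F k : R -> R -> R) (q : R -> R) (M : R) :
  measurable_fun setT (fun z : R * R => F z.1 z.2) ->
  measurable_fun setT (fun z : R * R => k z.1 z.2) ->
  (forall x y, 0 <= k x y) -> L1 q -> (forall x, 0 <= q x) ->
  (forall x, (\int[mu]_y (k x y)%:E <= M%:E)%E) ->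
  (forall y, (\int[mu]_x (k x y)%:E <= M%:E)%E) ->
  (forall x y, `|F x y| <= 2^-1 * ((q x + q y) * k x y)) ->
  `|Rint (fun x => Rint (F x))| <= M * Rint q.
Proof.
move=> mF mk k0 qi q0 kM1 kM2 FB.
have mq := L1_measurable qi.
have M0 : 0 <= M by rewrite -lee_fin; apply: le_trans (kM1 0); apply: integral_ge0 => y _; rewrite lee_fin.
have mq1 : measurable_fun setT (fun z : R * R => (q z.1 * k z.1 z.2)%:E).
  by apply/measurable_EFinP; apply: measurable_funM => //; exact: (measurableT_comp mq).
have mq2 : measurable_fun setT (fun z : R * R => (q z.2 * k z.1 z.2)%:E).
  by apply/measurable_EFinP; apply: measurable_funM => //; exact: (measurableT_comp mq).
have p1 z : (0 <= (q z.1 * k z.1 z.2)%:E)%E by rewrite lee_fin mulr_ge0.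
have p2 (z : R * R) : (0 <= (q z.2 * k z.1 z.2)%:E)%E by rewrite lee_fin mulr_ge0.
have mF1 := @measurable_fun_fubini_tonelli_F _ _ _ _ _ mu _ mq1 p1.
have mF2 := @measurable_fun_fubini_tonelli_F _ _ _ _ _ mu _ mq2 p2.
have mG2 := @measurable_fun_fubini_tonelli_G _ _ _ _ _ mu _ mq2 p2.
have I1 : (\int[mu]_x \int[mu]_y (q x * k x y)%:E <= (M * Rint q)%:E)%E.
  rewrite EFinM -(RintE qi) -ge0_integralZl//; last 2 first.
  - exact: measurable_EFin.
  - by move=> x _; rewrite lee_fin.
  apply: ge0_le_integral => //.
  - by move=> x _; apply: integral_ge0 => y _; rewrite lee_fin mulr_ge0.
  - exact: (measurable_funeM _ (measurable_EFin mq)).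
  - move=> x _; under eq_integral do rewrite EFinM.
    rewrite ge0_integralZl//; last 3 first.
    + by apply: measurable_EFin; exact: measurable_sec1.
    + by move=> y _; rewrite lee_fin.
    + by rewrite lee_fin.
    by rewrite muleC lee_wpmul2r// lee_fin.
have I2 : (\int[mu]_x \int[mu]_y (q y * k x y)%:E <= (M * Rint q)%:E)%E.
  rewrite (@fubini_tonelli _ _ _ _ _ mu mu (fun z : R * R => (q z.2 * k z.1 z.2)%:E))//.
  rewrite EFinM -(RintE qi) -ge0_integralZl//; last 2 first.
  - exact: measurable_EFin.
  - by move=> x _; rewrite lee_fin.
  apply: ge0_le_integral => //.
  - by move=> x _; apply: integral_ge0 => y _; rewrite lee_fin mulr_ge0.
  - exact: (measurable_funeM _ (measurable_EFin mq)).
  - move=> x _ /=; under eq_integral do rewrite EFinM.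
    rewrite ge0_integralZl//; last 3 first.
    + by apply: measurable_EFin; exact: (@measurable_sec1 _ (fun y x => k x y) x (measurable_swap mk)).
    + by move=> y _; rewrite lee_fin.
    + by rewrite lee_fin.
    by rewrite muleC lee_wpmul2r// lee_fin.
rewrite -lee_fin; apply: le_trans (norm_Rint_integral (measurable_Rint mF)) _.
apply: (@le_trans _ _ (\int[mu]_x (2^-1%:E * (\int[mu]_y (q x * k x y)%:E + \int[mu]_y (q y * k x y)%:E)))%E).
  apply: ge0_le_integral => //.
  - by apply: measurable_EFin; apply: measurable_norm; exact: measurable_Rint.
  - exact: (measurable_funeM _ (emeasurable_funD mF1 mF2)).
  - move=> x _; apply: le_trans (norm_Rint_integral (measurable_sec1 x mF)) _.
    have s1 : measurable_fun [set: g_sigma_algebraType R.-ocitv.-measurable] (fun y => (q x * k x y)%:E).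
      by apply: measurable_EFin; apply: measurable_funM => //; exact: measurable_sec1.
    have s2 : measurable_fun [set: g_sigma_algebraType R.-ocitv.-measurable] (fun y => (q y * k x y)%:E).
      by apply: measurable_EFin; apply: measurable_funM => //; exact: measurable_sec1.
    rewrite -ge0_integralD//; last 2 first.
    + by move=> y _; rewrite lee_fin mulr_ge0.
    + by move=> y _; rewrite lee_fin mulr_ge0.
    rewrite -ge0_integralZl//; last 2 first.
    + exact: emeasurable_funD.
    + by move=> y _; rewrite adde_ge0// lee_fin mulr_ge0.
    apply: ge0_le_integral => //.
    + by apply: measurable_EFin; apply: measurable_norm; exact: measurable_sec1.
    + exact: (measurable_funeM _ (emeasurable_funD s1 s2)).
    + by move=> y _; rewrite -EFinD -EFinM lee_fin -mulrDl.
have e0 x : (0 <= \int[mu]_y (q x * k x y)%:E)%E by apply: integral_ge0 => y _; rewrite lee_fin mulr_ge0.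
have e1 x : (0 <= \int[mu]_y (q y * k x y)%:E)%E by apply: integral_ge0 => y _; rewrite lee_fin mulr_ge0.
rewrite ge0_integralZl//; last 2 first.
- exact: emeasurable_funD mF1 mF2.
- by move=> x _; exact: adde_ge0.
rewrite ge0_integralD//.
apply: (@le_trans _ _ (2^-1%:E * ((M * Rint q)%:E + (M * Rint q)%:E))%E).
  by apply: lee_wpmul2l => //; exact: leeD.
by rewrite -EFinD -EFinM lee_fin; lra.
Qed.

End Schur.

Section TstarT.
Context {R : realType}.
Local Notation mu := (@lebesgue_measure R).
Variables (Phi : R -> R -> R) (rho p : R -> R).
Hypotheses (mPhi : measurable_fun setT (fun z : R * R => Phi z.1 z.2))
  (rhoi : L1 rho) (rho0 : forall x, 0 <= rho x) (pi1 : L1 p)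
  (pi2 : L1 (fun x => p x ^+ 2)).

(** Real and imaginary parts of the integral of [exp (i Phi x xi) p xi] in [xi], for a real
    amplitude [p]. *)
Definition oscc (x : R) := Rint (fun xi => cos (Phi x xi) * p xi).
Definition oscs (x : R) := Rint (fun xi => sin (Phi x xi) * p xi).

Let mp : measurable_fun setT p := L1_measurable pi1.
Let mrho : measurable_fun setT rho := L1_measurable rhoi.

Let mc : measurable_fun setT (fun z : R * R => cos (Phi z.1 z.2) * p z.2).
Proof.
by apply: measurable_funM; [exact: measurable_cos_comp|exact: (measurableT_comp mp)].
Qed.

Let ms : measurable_fun setT (fun z : R * R => sin (Phi z.1 z.2) * p z.2).
Proof.
by apply: measurable_funM; [exact: measurable_sin_comp|exact: (measurableT_comp mp)].
Qed.

Lemma L1_oscc x : L1 (fun xi => cos (Phi x xi) * p xi).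
Proof.
apply: (@L1_le _ (fun xi => `|p xi|)); last 2 first.
- exact: L1_norm.
- by move=> xi; rewrite normrM ler_piMl// ler_norml cos_geN1 cos_le1.
- exact: (@measurable_sec1 _ (fun x xi => cos (Phi x xi) * p xi) x).
Qed.

Lemma L1_oscs x : L1 (fun xi => sin (Phi x xi) * p xi).
Proof.
apply: (@L1_le _ (fun xi => `|p xi|)); last 2 first.
- exact: L1_norm.
- by move=> xi; rewrite normrM ler_piMl// ler_norml sin_geN1 sin_le1.
- exact: (@measurable_sec1 _ (fun x xi => sin (Phi x xi) * p xi) x).
Qed.

Lemma measurable_oscc : measurable_fun setT oscc.
Proof. exact: (@measurable_Rint _ _ _ (fun x xi => cos (Phi x xi) * p xi)). Qed.

Lemma measurable_oscs : measurable_fun setT oscs.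
Proof. exact: (@measurable_Rint _ _ _ (fun x xi => sin (Phi x xi) * p xi)). Qed.

Lemma oscc_le x : `|oscc x| <= Rint (fun xi => `|p xi|).
Proof.
apply: norm_Rint_le.
- exact: L1_measurable (L1_oscc x).
- exact: L1_norm.
- by move=> xi; rewrite normrM ler_piMl// ler_norml cos_geN1 cos_le1.
Qed.

Lemma oscs_le x : `|oscs x| <= Rint (fun xi => `|p xi|).
Proof.
apply: norm_Rint_le.
- exact: L1_measurable (L1_oscs x).
- exact: L1_norm.
- by move=> xi; rewrite normrM ler_piMl// ler_norml sin_geN1 sin_le1.
Qed.

Lemma L1_osc_sqr : L1 (fun x => rho x * (oscc x ^+ 2 + oscs x ^+ 2)).
Proof.
set P := Rint (fun xi => `|p xi|).
apply: (@L1_le _ (fun x => rho x * (P ^+ 2 + P ^+ 2))); last 2 first.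
- exact: L1Zr.
- move=> x; rewrite normrM ger0_norm// ler_wpM2l// ger0_norm ?addr_ge0 ?sqr_ge0//.
  by rewrite lerD// -(ger0_norm (sqr_ge0 _)) normrX lerXn2r ?nnegrE ?oscc_le ?oscs_le// Rint_ge0.
- apply: measurable_funM => //; apply: measurable_funD; apply: measurable_sqr.
    exact: measurable_oscc.
  exact: measurable_oscs.
Qed.

(** Expanding the square and integrating first in the outer variable leaves the kernel [K xi eta] of
    T* T, to which Schur's test applies. Its bound is required only where [p] vanishes at neither
    point: in the dual use, the support of the amplitude in a set of diameter 1 is what localises
    the kernel. *)
Lemma TstarT (k : R -> R -> R) (M : R) :
  measurable_fun setT (fun z : R * R => k z.1 z.2) ->
  (forall x y, 0 <= k x y) ->
  (forall xi, (\int[mu]_eta (k xi eta)%:E <= M%:E)%E) ->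
  (forall eta, (\int[mu]_xi (k xi eta)%:E <= M%:E)%E) ->
  (forall xi eta, p xi != 0 -> p eta != 0 ->
    `|Rint (fun x => rho x * cos (Phi x xi - Phi x eta))| <= k xi eta) ->
  Rint (fun x => rho x * (oscc x ^+ 2 + oscs x ^+ 2)) <= M * Rint (fun x => p x ^+ 2).
Proof.
move=> mk k0 kM1 kM2 Kk.
set P := Rint (fun xi => `|p xi|).
have P0 : 0 <= P by exact: Rint_ge0.
(* One factor of the square is opened up as an integral in [xi] while the other is kept; the second
   is opened in [H], after the first exchange. *)
pose G x xi := rho x * (oscc x * (cos (Phi x xi) * p xi) + oscs x * (sin (Phi x xi) * p xi)).
have mG : measurable_fun setT (fun z : R * R => G z.1 z.2).
  apply: measurable_funM; first exact: (measurableT_comp mrho).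
  apply: measurable_funD; apply: measurable_funM => //.
    exact: (measurableT_comp measurable_oscc).
  exact: (measurableT_comp measurable_oscs).
have GB x xi : `|G x xi| <= (rho x * (P + P)) * `|p xi|.
  rewrite /G normrM (ger0_norm (rho0 x)) -mulrA ler_wpM2l// mulrDl.
  rewrite (le_trans (ler_normD _ _))// lerD// normrM ler_pM ?oscc_le ?oscs_le//.
    by rewrite normrM ler_piMl// ler_norml cos_geN1 cos_le1.
  by rewrite normrM ler_piMl// ler_norml sin_geN1 sin_le1.
have E1 : Rint (fun x => rho x * (oscc x ^+ 2 + oscs x ^+ 2)) = Rint (fun x => Rint (G x)).
  apply: eq_Rint => x; rewrite /G RintZ; last first.
    by apply: L1D; apply: L1Z; [exact: L1_oscc|exact: L1_oscs].
  rewrite RintD; [|by apply: L1Z; exact: L1_oscc|by apply: L1Z; exact: L1_oscs].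
  by rewrite !RintZ; [|exact: L1_oscs|exact: L1_oscc].
rewrite E1 (swap_Rint mG _ (L1_norm pi1) GB); last exact: L1Zr.
pose K xi eta := Rint (fun x => rho x * cos (Phi x xi - Phi x eta)).
have mK : measurable_fun setT (fun z : R * R => K z.1 z.2).
  apply: (@measurable_Rint _ _ _ (fun (z : R * R) x => rho x * cos (Phi x z.1 - Phi x z.2))).
  apply: measurable_funM; first exact: (measurableT_comp mrho).
  apply: measurable_cos_comp; apply: measurable_funB.
    apply: (measurableT_comp mPhi (_ : measurable_fun setT (fun z : (R * R) * R => (z.2, z.1.1)))).
    apply: measurable_fun_pair => //; exact: measurableT_comp.
  apply: (measurableT_comp mPhi (_ : measurable_fun setT (fun z : (R * R) * R => (z.2, z.1.2)))).
  by apply: measurable_fun_pair => //; exact: measurableT_comp.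
pose F xi eta := p xi * (p eta * K xi eta).
have E2 xi : Rint (fun x => G x xi) = Rint (F xi).
  pose H x eta := rho x * (p eta * cos (Phi x xi - Phi x eta)).
  have mPxi : measurable_fun setT (fun x => Phi x xi).
    exact: (@measurable_sec1 _ (fun y x => Phi x y) xi (measurable_swap mPhi)).
  have mH : measurable_fun setT (fun z : R * R => H z.1 z.2).
    apply: measurable_funM; first exact: (measurableT_comp mrho).
    apply: measurable_funM; first exact: (measurableT_comp mp).
    apply: measurable_cos_comp; apply: measurable_funB => //.
    exact: (measurableT_comp mPxi).
  have HB x eta : `|H x eta| <= rho x * `|p eta|.
    rewrite normrM (ger0_norm (rho0 x)) ler_wpM2l// normrM ler_piMr//.
    by rewrite ler_norml cos_geN1 cos_le1.
  have : Rint (fun x => Rint (H x)) = Rint (fun x => rho x * (cos (Phi x xi) * oscc x + sin (Phi x xi) * oscs x)).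
    apply: eq_Rint => x; rewrite RintZ; last first.
      apply: (@L1_le _ (fun xi => `|p xi|)); last 2 first.
      - exact: L1_norm.
      - by move=> eta; rewrite normrM ler_piMr// ler_norml cos_geN1 cos_le1.
      - apply: measurable_funM => //; apply: measurable_cos_comp; apply: measurable_funB => //.
        exact: measurable_sec1.
    congr (_ * _); rewrite -(RintZ _ (L1_oscc x)) -(RintZ _ (L1_oscs x)) -RintD.
    - by apply: eq_Rint => eta; rewrite cosB; ring.
    - exact: L1Z (L1_oscc x).
    - exact: L1Z (L1_oscs x).
  rewrite (swap_Rint mH rhoi (L1_norm pi1) HB) => HE.
  have Gi : L1 (fun x => rho x * (cos (Phi x xi) * oscc x + sin (Phi x xi) * oscs x)).
    apply: (@L1_le _ (fun x => rho x * (P + P))); last 2 first.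
    - exact: L1Zr.
    - move=> x; rewrite normrM (ger0_norm (rho0 x)) ler_wpM2l//.
      rewrite (le_trans (ler_normD _ _))// lerD// normrM -[leRHS]mul1r ler_pM ?oscc_le ?oscs_le//.
        by rewrite ler_norml cos_geN1 cos_le1.
      by rewrite ler_norml sin_geN1 sin_le1.
    - apply: measurable_funM => //; apply: measurable_funD; apply: measurable_funM.
      + exact: measurable_cos_comp.
      + exact: measurable_oscc.
      + exact: measurable_sin_comp.
      + exact: measurable_oscs.
  transitivity (p xi * Rint (fun x => rho x * (cos (Phi x xi) * oscc x + sin (Phi x xi) * oscs x))).
    by rewrite -RintZ//; apply: eq_Rint => x; rewrite /G; ring.
  rewrite -HE -RintZ; last first.
    apply: (@L1_Rint _ (fun eta x => H x eta) (fun eta => `|p eta|) rho) => //.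
    - exact: (measurable_swap mH).
    - exact: L1_norm.
    - by move=> x y; rewrite mulrC.
  apply: eq_Rint => eta; rewrite /F; congr (_ * _); rewrite -RintZ; last first.
    apply: (@L1_le _ rho) => //.
    - apply: measurable_funM => //; apply: measurable_cos_comp; apply: measurable_funB => //.
      exact: (@measurable_sec1 _ (fun y x => Phi x y) eta (measurable_swap mPhi)).
    - by move=> x; rewrite normrM (ger0_norm (rho0 x)) ler_piMr// ler_norml cos_geN1 cos_le1.
  by apply: eq_Rint => x; rewrite /H; ring.
under eq_Rint do rewrite E2.
apply: le_trans (ler_norm _) _.
apply: (@schur_bound _ F k (fun x => p x ^+ 2) M) => //.
- apply: measurable_funM; first exact: (measurableT_comp mp).
  by apply: measurable_funM => //; exact: (measurableT_comp mp).
- by move=> x; exact: sqr_ge0.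
- move=> x y; have q0 : 0 <= 2^-1 * ((p x ^+ 2 + p y ^+ 2) * k x y).
    by rewrite mulr_ge0// mulr_ge0// addr_ge0// sqr_ge0.
  (* Where [p] vanishes so does [F]; elsewhere the kernel bound is combined with
     [2 |p x p y| <= p x ^ 2 + p y ^ 2]. *)
  have [px|px] := eqVneq (p x) 0; first by rewrite (_ : F x y = 0) ?normr0// /F px mul0r.
  have [py|py] := eqVneq (p y) 0; first by rewrite (_ : F x y = 0) ?normr0// /F py mul0r mulr0.
  rewrite /F !normrM mulrA [leRHS]mulrA ler_pM ?mulr_ge0//; last exact: Kk.
  have := sqr_ge0 (`|p x| - `|p y|); rewrite -[p x ^+ 2]real_normK ?num_real//.
  rewrite -[p y ^+ 2]real_normK ?num_real//; nra.
Qed.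

End TstarT.

(** * Plancherel's inequality *)

Section Poisson.
Context {R : realType}.
Local Notation mu := (@lebesgue_measure R).

(** Fourier transform of [expabs e]: up to the factor [2 pi], an approximate identity of width
    [e]. *)
Definition poisson (e u : R) : R := 2 * e / (e ^+ 2 + u ^+ 2).

Lemma poisson_ge0 e u : 0 <= e -> 0 <= poisson e u.
Proof. by move=> e0; rewrite divr_ge0 ?mulr_ge0// addr_ge0// sqr_ge0. Qed.

Lemma poisson_den_gt0 (e u : R) : 0 < e -> 0 < e ^+ 2 + u ^+ 2.
Proof. by move=> e0; rewrite ltr_wpDr ?sqr_ge0// exprn_gt0. Qed.

Lemma continuous_poisson e : 0 < e -> continuous (poisson e).
Proof.
move=> e0 u; apply: cvgM; first exact: cvg_cst.
apply: cvgV; first by rewrite gt_eqF// poisson_den_gt0.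
apply: cvgD; first exact: cvg_cst.
exact: exprn_continuous.
Qed.

Lemma is_derive_poisson (e : R) (x : R) : 0 < e ->
  is_derive x 1 (fun u => 2 * atan (e^-1 * u)) (poisson e x).
Proof.
move=> e0; apply: is_derive_eq.
rewrite /poisson /GRing.scale /=; have := poisson_den_gt0 x e0 => d0.
field; rewrite !gt_eqF//=; nra.
Qed.

Lemma cvg_poissony (e : R) : 0 < e -> (2 * atan (e^-1 * u)) @[u --> +oo] --> pi.
Proof.
move=> e0; rewrite [X in _ --> X](_ : _ = 2 * (pi / 2)); last by field.
have ei : 0 < e^-1 by rewrite invr_gt0.
by apply: cvgMr; exact: (cvg_comp _ _ (gt0_cvgMry ei cvg_id) (@cvgy_atan R)).
Qed.

Lemma cvg_poissonNy (e : R) : 0 < e -> (2 * atan (e^-1 * u)) @[u --> -oo] --> - pi.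
Proof.
move=> e0; apply/cvgNy_compNP.
rewrite [X in X @ _ --> _](_ : _ = (fun u => - (2 * atan (e^-1 * u)))); last first.
  by apply/funext => u /=; rewrite mulrN atanN mulrN.
by apply: cvgN; exact: cvg_poissony.
Qed.

Lemma L1_poisson (e : R) : 0 < e -> L1 (poisson e).
Proof.
move=> e0; apply: (FTCy_L1 (continuous_poisson e0) _ (fun x => is_derive_poisson x e0)
  (cvg_poissony e0) (cvg_poissonNy e0)).
by move=> u; rewrite poisson_ge0// ltW.
Qed.

Lemma Rint_poisson (e : R) : 0 < e -> Rint (poisson e) = 2 * pi.
Proof.
move=> e0; rewrite (FTCy_Rint (continuous_poisson e0) (L1_poisson e0)
  (fun x => is_derive_poisson x e0) (cvg_poissony e0) (cvg_poissonNy e0)).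
by rewrite opprK mulr2n mulrDl mul1r.
Qed.

Lemma poisson_sym (e u v : R) : poisson e (u - v) = poisson e (v - u).
Proof. by rewrite /poisson -opprB sqrrN. Qed.

Lemma L1_poisson_shift (e v : R) : 0 < e -> L1 (fun u => poisson e (u - v)).
Proof.
move=> e0; have := L1_affine (- v) ltr01 (L1_poisson e0).
by under eq_fun do rewrite mul1r.
Qed.

Lemma Rint_poisson_shift (e v : R) : 0 < e -> Rint (fun u => poisson e (u - v)) = 2 * pi.
Proof.
move=> e0; rewrite -(Rint_poisson e0) (Rint_affine (- v) ltr01 (L1_measurable (L1_poisson e0))).
by rewrite mul1r; apply: eq_Rint => u; rewrite mul1r.
Qed.

(** Summability factor. Its transform is explicit and nonnegative, with mass [2 pi] for every [e];
    this serves both Plancherel's inequality and Fourier inversion. *)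
Definition expabs (e x : R) : R := expR (- (e * `|x|)).

Lemma expabs_ge0 e x : 0 <= expabs e x. Proof. exact: expR_ge0. Qed.

Lemma continuous_expabs e : continuous (expabs e).
Proof.
move=> x; apply: cvg_comp; last exact: continuous_expR.
apply: cvgN; apply: cvgMr; exact: norm_continuous.
Qed.

Let halfline : set R := `[0, +oo[%classic.

Lemma expR_decay (e : R) : 0 < e -> expR (- (e * x)) @[x --> +oo] --> (0 : R).
Proof.
move=> e0; exact: (cvg_comp _ _ (gt0_cvgMry e0 cvg_id) (@cvgr_expR R)).
Qed.

Lemma L1_half_exp (e : R) : 0 < e -> L1 (fun x => \1_halfline x * expR (- (e * x))).
Proof.
move=> e0; apply: L1_indicE; first exact: measurable_itv.
apply/integrableP; split.
  apply/measurable_EFinP; apply: measurable_funTS; apply: measurable_expR_comp.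
  by apply: measurableT_comp => //; exact: measurable_funM.
under eq_integral do rewrite /= ger0_norm ?expR_ge0//.
rewrite (@ge0_continuous_FTC2y _ _ (fun x => - e^-1 * expR (- (e * x))) 0 0)//.
- by rewrite -EFinB ltry.
- apply: continuous_subspaceT => x; apply: cvg_comp; last exact: continuous_expR.
  by apply: cvgN; apply: cvgMr; exact: cvg_id.
- rewrite -(mulr0 (- e^-1)); apply: cvgMr; exact: expR_decay.
- apply: cvg_at_right_filter; apply: cvgMr; apply: cvg_comp; last exact: continuous_expR.
  by apply: cvgN; apply: cvgMr; exact: cvg_id.
- move=> x _; rewrite derive1E; apply: derive_val; apply: is_derive_eq.
  by rewrite /GRing.scale /=; field; rewrite gt_eqF.
Qed.

Lemma Rint_half_expcos (e xi : R) : 0 < e ->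
  Rint (fun x => \1_halfline x * (expR (- (e * x)) * cos (x * xi))) = e / (e ^+ 2 + xi ^+ 2).
Proof.
move=> e0; have d0 := poisson_den_gt0 xi e0.
pose f x := expR (- (e * x)) * cos (x * xi).
(* Primitive of [f]: the real part of [exp ((i xi - e) x) / (i xi - e)]. *)
pose F x := (e ^+ 2 + xi ^+ 2)^-1 * (expR (- (e * x)) * (xi * sin (x * xi) - e * cos (x * xi))).
have dF (x : R) : is_derive x 1 F (f x).
  by apply: is_derive_eq; rewrite /f /GRing.scale /=; field; rewrite gt_eqF.
have cf : continuous f.
  move=> x; apply: cvgM.
    apply: cvg_comp; last exact: continuous_expR.
    by apply: cvgN; apply: cvgMr; exact: cvg_id.
  apply: cvg_comp; last exact: continuous_cos.
  by apply: cvgMl; exact: cvg_id.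
have mf : measurable_fun setT f by exact: continuous_measurable_fun.
have [|||||_ cv] := @dominated_Rint R
  (fun n x => \1_(`[0, n%:R]%classic) x * f x) (fun x => \1_halfline x * f x)
  (fun x => \1_halfline x * expR (- (e * x))).
- by move=> n; exact: measurable_indicM.
- exact: L1_half_exp.
- move=> n x; rewrite normrM normrM (ger0_norm (expR_ge0 _)) (ger0_norm (indic_ge0' _ _)).
  apply: ler_pM => //; rewrite ?indic_ge0' ?mulr_ge0 ?expR_ge0//.
    rewrite !indicE; case: (boolP (x \in `[0, n%:R]%classic)) => //.
    by rewrite inE/= in_itv/= => /andP[x0 _]; rewrite mem_set//= /halfline /= in_itv/= x0.
  by rewrite ler_piMr ?expR_ge0// ler_norml cos_geN1 cos_le1.
- apply: ae_all => x; apply: cvg_near_cst; near=> n; rewrite !indicE; congr (_%:R * _).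
  congr nat_of_bool; apply/idP/idP; rewrite !inE/= /halfline /= !in_itv/= andbT.
    by case/andP.
  move=> ->/=; rewrite (le_trans (ler_norm _))//.
  by near: n; exact: nbhs_infty_ger.
- by apply: measurable_indicM => //; exact: measurable_itv.
have E n : Rint (fun x => \1_(`[0, n%:R]%classic) x * f x) = F n%:R - F 0.
  exact: FTC_Rint.
rewrite (eq_cvg _ _ E) in cv.
have -> : e / (e ^+ 2 + xi ^+ 2) = 0 - F 0.
  by rewrite /F mulr0 oppr0 expR0 !mul0r sin0 cos0; field; rewrite gt_eqF.
apply: (cvg_unique (@norm_hausdorff R R) cv).
apply: cvgB; last exact: cvg_cst.
apply: (cvg_comp _ _ cvgr_idn (_ : F x @[x --> +oo] --> 0)).
apply: norm_cvg0.
apply: (@squeeze_cvgr _ _ _ _ (cst 0) (fun x => (e ^+ 2 + xi ^+ 2)^-1 * (expR (- (e * x)) * (`|xi| + e)))).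
- apply: nearW => x; rewrite normr_ge0 /= !normrM (ger0_norm (_ : 0 <= _^-1)) ?invr_ge0 ?(ltW d0)//.
  rewrite ler_wpM2l ?invr_ge0 ?(ltW d0)// (ger0_norm (expR_ge0 _)) ler_wpM2l ?expR_ge0//.
  rewrite (le_trans (ler_normB _ _))// lerD// normrM ?(gtr0_norm e0) ler_piMr// ?(ltW e0)//.
    by rewrite ler_norml sin_geN1 sin_le1.
  by rewrite ler_norml cos_geN1 cos_le1.
- exact: cvg_cst.
- rewrite -(mulr0 (e ^+ 2 + xi ^+ 2)^-1); apply: cvgMr.
  rewrite -(mul0r (`|xi| + e)); apply: cvgMl; exact: expR_decay.
Unshelve. all: by end_near. Qed.

Lemma L1_expabs (e : R) : 0 < e -> L1 (expabs e).
Proof.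
move=> e0; have h := L1_half_exp e0.
apply: (@L1_le _ (fun x => \1_halfline x * expR (- (e * x)) + \1_halfline (- x) * expR (- (e * (- x))))).
- by apply: continuous_measurable_fun; exact: continuous_expabs.
- apply: L1D => //; exact: (L1_opp h).
- move=> x; rewrite ger0_norm ?expabs_ge0// /expabs !indicE.
  have [x0|x0] := leP 0 x.
    rewrite mem_set ?mul1r /halfline/= ?in_itv/= ?x0//.
    by rewrite ger0_norm// lerDl mulr_ge0 ?expR_ge0.
  have hx : (- x \in halfline) = true.
    by rewrite mem_set// /halfline/= in_itv/= andbT oppr_ge0 ltW.
  by rewrite ltr0_norm// hx mul1r lerDr mulr_ge0 ?expR_ge0.
Qed.

Lemma Rint_expabs_cos (e xi : R) : 0 < e ->
  Rint (fun x => expabs e x * cos (x * xi)) = poisson e xi.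
Proof.
move=> e0; have h := L1_half_exp e0.
pose g x := \1_halfline x * (expR (- (e * x)) * cos (x * xi)).
have mg : measurable_fun setT g.
  apply: measurable_indicM; first exact: measurable_itv.
  apply: measurable_funM.
    by apply: measurable_expR_comp; apply: measurableT_comp => //; exact: measurable_funM.
  by apply: measurable_cos_comp; exact: measurable_funM.
have gi : L1 g.
  apply: L1_le h _ => // x; rewrite /g mulrA normrM ger0_norm ?mulr_ge0 ?indic_ge0' ?expR_ge0//.
  by rewrite ler_piMr ?mulr_ge0 ?indic_ge0' ?expR_ge0// ler_norml cos_geN1 cos_le1.
transitivity (Rint (fun x => g x + g (- x))).
  apply: ae_eq_Rint.
  - apply: measurable_funM; last by apply: measurable_cos_comp; exact: measurable_funM.
    by apply: continuous_measurable_fun; exact: continuous_expabs.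
  - by apply: measurable_funD => //; apply: (measurableT_comp mg); exact: oppr_measurable.
  (* The two half lines share the origin, so the splitting holds off [0] only. *)
  - exists [set 0]; split => //; first exact: lebesgue_measure_set1.
    move=> x /=; apply: contra_notP => x0; rewrite /g /expabs !indicE mulNr cosN.
    have {x0} : x != 0 by apply/eqP.
    rewrite neq_lt => /orP[x0|x0].
      rewrite ltr0_norm// memNset; last by rewrite /halfline/= in_itv/= andbT leNgt x0.
      by rewrite mem_set ?mul0r ?add0r ?mul1r// /halfline/= in_itv/= oppr_ge0 ltW.
    rewrite gtr0_norm// mem_set; last by rewrite /halfline/= in_itv/= ltW.
    by rewrite memNset ?mul0r ?addr0 ?mul1r// /halfline/= in_itv/= andbT oppr_ge0 leNgt x0.
rewrite RintD//; last exact: L1_opp.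
rewrite -Rint_opp// Rint_half_expcos// /poisson; field.
by rewrite gt_eqF// poisson_den_gt0.
Qed.

Lemma L1_expabsM (e : R) (g : R -> R) : 0 < e -> measurable_fun setT g ->
  (forall x, `|g x| <= 1) -> L1 (fun x => expabs e x * g x).
Proof.
move=> e0 mg g1; apply: L1_le (L1_expabs e0) _ => [|x].
  apply: measurable_funM => //.
  by apply: continuous_measurable_fun; exact: continuous_expabs.
by rewrite normrM ger0_norm ?expabs_ge0// ler_piMr ?expabs_ge0.
Qed.

End Poisson.

Section Plancherel.
Context {R : realType}.
Local Notation mu := (@lebesgue_measure R).

(** With the factor [expabs] of parameter [1 / (n + 1)] as [rho], the kernel of T* T is a Poisson
    kernel, so Schur's test yields the constant [2 pi] for every [n]; Fatou then removes the
    factor. *)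
Lemma plancherel_le (p : R -> R) : L1 p -> L1 (fun x => p x ^+ 2) ->
  (\int[mu]_x (oscc *%R p x ^+ 2 + oscs *%R p x ^+ 2)%:E <=
    (2 * pi * Rint (fun x => p x ^+ 2))%:E)%E.
Proof.
move=> p1 p2.
have mPhi : measurable_fun setT (fun z : R * R => z.1 * z.2) by exact: measurable_funM.
have mc := measurable_oscc mPhi p1; have ms := measurable_oscs mPhi p1.
have e0 n : 0 < (n.+1%:R^-1 : R) by rewrite invr_gt0.
apply: (@integral_limit_le _ (fun n x => expabs n.+1%:R^-1 x *
  (oscc *%R p x ^+ 2 + oscs *%R p x ^+ 2))).
- move=> n; apply: measurable_funM; first by apply: continuous_measurable_fun; exact: continuous_expabs.
  by apply: measurable_funD; exact: measurable_sqr.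
- by apply: measurable_funD; exact: measurable_sqr.
- by move=> n x; rewrite mulr_ge0 ?expabs_ge0// addr_ge0// sqr_ge0.
- apply: ae_all => x; rewrite -[X in _ --> X]mul1r; apply: cvgMl.
  suff : expabs n.+1%:R^-1 x @[n --> \oo] --> expR (- (0 * `|x|)).
    by rewrite mul0r oppr0 expR0.
  apply: cvg_comp; last exact: continuous_expR.
  by apply: cvgN; apply: cvgMr_tmp; exact: cvg_harmonic.
- move=> n; have ei := L1_expabs (e0 n).
  have Li := L1_osc_sqr mPhi ei (expabs_ge0 _) p1.
  rewrite (RintE Li) lee_fin.
  apply: (@TstarT _ _ _ _ mPhi ei (expabs_ge0 _) p1 p2 (fun xi eta => poisson n.+1%:R^-1 (xi - eta))).
  + apply: (measurableT_comp (continuous_measurable_fun (continuous_poisson (e0 n)))).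
    exact: measurable_funB.
  + by move=> x y; apply: poisson_ge0; exact: ltW.
  + move=> xi; under eq_integral do rewrite poisson_sym.
    by rewrite RintE ?Rint_poisson_shift//; exact: L1_poisson_shift.
  + by move=> eta; rewrite RintE ?Rint_poisson_shift//; exact: L1_poisson_shift.
  + move=> xi eta; under eq_Rint do rewrite -mulrBr.
    by rewrite Rint_expabs_cos// ger0_norm// poisson_ge0// ltW.
Qed.

End Plancherel.

(** * Schwartz functions *)

Section Real_schwartz.
Context {R : realType}.
Local Notation mu := (@lebesgue_measure R).
Implicit Types (u v f : R -> R).

(** Real Schwartz functions, with bounds given by witnesses; [schwartzP] relates them to the
    seminorms. *)
Definition rschwartz u := (forall n (x : R), derivable (derive1n n u) x 1) /\
  forall k j : nat, exists M, forall x, `|x| ^+ k * `|derive1n j u x| <= M.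

Lemma derive1nSr n u : derive1n n.+1 u = derive1n n (derive1 u).
Proof. by rewrite /derive1n iterSr. Qed.

Lemma is_derive_derive1n u n (x : R) : rschwartz u ->
  is_derive x 1 (derive1n n u) (derive1n n.+1 u x).
Proof. by move=> [du _]; split => //=; rewrite derive1E. Qed.

Lemma is_derive1_fun f g (h : forall x : R, is_derive x 1 f (g x)) : derive1 f = g.
Proof. by apply/funext => x; rewrite derive1E; have [_] := h x. Qed.

Lemma rschwartz_lin a b u v : rschwartz u -> rschwartz v ->
  rschwartz (fun x => a * u x + b * v x).
Proof.
move=> Su Sv.
have E n : derive1n n (fun x => a * u x + b * v x) =
    fun x => a * derive1n n u x + b * derive1n n v x.
  elim: n => // n IH; rewrite derive1nS IH; apply: is_derive1_fun => x.
  have du := is_derive_derive1n n x Su; have dv := is_derive_derive1n n x Sv.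
  by apply: is_derive_eq; rewrite /GRing.scale /=.
split=> [n x|k j].
  rewrite E; have du := is_derive_derive1n n x Su; have dv := is_derive_derive1n n x Sv.
  by apply: ex_derive.
have [M HM] := Su.2 k j; have [N HN] := Sv.2 k j.
exists (`|a| * M + `|b| * N) => x; rewrite E.
have xk : 0 <= `|x| ^+ k by rewrite exprn_ge0.
apply: le_trans (_ : `|x| ^+ k * (`|a| * `|derive1n j u x| + `|b| * `|derive1n j v x|) <= _).
  by rewrite ler_wpM2l// (le_trans (ler_normD _ _))// !normrM.
by rewrite mulrDr lerD// mulrCA ler_wpM2l.
Qed.

Lemma rschwartzN u : rschwartz u -> rschwartz (fun x => - u x).
Proof.
move=> Su; have := rschwartz_lin (-1) 0 Su Su.
by under eq_fun do rewrite mulN1r mul0r addr0.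
Qed.

Lemma rschwartzD u v : rschwartz u -> rschwartz v -> rschwartz (fun x => u x + v x).
Proof.
move=> Su Sv; have := rschwartz_lin 1 1 Su Sv.
by under eq_fun do rewrite !mul1r.
Qed.

Lemma rschwartzZ a u : rschwartz u -> rschwartz (fun x => a * u x).
Proof.
move=> Su; have := rschwartz_lin a 0 Su Su.
by under eq_fun do rewrite mul0r addr0.
Qed.

Lemma rschwartz_derive u : rschwartz u -> rschwartz (derive1 u).
Proof.
move=> [du bu]; split=> [n x|k j]; rewrite -derive1nSr; [exact: du|exact: bu].
Qed.

Lemma rschwartz_mulx u : rschwartz u -> rschwartz (fun x => x * u x).
Proof.
move=> Su.
(* Leibniz rule. For [n = 0] the truncated predecessor does no harm, its coefficient being 0. *)
have E n : derive1n n (fun x => x * u x) =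
    fun x => x * derive1n n u x + n%:R * derive1n n.-1 u x.
  elim: n => [|n IH]; first by apply/funext => x /=; rewrite mul0r addr0.
  rewrite derive1nS IH; apply: is_derive1_fun => x.
  have du := is_derive_derive1n n x Su; have dv := is_derive_derive1n n.-1 x Su.
  apply: is_derive_eq; rewrite /GRing.scale /= ?mulr1.
  by case: n du dv {IH} => [|n] du dv /=; rewrite -?[n.+2%:R]natr1 -?[n.+1%:R]natr1; ring.
split=> [n x|k j].
  rewrite E; have du := is_derive_derive1n n x Su; have dv := is_derive_derive1n n.-1 x Su.
  by apply: ex_derive.
have [M HM] := Su.2 k.+1 j; have [N HN] := Su.2 k j.-1.
exists (M + j%:R * N) => x; rewrite E.
have xk : 0 <= `|x| ^+ k by rewrite exprn_ge0.
apply: le_trans (_ : `|x| ^+ k * (`|x| * `|derive1n j u x| + j%:R * `|derive1n j.-1 u x|) <= _).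
  by rewrite ler_wpM2l// (le_trans (ler_normD _ _))// !normrM normr_nat.
rewrite mulrDr mulrA -exprSr lerD// mulrCA ler_wpM2l//.
Qed.

Lemma rschwartz_is_derive u (x : R) : rschwartz u -> is_derive x 1 u (derive1 u x).
Proof. exact: (@is_derive_derive1n u 0 x). Qed.

Lemma rschwartz_continuous u : rschwartz u -> continuous u.
Proof.
by move=> [du _] x; apply/differentiable_continuous/derivable1_diffP; exact: (du 0%N x).
Qed.

Lemma rschwartz_measurable u : rschwartz u -> measurable_fun setT u.
Proof. by move=> /rschwartz_continuous; exact: continuous_measurable_fun. Qed.

Lemma rschwartz_bounded u : rschwartz u -> exists M, forall x, `|u x| <= M.
Proof. by move=> [_ /(_ 0 0)[M HM]]; exists M => x; have := HM x; rewrite expr0 mul1r. Qed.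

Lemma rschwartz_L1 u : rschwartz u -> L1 u.
Proof.
move=> Su; have [M HM] := Su.2 0 0; have [N HN] := Su.2 2 0.
(* The majorant is [(M + N) / (1 + x^2)], written through the Poisson kernel of width 1. *)
apply: (@L1_le _ (fun x => ((M + N) / 2) * poisson 1 x)).
- exact: rschwartz_measurable.
- by apply: L1Z; exact: L1_poisson.
- move=> x; rewrite /poisson expr1n mulr1 mulrA divfK//.
  have d0 : 0 < 1 + x ^+ 2 by rewrite ltr_wpDr ?sqr_ge0.
  rewrite ler_pdivlMr// mulrDr mulr1 lerD//.
    by have := HM x; rewrite expr0 mul1r.
  by have := HN x; rewrite mulrC real_normK ?num_real.
Qed.

Lemma rschwartz_L1_sqr u : rschwartz u -> L1 (fun x => u x ^+ 2).
Proof.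
move=> Su; have [M HM] := rschwartz_bounded Su.
apply: (@L1_le _ (fun x => M * `|u x|)).
- by apply: measurable_sqr; exact: rschwartz_measurable.
- by apply: L1Z; apply: L1_norm; exact: rschwartz_L1.
- by move=> x; rewrite normrX expr2 ler_wpM2r.
Qed.

Lemma rschwartz_cvg0 u : rschwartz u -> u x @[x --> +oo] --> 0 /\ u x @[x --> -oo] --> 0.
Proof.
move=> Su; have [M HM] := Su.2 1 0.
have M0 : 0 <= M by have := HM 0; apply: le_trans; rewrite mulr_ge0// exprn_ge0.
have key e : 0 < e -> forall x, (M + 1) / e < `|x| -> `|u x| <= e.
  move=> e0 x; rewrite ltr_pdivrMr// => H.
  have := HM x; rewrite expr1 /= => Hx.
  have xp : 0 < `|x| by rewrite -(pmulr_lgt0 _ e0); lra.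
  by rewrite -(ler_pM2l xp); lra.
split; apply/cvgrPdist_le => e e0; near=> x; rewrite sub0r normrN; apply: key => //.
- apply: lt_le_trans (ler_norm _).
  by near: x; apply: nbhs_pinfty_gt; rewrite num_real.
- rewrite -normrN; apply: lt_le_trans (ler_norm _); rewrite ltrNr.
  by near: x; apply: nbhs_ninfty_lt; rewrite num_real.
Unshelve. all: by end_near. Qed.

End Real_schwartz.

(** * Cosine and sine transforms of Schwartz functions, Fourier inversion *)

Section Cosine_sine_transforms.
Context {R : realType}.
Local Notation mu := (@lebesgue_measure R).
Implicit Types (u v f : R -> R).

Definition cosT u : R -> R := oscc *%R u.
Definition sinT u : R -> R := oscs *%R u.

Lemma measurable_mulr2 : measurable_fun setT (fun z : R * R => z.1 * z.2).
Proof. exact: measurable_funM. Qed.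

Lemma L1_cosT u x : L1 u -> L1 (fun y => cos (x * y) * u y).
Proof. by move=> ui; exact: (@L1_oscc R ( *%R ) u measurable_mulr2 ui x). Qed.

Lemma L1_sinT u x : L1 u -> L1 (fun y => sin (x * y) * u y).
Proof. by move=> ui; exact: (@L1_oscs R ( *%R ) u measurable_mulr2 ui x). Qed.

(** Differentiation under the integral sign: [|y u y|] dominates the derivative uniformly in the
    parameter. *)
Lemma is_derive_cosT u (xi : R) : rschwartz u ->
  is_derive xi 1 (cosT u) (sinT (fun x => - (x * u x)) xi).
Proof.
move=> Su; have ui := rschwartz_L1 Su; have xui := rschwartz_L1 (rschwartz_mulx Su).
pose f (z y : R) := cos (z * y) * u y.
have df (z y : R) : is_derive z 1 (f ^~ y) (sin (z * y) * - (y * u y)).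
  by apply: is_derive_eq; rewrite /GRing.scale /=; ring.
have hI : `](xi - 1), (xi + 1)[%classic xi by rewrite /= in_itv/= ltrBlDr ltrDl ltr01.
have intf z : `](xi - 1), (xi + 1)[%classic z -> mu.-integrable setT (EFin \o f z).
  by move=> _; exact: L1_cosT.
have d1f z y : partial1of2 f z y = sin (z * y) * - (y * u y).
  by rewrite partial1of2E; have [_] := df z y.
have Gub z y : `](xi - 1), (xi + 1)[%classic z -> setT y -> `|partial1of2 f z y| <= `|y * u y|.
  by move=> _ _; rewrite d1f normrM normrN ler_piMl// ler_norml sin_geN1 sin_le1.
have derf z y : `](xi - 1), (xi + 1)[%classic z -> setT y -> derivable (f ^~ y) z 1.
  by move=> _ _; have [] := df z y.
have D := @derivable_under_integral R _ _ mu f setT measurableT xi (xi - 1) (xi + 1) hI intf derf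
  (fun y => `|y * u y|) (fun y => normr_ge0 _) (L1_norm xui) Gub.
have E := @differentiation_under_integral R _ _ mu f setT measurableT xi (xi - 1) (xi + 1) hI intf derf
  (fun y => `|y * u y|) (fun y => normr_ge0 _) (L1_norm xui) Gub.
split; first exact: D.
rewrite -derive1E; apply: etrans E _.
by apply: eq_Rint => y; rewrite d1f.
Qed.

Lemma is_derive_sinT u (xi : R) : rschwartz u ->
  is_derive xi 1 (sinT u) (cosT (fun x => x * u x) xi).
Proof.
move=> Su; have ui := rschwartz_L1 Su; have xui := rschwartz_L1 (rschwartz_mulx Su).
pose f (z y : R) := sin (z * y) * u y.
have df (z y : R) : is_derive z 1 (f ^~ y) (cos (z * y) * (y * u y)).
  by apply: is_derive_eq; rewrite /GRing.scale /=; ring.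
have hI : `](xi - 1), (xi + 1)[%classic xi by rewrite /= in_itv/= ltrBlDr ltrDl ltr01.
have intf z : `](xi - 1), (xi + 1)[%classic z -> mu.-integrable setT (EFin \o f z).
  by move=> _; exact: L1_sinT.
have d1f z y : partial1of2 f z y = cos (z * y) * (y * u y).
  by rewrite partial1of2E; have [_] := df z y.
have Gub z y : `](xi - 1), (xi + 1)[%classic z -> setT y -> `|partial1of2 f z y| <= `|y * u y|.
  by move=> _ _; rewrite d1f normrM ler_piMl// ler_norml cos_geN1 cos_le1.
have derf z y : `](xi - 1), (xi + 1)[%classic z -> setT y -> derivable (f ^~ y) z 1.
  by move=> _ _; have [] := df z y.
have D := @derivable_under_integral R _ _ mu f setT measurableT xi (xi - 1) (xi + 1) hI intf derf
  (fun y => `|y * u y|) (fun y => normr_ge0 _) (L1_norm xui) Gub.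
have E := @differentiation_under_integral R _ _ mu f setT measurableT xi (xi - 1) (xi + 1) hI intf derf
  (fun y => `|y * u y|) (fun y => normr_ge0 _) (L1_norm xui) Gub.
split; first exact: D.
rewrite -derive1E; apply: etrans E _.
by apply: eq_Rint => y; rewrite d1f.
Qed.

Lemma cvg0_bddM (F : set_system R) {FF : Filter F} (g h : R -> R) :
  (forall x, `|g x| <= 1) -> h x @[x --> F] --> 0 -> (g x * h x) @[x --> F] --> 0.
Proof.
move=> g1 h0; apply: norm_cvg0.
apply: (@squeeze_cvgr _ _ _ _ (cst 0) (fun x => `|h x|)).
- by apply: nearW => x; rewrite normr_ge0/= normrM ler_piMl.
- exact: cvg_cst.
- by rewrite -(@normr0 _ R); exact: cvg_norm.
Qed.

(** Integration by parts: the derivative of [sin (xi x) u x] has integral 0 because [u] tends to 0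
    at both ends. *)
Lemma mul_cosT u xi : rschwartz u -> xi * cosT u xi = sinT (fun x => - derive1 u x) xi.
Proof.
move=> Su; have Sd := rschwartz_derive Su; have ui := rschwartz_L1 Su.
have di := rschwartz_L1 Sd.
pose F x := sin (xi * x) * u x.
pose f x := xi * (cos (xi * x) * u x) + sin (xi * x) * derive1 u x.
have dF (x : R) : is_derive x 1 F (f x).
  have du := rschwartz_is_derive x Su.
  by apply: is_derive_eq; rewrite /f /GRing.scale /=; ring.
have fi : L1 f by apply: L1D; [apply: L1Z; exact: L1_cosT|exact: L1_sinT].
have cf : continuous f.
  have cx : continuous (fun x : R => xi * x) by move=> x; apply: cvgMr; exact: cvg_id.
  move=> x; apply: cvgD.
    apply: cvgMr; apply: cvgM; last exact: rschwartz_continuous.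
    by apply: cvg_comp; [exact: cx|exact: continuous_cos].
  apply: cvgM; last exact: rschwartz_continuous.
  by apply: cvg_comp; [exact: cx|exact: continuous_sin].
have [up un] := rschwartz_cvg0 Su.
have s1 x : `|sin (xi * x)| <= 1 by rewrite ler_norml sin_geN1 sin_le1.
have c1 : F x @[x --> +oo] --> 0 by exact: cvg0_bddM.
have c2 : F x @[x --> -oo] --> 0 by exact: cvg0_bddM.
have := FTCy_Rint cf fi dF c1 c2.
rewrite subrr /f RintD; [|by apply: L1Z; exact: L1_cosT|exact: L1_sinT].
rewrite RintZ; last exact: L1_cosT.
move=> /eqP; rewrite addr_eq0 => /eqP ->; rewrite -RintN; last exact: L1_sinT.
by apply: eq_Rint => x; rewrite mulrN.
Qed.

Lemma mul_sinT u xi : rschwartz u -> xi * sinT u xi = cosT (derive1 u) xi.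
Proof.
move=> Su; have Sd := rschwartz_derive Su; have ui := rschwartz_L1 Su.
have di := rschwartz_L1 Sd.
pose F x := cos (xi * x) * u x.
pose f x := cos (xi * x) * derive1 u x - xi * (sin (xi * x) * u x).
have dF (x : R) : is_derive x 1 F (f x).
  have du := rschwartz_is_derive x Su.
  by apply: is_derive_eq; rewrite /f /GRing.scale /=; ring.
have fi : L1 f by apply: L1B; [exact: L1_cosT|apply: L1Z; exact: L1_sinT].
have cf : continuous f.
  have cx : continuous (fun x : R => xi * x) by move=> x; apply: cvgMr; exact: cvg_id.
  move=> x; apply: cvgB.
    apply: cvgM; last exact: rschwartz_continuous.
    by apply: cvg_comp; [exact: cx|exact: continuous_cos].
  apply: cvgMr; apply: cvgM; last exact: rschwartz_continuous.
  by apply: cvg_comp; [exact: cx|exact: continuous_sin].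
have [up un] := rschwartz_cvg0 Su.
have s1 x : `|cos (xi * x)| <= 1 by rewrite ler_norml cos_geN1 cos_le1.
have c1 : F x @[x --> +oo] --> 0 by exact: cvg0_bddM.
have c2 : F x @[x --> -oo] --> 0 by exact: cvg0_bddM.
have := FTCy_Rint cf fi dF c1 c2.
rewrite subrr /f RintB; [|exact: L1_cosT|by apply: L1Z; exact: L1_sinT].
by rewrite RintZ; [move/subr0_eq => H; exact/esym|exact: L1_sinT].
Qed.

(** This class is stable under differentiation and under multiplication by the variable, and its
    members are bounded; all Schwartz bounds follow from these three facts. *)
Let transf f := exists2 u, rschwartz u & f = cosT u \/ f = sinT u.

Let transf_derive f : transf f -> (forall x : R, derivable f x 1) /\ transf (derive1 f).
Proof.
move=> [u Su [->|->]].
  split; first by move=> x; have [] := is_derive_cosT x Su.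
  exists (fun x => - (x * u x)); first by apply: rschwartzN; exact: rschwartz_mulx.
  by right; apply: is_derive1_fun => x; exact: is_derive_cosT.
split; first by move=> x; have [] := is_derive_sinT x Su.
exists (fun x => x * u x); first exact: rschwartz_mulx.
by left; apply: is_derive1_fun => x; exact: is_derive_sinT.
Qed.

Let transf_mulx f : transf f -> transf (fun x => x * f x).
Proof.
move=> [u Su [->|->]].
  exists (fun x => - derive1 u x); first by apply: rschwartzN; exact: rschwartz_derive.
  by right; apply/funext => x; exact: mul_cosT.
exists (derive1 u); first exact: rschwartz_derive.
by left; apply/funext => x; exact: mul_sinT.
Qed.

Let transf_bounded f : transf f -> exists M, forall x, `|f x| <= M.
Proof.
move=> [u Su [->|->]]; exists (Rint (fun x => `|u x|)) => x.
  by apply: (oscc_le measurable_mulr2); exact: rschwartz_L1.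
by apply: (oscs_le measurable_mulr2); exact: rschwartz_L1.
Qed.

Let transf_schwartz f : transf f -> rschwartz f.
Proof.
move=> Tf; have Tn n : transf (derive1n n f) by elim: n => // n /transf_derive[].
split=> [n x|k j]; first by have [] := transf_derive (Tn n).
have Tk : transf (fun x => x ^+ k * derive1n j f x).
  elim: k => [|k IH]; first by under eq_fun do rewrite expr0 mul1r; exact: Tn.
  by under eq_fun do rewrite exprS -mulrA; exact: transf_mulx.
by have [M HM] := transf_bounded Tk; exists M => x; rewrite -normrX -normrM.
Qed.

Lemma rschwartz_cosT u : rschwartz u -> rschwartz (cosT u).
Proof. by move=> Su; apply: transf_schwartz; exists u => //; left. Qed.

Lemma rschwartz_sinT u : rschwartz u -> rschwartz (sinT u).
Proof. by move=> Su; apply: transf_schwartz; exists u => //; right. Qed.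

Lemma cosT_even u x : cosT u (- x) = cosT u x.
Proof. by apply: eq_Rint => y; rewrite mulNr cosN. Qed.

Lemma sinT_odd u x : L1 u -> sinT u (- x) = - sinT u x.
Proof.
move=> ui; rewrite /sinT /oscs -RintN; last exact: L1_sinT.
by apply: eq_Rint => y; rewrite mulNr sinN mulNr.
Qed.

Lemma Rint_odd f : L1 f -> (forall x, f (- x) = - f x) -> Rint f = 0.
Proof.
move=> fi fo; suff : Rint f = - Rint f by move=> H; lra.
rewrite -RintN// {1}Rint_opp; last exact: L1_measurable fi.
exact: eq_Rint.
Qed.

Lemma cosT_sinT u x : L1 u -> L1 (sinT u) -> cosT (sinT u) x = 0.
Proof.
move=> ui si; apply: Rint_odd; first exact: L1_cosT.
by move=> y; rewrite mulrN cosN sinT_odd// mulrN.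
Qed.

Lemma sinT_cosT u x : L1 (cosT u) -> sinT (cosT u) x = 0.
Proof.
move=> ci; apply: Rint_odd; first exact: L1_sinT.
by move=> y; rewrite mulrN sinN cosT_even mulNr.
Qed.

(** Rescaling moves the width from the kernel into the argument of [u], so that dominated
    convergence applies with the fixed kernel [poisson 1]. *)
Lemma poisson_approx u x : continuous u -> L1 u -> (exists M, forall y, `|u y| <= M) ->
  Rint (fun y => u y * poisson n.+1%:R^-1 (y - x)) @[n --> \oo] --> 2 * pi * u x.
Proof.
move=> cu ui [M HM].
have e0 n : 0 < (n.+1%:R^-1 : R) by rewrite invr_gt0.
have P1 := L1_poisson (@ltr01 R).
have PL n : L1 (fun y => u y * poisson n.+1%:R^-1 (y - x)).
  apply: (@L1_le _ (fun y => M * poisson n.+1%:R^-1 (y - x))).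
  - apply: measurable_funM; first exact: continuous_measurable_fun.
    exact: L1_measurable (L1_poisson_shift x (e0 n)).
  - by apply: L1Z; exact: L1_poisson_shift.
  - move=> y; rewrite normrM ler_pM//.
    by rewrite ger0_norm// poisson_ge0// ltW.
have E n : Rint (fun y => u y * poisson n.+1%:R^-1 (y - x)) =
    Rint (fun z => u (n.+1%:R^-1 * z + x) * poisson 1 z).
  rewrite (Rint_affine x (e0 n)); last exact: L1_measurable (PL n).
  rewrite -RintZ; last exact: (L1_affine x (e0 n) (PL n)).
  apply: eq_Rint => z; rewrite mulrCA; congr (_ * _); rewrite addrK.
  have := e0 n; set e := _^-1 => {}e0.
  have d0 := poisson_den_gt0 z (@ltr01 R); have d1 := poisson_den_gt0 (e * z) e0.
  rewrite /poisson; rewrite expr1n in d0 *.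
  by field; rewrite !gt_eqF.
rewrite (eq_cvg _ _ E).
have -> : 2 * pi * u x = Rint (fun z => u x * poisson 1 z).
  by rewrite RintZ// Rint_poisson// mulrC.
apply: (dominated_Rint (g := fun z => M * poisson 1 z) _ _ _ _ _).2.
- move=> n; apply: measurable_funM; last exact: L1_measurable.
  by apply: measurable_comp_affine; exact: continuous_measurable_fun.
- exact: L1Z.
- by move=> n z; rewrite normrM ler_pM// ger0_norm// poisson_ge0.
- apply: ae_all => z; apply: cvgMl.
  apply: (cvg_comp (fun n => n.+1%:R^-1 * z + x) u); last exact: cu.
  suff : n.+1%:R^-1 * z + x @[n --> \oo] --> 0 * z + x by rewrite mul0r add0r.
  apply: cvgD; last exact: cvg_cst.
  apply: cvgMr_tmp; exact: cvg_harmonic.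
- by apply: L1_measurable; exact: L1Z.
Qed.

(** Inserting [expabs] permits the exchange of integrals and turns the left side into a Poisson
    average of [u]. As the width tends to 0, dominated convergence on one side and [poisson_approx]
    on the other identify the limit. *)
Lemma cosT_sinT_inversion u x : rschwartz u ->
  cosT (cosT u) x + sinT (sinT u) x = 2 * pi * u x.
Proof.
move=> Su; have ui := rschwartz_L1 Su.
have Ai := rschwartz_L1 (rschwartz_cosT Su); have Bi := rschwartz_L1 (rschwartz_sinT Su).
have e0 n : 0 < (n.+1%:R^-1 : R) by rewrite invr_gt0.
pose h xi := cos (x * xi) * cosT u xi + sin (x * xi) * sinT u xi.
have hi : L1 h by apply: L1D; [exact: L1_cosT|exact: L1_sinT].
have -> : cosT (cosT u) x + sinT (sinT u) x = Rint h.
  by rewrite RintD//; [exact: L1_cosT|exact: L1_sinT].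
have cv1 : Rint (fun xi => expabs n.+1%:R^-1 xi * h xi) @[n --> \oo] --> Rint h.
  apply: (dominated_Rint (g := fun xi => `|h xi|) _ _ _ _ _).2.
  - move=> n; apply: measurable_funM; last exact: L1_measurable.
    by apply: continuous_measurable_fun; exact: continuous_expabs.
  - exact: L1_norm.
  - move=> n xi; rewrite normrM ger0_norm ?expabs_ge0// ler_piMl//.
    by rewrite /expabs expR_le1 oppr_le0 mulr_ge0.
  - apply: ae_all => xi; rewrite -[X in _ --> X]mul1r; apply: cvgMl.
    suff : expabs n.+1%:R^-1 xi @[n --> \oo] --> expR (- (0 * `|xi|)).
      by rewrite mul0r oppr0 expR0.
    apply: cvg_comp; last exact: continuous_expR.
    by apply: cvgN; apply: cvgMr_tmp; exact: cvg_harmonic.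
  - exact: L1_measurable.
apply: (cvg_unique (@norm_hausdorff R R) cv1).
have E n : Rint (fun xi => expabs n.+1%:R^-1 xi * h xi) =
    Rint (fun y => u y * poisson n.+1%:R^-1 (y - x)).
  pose F xi y := expabs n.+1%:R^-1 xi * (cos (xi * (y - x)) * u y).
  have ei := L1_expabs (e0 n).
  have mF : measurable_fun setT (fun z : R * R => F z.1 z.2).
    apply: measurable_funM.
      exact: (measurableT_comp (L1_measurable ei)).
    apply: measurable_funM; last exact: (measurableT_comp (L1_measurable ui)).
    by apply: measurable_cos_comp; apply: measurable_funM => //; exact: measurable_funB.
  have FB xi y : `|F xi y| <= expabs n.+1%:R^-1 xi * `|u y|.
    rewrite normrM ger0_norm ?expabs_ge0// ler_wpM2l ?expabs_ge0// normrM ler_piMl//.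
    by rewrite ler_norml cos_geN1 cos_le1.
  transitivity (Rint (fun xi => Rint (F xi))).
    apply: eq_Rint => xi; rewrite RintZ; last first.
      have := L1D (L1Z (cos (x * xi)) (L1_cosT xi ui)) (L1Z (sin (x * xi)) (L1_sinT xi ui)).
      congr (L1 _); apply/funext => y; rewrite mulrBr cosB [xi * x]mulrC; ring.
    congr (_ * _); rewrite /h -RintZ; last exact: L1_cosT.
    rewrite -RintZ; last exact: L1_sinT.
    rewrite -RintD; [|by apply: L1Z; exact: L1_cosT|by apply: L1Z; exact: L1_sinT].
    by apply: eq_Rint => y; rewrite mulrBr cosB [xi * x]mulrC; ring.
  rewrite (swap_Rint mF ei (L1_norm ui) FB); apply: eq_Rint => y.
  rewrite -(Rint_expabs_cos _ (e0 n)) -RintZ.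
    by apply: eq_Rint => xi; rewrite /F; ring.
  apply: L1_expabsM => //; first by apply: measurable_cos_comp; exact: measurable_funM.
  by move=> z; rewrite ler_norml cos_geN1 cos_le1.
rewrite /= (eq_cvg _ _ E); apply: poisson_approx => //.
- exact: rschwartz_continuous.
- exact: rschwartz_bounded.
Qed.

End Cosine_sine_transforms.

(** * Test functions determine a function almost everywhere *)

Section Uniqueness.
Context {R : realType}.
Local Notation mu := (@lebesgue_measure R).
Implicit Types (h : R -> R) (P : {poly R}).

(** An even power, tending with [N] to 0 inside []c - d, c + d[] and to infinity outside its
    closure, so that [expR (- bump_poly c d N)] approximates the indicator of that interval by
    Schwartz functions. *)
Definition bump_poly (c d : R) (N : nat) : {poly R} := (d^-1 *: ('X - c%:P)) ^+ (N.+1).*2.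
(** The polynomial factor makes the family stable under differentiation and under multiplication by
    powers of [x]. *)
Definition poly_bump P c d N (x : R) : R := P.[x] * expR (- (bump_poly c d N).[x]).

Lemma bump_polyE c d N x : (bump_poly c d N).[x] = (((x - c) / d) ^+ 2) ^+ N.+1.
Proof. by rewrite /bump_poly !hornerE mulrC -exprM -mul2n. Qed.

Lemma is_derive_poly_bump P c d N (x : R) :
  is_derive x 1 (poly_bump P c d N)
    (poly_bump (P^`() - P * (bump_poly c d N)^`()) c d N x).
Proof.
rewrite /poly_bump; move: (bump_poly c d N) => Q.
have d1 := is_derive_poly P x; have d2 := is_derive_poly Q x.
by apply: is_derive_eq; rewrite /GRing.scale /= hornerD hornerN hornerM; ring.
Qed.

(** Since [y^(N+1) >= y - 1] for [y >= 0], one Gaussian dominates all [N]. *)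
Lemma bump_bound (c d : R) N (x : R) : expR (- (bump_poly c d N).[x]) <= expR 1 * expR (- ((x - c) / d) ^+ 2).
Proof.
rewrite -expRD ler_expR bump_polyE; set y := _ ^+ 2; have y0 : 0 <= y by exact: sqr_ge0.
have [y1|/ltW y1] := leP y 1; last by have := ler_eXnr (ltn0Sn N) y1; lra.
have : 0 <= y ^+ N.+1 by rewrite exprn_ge0.
lra.
Qed.

Lemma monomial_bump_bounded (c d : R) N i : 0 < d ->
  exists M, forall x, `|x| ^+ i * expR (- (bump_poly c d N).[x]) <= M.
Proof.
(* [A] is chosen for [|x| <= A exp |y|]; the Gaussian then absorbs [exp (i |y|)]. *)
move=> d0; pose A := `|c| + d; have A0 : 0 <= A by rewrite addr_ge0// ltW.
exists (A ^+ i * expR (i%:R ^+ 2 + 1)) => x; set y := (x - c) / d.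
have xA : `|x| <= A * expR `|y|.
  have -> : x = c + d * y by rewrite /y mulrC divfK ?gt_eqF// addrC subrK.
  rewrite mulrDl (le_trans (ler_normD _ _))// lerD//.
    by rewrite ler_peMr// -expR0 ler_expR.
  rewrite normrM gtr0_norm// ler_wpM2l ?(ltW d0)//.
  by have := expR_ge1Dx `|y|; lra.
apply: le_trans (_ : (A ^+ i * expR `|y| ^+ i) * (expR 1 * expR (- y ^+ 2)) <= _).
  apply: ler_pM; rewrite ?exprn_ge0 ?expR_ge0//; last exact: bump_bound.
  by rewrite -exprMn lerXn2r ?nnegrE ?mulr_ge0 ?expR_ge0.
rewrite -mulrA ler_wpM2l ?exprn_ge0// -expRM_natl -!expRD ler_expR.
rewrite -[y ^+ 2]real_normK ?num_real//; have := normr_ge0 y.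
set z := `|y|; set j := i%:R => z0; have j0 : 0 <= j by rewrite /j.
nra.
Qed.

Lemma poly_bump_bounded P c d N : 0 < d -> exists M, forall x, `|poly_bump P c d N x| <= M.
Proof.
move=> d0; have /choice[M HM] := fun i => monomial_bump_bounded c N i d0.
exists (\sum_(i < size P) `|P`_i| * M i) => x.
rewrite /poly_bump horner_coef normrM (ger0_norm (expR_ge0 _)).
apply: le_trans (_ : (\sum_(i < size P) `|P`_i| * `|x| ^+ i) * expR (- (bump_poly c d N).[x]) <= _).
  rewrite ler_wpM2r ?expR_ge0// (le_trans (ler_norm_sum _ _ _))//.
  by apply: ler_sum => i _; rewrite normrM normrX.
rewrite mulr_suml; apply: ler_sum => i _.
by rewrite -mulrA ler_wpM2l.
Qed.

Lemma rschwartz_poly_bump P c d N : 0 < d -> rschwartz (poly_bump P c d N).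
Proof.
move=> d0.
have E n : exists P', derive1n n (poly_bump P c d N) = poly_bump P' c d N.
  elim: n => [|n [P' IH]]; first by exists P.
  exists (P'^`() - P' * (bump_poly c d N)^`()); rewrite derive1nS IH.
  by apply: is_derive1_fun => x; exact: is_derive_poly_bump.
split=> [n x|k j].
  by have [P' ->] := E n; have [] := is_derive_poly_bump P' c d N x.
have [P' ->] := E j; have [M HM] := poly_bump_bounded ('X^k * P') c N d0.
exists M => x; have := HM x; rewrite /poly_bump hornerM hornerXn -mulrA normrM normrX.
by [].
Qed.

Lemma cvg_bump (c d x : R) : 0 < d -> x != c - d -> x != c + d ->
  poly_bump 1 c d N x @[N --> \oo] --> (\1_(`]c - d, c + d[%classic) x : R).
Proof.
move=> d0 xn xp; rewrite /poly_bump.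
under eq_fun do rewrite hornerC mul1r bump_polyE.
set y := _ ^+ 2; have y0 : 0 <= y by exact: sqr_ge0.
have yE : (y < 1) = (x \in `]c - d, c + d[%classic).
  rewrite mem_setE in_itv/= /y -[X in X < _]real_normK ?num_real//.
  rewrite expr_lt1// normrM normfV (gtr0_norm d0) ltr_pdivrMr// mul1r.
  by rewrite ltr_distl.
rewrite indicE -yE; have [y1|y1] := ltP y 1.
  suff : expR (- y ^+ N.+1) @[N --> \oo] --> expR (- (0 : R)) by rewrite oppr0 expR0.
  apply: cvg_comp; last exact: continuous_expR.
  apply: cvgN; rewrite (cvg_shiftS (fun n => y ^+ n)).
  by apply: cvg_expr; rewrite ger0_norm.
have {}y1 : 1 < y.
  rewrite lt_neqAle y1 andbT; apply/negP => /eqP ye.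
  have e2 : (x - c) ^+ 2 = d ^+ 2.
    by move: ye; rewrite /y exprMn exprVn => /(congr1 (fun z => z * d ^+ 2)); rewrite divfK ?mul1r ?expf_neq0 ?gt_eqF.
  have /eqP : (x - c - d) * (x - c + d) = 0 by rewrite -subr_sqr e2 subrr.
  rewrite mulf_eq0 => /orP[/eqP H|/eqP H].
    by move/eqP : xp; apply; lra.
  by move/eqP : xn; apply; lra.
apply: (@squeeze_cvgr _ _ _ _ (cst 0) (fun N => y^-1 ^+ N.+1)).
- have yp : 0 < y by lra.
  apply: nearW => N; rewrite expR_ge0 /= expRN exprVn lef_pV2 ?posrE ?expR_gt0 ?(exprn_gt0 _ yp)//.
  by have := expR_ge1Dx (y ^+ N.+1); lra.
- exact: cvg_cst.
- rewrite (cvg_shiftS (fun n => y^-1 ^+ n)); apply: cvg_expr.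
  by rewrite normfV ger0_norm// invf_lt1// (lt_trans ltr01).
Qed.

(** Letting [N] grow in the bumps shows that [h] has integral 0 over every bounded open interval;
    the primitive of a truncation of [h] then vanishes identically, and Lebesgue differentiation
    gives [h = 0]. *)
Lemma ae_eq0_of_bumps h : measurable_fun setT h ->
  (forall u, rschwartz u -> L1 (fun x => h x * u x) /\ Rint (fun x => h x * u x) = 0) ->
  {ae mu, forall x, h x = 0}.
Proof.
move=> mh Hh.
have itv0 c d : 0 < d -> Rint (fun x => \1_(`]c - d, c + d[%classic) x * h x) = 0 /\
    L1 (fun x => \1_(`]c - d, c + d[%classic) x * h x).
  move=> d0; have S0 := rschwartz_poly_bump 1 c 0 d0.
  have [|||||Li cv] := @dominated_Rint R (fun N x => h x * poly_bump 1 c d N x)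
    (fun x => \1_(`]c - d, c + d[%classic) x * h x)
    (fun x => expR 1 * `|h x * poly_bump 1 c d 0 x|).
  - by move=> N; exact: L1_measurable (Hh _ (rschwartz_poly_bump 1 c N d0)).1.
  - by apply: L1Z; apply: L1_norm; exact: (Hh _ S0).1.
  (* [bump_bound] compares every [N] with [N = 0], and [h] times that one bump is integrable by
     hypothesis. *)
  - move=> N x; rewrite 2!(normrM (h x)) mulrCA ler_wpM2l// /poly_bump !hornerC !mul1r.
    rewrite !ger0_norm ?expR_ge0//; apply: le_trans (bump_bound _ _ _ _) _.
    by rewrite bump_polyE expr1.
  - have a1 : {ae mu, forall x, x != c - d}.
      exists [set c - d]; split => //; first exact: lebesgue_measure_set1.
      by move=> x /= /negP; rewrite negbK => /eqP.
    have a2 : {ae mu, forall x, x != c + d}.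
      exists [set c + d]; split => //; first exact: lebesgue_measure_set1.
      by move=> x /= /negP; rewrite negbK => /eqP.
    apply: ae_imp (ae_and a1 a2) => x [x1 x2]; rewrite mulrC; apply: cvgMr.
    exact: cvg_bump.
  - by apply: measurable_indicM => //; exact: measurable_itv.
  split=> //; apply: (cvg_unique (@norm_hausdorff R R) cv).
  have E N : Rint (fun x => h x * poly_bump 1 c d N x) = 0.
    exact: (Hh _ (rschwartz_poly_bump 1 c N d0)).2.
  by rewrite /= (eq_cvg _ _ E); exact: cvg_cst.
have key n : {ae mu, forall x, `|x| < n.+1%:R -> h x = 0}.
  pose A : set R := `]0 - n.+1%:R, 0 + n.+1%:R[%classic.
  pose k x := \1_A x * h x.
  have [_ ki] : Rint k = 0 /\ L1 k by apply: itv0.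
  have mk := L1_measurable ki.
  have kint y : mu.-integrable `]-oo, y] (EFin \o k).
    by apply: integrableS ki => //; exact: measurable_itv.
  have kloc : locally_integrable setT k.
    split; [exact: mk|exact: openT|].
    move=> K _ cK; apply: le_lt_trans (L1_lty ki).
    apply: ge0_subset_integral => //; first exact: compact_measurable.
    by apply: measurable_EFin; exact: measurable_norm.
  have F0 (x : R) : \int[mu]_(t in [set` `]-oo, x]]) (k t) = 0.
    have [xn|xn] := leP x (- n.+1%:R).
      rewrite (@eq_Rintegral _ _ _ _ _ (cst 0)).
        by rewrite Rintegral_cst ?mul0r//; exact: measurable_itv.
      move=> t; rewrite inE/= in_itv/= => tx; rewrite /k indicE memNset ?mul0r//.
      by rewrite /A /= in_itv/= sub0r => /andP[tn _]; move: (lt_le_trans tn tx); rewrite ltNge xn.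
    (* Up to an endpoint, []-oo, x]] meets the support of [k] in the interval of centre [c] and
       half-width [d]. *)
    pose y := Num.min x n.+1%:R; pose c := (y - n.+1%:R) / 2; pose d := (y + n.+1%:R) / 2.
    have ny : - n.+1%:R < y by rewrite lt_min xn/= gtrN.
    have d0 : 0 < d by rewrite divr_gt0// -ltrBlDr sub0r.
    rewrite -Rint_indic; last exact: measurable_itv.
    have [<- _] := itv0 c d d0.
    apply: ae_eq_Rint.
    - by apply: measurable_indicM => //; exact: measurable_itv.
    - by apply: measurable_indicM => //; exact: measurable_itv.
    have a1 : {ae mu, forall z, z != x}.
      exists [set x]; split => //; first exact: lebesgue_measure_set1.
      by move=> z /= /negP; rewrite negbK => /eqP.
    apply: ae_imp a1 => z zx; rewrite /k mulrA; congr (_ * _).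
    have -> : c - d = - n.+1%:R by rewrite /c /d; lra.
    have -> : c + d = y by rewrite /c /d; lra.
    rewrite !indicE -natrM mulnb; congr (nat_of_bool _)%:R.
    rewrite !mem_setE !in_itv/= sub0r add0r /y lt_min [z <= x]le_eqVlt (negbTE zx)/=.
    by case: (z < x); case: (z < n.+1%:R); rewrite ?andbT ?andbF.
  have := FTC1Ny kint kloc; apply: ae_imp => x [_].
  have -> : (fun x => \int[mu]_(t in [set` `]-oo, x]]) (k t)) = cst 0.
    by apply/funext => y; exact: F0.
  rewrite derive1_cst /k => k0 xn; move: k0.
  by rewrite indicE mem_set ?mul1r// /A /= in_itv/= sub0r add0r -ltr_norml.
apply: ae_imp (ae_forall key) => x Hx.
by apply: (Hx (Num.truncn `|x|)); exact: truncnS_gt.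
Qed.

End Uniqueness.

(** * Square integrable functions *)

Section Square_integrable.
Context {R : realType}.
Local Notation mu := (@lebesgue_measure R).
Implicit Types (f g p u : R -> R).

(** Cauchy-Schwarz for [w^(-1/2)] against [w^(1/2) x]. The induction avoids square roots: the new
    cross terms [a] and [b] satisfy [a b >= (x X)^2], hence [a + b >= 2 x X]. *)
Lemma weighted_cauchy_schwarz (I : Type) (r : seq I) (P : pred I) (w x : I -> R) :
  (forall i, P i -> 0 < w i) ->
  (\sum_(i <- r | P i) x i) ^+ 2 <=
  (\sum_(i <- r | P i) (w i)^-1) * (\sum_(i <- r | P i) w i * x i ^+ 2).
Proof.
move=> w0.
suff : [/\ 0 <= \sum_(i <- r | P i) (w i)^-1, 0 <= \sum_(i <- r | P i) w i * x i ^+ 2 &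
  (\sum_(i <- r | P i) x i) ^+ 2 <=
  (\sum_(i <- r | P i) (w i)^-1) * (\sum_(i <- r | P i) w i * x i ^+ 2)] by case.
elim: r => [|i r [IH1 IH2 IH3]]; first by rewrite !big_nil expr0n mul0r.
rewrite !big_cons; case: ifPn => // Pi; have wi := w0 i Pi.
move: IH1 IH2 IH3; set S := \sum_(_ <- _ | _) _^-1; set T := \sum_(_ <- _ | _) (_ * _).
set X := \sum_(_ <- _ | _) x _ => S0 T0 XST.
have wi' : 0 <= (w i)^-1 by rewrite invr_ge0 ltW.
have wx : 0 <= w i * x i ^+ 2 by rewrite mulr_ge0 ?sqr_ge0// ltW.
split; [exact: addr_ge0|exact: addr_ge0|].
set a := S * (w i * x i ^+ 2); set b := (w i)^-1 * T.
have a0 : 0 <= a by exact: mulr_ge0.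
have b0 : 0 <= b by exact: mulr_ge0.
have ab : (x i * X) ^+ 2 <= a * b.
  have -> : a * b = x i ^+ 2 * (S * T) by rewrite /a /b; field; rewrite gt_eqF.
  by rewrite exprMn ler_wpM2l ?sqr_ge0.
have key : 2 * (x i * X) <= a + b.
  have [|h] := leP (x i * X) 0; first by lra.
  rewrite -(@ler_pXn2r _ 2)// ?nnegrE ?(addr_ge0 a0 b0) ?(mulr_ge0 _ (ltW h))//.
  have := sqr_ge0 (a - b); nra.
have -> : ((w i)^-1 + S) * (w i * x i ^+ 2 + T) = x i ^+ 2 + S * T + (a + b).
  by rewrite /a /b; field; rewrite gt_eqF.
by rewrite sqrrD -mulr_natl; lra.
Qed.

Definition L2 f := measurable_fun setT f /\ L1 (fun x => f x ^+ 2).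

Lemma L2_le g f : measurable_fun setT f -> L2 g -> (forall x, `|f x| <= `|g x|) -> L2 f.
Proof.
move=> mf [mg gi] fg; split=> //; apply: L1_le gi _ => [|x]; first exact: measurable_sqr.
by rewrite normrX -[leRHS]real_normK ?num_real// lerXn2r ?nnegrE.
Qed.

Lemma L2Z c f : L2 f -> L2 (fun x => c * f x).
Proof.
move=> [mf fi]; split; first exact: measurable_funM.
by under eq_fun do rewrite exprMn; exact: L1Z.
Qed.

Lemma L2N f : L2 f -> L2 (fun x => - f x).
Proof. by move=> [mf fi]; split; [exact: measurableT_comp|under eq_fun do rewrite sqrrN]. Qed.

Lemma L2D f g : L2 f -> L2 g -> L2 (fun x => f x + g x).
Proof.
move=> [mf fi] [mg gi]; split; first exact: measurable_funD.
apply: (@L1_le _ (fun x => 2 * (f x ^+ 2 + g x ^+ 2))).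
- by apply: measurable_sqr; exact: measurable_funD.
- by apply: L1Z; exact: L1D.
- by move=> x; rewrite ger0_norm ?sqr_ge0//; have := sqr_ge0 (f x - g x); nra.
Qed.

Lemma L2B f g : L2 f -> L2 g -> L2 (fun x => f x - g x).
Proof. by move=> Lf Lg; apply: L2D => //; exact: L2N. Qed.

Lemma L2_mul f g : L2 f -> L2 g -> L1 (fun x => f x * g x).
Proof.
move=> [mf fi] [mg gi]; apply: (@L1_le _ (fun x => f x ^+ 2 + g x ^+ 2)).
- exact: measurable_funM.
- exact: L1D.
- move=> x; rewrite normrM -[f x ^+ 2]real_normK ?num_real// -[g x ^+ 2]real_normK ?num_real//.
  have := sqr_ge0 (`|f x| - `|g x|); have := normr_ge0 (f x); have := normr_ge0 (g x); nra.
Qed.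

Lemma L2_indicM A f : measurable A -> L2 f -> L2 (fun x => \1_A x * f x).
Proof.
move=> mA Lf; apply: (@L2_le f) => //; first by apply: measurable_indicM => //; exact: Lf.1.
by move=> x; rewrite normrM ger0_norm ?indic_ge0'// ler_piMl// indic_le1.
Qed.

Lemma rschwartz_L2 u : rschwartz u -> L2 u.
Proof. by move=> Su; split; [exact: rschwartz_measurable|exact: rschwartz_L1_sqr]. Qed.

Lemma cauchy_schwarz f g : L2 f -> L2 g ->
  Rint (fun x => f x * g x) ^+ 2 <= Rint (fun x => f x ^+ 2) * Rint (fun x => g x ^+ 2).
Proof.
move=> Lf Lg; set F := Rint (fun x => f x ^+ 2); set G := Rint (fun x => g x ^+ 2).
set I := Rint _; have Li := L2_mul Lf Lg.
have G0 : 0 <= G by apply: Rint_ge0 => x; exact: sqr_ge0.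
have key l : 0 <= F + 2 * l * I + l ^+ 2 * G.
  have -> : F + 2 * l * I + l ^+ 2 * G = Rint (fun x => (f x + l * g x) ^+ 2).
    rewrite -RintZ// -RintZ; last exact: Lg.2.
    rewrite -RintD; [|exact: Lf.2|exact: L1Z].
    rewrite -RintD; [|by apply: L1D; [exact: Lf.2|exact: L1Z]|by apply: L1Z; exact: Lg.2].
    by apply: eq_Rint => x; ring.
  by apply: Rint_ge0 => x; exact: sqr_ge0.
have [G1|G1] := eqVneq G 0.
  rewrite G1 mulr0; have [->|I0] := eqVneq I 0; first by rewrite expr0n.
  (* With [G = 0] the polynomial is affine in [l], and takes the value [-1] here. *)
  have := key (- (F + 1) / (2 * I)); rewrite G1 mulr0 addr0.
  have -> : 2 * (- (F + 1) / (2 * I)) * I = - (F + 1) by field.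
  lra.
have Gp : 0 < G by rewrite lt_neqAle eq_sym G1.
(* The point where the quadratic polynomial is minimal. *)
have := key (- I / G).
have -> : F + 2 * (- I / G) * I + (- I / G) ^+ 2 * G = F - I ^+ 2 / G by field.
by rewrite subr_ge0 ler_pdivrMr.
Qed.

Lemma Rint_sqrD_le f g : L2 f -> L2 g ->
  Rint (fun x => (f x + g x) ^+ 2) <= 2 * (Rint (fun x => f x ^+ 2) + Rint (fun x => g x ^+ 2)).
Proof.
move=> Lf Lg; rewrite -RintD; [|exact: Lf.2|exact: Lg.2].
rewrite -RintZ; last by apply: L1D; [exact: Lf.2|exact: Lg.2].
apply: le_Rint; first exact: (L2D Lf Lg).2.
  by apply: L1Z; apply: L1D; [exact: Lf.2|exact: Lg.2].
by move=> x; have := sqr_ge0 (f x - g x); nra.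
Qed.

Lemma L2_L1_indic f (a b : R) : L2 f -> L1 (fun x => \1_(`[a, b]%classic) x * f x).
Proof.
move=> Lf; have mI : measurable (`[a, b]%classic : set R) by exact: measurable_itv.
have -> : (fun x => \1_(`[a, b]%classic) x * f x) = (fun x => f x * \1_(`[a, b]%classic) x).
  by apply/funext => x; rewrite mulrC.
apply: L2_mul => //; split; first exact: measurable_indic.
under eq_fun do rewrite indic_sqr.
apply: L1_indic => //; rewrite lebesgue_measure_itv/= lte_fin.
by case: ifPn => _; rewrite -?EFinB ltry.
Qed.

Lemma tail_cvg0 f : L1 f ->
  Rint (fun x => (1 - \1_(`[- n%:R, n%:R]%classic) x) * f x) @[n --> \oo] --> 0.
Proof.
move=> fi; rewrite -(Rint0 (R := R)).
apply: (dominated_Rint (g := fun x => `|f x|) _ _ _ _ _).2 => //.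
- move=> n; apply: measurable_funM; last exact: L1_measurable.
  by apply: measurable_funB => //; apply: measurable_indic; exact: measurable_itv.
- exact: L1_norm.
- move=> n x; rewrite normrM ler_piMl// ger0_norm ?subr_ge0 ?indic_le1// gerBl.
- apply: ae_all => x; have H := @cvg_truncation R f x.
  under eq_fun do rewrite mulrBl mul1r.
  by rewrite -(subrr (f x)); apply: cvgB => //; exact: cvg_cst.
Qed.

(** Riesz-Fischer for a rapidly Cauchy sequence. The weights [2^i] turn the rate [4^(-i)] of the
    increments into a convergent sum of integrals; the integrand [H] is therefore finite almost
    everywhere, which forces pointwise convergence. *)
Lemma fast_cauchy_L2 (f : nat -> R -> R) : (forall j, L2 (f j)) ->
  (forall j, Rint (fun x => (f j.+1 x - f j x) ^+ 2) <= 4^-1 ^+ j) ->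
  exists F : R -> R, [/\ measurable_fun setT F, {ae mu, forall x, f j x @[j --> \oo] --> F x} &
    forall j, L2 (fun x => F x - f j x) /\ Rint (fun x => (F x - f j x) ^+ 2) <= 4 * 4^-1 ^+ j].
Proof.
move=> Lf Hf; pose d i x := f i.+1 x - f i x.
have q : 2 * 4^-1 = 2^-1 :> R by field.
have Ld i : L2 (d i) by exact: L2B.
(* The upper limit is measurable on the whole line and equals the limit wherever that exists. *)
pose F x := fine (limn_esup (fun j => (f j x)%:E)).
have mF : measurable_fun setT F.
  have mE n : measurable_fun setT (fun x => (f n x)%:E).
    by apply/measurable_EFinP; exact: (Lf n).1.
  exact: (measurableT_comp (fine_measurable measurableT) (measurable_fun_limn_esup mE)).
have cF : {ae mu, forall x, f j x @[j --> \oo] --> F x}.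
  pose H x := (\sum_(0 <= i <oo) (2 ^+ i * d i x ^+ 2)%:E)%E.
  have HE : (\int[mu]_x H x = \sum_(0 <= i <oo) \int[mu]_x (2 ^+ i * d i x ^+ 2)%:E)%E.
    apply: integral_nneseries => //.
    - by move=> n; apply: measurable_EFin; apply: measurable_funM => //; apply: measurable_sqr; exact: (Ld n).1.
    - by move=> n x _; rewrite lee_fin mulr_ge0 ?sqr_ge0 ?exprn_ge0.
  have Hoo : (\int[mu]_x H x < +oo)%E.
    rewrite HE; apply: le_lt_trans (ltry (2 : R)).
    apply: lime_le; first apply: is_cvg_nneseries => n _ _.
      by apply: integral_ge0 => x _; rewrite lee_fin mulr_ge0 ?sqr_ge0 ?exprn_ge0.
    apply: nearW => n; apply: (@le_trans _ _ (\sum_(0 <= i < n) ((2^-1 : R) ^+ i)%:E)%E).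
      apply: lee_sum => i _; rewrite RintE; last by apply: L1Z; exact: (Ld i).2.
      rewrite lee_fin RintZ; last exact: (Ld i).2.
      apply: le_trans (_ : 2 ^+ i * 4^-1 ^+ i <= _); first by rewrite ler_wpM2l ?exprn_ge0//; exact: Hf.
      by rewrite -exprMn q.
    rewrite sumEFin lee_fin.
    suff -> : \sum_(0 <= i < n) (2^-1 : R) ^+ i = 2 - 2 * 2^-1 ^+ n.
      by rewrite gerBl mulr_ge0// exprn_ge0.
    elim: n => [|n IH]; first by rewrite big_nil expr0 mulr1 subrr.
    by rewrite big_nat_recr//= IH exprS; field.
  have mH : measurable_fun [set: g_sigma_algebraType R.-ocitv.-measurable] H.
    apply: ge0_emeasurable_sum => //.
    - by move=> n x _ _; rewrite lee_fin mulr_ge0 ?sqr_ge0 ?exprn_ge0.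
    - by move=> n _; apply: measurable_EFin; apply: measurable_funM => //; apply: measurable_sqr; exact: (Ld n).1.
  have H0 x : (0 <= H x)%E by apply: nneseries_ge0 => n _ _; rewrite lee_fin mulr_ge0 ?sqr_ge0 ?exprn_ge0.
  have Hi : mu.-integrable setT H.
    by apply/integrableP; split => //; under eq_integral do rewrite gee0_abs//.
  have := integrable_ae measurableT Hi; apply: ae_imp => x /(_ I) Hx.
  have : cvgn (fun j => f j x).
    have -> : (fun j => f j x) = (fun j => f 0 x + series (d ^~ x) j).
      apply/funext => j; rewrite /series /= /d telescope_sumr//; ring.
    apply: is_cvgD; first exact: is_cvg_cst.
    apply: normed_cvg; apply: nondecreasing_is_cvgn.
      by apply: nondecreasing_series => *; exact: normr_ge0.
    exists (2 + fine (H x)) => _ [n _ <-]; rewrite /series /=.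
    (* [|d| <= 2^(-i) + 2^i d^2], so the series of increments converges absolutely wherever [H] is
       finite. *)
    apply: le_trans (_ : \sum_(0 <= i < n) (2^-1 ^+ i + 2 ^+ i * d i x ^+ 2) <= _).
      apply: ler_sum => i _.
      have p0 : 0 < (2 : R) ^+ i by rewrite exprn_gt0.
      have := sqr_ge0 (2 ^+ i * `|d i x| - 1); rewrite -[d i x ^+ 2]real_normK ?num_real//.
      have z0 := normr_ge0 (d i x); set z := `|_| in z0 * => h.
      have h2 : 0 <= 2 ^+ i * z ^+ 2 - 2 * z + 2^-1 ^+ i.
        have -> : 2 ^+ i * z ^+ 2 - 2 * z + 2^-1 ^+ i = (2 ^+ i * z - 1) ^+ 2 * 2^-1 ^+ i.
          by rewrite exprVn; field; rewrite gt_eqF.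
        by rewrite mulr_ge0// exprn_ge0.
      lra.
    rewrite big_split/= lerD//.
      suff -> : \sum_(0 <= i < n) (2^-1 : R) ^+ i = 2 - 2 * 2^-1 ^+ n.
        by rewrite gerBl mulr_ge0// exprn_ge0.
      elim: n => [|n IH]; first by rewrite big_nil expr0 mulr1 subrr.
      by rewrite big_nat_recr//= IH exprS; field.
    rewrite -lee_fin fineK// -sumEFin; apply: nneseries_lim_ge => i _ _.
    by rewrite lee_fin mulr_ge0 ?sqr_ge0 ?exprn_ge0.
  move=> /cvg_ex[l cl]; rewrite /F.
  have cE : (f n x)%:E @[n --> \oo] --> l%:E by apply: cvg_EFin; [exact: nearW|].
  by rewrite (cvg_limn_einf_sup cE).
exists F; split => // j.
(* The bound is uniform in [m], ready for Fatou: weighted Cauchy-Schwarz with weights [2^i] costs a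
   factor 2, and the sum of [2^i 4^(-j-i)] another factor 2. *)
have B m : Rint (fun x => (f (j + m)%N x - f j x) ^+ 2) <= 4 * 4^-1 ^+ j.
  pose S x := \sum_(i < m) 2 ^+ i * d (j + i)%N x ^+ 2.
  have LS (P : nat -> R) k : L1 (fun x => \sum_(i < k) P i * d (j + i)%N x ^+ 2).
    elim: k => [|k IH]; first by under eq_fun do rewrite big_ord0; exact: L10.
    by under eq_fun do rewrite big_ord_recr/=; apply: L1D => //; apply: L1Z; exact: (Ld _).2.
  apply: le_trans (_ : Rint (fun x => 2 * S x) <= _).
    apply: le_Rint; [exact: (L2B (Lf _) (Lf _)).2|by apply: L1Z; exact: (LS (GRing.exp 2))|].
    move=> x; have -> : f (j + m)%N x - f j x = \sum_(i < m) d (j + i)%N x.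
      elim: m {S LS} => [|m IH]; first by rewrite addn0 subrr big_ord0.
      by rewrite big_ord_recr/= -IH /d addnS; ring.
    apply: le_trans (weighted_cauchy_schwarz _ _ (w := fun i : 'I_m => 2 ^+ i) _) _.
      by move=> i _; rewrite exprn_gt0.
    rewrite ler_wpM2r//; first by apply: sumr_ge0 => i _; rewrite mulr_ge0 ?sqr_ge0 ?exprn_ge0.
    suff -> : \sum_(i < m) ((2 : R) ^+ i)^-1 = 2 - 2 * 2^-1 ^+ m.
      by rewrite gerBl mulr_ge0// exprn_ge0.
    elim: m {S LS} => [|m IH]; first by rewrite big_ord0 expr0 mulr1 subrr.
    by rewrite big_ord_recr/= IH exprS exprVn; field; rewrite expf_neq0.
  rewrite RintZ; last exact: (LS (GRing.exp 2)).
  have -> : Rint S = \sum_(i < m) 2 ^+ i * Rint (fun x => d (j + i)%N x ^+ 2).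
    rewrite /S; elim: m {S} => [|m IH].
      by under eq_Rint do rewrite big_ord0; rewrite big_ord0 Rint0.
    under eq_Rint do rewrite big_ord_recr/=.
    rewrite RintD ?IH ?big_ord_recr/= ?RintZ//; [exact: (Ld _).2|exact: (LS (GRing.exp 2))|].
    by apply: L1Z; exact: (Ld _).2.
  apply: le_trans (_ : 2 * \sum_(i < m) 4^-1 ^+ j * 2^-1 ^+ i <= _).
    rewrite ler_wpM2l//; apply: ler_sum => i _.
    apply: le_trans (_ : 2 ^+ i * 4^-1 ^+ (j + i) <= _); first by rewrite ler_wpM2l ?exprn_ge0//; exact: Hf.
    by rewrite exprD mulrCA -exprMn q.
  rewrite -mulr_sumr.
  suff : \sum_(i < m) (2^-1 : R) ^+ i <= 2.
    have : 0 <= (4^-1 : R) ^+ j by rewrite exprn_ge0.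
    nra.
  suff -> : \sum_(i < m) (2^-1 : R) ^+ i = 2 - 2 * 2^-1 ^+ m.
    by rewrite gerBl mulr_ge0// exprn_ge0.
  elim: m {S LS} => [|m IH]; first by rewrite big_ord0 expr0 mulr1 subrr.
  by rewrite big_ord_recr/= IH exprS; field.
have I : (\int[mu]_x ((F x - f j x) ^+ 2)%:E <= (4 * 4^-1 ^+ j)%:E)%E.
  apply: (@integral_limit_le _ (fun m x => (f (j + m)%N x - f j x) ^+ 2)).
  - by move=> m; apply: measurable_sqr; apply: measurable_funB; exact: (Lf _).1.
  - by apply: measurable_sqr; apply: measurable_funB => //; exact: (Lf _).1.
  - by move=> m x; exact: sqr_ge0.
  - apply: ae_imp cF => x cx; rewrite expr2; under eq_fun do rewrite expr2.
    have cs : f (j + m)%N x - f j x @[m --> \oo] --> F x - f j x.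
      apply: cvgB; last exact: cvg_cst.
      have -> : (fun m => f (j + m)%N x) = (fun m => f (m + j)%N x).
        by apply/funext => m; rewrite addnC.
      by rewrite (cvg_shiftn j (f ^~ x)).
    exact: cvgM.
  - by move=> m; rewrite RintE ?lee_fin//; exact: (L2B (Lf _) (Lf _)).2.
have mFj : measurable_fun setT (fun x => F x - f j x).
  by apply: measurable_funB => //; exact: (Lf _).1.
have LFj : L1 (fun x => (F x - f j x) ^+ 2).
  apply: L1_fin; [exact: measurable_sqr|by move=> x; exact: sqr_ge0|].
  by apply: le_lt_trans I _; exact: ltry.
by split => //; rewrite -lee_fin -RintE.
Qed.

End Square_integrable.

(** * Extension of the cosine and sine transforms to L2 *)

Section L2_transforms.
Context {R : realType}.
Local Notation mu := (@lebesgue_measure R).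
Implicit Types (f g p u : R -> R).

Lemma le_geometric_eq0 (z C q : R) : 0 <= z -> 0 <= q < 1 ->
  (forall j, z <= C * q ^+ j) -> z = 0.
Proof.
move=> z0 /andP[q0 q1] H; apply/eqP; rewrite eq_le z0 andbT leNgt; apply/negP => zp.
have cv : C * q ^+ j @[j --> \oo] --> C * 0.
  by apply: cvgMl_tmp; apply: cvg_expr; rewrite ger0_norm.
rewrite mulr0 in cv.
near \oo => j; have := H j; apply/negP; rewrite -ltNge.
by near: j; exact: (cvgr_lt _ cv).
Unshelve. all: by end_near. Qed.

Definition cut (n : nat) p : R -> R := fun x => \1_(`[- n%:R, n%:R]%classic) x * p x.

Lemma L1_cut n p : L2 p -> L1 (cut n p).
Proof. exact: L2_L1_indic. Qed.

Lemma L2_cut n p : L2 p -> L2 (cut n p).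
Proof. by apply: L2_indicM; exact: measurable_itv. Qed.

Lemma Rint_cut_le n p : L2 p -> Rint (fun x => cut n p x ^+ 2) <= Rint (fun x => p x ^+ 2).
Proof.
move=> Lp; apply: le_Rint; [exact: (L2_cut n Lp).2|exact: Lp.2|].
by move=> x; rewrite exprMn indic_sqr ler_piMl ?sqr_ge0// indic_le1.
Qed.

Lemma cut_tail p e : L2 p -> 0 < e ->
  exists n, Rint (fun x => (p x - cut n p x) ^+ 2) <= e.
Proof.
move=> Lp e0; have cv := tail_cvg0 Lp.2.
near \oo => n; exists n; apply: ltW.
rewrite (_ : Rint _ = Rint (fun x => (1 - \1_(`[- n%:R, n%:R]%classic) x) * p x ^+ 2)).
  by near: n; exact: (cvgr_lt _ cv).
apply: eq_Rint => x; rewrite /cut; set i := \1_ _ _.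
have : i ^+ 2 = i by exact: indic_sqr.
by rewrite !expr2 => H; rewrite -{2}H; ring: H.
Unshelve. all: by end_near. Qed.

Section Extension.
Variable T : (R -> R) -> R -> R.
Hypothesis TB : forall p q, L1 p -> L1 q -> forall x, T (fun y => p y - q y) x = T p x - T q x.
Hypothesis TL2 : forall p, L1 p -> L2 p ->
  L2 (T p) /\ Rint (fun x => T p x ^+ 2) <= 2 * pi * Rint (fun x => p x ^+ 2).
Hypothesis TM : forall p u, L1 p -> L1 u ->
  Rint (fun x => T p x * u x) = Rint (fun x => p x * T u x).

(** Transforms of suitable cut-offs of [p] converge rapidly by the Plancherel bound; the limit is
    pinned down by the multiplication formula against Schwartz functions, which is the form that
    distributions call for. *)
Lemma ex_L2_transform p : L2 p ->
  exists F, [/\ L2 F, Rint (fun x => F x ^+ 2) <= 2 * pi * Rint (fun x => p x ^+ 2) &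
    forall u, rschwartz u -> Rint (fun x => F x * u x) = Rint (fun x => p x * T u x)].
Proof.
move=> Lp; have pi0 : 0 < pi :> R by exact: pi_gt0.
(* Tail tolerance: a difference of two cut-offs costs a factor 2 and Plancherel [2 pi], which leaves
   [5/8] of the required [4^(-j)]. *)
have ej (j : nat) : 0 < 4^-1 ^+ j / (8 * pi) :> R by rewrite divr_gt0 ?exprn_gt0 ?mulr_gt0 ?invr_gt0.
have /choice[N HN] := fun j => cut_tail Lp (ej j).
pose f j := T (cut (N j) p).
have Lf j : L2 (f j) by exact: (TL2 (L1_cut _ Lp) (L2_cut _ Lp)).1.
have Hf j : Rint (fun x => (f j.+1 x - f j x) ^+ 2) <= 4^-1 ^+ j.
  pose D x := cut (N j.+1) p x - cut (N j) p x.
  have D1 : L1 D by apply: L1B; exact: L1_cut.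
  have D2 : L2 D by apply: L2B; exact: L2_cut.
  have -> : Rint (fun x => (f j.+1 x - f j x) ^+ 2) = Rint (fun x => T D x ^+ 2).
    by apply: eq_Rint => x; rewrite TB//; exact: L1_cut.
  apply: le_trans (TL2 D1 D2).2 _.
  have : Rint (fun x => D x ^+ 2) <= 2 * (4^-1 ^+ j.+1 / (8 * pi) + 4^-1 ^+ j / (8 * pi)).
    pose D1' x := p x - cut (N j) p x; pose D2' x := - (p x - cut (N j.+1) p x).
    have -> : Rint (fun x => D x ^+ 2) = Rint (fun x => (D1' x + D2' x) ^+ 2).
      by apply: eq_Rint => x; rewrite /D /D1' /D2'; ring.
    apply: le_trans (Rint_sqrD_le _ _) _.
    - by apply: L2B => //; exact: L2_cut.
    - by apply: L2N; apply: L2B => //; exact: L2_cut.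
    rewrite ler_wpM2l// addrC lerD//; last exact: HN.
    by apply: le_trans (HN j.+1); under eq_Rint do rewrite /D2' sqrrN.
  move=> H; apply: le_trans (_ : 2 * pi * (2 * (4^-1 ^+ j.+1 / (8 * pi) + 4^-1 ^+ j / (8 * pi))) <= _).
    by rewrite ler_wpM2l// mulr_ge0// ltW.
  have -> : 2 * pi * (2 * (4^-1 ^+ j.+1 / (8 * pi) + 4^-1 ^+ j / (8 * pi))) = (5 / 8) * 4^-1 ^+ j :> R.
    have pn : pi != 0 :> R by rewrite gt_eqF.
    by move: pn; rewrite exprS; move: (4^-1 ^+ j) (pi : R) => q P pn; field.
  have : 0 <= (4^-1 : R) ^+ j by rewrite exprn_ge0.
  lra.
have [F [mF cF HF]] := fast_cauchy_L2 Lf Hf.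
have LF : L2 F.
  have := L2D (HF 0%N).1 (Lf 0%N); congr L2; apply/funext => x; ring.
exists F; split => //.
  rewrite -lee_fin -(RintE LF.2).
  apply: (@integral_limit_le _ (fun j x => f j x ^+ 2)).
  - by move=> j; apply: measurable_sqr; exact: (Lf j).1.
  - exact: measurable_sqr.
  - by move=> j x; exact: sqr_ge0.
  - by apply: ae_imp cF => x cx; rewrite expr2; under eq_fun do rewrite expr2; exact: cvgM.
  - move=> j; rewrite RintE ?lee_fin; last exact: (Lf j).2.
    apply: le_trans (TL2 (L1_cut _ Lp) (L2_cut _ Lp)).2 _.
    by rewrite ler_wpM2l ?Rint_cut_le// mulr_ge0// ltW.
move=> u Su; have u1 := rschwartz_L1 Su; have u2 := rschwartz_L2 Su.
have LTu := (TL2 u1 u2).1.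
(* The defect [z] does not depend on [j], while Cauchy-Schwarz on both remainders bounds [z^2] by a
   multiple of [4^(-j)]. *)
pose z := Rint (fun x => F x * u x) - Rint (fun x => p x * T u x).
suff : z ^+ 2 = 0 by move=> /eqP; rewrite sqrf_eq0 subr_eq0 => /eqP.
pose U := Rint (fun x => u x ^+ 2); pose V := Rint (fun x => T u x ^+ 2).
have U0 : 0 <= U by apply: Rint_ge0 => x; exact: sqr_ge0.
have V0 : 0 <= V by apply: Rint_ge0 => x; exact: sqr_ge0.
apply: (@le_geometric_eq0 _ (2 * (4 * U + (8 * pi)^-1 * V)) 4^-1); first exact: sqr_ge0.
  by rewrite invr_ge0 ler0n invf_lt1// ltr1n.
move=> j; pose pj := cut (N j) p.
have Lpj : L2 pj by exact: L2_cut.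
have Lp' : L2 (fun x => p x - pj x) by exact: L2B.
have E : z = Rint (fun x => (F x - f j x) * u x) - Rint (fun x => (p x - pj x) * T u x).
  have -> : Rint (fun x => (F x - f j x) * u x) = Rint (fun x => F x * u x) - Rint (fun x => f j x * u x).
    rewrite -RintB; [|exact: L2_mul|exact: L2_mul].
    by apply: eq_Rint => x; rewrite mulrBl.
  have -> : Rint (fun x => (p x - pj x) * T u x) = Rint (fun x => p x * T u x) - Rint (fun x => pj x * T u x).
    rewrite -RintB; [|exact: L2_mul|exact: L2_mul].
    by apply: eq_Rint => x; rewrite mulrBl.
  rewrite /f TM//; [rewrite /z; ring|exact: L1_cut].
have H1 := cauchy_schwarz (HF j).1 u2; have H2 := cauchy_schwarz Lp' LTu.
rewrite E; set A := Rint _ in H1 *; set B := Rint _ in H2 *.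
have HA : A ^+ 2 <= 4 * 4^-1 ^+ j * U by apply: le_trans H1 _; rewrite ler_wpM2r//; exact: (HF j).2.
have HB : B ^+ 2 <= 4^-1 ^+ j / (8 * pi) * V by apply: le_trans H2 _; rewrite ler_wpM2r//; exact: HN.
have := sqr_ge0 (A + B); set q := 4^-1 ^+ j in HA HB *.
have -> : 2 * (4 * U + (8 * pi)^-1 * V) * q = 2 * (4 * q * U + q / (8 * pi) * V) by ring.
by nra.
Qed.

End Extension.

Lemma cosT_L2 p : L1 p -> L2 p ->
  L2 (cosT p) /\ Rint (fun x => cosT p x ^+ 2) <= 2 * pi * Rint (fun x => p x ^+ 2).
Proof.
move=> p1 p2; have := plancherel_le p1 p2.2.
have mc := measurable_oscc (@measurable_mulr2 R) p1; have ms := measurable_oscs (@measurable_mulr2 R) p1.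
move=> H.
have H' : (\int[mu]_x (cosT p x ^+ 2)%:E <= (2 * pi * Rint (fun x => p x ^+ 2))%:E)%E.
  apply: le_trans H; apply: ge0_le_integral => //.
  - by move=> x _; rewrite lee_fin sqr_ge0.
  - by apply: measurable_EFin; exact: measurable_sqr.
  - by apply: measurable_EFin; apply: measurable_funD; exact: measurable_sqr.
  - by move=> x _; rewrite lee_fin lerDl sqr_ge0.
have L : L1 (fun x => cosT p x ^+ 2).
  apply: L1_fin; [exact: measurable_sqr|by move=> x; exact: sqr_ge0|].
  by apply: le_lt_trans H' _; exact: ltry.
by split; [split|rewrite -lee_fin -RintE].
Qed.

Lemma sinT_L2 p : L1 p -> L2 p ->
  L2 (sinT p) /\ Rint (fun x => sinT p x ^+ 2) <= 2 * pi * Rint (fun x => p x ^+ 2).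
Proof.
move=> p1 p2; have := plancherel_le p1 p2.2.
have mc := measurable_oscc (@measurable_mulr2 R) p1; have ms := measurable_oscs (@measurable_mulr2 R) p1.
move=> H.
have H' : (\int[mu]_x (sinT p x ^+ 2)%:E <= (2 * pi * Rint (fun x => p x ^+ 2))%:E)%E.
  apply: le_trans H; apply: ge0_le_integral => //.
  - by move=> x _; rewrite lee_fin sqr_ge0.
  - by apply: measurable_EFin; exact: measurable_sqr.
  - by apply: measurable_EFin; apply: measurable_funD; exact: measurable_sqr.
  - by move=> x _; rewrite lee_fin lerDr sqr_ge0.
have L : L1 (fun x => sinT p x ^+ 2).
  apply: L1_fin; [exact: measurable_sqr|by move=> x; exact: sqr_ge0|].
  by apply: le_lt_trans H' _; exact: ltry.
by split; [split|rewrite -lee_fin -RintE].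
Qed.

Lemma cosTB p q : L1 p -> L1 q -> forall x, cosT (fun y => p y - q y) x = cosT p x - cosT q x.
Proof.
move=> p1 q1 x; rewrite /cosT /oscc -RintB; [|exact: L1_cosT|exact: L1_cosT].
by apply: eq_Rint => y; rewrite mulrBr.
Qed.

Lemma sinTB p q : L1 p -> L1 q -> forall x, sinT (fun y => p y - q y) x = sinT p x - sinT q x.
Proof.
move=> p1 q1 x; rewrite /sinT /oscs -RintB; [|exact: L1_sinT|exact: L1_sinT].
by apply: eq_Rint => y; rewrite mulrBr.
Qed.

Lemma kernel_swap (e : R -> R) p u : measurable_fun setT e -> (forall x, `|e x| <= 1) ->
  L1 p -> L1 u ->
  Rint (fun x => Rint (fun y => e (x * y) * p y) * u x) =
  Rint (fun y => p y * Rint (fun x => e (y * x) * u x)).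
Proof.
move=> me e1 p1 u1; have mp := L1_measurable p1; have mu' := L1_measurable u1.
have mxy (x : R) : measurable_fun setT (fun y : R => e (x * y)).
  by apply: (measurableT_comp me); exact: measurable_funM.
have Lk v x : L1 v -> L1 (fun y => e (x * y) * v y).
  move=> v1; apply: L1_le (L1_norm v1) _ => [|y].
    by apply: measurable_funM => //; exact: L1_measurable.
  by rewrite normrM ler_piMl.
pose F x y := e (x * y) * p y * u x.
have mF : measurable_fun setT (fun z : R * R => F z.1 z.2).
  apply: measurable_funM; last exact: (measurableT_comp mu').
  apply: measurable_funM; last exact: (measurableT_comp mp).
  by apply: (measurableT_comp me); exact: measurable_funM.
have FB x y : `|F x y| <= `|u x| * `|p y|.
  by rewrite /F !normrM mulrC ler_wpM2l// ler_piMl.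
transitivity (Rint (fun x => Rint (F x))).
  by apply: eq_Rint => x; rewrite -RintZr//; exact: Lk.
rewrite (swap_Rint mF (L1_norm u1) (L1_norm p1) FB); apply: eq_Rint => y.
rewrite -RintZ; last exact: Lk.
by apply: eq_Rint => x; rewrite /F [y * x]mulrC; ring.
Qed.

Lemma cosT_swap p u : L1 p -> L1 u ->
  Rint (fun x => cosT p x * u x) = Rint (fun x => p x * cosT u x).
Proof.
move=> p1 u1; apply: (kernel_swap (e := cos)) => //.
  by apply: continuous_measurable_fun; exact: continuous_cos.
by move=> x; rewrite ler_norml cos_geN1 cos_le1.
Qed.

Lemma sinT_swap p u : L1 p -> L1 u ->
  Rint (fun x => sinT p x * u x) = Rint (fun x => p x * sinT u x).
Proof.
move=> p1 u1; apply: (kernel_swap (e := sin)) => //.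
  by apply: continuous_measurable_fun; exact: continuous_sin.
by move=> x; rewrite ler_norml sin_geN1 sin_le1.
Qed.

Lemma ex_cosT_L2 p : L2 p ->
  exists F, [/\ L2 F, Rint (fun x => F x ^+ 2) <= 2 * pi * Rint (fun x => p x ^+ 2) &
    forall u, rschwartz u -> Rint (fun x => F x * u x) = Rint (fun x => p x * cosT u x)].
Proof. exact: (ex_L2_transform cosTB cosT_L2 cosT_swap). Qed.

Lemma ex_sinT_L2 p : L2 p ->
  exists F, [/\ L2 F, Rint (fun x => F x ^+ 2) <= 2 * pi * Rint (fun x => p x ^+ 2) &
    forall u, rschwartz u -> Rint (fun x => F x * u x) = Rint (fun x => p x * sinT u x)].
Proof. exact: (ex_L2_transform sinTB sinT_L2 sinT_swap). Qed.

End L2_transforms.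

(** * Inverse Fourier transforms of square integrable functions *)

Section Complex_functions.
Local Open Scope complex_scope.
Context {R : realType}.
Local Notation mu := (@lebesgue_measure R).
Local Notation C := R[i].
Local Notation Re := (@complex.Re R).
Local Notation Im := (@complex.Im R).
Local Notation normc := (@Normc.normc R).
Implicit Types (f g F G phi psi : R -> C) (u v p q : R -> R).

Lemma cReM (z w : C) : Re (z * w) = Re z * Re w - Im z * Im w.
Proof. by case: z; case: w. Qed.

Lemma cImM (z w : C) : Im (z * w) = Re z * Im w + Im z * Re w.
Proof. by case: z; case: w. Qed.

Lemma cReD (z w : C) : Re (z + w) = Re z + Re w.
Proof. by case: z; case: w. Qed.

Lemma cImD (z w : C) : Im (z + w) = Im z + Im w.
Proof. by case: z; case: w. Qed.

Lemma complex_ext (z w : C) : Re z = Re w -> Im z = Im w -> z = w.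
Proof. by case: z => a b; case: w => c d /= -> ->. Qed.

Lemma normc_sqr (z : C) : normc z ^+ 2 = Re z ^+ 2 + Im z ^+ 2.
Proof. by case: z => a b /=; rewrite sqr_sqrtr// addr_ge0// sqr_ge0. Qed.

Lemma normc_ge0 (z : C) : 0 <= normc z.
Proof. by case: z => a b /=; exact: sqrtr_ge0. Qed.

Lemma normc_le (z : C) : normc z <= `|Re z| + `|Im z|.
Proof.
rewrite -(@ler_pXn2r _ 2)// ?nnegrE ?normc_ge0 ?addr_ge0//.
rewrite normc_sqr sqrrD !real_normK ?num_real//.
have : 0 <= `|Re z| * `|Im z| by rewrite mulr_ge0.
by lra.
Qed.

Lemma Re_le_normc (z : C) : `|Re z| <= normc z.
Proof.
rewrite -(@ler_pXn2r _ 2)// ?nnegrE ?normc_ge0//.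
by rewrite normc_sqr real_normK ?num_real// lerDl sqr_ge0.
Qed.

Lemma Im_le_normc (z : C) : `|Im z| <= normc z.
Proof.
rewrite -(@ler_pXn2r _ 2)// ?nnegrE ?normc_ge0//.
by rewrite normc_sqr real_normK ?num_real// lerDr sqr_ge0.
Qed.

Lemma divC_real (z : C) (r : R) : r != 0 -> z / r%:C = (Re z / r) +i* (Im z / r).
Proof.
case: z => a b r0; apply/eqP; rewrite eq_sym -(inj_eq (@mulIf _ r%:C _)); last first.
  by rewrite eq_complex /= (negbTE r0).
rewrite divfK; last by rewrite eq_complex /= (negbTE r0).
by rewrite eq_complex /= !mulr0 subr0 add0r !divfK// !eqxx.
Qed.

Lemma rschwartz0 : rschwartz (fun=> 0 : R).
Proof.
have E n : derive1n n (fun=> 0 : R) = (fun=> 0).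
  by elim: n => // n IH; rewrite derive1nS IH; apply/funext => x; rewrite derive1_cst.
split=> [n x|k j]; first by rewrite E; exact: derivable_cst.
by exists 0 => x; rewrite E normr0 mulr0.
Qed.

Lemma schwartz_seminorm_ub phi : schwartz phi -> forall k j,
  schwartz_seminorm k j phi \is a fin_num /\
  forall x, `|x| ^+ k * normc (cderiven j phi x) <= fine (schwartz_seminorm k j phi).
Proof.
move=> [_ Sp] k j.
have ub x : ((`|x| ^+ k * normc (cderiven j phi x))%:E <= schwartz_seminorm k j phi)%E.
  by apply: ereal_sup_ubound; exists x.
have fn : schwartz_seminorm k j phi \is a fin_num.
  rewrite ge0_fin_numE//; apply: le_trans (ub 0).
  by rewrite lee_fin mulr_ge0 ?normc_ge0 ?exprn_ge0.
by split => // x; rewrite -lee_fin fineK.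
Qed.

(** Hands complex Schwartz functions over to the real calculus: the modulus lies between the modulus
    of each part and the sum of the two. *)
Lemma schwartzP phi : schwartz phi <->
  rschwartz (fun x => Re (phi x)) /\ rschwartz (fun x => Im (phi x)).
Proof.
split=> [Sp|[Su Sv]].
  split; split=> [n x|k j].
  - exact: (Sp.1 n x).1.
  - have [_ H] := schwartz_seminorm_ub Sp k j; exists (fine (schwartz_seminorm k j phi)) => x.
    by apply: le_trans (H x); rewrite ler_wpM2l ?exprn_ge0//; exact: (Re_le_normc (cderiven j phi x)).
  - exact: (Sp.1 n x).2.
  - have [_ H] := schwartz_seminorm_ub Sp k j; exists (fine (schwartz_seminorm k j phi)) => x.
    by apply: le_trans (H x); rewrite ler_wpM2l ?exprn_ge0//; exact: (Im_le_normc (cderiven j phi x)).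
split=> [n x|k j]; first by split; [exact: Su.1|exact: Sv.1].
have [M HM] := Su.2 k j; have [N HN] := Sv.2 k j.
apply: le_lt_trans (ltry (M + N)); apply: ge_ereal_sup => _ [x _ <-].
rewrite lee_fin; apply: le_trans (lerD (HM x) (HN x)).
by rewrite -mulrDr ler_wpM2l ?exprn_ge0//; exact: (normc_le (cderiven j phi x)).
Qed.

Lemma schwartz_real u : rschwartz u -> schwartz (fun x => u x +i* 0).
Proof. by move=> Su; apply/schwartzP; split => //=; exact: rschwartz0. Qed.

Definition ip p q := Rint (fun x => p x * q x).

Lemma ipDl p q u : L2 p -> L2 q -> L2 u -> ip (fun x => p x + q x) u = ip p u + ip q u.
Proof.
move=> Lp Lq Lu; rewrite /ip -RintD; [|exact: L2_mul|exact: L2_mul].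
by apply: eq_Rint => x; rewrite mulrDl.
Qed.

Lemma ipBl p q u : L2 p -> L2 q -> L2 u -> ip (fun x => p x - q x) u = ip p u - ip q u.
Proof.
move=> Lp Lq Lu; rewrite /ip -RintB; [|exact: L2_mul|exact: L2_mul].
by apply: eq_Rint => x; rewrite mulrBl.
Qed.

Lemma ipZl c p u : L2 p -> L2 u -> ip (fun x => c * p x) u = c * ip p u.
Proof.
move=> Lp Lu; rewrite /ip -RintZ; last exact: L2_mul.
by apply: eq_Rint => x; rewrite mulrA.
Qed.

Lemma ipC p q : ip p q = ip q p.
Proof. by apply: eq_Rint => x; rewrite mulrC. Qed.

Definition cL2 F := L2 (fun x => Re (F x)) /\ L2 (fun x => Im (F x)).
(** Squared L2 norm, kept as two real integrals so that real estimates apply to each part. *)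
Definition energy F := Rint (fun x => Re (F x) ^+ 2) + Rint (fun x => Im (F x) ^+ 2).
Definition cL1 F := L1 (fun x => Re (F x)) /\ L1 (fun x => Im (F x)).

Lemma schwartz_cL2 phi : schwartz phi -> cL2 phi.
Proof. by move=> /schwartzP[Su Sv]; split; exact: rschwartz_L2. Qed.

Lemma schwartz_cL1 phi : schwartz phi -> cL1 phi.
Proof. by move=> /schwartzP[Su Sv]; split; exact: rschwartz_L1. Qed.

Lemma cL2_measurable F : cL2 F -> cmeasurable F.
Proof. by move=> [[m1 _] [m2 _]]. Qed.

Lemma cintegral_mul F G : cL2 F -> cL2 G ->
  cintegrable (fun x => F x * G x) /\
  cintegral (fun x => F x * G x) =
   (ip (fun x => Re (F x)) (fun x => Re (G x)) - ip (fun x => Im (F x)) (fun x => Im (G x))) +i*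
   (ip (fun x => Re (F x)) (fun x => Im (G x)) + ip (fun x => Im (F x)) (fun x => Re (G x))).
Proof.
move=> [F1 F2] [G1 G2].
have eR : (fun x => Re (F x * G x)) = (fun x => Re (F x) * Re (G x) - Im (F x) * Im (G x)).
  by apply/funext => x; rewrite cReM.
have eI : (fun x => Im (F x * G x)) = (fun x => Re (F x) * Im (G x) + Im (F x) * Re (G x)).
  by apply/funext => x; rewrite cImM.
split.
  split.
    by rewrite -[X in integrable _ _ X]/(EFin \o (fun x => Re (F x * G x))) eR; apply: L1B; exact: L2_mul.
  by rewrite -[X in integrable _ _ X]/(EFin \o (fun x => Im (F x * G x))) eI; apply: L1D; exact: L2_mul.
apply: complex_ext => /=.
  by rewrite -[LHS]/(Rint (fun x => Re (F x * G x))) eR RintB//; exact: L2_mul.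
by rewrite -[LHS]/(Rint (fun x => Im (F x * G x))) eI RintD//; exact: L2_mul.
Qed.

Lemma cintegral_lin (c : C) f g : cL1 f -> cL1 g ->
  cintegral (fun x => c * f x + g x) = c * cintegral f + cintegral g.
Proof.
move=> [f1 f2] [g1 g2]; apply: complex_ext => /=.
  rewrite -[LHS]/(Rint (fun x => Re (c * f x + g x))) cReD cReM /=.
  transitivity (Rint (fun x => (Re c * Re (f x) - Im c * Im (f x)) + Re (g x))).
    by apply: eq_Rint => x; rewrite cReD cReM.
  rewrite RintD//; last by apply: L1B; exact: L1Z.
  by rewrite RintB ?RintZ//; exact: L1Z.
rewrite -[LHS]/(Rint (fun x => Im (c * f x + g x))) cImD cImM /=.
transitivity (Rint (fun x => (Re c * Im (f x) + Im c * Re (f x)) + Im (g x))).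
  by apply: eq_Rint => x; rewrite cImD cImM.
rewrite RintD//; last by apply: L1D; exact: L1Z.
by rewrite RintD ?RintZ//; exact: L1Z.
Qed.

Lemma pi2_neq0 : 2 * pi != 0 :> R.
Proof. by rewrite mulf_neq0// gt_eqF// pi_gt0. Qed.

Lemma ifourierE phi x : cL1 phi ->
  ifourier phi x =
   ((2 * pi)^-1 * (cosT (fun y => Re (phi y)) x - sinT (fun y => Im (phi y)) x)) +i*
   ((2 * pi)^-1 * (sinT (fun y => Re (phi y)) x + cosT (fun y => Im (phi y)) x)).
Proof.
move=> [u1 v1]; rewrite /ifourier divC_real ?pi2_neq0//; apply: complex_ext => /=.
  rewrite mulrC; congr (_ * _); rewrite -RintB; [|exact: L1_cosT|exact: L1_sinT].
  by apply: eq_Rint => y; rewrite cReM.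
rewrite mulrC; congr (_ * _); rewrite addrC -RintD; [|exact: L1_cosT|exact: L1_sinT].
by apply: eq_Rint => y; rewrite cImM.
Qed.

Lemma fourierE phi x : cL1 phi ->
  fourier phi x =
   (cosT (fun y => Re (phi y)) x + sinT (fun y => Im (phi y)) x) +i*
   (cosT (fun y => Im (phi y)) x - sinT (fun y => Re (phi y)) x).
Proof.
move=> [u1 v1]; rewrite /fourier; apply: complex_ext => /=.
  rewrite -RintD; [|exact: L1_cosT|exact: L1_sinT].
  by apply: eq_Rint => y; rewrite cReM /= cosN sinN [y * x]mulrC; ring.
rewrite -RintB; [|exact: L1_cosT|exact: L1_sinT].
by apply: eq_Rint => y; rewrite cImM /= cosN sinN [y * x]mulrC; ring.
Qed.

Lemma Re_ifourier phi : cL1 phi -> (fun x => Re (ifourier phi x)) =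
  (fun x => (2 * pi)^-1 * (cosT (fun y => Re (phi y)) x - sinT (fun y => Im (phi y)) x)).
Proof. by move=> h; apply/funext => x; rewrite ifourierE. Qed.

Lemma Im_ifourier phi : cL1 phi -> (fun x => Im (ifourier phi x)) =
  (fun x => (2 * pi)^-1 * (sinT (fun y => Re (phi y)) x + cosT (fun y => Im (phi y)) x)).
Proof. by move=> h; apply/funext => x; rewrite ifourierE. Qed.

Lemma schwartz_ifourier phi : schwartz phi -> schwartz (ifourier phi).
Proof.
move=> Sp; have [Su Sv] := (schwartzP phi).1 Sp; have h := schwartz_cL1 Sp.
apply/schwartzP; rewrite Re_ifourier// Im_ifourier//; split; apply: rschwartzZ; apply: rschwartzD.
- exact: rschwartz_cosT.
- by apply: rschwartzN; exact: rschwartz_sinT.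
- exact: rschwartz_sinT.
- exact: rschwartz_cosT.
Qed.

Lemma schwartz_fourier phi : schwartz phi -> schwartz (fourier phi).
Proof.
move=> Sp; have [Su Sv] := (schwartzP phi).1 Sp; have h := schwartz_cL1 Sp.
apply/schwartzP.
have -> : (fun x => Re (fourier phi x)) =
    (fun x => cosT (fun y => Re (phi y)) x + sinT (fun y => Im (phi y)) x).
  by apply/funext => x; rewrite fourierE.
have -> : (fun x => Im (fourier phi x)) =
    (fun x => cosT (fun y => Im (phi y)) x - sinT (fun y => Re (phi y)) x).
  by apply/funext => x; rewrite fourierE.
split; apply: rschwartzD.
- exact: rschwartz_cosT.
- exact: rschwartz_sinT.
- exact: rschwartz_cosT.
- by apply: rschwartzN; exact: rschwartz_sinT.
Qed.

Lemma cosTD p q x : L1 p -> L1 q -> cosT (fun y => p y + q y) x = cosT p x + cosT q x.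
Proof.
move=> p1 q1; rewrite /cosT /oscc -RintD; [|exact: L1_cosT|exact: L1_cosT].
by apply: eq_Rint => y; rewrite mulrDr.
Qed.

Lemma sinTD p q x : L1 p -> L1 q -> sinT (fun y => p y + q y) x = sinT p x + sinT q x.
Proof.
move=> p1 q1; rewrite /sinT /oscs -RintD; [|exact: L1_sinT|exact: L1_sinT].
by apply: eq_Rint => y; rewrite mulrDr.
Qed.

Lemma cosTZ c p x : L1 p -> cosT (fun y => c * p y) x = c * cosT p x.
Proof.
move=> p1; rewrite /cosT /oscc -RintZ; last exact: L1_cosT.
by apply: eq_Rint => y; rewrite mulrCA.
Qed.

Lemma sinTZ c p x : L1 p -> sinT (fun y => c * p y) x = c * sinT p x.
Proof.
move=> p1; rewrite /sinT /oscs -RintZ; last exact: L1_sinT.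
by apply: eq_Rint => y; rewrite mulrCA.
Qed.

(** The cosine transform of an odd function and the sine transform of an even one vanish, which
    removes the cross terms; what remains is the real inversion formula for each part. *)
Lemma ifourier_fourier phi : schwartz phi -> ifourier (fourier phi) = phi.
Proof.
move=> Sp; have [Su Sv] := (schwartzP phi).1 Sp; have h := schwartz_cL1 Sp.
apply/funext => x; rewrite ifourierE; last exact/schwartz_cL1/schwartz_fourier.
under (@eq_fun R) => y do rewrite fourierE// /=.
under [X in _ - sinT X _](@eq_fun R) => y do rewrite fourierE// /=.
under [X in _ + cosT X _](@eq_fun R) => y do rewrite fourierE// /=.
set u := (fun y => Re (phi y)) in Su *; set v := (fun y => Im (phi y)) in Sv *.
have cu := rschwartz_L1 (rschwartz_cosT Su); have su := rschwartz_L1 (rschwartz_sinT Su).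
have cv := rschwartz_L1 (rschwartz_cosT Sv); have sv := rschwartz_L1 (rschwartz_sinT Sv).
have u1 := rschwartz_L1 Su; have v1 := rschwartz_L1 Sv.
rewrite cosTD// sinTB// sinTD// cosTB//.
have Iu := cosT_sinT_inversion x Su; have Iv := cosT_sinT_inversion x Sv.
rewrite !cosT_sinT// !sinT_cosT//.
apply: complex_ext => /=.
  by rewrite addr0 sub0r opprK Iu mulKf ?pi2_neq0.
by rewrite add0r subr0 addrC Iv mulKf ?pi2_neq0.
Qed.

Lemma fourier_ifourier phi : schwartz phi -> fourier (ifourier phi) = phi.
Proof.
move=> Sp; have [Su Sv] := (schwartzP phi).1 Sp; have h := schwartz_cL1 Sp.
apply/funext => x; rewrite fourierE; last exact/schwartz_cL1/schwartz_ifourier.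
rewrite Re_ifourier// Im_ifourier//.
set u := (fun y => Re (phi y)) in Su *; set v := (fun y => Im (phi y)) in Sv *.
have cu := rschwartz_L1 (rschwartz_cosT Su); have su := rschwartz_L1 (rschwartz_sinT Su).
have cv := rschwartz_L1 (rschwartz_cosT Sv); have sv := rschwartz_L1 (rschwartz_sinT Sv).
have u1 := rschwartz_L1 Su; have v1 := rschwartz_L1 Sv.
have l1 := L1B cu sv; have l2 := L1D su cv.
rewrite !cosTZ// !sinTZ// cosTB// sinTD// cosTD// sinTB//.
have Iu := cosT_sinT_inversion x Su; have Iv := cosT_sinT_inversion x Sv.
rewrite !cosT_sinT// !sinT_cosT//.
apply: complex_ext => /=.
  by rewrite subr0 addr0 -mulrDr Iu mulKf ?pi2_neq0.
by rewrite !add0r -mulrBr opprK Iv mulKf ?pi2_neq0.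
Qed.

End Complex_functions.

(** * Representatives of distributions and the inverse transform on L2 *)

Section Inverse_transform.
Local Open Scope complex_scope.
Context {R : realType}.
Local Notation mu := (@lebesgue_measure R).
Local Notation C := R[i].
Local Notation Re := (@complex.Re R).
Local Notation Im := (@complex.Im R).
Local Notation normc := (@Normc.normc R).
Implicit Types (F G H phi psi : R -> C) (u v p q : R -> R) (d : distribution_on R).

Lemma cmeasurable_normc F : cmeasurable F -> measurable_fun setT (fun x => normc (F x)).
Proof.
move=> [m1 m2].
have -> : (fun x => normc (F x)) = (fun x => Num.sqrt (Re (F x) ^+ 2 + Im (F x) ^+ 2)).
  by apply/funext => x; rewrite -normc_sqr sqrtr_sqr ger0_norm ?normc_ge0.
apply: measurableT_comp; last by apply: measurable_funD; exact: measurable_sqr.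
by apply: continuous_measurable_fun; exact: sqrt_continuous.
Qed.

Lemma cmeasurableD F G : cmeasurable F -> cmeasurable G -> cmeasurable (fun x => F x + G x).
Proof.
move=> [m1 m2] [n1 n2]; split.
  by under eq_fun do rewrite cReD; exact: measurable_funD.
by under eq_fun do rewrite cImD; exact: measurable_funD.
Qed.

Lemma cmeasurableM F G : cmeasurable F -> cmeasurable G -> cmeasurable (fun x => F x * G x).
Proof.
move=> [m1 m2] [n1 n2]; split.
  by under eq_fun do rewrite cReM; apply: measurable_funB; exact: measurable_funM.
by under eq_fun do rewrite cImM; apply: measurable_funD; exact: measurable_funM.
Qed.

(** Real test functions separate the real part of the difference from its imaginary part, and bumps
    detect each of them. *)
Lemma represents_unique F G d : represents F d -> represents G d ->
  {ae mu, forall x, F x = G x}.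
Proof.
move=> [mF HF] [mG HG].
have key u : rschwartz u ->
   [/\ L1 (fun x => Re (F x) * u x), L1 (fun x => Re (G x) * u x),
       L1 (fun x => Im (F x) * u x) & L1 (fun x => Im (G x) * u x)] /\
   Rint (fun x => Re (F x) * u x) = Rint (fun x => Re (G x) * u x) /\
   Rint (fun x => Im (F x) * u x) = Rint (fun x => Im (G x) * u x).
  move=> Su; have Sp := schwartz_real Su.
  have [[F1 F2] dF] := HF _ Sp; have [[G1 G2] dG] := HG _ Sp.
  have rE K : (fun x => (Re (K x * (u x +i* 0)))%:E) = EFin \o (fun x => Re (K x) * u x).
    by apply/funext => x; rewrite cReM /= mulr0 subr0.
  have iE K : (fun x => (Im (K x * (u x +i* 0)))%:E) = EFin \o (fun x => Im (K x) * u x).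
    by apply/funext => x; rewrite cImM /= mulr0 add0r.
  rewrite !rE !iE in F1 F2 G1 G2.
  split; first by split.
  have := dF; rewrite dG /dist_of_fun /cintegral => -[e1 e2].
  have rE' K : (fun x => Re (K x * (u x +i* 0))) = (fun x => Re (K x) * u x).
    by apply/funext => x; rewrite cReM /= mulr0 subr0.
  have iE' K : (fun x => Im (K x * (u x +i* 0))) = (fun x => Im (K x) * u x).
    by apply/funext => x; rewrite cImM /= mulr0 add0r.
  split; first by rewrite -!rE'; exact/esym.
  by rewrite -!iE'; exact/esym.
have aR : {ae mu, forall x, Re (F x) - Re (G x) = 0}.
  apply: ae_eq0_of_bumps; first by apply: measurable_funB; [exact: mF.1|exact: mG.1].
  move=> u Su; have [[F1 G1 F2 G2] [e1 e2]] := key u Su.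
  under eq_fun do rewrite mulrBl; split; first exact: L1B.
  by rewrite RintB// e1 subrr.
have aI : {ae mu, forall x, Im (F x) - Im (G x) = 0}.
  apply: ae_eq0_of_bumps; first by apply: measurable_funB; [exact: mF.2|exact: mG.2].
  move=> u Su; have [[F1 G1 F2 G2] [e1 e2]] := key u Su.
  under eq_fun do rewrite mulrBl; split; first exact: L1B.
  by rewrite RintB// e2 subrr.
by apply: ae_imp (ae_and aR aI) => x [/subr0_eq e1 /subr0_eq e2]; exact: complex_ext.
Qed.

Lemma fun_of_dist_represents F d : represents F d -> represents (fun_of_dist d) d.
Proof.
by move=> rF; rewrite /fun_of_dist; apply: (@xgetPex _ _ [set f | represents f d]); exists F.
Qed.

(** Only values on Schwartz functions enter [represents], so the two sets of candidates coincide and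
    the same candidate is chosen. *)
Lemma eq_fun_of_dist d1 d2 : (forall phi, schwartz phi -> d1 phi = d2 phi) ->
  fun_of_dist d1 = fun_of_dist d2.
Proof.
move=> E; rewrite /fun_of_dist; congr xget; apply/seteqP; split=> F [mF HF]; split=> // phi Sp.
  by rewrite -E//; exact: HF.
by rewrite E//; exact: HF.
Qed.

Lemma ae_eq_energy F G : cL2 F -> cmeasurable G -> {ae mu, forall x, F x = G x} ->
  cL2 G /\ energy G = energy F.
Proof.
move=> [[mF1 F1] [mF2 F2]] [mG1 mG2] FG.
have eR : {ae mu, forall x, Re (F x) ^+ 2 = Re (G x) ^+ 2} by apply: ae_imp FG => x ->.
have eI : {ae mu, forall x, Im (F x) ^+ 2 = Im (G x) ^+ 2} by apply: ae_imp FG => x ->.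
have L p q : measurable_fun setT p -> measurable_fun setT q ->
    L1 (fun x => p x ^+ 2) -> {ae mu, forall x, p x ^+ 2 = q x ^+ 2} -> L1 (fun x => q x ^+ 2).
  move=> mp mq Lp pq; apply: L1_fin; [exact: measurable_sqr|by move=> x; exact: sqr_ge0|].
  rewrite (@ae_eq_integral _ _ _ mu setT (fun x => (p x ^+ 2)%:E)); last 4 first.
  - exact: measurableT.
  - by apply: measurable_EFin; exact: measurable_sqr.
  - by apply: measurable_EFin; exact: measurable_sqr.
  - by apply: ae_imp pq => x -> _.
  by rewrite RintE// ltry.
split; first by split; split => //; [exact: L eR|exact: L eI].
congr (_ + _); apply: ae_eq_Rint; try exact: measurable_sqr.
  by apply: ae_imp eR => x ->.
by apply: ae_imp eI => x ->.
Qed.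

(** Bounding squares of sums by twice sums of squares is affordable: the total factor is
    [8 pi / (2 pi)^2 = 2 / pi <= 1]. *)
Lemma energy_comb (c1 s1 c2 s2 : R -> R) (P Q : R) :
  L2 c1 -> L2 s1 -> L2 c2 -> L2 s2 ->
  Rint (fun x => c1 x ^+ 2) <= 2 * pi * P -> Rint (fun x => s1 x ^+ 2) <= 2 * pi * P ->
  Rint (fun x => c2 x ^+ 2) <= 2 * pi * Q -> Rint (fun x => s2 x ^+ 2) <= 2 * pi * Q ->
  0 <= P -> 0 <= Q ->
  let F x := ((2 * pi)^-1 * (c1 x - s2 x)) +i* ((2 * pi)^-1 * (s1 x + c2 x)) in
  cL2 F /\ energy F <= P + Q.
Proof.
move=> Lc1 Ls1 Lc2 Ls2 B1 B2 B3 B4 P0 Q0 F.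
have La : L2 (fun x => c1 x - s2 x) by exact: L2B.
have Lb : L2 (fun x => s1 x + c2 x) by exact: L2D.
have LF : cL2 F by split; exact: L2Z.
split => //; rewrite /energy /=.
have -> : Rint (fun x => ((2 * pi)^-1 * (c1 x - s2 x)) ^+ 2) =
    (2 * pi)^-1 ^+ 2 * Rint (fun x => (c1 x + - s2 x) ^+ 2).
  by rewrite -RintZ; [apply: eq_Rint => x; rewrite exprMn|exact: La.2].
have -> : Rint (fun x => ((2 * pi)^-1 * (s1 x + c2 x)) ^+ 2) =
    (2 * pi)^-1 ^+ 2 * Rint (fun x => (s1 x + c2 x) ^+ 2).
  by rewrite -RintZ; [apply: eq_Rint => x; rewrite exprMn|exact: Lb.2].
have h1 := Rint_sqrD_le Lc1 (L2N Ls2); have h2 := Rint_sqrD_le Ls1 Lc2.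
have E : Rint (fun x => (- s2 x) ^+ 2) = Rint (fun x => s2 x ^+ 2).
  by apply: eq_Rint => x; rewrite sqrrN.
rewrite E in h1.
have pi2 : 2 <= pi :> R by exact: pi_ge2.
rewrite -mulrDr exprVn mulrC ler_pdivrMr; last by rewrite exprn_gt0// mulr_gt0// pi_gt0.
apply: le_trans (_ : 8 * pi * (P + Q) <= _); first by lra.
have PQ : 0 <= P + Q by exact: addr_ge0.
rewrite [leRHS]mulrC exprMn ler_wpM2r//; nra.
Qed.

Lemma ifourier_energy phi : cL1 phi -> cL2 phi ->
  cL2 (ifourier phi) /\ energy (ifourier phi) <= energy phi.
Proof.
move=> h1 [h2 h3]; have [Lc1 B1] := cosT_L2 h1.1 h2; have [Ls1 B2] := sinT_L2 h1.1 h2.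
have [Lc2 B3] := cosT_L2 h1.2 h3; have [Ls2 B4] := sinT_L2 h1.2 h3.
have -> : ifourier phi = fun x =>
   ((2 * pi)^-1 * (cosT (fun y => Re (phi y)) x - sinT (fun y => Im (phi y)) x)) +i*
   ((2 * pi)^-1 * (sinT (fun y => Re (phi y)) x + cosT (fun y => Im (phi y)) x)).
  by apply/funext => x; exact: ifourierE.
apply: energy_comb => //; by apply: Rint_ge0 => x; exact: sqr_ge0.
Qed.

(** [c1, s1] and [c2, s2] stand for the transforms of the real and imaginary parts of [G], known by
    duality in general and explicitly for integrable [G]; the duality identities move them onto the
    test function. *)
Lemma represents_comb G (c1 s1 c2 s2 : R -> R) : cL2 G ->
  L2 c1 -> L2 s1 -> L2 c2 -> L2 s2 ->
  (forall u, rschwartz u -> ip c1 u = ip (fun x => Re (G x)) (cosT u)) ->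
  (forall u, rschwartz u -> ip s1 u = ip (fun x => Re (G x)) (sinT u)) ->
  (forall u, rschwartz u -> ip c2 u = ip (fun x => Im (G x)) (cosT u)) ->
  (forall u, rschwartz u -> ip s2 u = ip (fun x => Im (G x)) (sinT u)) ->
  represents (fun x => ((2 * pi)^-1 * (c1 x - s2 x)) +i* ((2 * pi)^-1 * (s1 x + c2 x)))
    (dist_ifourier (dist_of_fun G)).
Proof.
move=> LG Lc1 Ls1 Lc2 Ls2 E1 E2 E3 E4.
set F := fun x => _.
have La : L2 (fun x => c1 x - s2 x) by exact: L2B.
have Lb : L2 (fun x => s1 x + c2 x) by exact: L2D.
have LF : cL2 F by split; exact: L2Z.
split; first exact: cL2_measurable.
move=> phi Sp; have [Su Sv] := (schwartzP phi).1 Sp.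
have Lp := schwartz_cL2 Sp; have h := schwartz_cL1 Sp.
have [LFi EF] := cintegral_mul LF Lp.
split => //; rewrite /dist_ifourier /dist_of_fun EF.
have LI := schwartz_cL2 (schwartz_ifourier Sp).
have [_ ->] := cintegral_mul LG LI.
have [G1 G2] := LG.
set u := (fun x => Re (phi x)) in Su *; set v := (fun x => Im (phi x)) in Sv *.
have Lu := rschwartz_L2 Su; have Lv := rschwartz_L2 Sv.
have cu := rschwartz_L2 (rschwartz_cosT Su); have su := rschwartz_L2 (rschwartz_sinT Su).
have cv := rschwartz_L2 (rschwartz_cosT Sv); have sv := rschwartz_L2 (rschwartz_sinT Sv).
rewrite Re_ifourier// Im_ifourier//.
have rF w : rschwartz w -> ip (fun x => Re (F x)) w =
    (2 * pi)^-1 * (ip (fun x => Re (G x)) (cosT w) - ip (fun x => Im (G x)) (sinT w)).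
  by move=> Sw; have Lw := rschwartz_L2 Sw; rewrite /= ipZl// ipBl// E1// E4.
have iF w : rschwartz w -> ip (fun x => Im (F x)) w =
    (2 * pi)^-1 * (ip (fun x => Re (G x)) (sinT w) + ip (fun x => Im (G x)) (cosT w)).
  by move=> Sw; have Lw := rschwartz_L2 Sw; rewrite /= ipZl// ipDl// E2// E3.
have hB p q w c : L2 p -> L2 q -> L2 w -> ip w (fun x => c * (p x - q x)) = c * (ip w p - ip w q).
  by move=> *; rewrite ipC ipZl ?ipBl 1?ipC 1?(ipC w q)//; exact: L2B.
have hD p q w c : L2 p -> L2 q -> L2 w -> ip w (fun x => c * (p x + q x)) = c * (ip w p + ip w q).
  by move=> *; rewrite ipC ipZl ?ipDl 1?ipC 1?(ipC w q)//; exact: L2D.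
rewrite (hB _ _ _ _ cu sv G1) (hB _ _ _ _ cu sv G2) (hD _ _ _ _ su cv G1) (hD _ _ _ _ su cv G2).
rewrite (rF _ Su) (rF _ Sv) (iF _ Su) (iF _ Sv) -/u -/v.
move: (ip _ (cosT u)) (ip _ (sinT u)) (ip _ (cosT v)) (ip _ (sinT v)).
move: (ip _ (cosT u)) (ip _ (sinT u)) (ip _ (cosT v)) (ip _ (sinT v)) (2 * pi)^-1 => *.
by apply: complex_ext => /=; ring.
Qed.

(** Keeps the shape of [schrodinger], which makes [schrodingerE] a computation. Its values are those
    of a chosen representative, so explicit formulas for it hold almost everywhere. *)
Definition ifourier2 G : R -> C := fun_of_dist (dist_ifourier (dist_of_fun G)).

Lemma ifourier2_L2 G : cL2 G ->
  [/\ cL2 (ifourier2 G), energy (ifourier2 G) <= energy G &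
    represents (ifourier2 G) (dist_ifourier (dist_of_fun G))].
Proof.
move=> LG; have [G1 G2] := LG.
have [c1 [Lc1 B1 E1]] := ex_cosT_L2 G1; have [s1 [Ls1 B2 E2]] := ex_sinT_L2 G1.
have [c2 [Lc2 B3 E3]] := ex_cosT_L2 G2; have [s2 [Ls2 B4 E4]] := ex_sinT_L2 G2.
have P0 : 0 <= Rint (fun x => Re (G x) ^+ 2) by apply: Rint_ge0 => x; exact: sqr_ge0.
have Q0 : 0 <= Rint (fun x => Im (G x) ^+ 2) by apply: Rint_ge0 => x; exact: sqr_ge0.
have := energy_comb Lc1 Ls1 Lc2 Ls2 B1 B2 B3 B4 P0 Q0.
have rF := represents_comb LG Lc1 Ls1 Lc2 Ls2 E1 E2 E3 E4.
set F := fun x => _ in rF * => -[LF BF].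
have rI := fun_of_dist_represents rF.
have [LI EI] := ae_eq_energy LF rI.1 (represents_unique rF rI).
by split => //; rewrite EI.
Qed.

Lemma ifourier2_ifourier G : cL1 G -> cL2 G ->
  {ae mu, forall x, ifourier2 G x = ifourier G x}.
Proof.
move=> [G1 G2] LG; have [L1G L2G] := LG.
have [_ _ rI] := ifourier2_L2 LG.
apply: represents_unique rI _.
have -> : ifourier G = fun x =>
   ((2 * pi)^-1 * (cosT (fun y => Re (G y)) x - sinT (fun y => Im (G y)) x)) +i*
   ((2 * pi)^-1 * (sinT (fun y => Re (G y)) x + cosT (fun y => Im (G y)) x)).
  by apply/funext => x; exact: ifourierE.
apply: represents_comb => //.
- exact: (cosT_L2 G1 L1G).1.
- exact: (sinT_L2 G1 L1G).1.
- exact: (cosT_L2 G2 L2G).1.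
- exact: (sinT_L2 G2 L2G).1.
- by move=> u Su; apply: cosT_swap => //; exact: rschwartz_L1.
- by move=> u Su; apply: sinT_swap => //; exact: rschwartz_L1.
- by move=> u Su; apply: cosT_swap => //; exact: rschwartz_L1.
- by move=> u Su; apply: sinT_swap => //; exact: rschwartz_L1.
Qed.

Lemma cL2D F G : cL2 F -> cL2 G -> cL2 (fun x => F x + G x).
Proof.
move=> [F1 F2] [G1 G2]; split.
  by under eq_fun do rewrite cReD; exact: L2D.
by under eq_fun do rewrite cImD; exact: L2D.
Qed.

(** The sum of the representatives represents the sum, and representatives are unique up to null
    sets. *)
Lemma ifourier2D F G : cL2 F -> cL2 G ->
  {ae mu, forall x, ifourier2 (fun y => F y + G y) x = ifourier2 F x + ifourier2 G x}.
Proof.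
move=> LF LG; have LFG := cL2D LF LG.
have [_ _ rFG] := ifourier2_L2 LFG; have [KF _ [mF rF]] := ifourier2_L2 LF.
have [KG _ [mG rG]] := ifourier2_L2 LG.
apply: represents_unique rFG _; split; first exact: cmeasurableD.
move=> phi Sp; have Lp := schwartz_cL2 Sp.
have [_ e1] := rF phi Sp; have [_ e2] := rG phi Sp.
have add (K1 K2 K3 : R -> C) : cL2 K1 -> cL2 K2 -> cL2 K3 ->
    cintegral (fun x => (K1 x + K2 x) * K3 x) =
    cintegral (fun x => K1 x * K3 x) + cintegral (fun x => K2 x * K3 x).
  move=> H1 H2 H3; have [_ ->] := cintegral_mul (cL2D H1 H2) H3.
  have [_ ->] := cintegral_mul H1 H3; have [_ ->] := cintegral_mul H2 H3.
  have -> : (fun x => Re (K1 x + K2 x)) = (fun x => Re (K1 x) + Re (K2 x)).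
    by apply/funext => x; rewrite cReD.
  have -> : (fun x => Im (K1 x + K2 x)) = (fun x => Im (K1 x) + Im (K2 x)).
    by apply/funext => x; rewrite cImD.
  move: H1 H2 H3 => [? ?] [? ?] [? ?].
  by rewrite !ipDl//; apply: complex_ext => /=; ring.
split; first exact: (cintegral_mul (cL2D KF KG) Lp).1.
rewrite /dist_of_fun add// -/(dist_of_fun (ifourier2 F) phi) -/(dist_of_fun (ifourier2 G) phi).
rewrite -e1 -e2 /dist_ifourier /dist_of_fun add//.
exact/schwartz_cL2/schwartz_ifourier.
Qed.

(** Equality holds at every point: data equal almost everywhere define the same functional on
    Schwartz functions, hence lead to the same choice. *)
Lemma ifourier2_ae F G : cmeasurable F -> cmeasurable G ->
  {ae mu, forall x, F x = G x} -> ifourier2 F = ifourier2 G.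
Proof.
move=> mF mG FG; apply: eq_fun_of_dist => phi Sp.
have mI := cL2_measurable (schwartz_cL2 (schwartz_ifourier Sp)).
have [m1 m2] := cmeasurableM mF mI; have [n1 n2] := cmeasurableM mG mI.
apply: complex_ext.
  by apply: ae_eq_Rint => //; apply: ae_imp FG => x ->.
by apply: ae_eq_Rint => //; apply: ae_imp FG => x ->.
Qed.

Lemma energy_normc F : cL2 F -> L1 (fun x => normc (F x) ^+ 2) /\
  energy F = Rint (fun x => normc (F x) ^+ 2).
Proof.
move=> [[_ F1] [_ F2]]; have E : (fun x => normc (F x) ^+ 2) = (fun x => Re (F x) ^+ 2 + Im (F x) ^+ 2).
  by apply/funext => x; rewrite normc_sqr.
by rewrite E; split; [exact: L1D|rewrite RintD].
Qed.

Lemma cL2_normc F : cmeasurable F -> L1 (fun x => normc (F x) ^+ 2) -> cL2 F.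
Proof.
move=> [m1 m2] Li; split; split => //; apply: L1_le Li _ => [|x]; try exact: measurable_sqr.
  by rewrite ger0_norm ?sqr_ge0// normc_sqr lerDl sqr_ge0.
by rewrite ger0_norm ?sqr_ge0// normc_sqr lerDr sqr_ge0.
Qed.

End Inverse_transform.

(** * Sobolev distributions and the evolution on the Fourier side *)

Section Sobolev.
Local Open Scope complex_scope.
Context {R : realType}.
Local Notation mu := (@lebesgue_measure R).
Local Notation C := R[i].
Local Notation Re := (@complex.Re R).
Local Notation Im := (@complex.Im R).
Local Notation normc := (@Normc.normc R).
Implicit Types (F G H phi psi : R -> C) (u v p q : R -> R) (f : distribution_on R) (a s t : R).

Definition sweight s (x : R) : R := (1 + `|x| ^+ 2) `^ s.

Definition evolve a t G : R -> C := fun xi => expi (t * `|xi| `^ a) * G xi.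

Definition fhat f : R -> C := fun_of_dist (dist_fourier f).

Lemma schrodingerE a f x t : schrodinger a f x t = ifourier2 (evolve a t (fhat f)) x.
Proof. by []. Qed.

Lemma measurable_sweight s : measurable_fun setT (sweight s).
Proof.
apply: (measurableT_comp (measurable_powR s)).
by apply: measurable_funD => //; apply: measurable_sqr; exact: measurable_norm.
Qed.

Lemma sweight_ge1 s x : 0 <= s -> 1 <= sweight s x.
Proof.
move=> s0; apply: le_trans (_ : 1 `^ s <= _); first by rewrite powR1.
apply: ge0_ler_powR => //; rewrite ?nnegrE ?addr_ge0 ?sqr_ge0//.
by rewrite lerDl sqr_ge0.
Qed.

Lemma measurable_phase a t : measurable_fun setT (fun x : R => t * `|x| `^ a).
Proof.
apply: measurable_funM => //; apply: (measurableT_comp (measurable_powR a)).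
exact: measurable_norm.
Qed.

Lemma normc_expiM (th : R) (z : C) : normc (expi th * z) = normc z.
Proof.
apply/eqP; rewrite -(@eqrXn2 _ 2) ?normc_ge0// !normc_sqr cReM cImM /=.
have h := cos2Dsin2 th; set A := Re z; set B := Im z.
have -> : (cos th * A - sin th * B) ^+ 2 + (cos th * B + sin th * A) ^+ 2 =
   (cos th ^+ 2 + sin th ^+ 2) * (A ^+ 2 + B ^+ 2) by ring.
by rewrite h mul1r.
Qed.

Lemma cmeasurable_evolve a t G : cmeasurable G -> cmeasurable (evolve a t G).
Proof.
move=> mG; apply: cmeasurableM => //; split => /=.
  by apply: measurable_cos_comp; exact: measurable_phase.
by apply: measurable_sin_comp; exact: measurable_phase.
Qed.

Lemma cL2_evolve a t G : cL2 G -> cL2 (evolve a t G).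
Proof.
move=> LG; apply: cL2_normc; first exact/cmeasurable_evolve/cL2_measurable.
by under eq_fun do rewrite normc_expiM; exact: (energy_normc LG).1.
Qed.

Lemma energy_evolve a t G : cL2 G -> energy (evolve a t G) = energy G.
Proof.
move=> LG; rewrite (energy_normc (cL2_evolve a t LG)).2 (energy_normc LG).2.
by apply: eq_Rint => x; rewrite normc_expiM.
Qed.

Lemma cL1_evolve a t G : cL1 G -> cL1 (evolve a t G).
Proof.
move=> [G1 G2]; have mG : cmeasurable G by split; exact: L1_measurable.
have [m1 m2] := cmeasurable_evolve a t mG.
have h x : normc (evolve a t G x) <= `|Re (G x)| + `|Im (G x)|.
  by rewrite normc_expiM; exact: normc_le.
have L := L1D (L1_norm G1) (L1_norm G2).
split; apply: L1_le L _ => // x; apply: le_trans (h x); [exact: Re_le_normc|exact: Im_le_normc].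
Qed.

Definition sL2 s G := cmeasurable G /\ L1 (fun x => sweight s x * normc (G x) ^+ 2).
Definition senergy s G := Rint (fun x => sweight s x * normc (G x) ^+ 2).

Lemma senergy_ge0 s G : 0 <= senergy s G.
Proof. by apply: Rint_ge0 => x; rewrite mulr_ge0 ?powR_ge0 ?sqr_ge0. Qed.

Lemma sL2_cL2 s G : 0 <= s -> sL2 s G -> cL2 G.
Proof.
move=> s0 [mG LG]; apply: cL2_normc => //; apply: L1_le LG _ => [|x].
  by apply: measurable_sqr; exact: cmeasurable_normc.
by rewrite ger0_norm ?sqr_ge0// ler_peMl ?sqr_ge0// sweight_ge1.
Qed.

Lemma energy_le_senergy s G : 0 <= s -> sL2 s G -> energy G <= senergy s G.
Proof.
move=> s0 LG; have [L1G ->] := energy_normc (sL2_cL2 s0 LG).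
by apply: le_Rint => //; [exact: LG.2|move=> x; rewrite ler_peMl ?sqr_ge0// sweight_ge1].
Qed.

(** A representative of the transform and the finite norm give the weighted integrability; [f] is
    recovered from its transform because [fourier (ifourier phi) = phi] on test functions. *)
Lemma sobolevP s f : 0 <= s -> sobolev s f ->
  [/\ sL2 s (fhat f), fun_of_dist f = ifourier2 (fhat f) &
    sobolev_norm s f = (Num.sqrt (senergy s (fhat f)))%:E].
Proof.
move=> s0 [_ [g rg] fin]; have [mG HG] := fun_of_dist_represents rg; rewrite -/(fhat f) in mG HG *.
have mn : measurable_fun setT (fun x => normc (fhat f x) ^+ 2).
  by apply: measurable_sqr; exact: cmeasurable_normc.
have LG : L1 (fun x => sweight s x * normc (fhat f x) ^+ 2).
  apply: L1_fin => [|x|].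
  - by apply: measurable_funM => //; exact: measurable_sweight.
  - by rewrite mulr_ge0 ?sqr_ge0 ?powR_ge0.
  - by apply: (@lty_poweRy _ _ 2^-1) => //; rewrite invr_eq0.
split => //.
  apply: eq_fun_of_dist => phi Sp.
  by rewrite /dist_ifourier -(HG _ (schwartz_ifourier Sp)).2 /dist_fourier fourier_ifourier.
rewrite /sobolev_norm -/(fhat f) (RintE LG) poweR_EFin; congr EFin.
by rewrite -powR12_sqrt// senergy_ge0.
Qed.

Lemma ip_le p q : L2 p -> L2 q ->
  `|ip p q| <= Num.sqrt (Rint (fun x => p x ^+ 2)) * Num.sqrt (Rint (fun x => q x ^+ 2)).
Proof.
move=> Lp Lq; have h := cauchy_schwarz Lp Lq.
have P0 : 0 <= Rint (fun x => p x ^+ 2) by apply: Rint_ge0 => x; exact: sqr_ge0.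
by rewrite -sqrtrM// -sqrtr_sqr ler_wsqrtr.
Qed.

Lemma normc_cintegral_le F G : cL2 F -> cL2 G ->
  normc (cintegral (fun x => F x * G x)) <= 4 * (Num.sqrt (energy F) * Num.sqrt (energy G)).
Proof.
move=> LF LG; have [_ ->] := cintegral_mul LF LG; apply: le_trans (normc_le _) _ => /=.
have [F1 F2] := LF; have [G1 G2] := LG.
have P p q : L2 p -> L2 q -> Rint (fun x => p x ^+ 2) <= energy F ->
   Rint (fun x => q x ^+ 2) <= energy G -> `|ip p q| <= Num.sqrt (energy F) * Num.sqrt (energy G).
  move=> Lp Lq le1 le2; apply: le_trans (ip_le Lp Lq) _.
  by apply: ler_pM; rewrite ?sqrtr_ge0// ler_wsqrtr.
have e1 : Rint (fun x => Re (F x) ^+ 2) <= energy F by rewrite lerDl Rint_ge0// => x; exact: sqr_ge0.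
have e2 : Rint (fun x => Im (F x) ^+ 2) <= energy F by rewrite lerDr Rint_ge0// => x; exact: sqr_ge0.
have e3 : Rint (fun x => Re (G x) ^+ 2) <= energy G by rewrite lerDl Rint_ge0// => x; exact: sqr_ge0.
have e4 : Rint (fun x => Im (G x) ^+ 2) <= energy G by rewrite lerDr Rint_ge0// => x; exact: sqr_ge0.
have := P _ _ F1 G1 e1 e3; have := P _ _ F2 G2 e2 e4.
have := P _ _ F1 G2 e1 e4; have := P _ _ F2 G1 e2 e3.
set K := _ * _; move: (ip _ _) (ip _ _) (ip _ _) (ip _ _) => x y z w h1 h2 h3 h4.
apply: le_trans (lerD (ler_normB _ _) (ler_normD _ _)) _.
by lra.
Qed.

(** [|phi| (1 + |x|)] is at most the sum of the two seminorms, [(1 + |x|)^2 >= 1 + x^2], and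
    [1 / (1 + x^2)] has integral [pi]. *)
Lemma schwartz_energy_le phi : schwartz phi -> energy phi <=
  pi * (fine (schwartz_seminorm 0 0 phi) + fine (schwartz_seminorm 1 0 phi)) ^+ 2.
Proof.
move=> Sp; have [_ h0] := schwartz_seminorm_ub Sp 0 0; have [_ h1] := schwartz_seminorm_ub Sp 1 0.
set A := fine _ in h0 *; set B := fine _ in h1 *.
have [Li ->] := energy_normc (schwartz_cL2 Sp).
have E x : cderiven 0 phi x = phi x by rewrite /cderiven /=; case: (phi x).
have LP : L1 (fun x => 2^-1 * (A + B) ^+ 2 * poisson 1 x) by apply: L1Z; exact: L1_poisson.
apply: le_trans (le_Rint Li LP _) _ => [x|].
  have := h0 x; have := h1 x; rewrite E expr0 mul1r expr1 => b a.
  have N0 := normc_ge0 (phi x); have X0 := normr_ge0 x.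
  have D0 : 0 < 1 ^+ 2 + x ^+ 2 :> R by exact: poisson_den_gt0.
  have -> : 2^-1 * (A + B) ^+ 2 * poisson 1 x = (A + B) ^+ 2 / (1 ^+ 2 + x ^+ 2).
    by rewrite /poisson; move: (1 ^+ 2 + x ^+ 2) (lt0r_neq0 D0) => D D1; field.
  rewrite ler_pdivlMr//.
  have -> : x ^+ 2 = `|x| ^+ 2 by rewrite real_normK// num_real.
  have h : normc (phi x) * (1 + `|x|) <= A + B by rewrite mulrDr mulr1 lerD// mulrC.
  have h' : (normc (phi x) * (1 + `|x|)) ^+ 2 <= (A + B) ^+ 2.
    have h0' : 0 <= normc (phi x) * (1 + `|x|) by rewrite mulr_ge0// addr_ge0.
    by rewrite ler_pXn2r// nnegrE; exact: le_trans h.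
  have hx : 0 <= normc (phi x) ^+ 2 * `|x| by rewrite mulr_ge0// sqr_ge0.
  rewrite exprMn in h'; rewrite expr1n.
  move: (normc (phi x) ^+ 2) (`|x|) ((A + B) ^+ 2) h' hx => n y z h' hx; lra.
by rewrite RintZ ?Rint_poisson//; [lra|exact: L1_poisson].
Qed.

Lemma ifourier_lin (c : C) phi psi : cL1 phi -> cL1 psi ->
  ifourier (fun x => c * phi x + psi x) = (fun x => c * ifourier phi x + ifourier psi x).
Proof.
have L x phi' : cL1 phi' -> cL1 (fun xi => expi (x * xi) * phi' xi).
  move=> [f1 f2]; split => /=.
    under eq_fun do rewrite cReM /=; apply: L1B; [exact: L1_cosT|exact: L1_sinT].
  under eq_fun do rewrite cImM /=; apply: L1D; [exact: L1_cosT|exact: L1_sinT].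
move=> h1 h2; apply/funext => x; rewrite /ifourier mulrA -mulrDl -cintegral_lin; try exact: L.
by congr (_ / _); congr cintegral; apply/funext => xi; rewrite mulrDr mulrCA.
Qed.

Lemma tempered_dist_ifourier G : cL2 G -> tempered (dist_ifourier (dist_of_fun G)).
Proof.
move=> LG; split=> [c phi psi Sp Sq|].
  have Lp := schwartz_cL2 (schwartz_ifourier Sp); have Lq := schwartz_cL2 (schwartz_ifourier Sq).
  rewrite /dist_ifourier /dist_of_fun ifourier_lin; try exact: schwartz_cL1.
  have L H : cL2 H -> cL1 (fun x => G x * H x).
    by move=> LH; have [[? ?] _] := cintegral_mul LG LH.
  rewrite -cintegral_lin; try exact: L.
  by congr cintegral; apply/funext => x; rewrite mulrDr mulrCA.
(* Indices below 2 are enough, since the seminorms of indices [0 0] and [1 0] control the L2 norm;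
   the factor 4 is that of [normc_cintegral_le]. *)
exists 2, (4 * (Num.sqrt (energy G) * Num.sqrt pi)) => phi Sp.
have [f0 _] := schwartz_seminorm_ub Sp 0 0; have [f1 _] := schwartz_seminorm_ub Sp 1 0.
have [f01 _] := schwartz_seminorm_ub Sp 0 1; have [f11 _] := schwartz_seminorm_ub Sp 1 1.
have P k j : 0 <= fine (schwartz_seminorm k j phi).
  have [_ h] := schwartz_seminorm_ub Sp k j; apply: le_trans (h 0).
  by rewrite mulr_ge0 ?exprn_ge0 ?normc_ge0.
rewrite !big_ord_recl !big_ord0 /= !adde0.
rewrite -(fineK f0) -(fineK f1) -(fineK f01) -(fineK f11) -!EFinD -EFinM lee_fin.
have := P 0%N 1%N; have := P 1%N 1%N; have := P 0%N 0%N; have := P 1%N 0%N.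
have := schwartz_energy_le Sp.
set x00 := fine _; set x10 := fine _; set x01 := fine _; set x11 := fine _ => E p1 p2 p3 p4.
have LI := schwartz_cL2 (schwartz_ifourier Sp).
apply: le_trans (normc_cintegral_le LG LI) _.
rewrite -!mulrA ler_pM2l// ler_wpM2l ?sqrtr_ge0//.
have [_ e] := ifourier_energy (schwartz_cL1 Sp) (schwartz_cL2 Sp).
apply: le_trans (ler_wsqrtr (le_trans e E)) _.
rewrite sqrtrM ?pi_ge0// ler_wpM2l ?sqrtr_ge0// sqrtr_sqr ger0_norm ?addr_ge0//.
by lra.
Qed.

(** Prescribes the Fourier transform; every Sobolev distribution constructed below arises in this
    way. *)
Lemma sobolev_of_fhat s G : 0 <= s -> sL2 s G ->
  let f := dist_ifourier (dist_of_fun G) in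
  [/\ sobolev s f, {ae mu, forall x, fhat f x = G x} & cmeasurable (fhat f)].
Proof.
move=> s0 LG f; have cG := sL2_cL2 s0 LG.
have rG : represents G (dist_fourier f).
  split; first exact: LG.1.
  move=> phi Sp; split; first exact: (cintegral_mul cG (schwartz_cL2 Sp)).1.
  by rewrite /dist_fourier /f /dist_ifourier ifourier_fourier.
have rf := fun_of_dist_represents rG; rewrite -/(fhat f) in rf.
have ae := represents_unique rf rG; have mf := rf.1.
split => //; split; [exact: tempered_dist_ifourier|by exists G|].
rewrite /sobolev_norm -/(fhat f) (@ae_eq_integral _ _ _ mu setT (fun x => (sweight s x * normc (G x) ^+ 2)%:E)).
- by rewrite (RintE LG.2) poweR_EFin ltry.
- exact: measurableT.
- apply: measurable_EFin; apply: measurable_funM; first exact: measurable_sweight.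
  by apply: measurable_sqr; exact: cmeasurable_normc.
- by apply: measurable_EFin; apply: (L1_measurable LG.2).
- by apply: ae_imp ae => x ->.
Qed.

Lemma schrodinger_of_fhat s a t G : 0 <= s -> sL2 s G ->
  (fun x => schrodinger a (dist_ifourier (dist_of_fun G)) x t) = ifourier2 (evolve a t G).
Proof.
move=> s0 LG; have [_ ae mf] := sobolev_of_fhat s0 LG.
apply: ifourier2_ae; [exact: cmeasurable_evolve|exact: (cmeasurable_evolve _ _ LG.1)|].
by apply: ae_imp ae => x; rewrite /evolve => <-.
Qed.

End Sobolev.

(** * Oscillatory integrals *)

Section Oscillatory_integrals.
Context {R : realType}.
Local Notation mu := (@lebesgue_measure R).
Implicit Types (f g h e F G H E phi : R -> R) (A B m : R).

Lemma is_derive_continuous f (x v : R) : is_derive x 1 f v -> {for x, continuous f}.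
Proof. by move=> df; apply/differentiable_continuous/derivable1_diffP; have [] := df. Qed.

Lemma within_itv_continuous A B f : (forall x, A <= x <= B -> {for x, continuous f}) ->
  {within `[A, B]%classic, continuous f}.
Proof.
by move=> cf; apply: continuous_in_subspaceT => x; rewrite inE/= in_itv/=; exact: cf.
Qed.

Lemma L1_itv A B f : (forall x, A <= x <= B -> {for x, continuous f}) ->
  L1 (fun x => \1_(`[A, B]%classic) x * f x).
Proof.
move=> cf; apply: L1_indicE => //; apply: continuous_compact_integrable.
  exact: segment_compact.
exact: within_itv_continuous.
Qed.

Lemma FTC_itv A B F f : A < B ->
  (forall x, A <= x <= B -> is_derive x 1 F (f x)) ->
  (forall x, A <= x <= B -> {for x, continuous f}) ->
  Rint (fun x => \1_(`[A, B]%classic) x * f x) = F B - F A.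
Proof.
move=> AB dF cf; rewrite Rint_indic//.
have cF x : A <= x <= B -> {for x, continuous F}.
  by move=> /dF; exact: is_derive_continuous.
rewrite /Rintegral (@continuous_FTC2 _ f F)//.
- exact: within_itv_continuous.
- split.
  + by move=> x /[!in_itv]/= /andP[Ax xB]; have [] := dF x; rewrite ?(ltW Ax) ?ltW.
  + by apply: cvg_at_right_filter; apply: cF; rewrite lexx ltW.
  + by apply: cvg_at_left_filter; apply: cF; rewrite lexx ltW.
- move=> x /[!in_itv]/= /andP[Ax xB]; rewrite derive1E; have [|_] := dF x; last by [].
  by rewrite !ltW.
Qed.

(* [cos phi] is written as the derivative of a bounded function [H] plus an error that is
   dominated by the derivative of a bounded monotone function [E]. *)
Lemma norm_Rint_itv_le A B g H h E e : A < B ->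
  (forall x, A <= x <= B -> {for x, continuous g}) ->
  (forall x, A <= x <= B -> is_derive x 1 H (h x)) ->
  (forall x, A <= x <= B -> {for x, continuous h}) ->
  (forall x, A <= x <= B -> is_derive x 1 E (e x)) ->
  (forall x, A <= x <= B -> {for x, continuous e}) ->
  (forall x, A <= x <= B -> `|g x - h x| <= e x) ->
  `|Rint (fun x => \1_(`[A, B]%classic) x * g x)| <= `|H A| + `|H B| + (E B - E A).
Proof.
move=> AB cg dH ch dE ce le.
have Lg := L1_itv cg; have Lh := L1_itv ch; have Le := L1_itv ce.
have -> : Rint (fun x => \1_(`[A, B]%classic) x * g x) = (H B - H A) +
    Rint (fun x => \1_(`[A, B]%classic) x * g x - \1_(`[A, B]%classic) x * h x).
  by rewrite RintB// -(FTC_itv AB dH ch) addrC subrK.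
apply: le_trans (ler_normD _ _) _; apply: lerD.
  by rewrite [leRHS]addrC (le_trans (ler_normB _ _)).
rewrite -(FTC_itv AB dE ce); apply: norm_Rint_le => //.
  exact: (L1_measurable (L1B Lg Lh)).
move=> x; rewrite -mulrBr normrM ger0_norm ?indic_ge0'//.
rewrite indicE; case: (boolP (x \in _)) => [|_]; last by rewrite !mul0r.
by rewrite inE/= in_itv/= !mul1r => /le.
Qed.

Lemma continuous_cos_comp phi (x : R) : {for x, continuous phi} ->
  {for x, continuous (fun y => cos (phi y))}.
Proof. by move=> c; apply: (continuous_comp c); exact: continuous_cos. Qed.

Lemma continuous_sin_comp phi (x : R) : {for x, continuous phi} ->
  {for x, continuous (fun y => sin (phi y))}.
Proof. by move=> c; apply: (continuous_comp c); exact: continuous_sin. Qed.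

Lemma continuous_sqr_comp phi (x : R) : {for x, continuous phi} ->
  {for x, continuous (fun y => phi y ^+ 2)}.
Proof.
by move=> c; rewrite (_ : (fun y => _) = (fun y => phi y * phi y));
  [exact: continuousM|apply/funext => y; rewrite expr2].
Qed.

(** * Van der Corput's first and second derivative tests *)

Section Van_der_Corput.
Variables (A B m : R) (phi phi1 phi2 : R -> R).
Hypotheses (AB : A < B) (m0 : 0 < m)
  (d1 : forall x, A <= x <= B -> is_derive x 1 phi (phi1 x))
  (d2 : forall x, A <= x <= B -> is_derive x 1 phi1 (phi2 x))
  (c2 : forall x, A <= x <= B -> {for x, continuous phi2}).

(** Here [H = sin phi / phi'], and the error [sin phi phi'' / phi'^2] is dominated by the derivative
    of [- s / phi'], monotone because [phi''] has a constant sign [s]. The two endpoint values and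
    the total variation contribute [1 / m] each. *)
Lemma van_der_corput1 : (forall x, A <= x <= B -> m <= phi1 x) ->
  (forall x, A <= x <= B -> 0 <= phi2 x) \/ (forall x, A <= x <= B -> phi2 x <= 0) ->
  `|Rint (fun x => \1_(`[A, B]%classic) x * cos (phi x))| <= 3 / m.
Proof.
move=> ge_m sg.
have [s [s1 s2]] : exists s : R, `|s| = 1 /\ forall x, A <= x <= B -> s * phi2 x = `|phi2 x|.
  case: sg => sg; [exists 1; split; rewrite ?normr1//|exists (-1); split; rewrite ?normrN1//].
    by move=> x xAB; rewrite mul1r ger0_norm// sg.
  by move=> x xAB; rewrite mulN1r ler0_norm// sg.
have p1 x : A <= x <= B -> 0 < phi1 x by move=> /ge_m; exact: lt_le_trans.
have cp x : A <= x <= B -> {for x, continuous phi} by move=> /d1; exact: is_derive_continuous.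
have cp1 x : A <= x <= B -> {for x, continuous phi1} by move=> /d2; exact: is_derive_continuous.
have ci x : A <= x <= B -> {for x, continuous (fun y => (phi1 y ^+ 2)^-1)}.
  by move=> xAB; apply: continuousV; [rewrite expf_neq0// gt_eqF// p1|
    by apply: continuous_sqr_comp; exact: cp1].
have bd (x c : R) : A <= x <= B -> `|c| <= 1 -> `|c * (phi1 x)^-1| <= 1 / m.
  move=> xAB c1; rewrite normrM ler_pM// normfV gtr0_norm ?p1// lef_pV2 ?posrE ?p1//.
  exact: ge_m.
have hA : A <= A <= B by rewrite lexx ltW.
have hB : A <= B <= B by rewrite lexx ltW.
apply: le_trans (@norm_Rint_itv_le A B _ (fun x => sin (phi x) * (phi1 x)^-1)
  (fun x => cos (phi x) - sin (phi x) * phi2 x * (phi1 x ^+ 2)^-1)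
  (fun x => - s * (phi1 x)^-1) (fun x => s * phi2 x * (phi1 x ^+ 2)^-1) AB _ _ _ _ _ _) _.
- by move=> x xAB; apply: continuous_cos_comp; exact: cp.
- move=> x xAB; have D1 := d1 xAB; have D2 := d2 xAB; have n0 := lt0r_neq0 (p1 _ xAB).
  by apply: is_derive_eq; rewrite /GRing.scale /=; field.
- move=> x xAB; apply: continuousB; first by apply: continuous_cos_comp; exact: cp.
  apply: continuousM; last exact: ci.
  by apply: continuousM; [apply: continuous_sin_comp; exact: cp|exact: c2].
- move=> x xAB; have D1 := d1 xAB; have D2 := d2 xAB; have n0 := lt0r_neq0 (p1 _ xAB).
  by apply: is_derive_eq; rewrite /GRing.scale /=; field.
- move=> x xAB; apply: continuousM; last exact: ci.
  by apply: continuousM; [exact: cst_continuous|exact: c2].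
- move=> x xAB; rewrite opprB addrC subrK normrM s2//.
  rewrite [X in _ * X]ger0_norm ?invr_ge0 ?sqr_ge0// ler_wpM2r ?invr_ge0 ?sqr_ge0//.
  by rewrite normrM ler_piMl// ler_norml sin_geN1 sin_le1.
- have sA := bd A (sin (phi A)) hA; have sB := bd B (sin (phi B)) hB.
  have := sA (_ : _ <= 1); have := sB (_ : _ <= 1); rewrite !ler_norml !sin_geN1 !sin_le1.
  move=> /(_ isT) h1 /(_ isT) h2.
  have h3 : - s * (phi1 B)^-1 - - s * (phi1 A)^-1 <= 1 / m.
    rewrite [leRHS]mul1r; apply: le_trans (ler_norm _) _; rewrite -mulrBr normrM normrN s1 mul1r.
    have i0 x : A <= x <= B -> 0 < (phi1 x)^-1 by move=> /p1; rewrite invr_gt0.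
    have im x : A <= x <= B -> (phi1 x)^-1 <= m^-1.
      by move=> xAB; rewrite lef_pV2 ?posrE ?p1//; exact: ge_m.
    have := i0 _ hA; have := i0 _ hB; have := im _ hA; have := im _ hB.
    by rewrite ler_norml => *; apply/andP; split; lra.
  rewrite -ler_norml in h1; rewrite -ler_norml in h2; lra.
Qed.

(** Here [H = sin phi phi' / (phi'^2 + m)] is regular at stationary points, so the interval stays in
    one piece. The error is at most [2 phi'' / (phi'^2 + m)], the derivative of a multiple of an
    arctangent. The endpoints give [2 / sqrt m], the arctangent [8 / sqrt m] since [|atan| < 2]. *)
Lemma van_der_corput2 : (forall x, A <= x <= B -> m <= phi2 x) ->
  `|Rint (fun x => \1_(`[A, B]%classic) x * cos (phi x))| <= 10 / Num.sqrt m.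
Proof.
move=> ge_m; set r := Num.sqrt m; have r0 : 0 < r by rewrite sqrtr_gt0.
have rm : r ^+ 2 = m by rewrite sqr_sqrtr// ltW.
have cp x : A <= x <= B -> {for x, continuous phi} by move=> /d1; exact: is_derive_continuous.
have cp1 x : A <= x <= B -> {for x, continuous phi1} by move=> /d2; exact: is_derive_continuous.
have D0 x : 0 < phi1 x ^+ 2 + m by rewrite addrC ltr_pwDl// sqr_ge0.
have cD x : A <= x <= B -> {for x, continuous (fun y => phi1 y ^+ 2 + m)}.
  move=> xAB; apply: continuousD; last exact: cst_continuous.
  by apply: continuous_sqr_comp; exact: cp1.
have cDi x : A <= x <= B -> {for x, continuous (fun y => (phi1 y ^+ 2 + m)^-1)}.
  by move=> xAB; apply: continuousV; [rewrite gt_eqF|exact: cD].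
have cs x : A <= x <= B -> {for x, continuous (fun y => phi1 y ^+ 2)}.
  by move=> xAB; apply: continuous_sqr_comp; exact: cp1.
have hA : A <= A <= B by rewrite lexx ltW.
have hB : A <= B <= B by rewrite lexx ltW.
apply: le_trans (@norm_Rint_itv_le A B _ (fun x => sin (phi x) * phi1 x * (phi1 x ^+ 2 + m)^-1)
  (fun x => cos (phi x) * phi1 x ^+ 2 * (phi1 x ^+ 2 + m)^-1 +
     sin (phi x) * phi2 x * (m - phi1 x ^+ 2) * ((phi1 x ^+ 2 + m)^-1 * (phi1 x ^+ 2 + m)^-1))
  (fun x => 2 / r * atan (r^-1 * phi1 x)) (fun x => 2 * phi2 x * (phi1 x ^+ 2 + m)^-1) AB _ _ _ _ _ _) _.
- by move=> x xAB; apply: continuous_cos_comp; exact: cp.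
- move=> x xAB; have D1 := d1 xAB; have D2 := d2 xAB; have n0 := lt0r_neq0 (D0 x).
  by apply: is_derive_eq; rewrite /GRing.scale /=; field.
- move=> x xAB; apply: continuousD; apply: continuousM.
  + by apply: continuousM; [apply: continuous_cos_comp; exact: cp|exact: cs].
  + exact: cDi.
  + apply: continuousM; first by apply: continuousM; [apply: continuous_sin_comp; exact: cp|exact: c2].
    by apply: continuousB; [exact: cst_continuous|exact: cs].
  + by apply: continuousM; exact: cDi.
- move=> x xAB; have D1 := d1 xAB; have D2 := d2 xAB; have n0 := lt0r_neq0 (D0 x).
  apply: is_derive_eq; rewrite /GRing.scale /= -rm; rewrite -rm in n0.
  have n1 : 1 + (r^-1 * phi1 x) ^+ 2 != 0 by rewrite gt_eqF// ltr_pwDl// sqr_ge0.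
  have n2 := lt0r_neq0 r0; field; rewrite n2 n0 /=.
  by move: n0; rewrite addrC.
- move=> x xAB; apply: continuousM; last exact: cDi.
  by apply: continuousM; [exact: cst_continuous|exact: c2].
- move=> x xAB; have d0 := D0 x; have := ge_m _ xAB.
  have n0 := lt0r_neq0 d0; have P0 := sqr_ge0 (phi1 x).
  move: (phi1 x ^+ 2) (phi2 x) d0 n0 P0 => P Q d0 n0 P0 mQ.
  have -> : cos (phi x) - (cos (phi x) * P * (P + m)^-1 +
     sin (phi x) * Q * (m - P) * ((P + m)^-1 * (P + m)^-1)) =
     cos (phi x) * (m / (P + m)) - sin (phi x) * (Q / (P + m)) * ((m - P) / (P + m)) by field.
  have i0 : 0 < (P + m)^-1 by rewrite invr_gt0.
  have Q0 : 0 < Q / (P + m) by rewrite mulr_gt0//; exact: lt_le_trans mQ.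
  have h1 : `|cos (phi x) * (m / (P + m))| <= Q / (P + m).
    rewrite normrM -[leRHS]mul1r ler_pM//; first by rewrite ler_norml cos_geN1 cos_le1.
    by rewrite gtr0_norm ?mulr_gt0// ler_pM2r.
  have h2 : `|sin (phi x) * (Q / (P + m)) * ((m - P) / (P + m))| <= Q / (P + m).
    rewrite normrM; apply: (@le_trans _ _ (`|sin (phi x) * (Q / (P + m))|)).
      apply: ler_piMr => //; rewrite normrM (gtr0_norm i0) ler_pdivrMr// mul1r ler_norml.
      by move: (m0) => m0'; apply/andP; split; lra.
    rewrite normrM (gtr0_norm Q0); apply: ler_piMl; first exact: ltW.
    by rewrite ler_norml sin_geN1 sin_le1.
  apply: le_trans (ler_normB _ _) _.
  rewrite (_ : 2 * Q / (P + m) = Q / (P + m) + Q / (P + m)); last by field.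
  exact: lerD.
- have bd x : `|sin (phi x) * phi1 x * (phi1 x ^+ 2 + m)^-1| <= 1 / r.
    rewrite normrM [X in _ * X]gtr0_norm ?invr_gt0// ler_pdivrMr//.
    rewrite -[leRHS]mul1r normrM ler_pM//; first by rewrite ler_norml sin_geN1 sin_le1.
    rewrite -mulrA mul1r mulrC ler_pdivlMr// -rm.
    have := sqr_ge0 (`|phi1 x| - r); rewrite sqrrB real_normK ?num_real//.
    have : 0 <= `|phi1 x| * r by rewrite mulr_ge0// ltW.
    move: (`|phi1 x|) (phi1 x ^+ 2) => u v; lra.
  have at4 (y : R) : - 2 < atan y < 2.
    have := atan_gtNpi2 y; have := atan_ltpi2 y.
    have := pihalf_lt2 R => h0 h1 h2; apply/andP; split; lra.
  have h3 : 2 / r * atan (r^-1 * phi1 B) - 2 / r * atan (r^-1 * phi1 A) <= 8 / r.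
    have := at4 (r^-1 * phi1 A); have := at4 (r^-1 * phi1 B).
    have r2 : 0 < 2 / r by rewrite divr_gt0.
    rewrite -mulrBr => /andP[u1 u2] /andP[u3 u4].
    have -> : 8 / r = 2 / r * 4 by field; rewrite gt_eqF.
    by rewrite ler_pM2l//; lra.
  have := bd A; have := bd B; lra.
Qed.

End Van_der_Corput.
End Oscillatory_integrals.

(** * Bounds for the kernel of a frequency shell *)

Section Kernel_bound.
Context {R : realType}.
Local Notation mu := (@lebesgue_measure R).
Implicit Types (a b u v l x y p : R).

Lemma powR_dyadic l x p : 0 < l -> l <= x <= 2 * l ->
  l `^ p * 2 `^ (- `|p|) <= x `^ p <= l `^ p * 2 `^ `|p|.
Proof.
move=> l0 /andP[lx xl]; have x0 : 0 < x := lt_le_trans l0 lx.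
have l2 : 0 < 2 * l by rewrite mulr_gt0.
have p1 : 1 <= 2 `^ `|p| :> R by rewrite -[leLHS](powRr0 2) ler_powR// ler1n.
have p2 : 2 `^ (- `|p|) <= 1 :> R by rewrite -[leRHS](powRr0 2) ler_powR ?ler1n// oppr_le0.
have P : 0 < l `^ p by rewrite powR_gt0.
have E : (2 * l) `^ p = l `^ p * 2 `^ p by rewrite powRM ?ltW// mulrC.
have [p0|p0] := leP 0 p.
  have h1 : l `^ p <= x `^ p by rewrite ge0_ler_powR// nnegrE ltW.
  have h2 : x `^ p <= (2 * l) `^ p by rewrite ge0_ler_powR// nnegrE ltW.
  rewrite E in h2; rewrite ger0_norm// h2 andbT; apply: le_trans h1.
  by rewrite ger_pMr// -[leRHS](powRr0 2) ler_powR ?ler1n// oppr_le0.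
have Np : 0 <= - p by rewrite oppr_ge0 ltW.
have inv y : 0 < y -> y `^ p = (y `^ (- p))^-1 by move=> y0; rewrite powRN invrK.
have h1 : x `^ p <= l `^ p.
  rewrite (inv x)// (inv l)// lef_pV2 ?posrE ?powR_gt0//.
  by rewrite ge0_ler_powR// nnegrE ltW.
have h2 : (2 * l) `^ p <= x `^ p.
  rewrite (inv x)// (inv (2 * l))// lef_pV2 ?posrE ?powR_gt0//.
  by rewrite ge0_ler_powR// nnegrE ltW.
rewrite E in h2; rewrite ltr0_norm// opprK h2 /=; apply: (le_trans h1).
by apply: ler_peMr; [exact: ltW|move: p1; rewrite ltr0_norm].
Qed.

(** The T T* kernel of the positive half of a shell, for a displacement [u] and a time difference
    [v]. *)
Definition osc_kernel a l u v :=
  Rint (fun x => \1_(`[l, 2 * l]%classic) x * cos (u * x + v * x `^ a)).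

Lemma osc_kernelN a l u v : osc_kernel a l (- u) (- v) = osc_kernel a l u v.
Proof.
by apply: eq_Rint => x; rewrite -cosN; congr (_ * cos _); rewrite !mulNr opprD !opprK.
Qed.

Section Fixed_phase.
Variables (a l u v : R).
Hypotheses (a0 : 0 < a) (a1 : a != 1) (l0 : 0 < l).
Let phi x := u * x + v * x `^ a.
Let phi1 x := u + v * (a * x `^ (a - 1)).
Let phi2 x := v * (a * ((a - 1) * x `^ (a - 2))).

Let pos x : l <= x <= 2 * l -> 0 < x.
Proof. by case/andP => lx _; exact: lt_le_trans lx. Qed.

Let d1 x : l <= x <= 2 * l -> is_derive x 1 phi (phi1 x).
Proof.
move=> /pos x0; have D := is_derive1_powR a x0.
by apply: is_derive_eq; rewrite /phi1 /GRing.scale /=; ring.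
Qed.

Let d2 x : l <= x <= 2 * l -> is_derive x 1 phi1 (phi2 x).
Proof.
move=> /pos x0; have D := is_derive1_powR (a - 1) x0.
apply: is_derive_eq; rewrite /phi2 /GRing.scale /=.
by rewrite (_ : a - 1 - 1 = a - 2); [ring|lra].
Qed.

Let c2 x : l <= x <= 2 * l -> {for x, continuous phi2}.
Proof.
move=> /pos x0; have D := is_derive1_powR (a - 2) x0; rewrite /phi2.
apply: continuousM; first exact: cst_continuous.
apply: continuousM; first exact: cst_continuous.
by apply: continuousM; [exact: cst_continuous|exact: is_derive_continuous D].
Qed.

Let ll : l < 2 * l. Proof. by rewrite ltr_pMl// ltr1n. Qed.

(** The time part of [phi1] is at most [u / 2] in modulus, so [phi1 >= u / 2]; [phi2] keeps the sign
    of [v (a - 1)]. *)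
Lemma osc_kernel_far_pos : 0 < u -> `|v| * (2 * a * 2 `^ `|a - 1| * l `^ (a - 1)) <= u ->
  `|osc_kernel a l u v| <= 6 / u.
Proof.
move=> u0 hv; have -> : 6 / u = 3 / (u / 2) by field; rewrite gt_eqF.
apply: (@van_der_corput1 _ l (2 * l) (u / 2) phi phi1 phi2) => //.
- by rewrite divr_gt0.
- move=> x hx; have /andP[_ up] := powR_dyadic (a - 1) l0 hx.
  have h : `|v * (a * x `^ (a - 1))| <= u / 2.
    rewrite normrM (ger0_norm (mulr_ge0 (ltW a0) (powR_ge0 _ _))).
    have : `|v| * (a * x `^ (a - 1)) <= `|v| * (a * (l `^ (a - 1) * 2 `^ `|a - 1|)).
      by rewrite ler_wpM2l// ler_pM2l.
    rewrite ler_pdivlMr//; move: hv; set P := l `^ _; set Q := 2 `^ _; move=> hv h.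
    by apply: le_trans hv; move: h; rewrite -!mulrA => h; lra.
  by move: h; rewrite /phi1 ler_norml => /andP[? ?]; lra.
- have E x : phi2 x = v * (a - 1) * (a * x `^ (a - 2)) by rewrite /phi2; ring.
  have p0 x : 0 <= a * x `^ (a - 2) by rewrite mulr_ge0 ?powR_ge0// ltW.
  have [h|/ltW h] := leP 0 (v * (a - 1)).
    by left => x hx; rewrite E mulr_ge0.
  by right => x hx; rewrite E mulr_le0_ge0.
Qed.

Lemma osc_kernel_near_pos : 0 < v * (a - 1) ->
  `|osc_kernel a l u v| <= 10 / Num.sqrt (`|v| * (a * `|a - 1| * (l `^ (a - 2) * 2 `^ (- `|a - 2|)))).
Proof.
move=> va; have n1 : 0 < `|a - 1| by rewrite normr_gt0 subr_eq0.
have v0 : 0 < `|v| by rewrite normr_gt0; apply: contraTN va => /eqP ->; rewrite mul0r ltxx.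
apply: (@van_der_corput2 _ l (2 * l) _ phi phi1 phi2) => //.
- by rewrite !mulr_gt0// powR_gt0.
- move=> x hx; have /andP[lo _] := powR_dyadic (a - 2) l0 hx.
  have -> : phi2 x = `|v| * (a * `|a - 1| * x `^ (a - 2)).
    rewrite /phi2 !mulrA -[in RHS](mulrA `|v|) (mulrC a) [in RHS]mulrA -normrM (gtr0_norm va).
    by rewrite -(mulrA v) (mulrC a) !mulrA.
  by rewrite ler_pM2l// ler_pM2l// mulr_gt0.
Qed.

End Fixed_phase.

Lemma osc_kernel_le a l u v : 0 < l -> `|osc_kernel a l u v| <= l.
Proof.
move=> l0; have ml : (mu `[l, (2 * l)%R]%classic = l%:E)%E.
  rewrite lebesgue_measure_itv /= lte_fin ltr_pMl// ltr1n -EFinB; congr EFin.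
  by lra.
apply: (@le_trans _ _ (Rint (\1_(`[l, 2 * l]%classic) : R -> R))); last by rewrite Rint_indic1// ml.
apply: norm_Rint_le.
- apply: measurable_indicM => //; apply: measurable_cos_comp.
  by apply: measurable_funD; apply: measurable_funM => //; exact: measurable_powR.
- by apply: L1_indic => //; rewrite ml ltry.
- move=> x; rewrite normrM ger0_norm ?indic_ge0'// ler_piMr ?indic_ge0'//.
  by rewrite ler_norml cos_geN1 cos_le1.
Qed.

Lemma osc_kernel_far a l u v : 0 < a -> a != 1 -> 0 < l -> u != 0 ->
  `|v| * (2 * a * 2 `^ `|a - 1| * l `^ (a - 1)) <= `|u| ->
  `|osc_kernel a l u v| <= 6 / `|u|.
Proof.
move=> a0 a1 l0 u0 h; have [up|un] := ltP 0 u.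
  by rewrite (gtr0_norm up) in h *; exact: osc_kernel_far_pos.
have un' : 0 < - u by rewrite oppr_gt0 lt_neqAle u0.
rewrite -osc_kernelN (ler0_norm un) in h *.
by apply: osc_kernel_far_pos; rewrite ?normrN.
Qed.

Lemma osc_kernel_near a l u v : 0 < a -> a != 1 -> 0 < l -> v != 0 ->
  `|osc_kernel a l u v| <=
    10 / Num.sqrt (`|v| * (a * `|a - 1| * (l `^ (a - 2) * 2 `^ (- `|a - 2|)))).
Proof.
move=> a0 a1 l0 v0; have [h|h] := ltP 0 (v * (a - 1)); first exact: osc_kernel_near_pos.
rewrite -osc_kernelN -(normrN v); apply: osc_kernel_near_pos => //.
by rewrite mulNr oppr_gt0 lt_neqAle h mulf_neq0// subr_eq0.
Qed.

(** Three regimes: for [|u| <= 1 / l], the length of the interval; far from resonance, the first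
    derivative test; near it, [|u| < D l^(a-1) |v|] bounds [|v|] from below, and the second
    derivative test gives a multiple of [sqrt (l / |u|)]. Replacing [|u|] by [1 / l + |u|] merges
    them into a bound in which the time difference occurs through [b] only. *)
Lemma osc_kernel_bound a : 0 < a -> a != 1 -> exists2 c : R, 0 < c &
  forall l b u v, 0 < l -> `|v| <= b ->
  `|osc_kernel a l u v| <= c * ((l^-1 + `|u|)^-1 +
     \1_(`[- (c * l `^ (a - 1) * b), c * l `^ (a - 1) * b]%classic) u *
       (Num.sqrt l / Num.sqrt (l^-1 + `|u|))).
Proof.
move=> a0 a1; have n1 : 0 < `|a - 1| by rewrite normr_gt0 subr_eq0.
pose D : R := 2 * a * 2 `^ `|a - 1|.
have D0 : 0 < D by rewrite !mulr_gt0// powR_gt0.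
pose k : R := a * `|a - 1| * 2 `^ (- `|a - 2|) / D.
have k0 : 0 < k by rewrite divr_gt0// !mulr_gt0// powR_gt0.
have sk0 : 0 < Num.sqrt k by rewrite sqrtr_gt0.
(* The three summands serve the first two regimes, the width of the resonant interval, and the
   resonant bound. *)
pose c := 12 + D + 20 / Num.sqrt k.
have q0 : 0 < 20 / Num.sqrt k by rewrite divr_gt0.
have c0 : 0 < c by rewrite /c; lra.
exists c => // l b u v l0 vb; have i0 : 0 < l^-1 by rewrite invr_gt0.
have e0 : 0 < l^-1 + `|u| by rewrite ltr_pwDl.
have I0 : 0 <= (\1_(`[- (c * l `^ (a - 1) * b), c * l `^ (a - 1) * b]%classic) u : R) *
    (Num.sqrt l / Num.sqrt (l^-1 + `|u|)).
  by rewrite mulr_ge0 ?indic_ge0'// divr_ge0 ?sqrtr_ge0.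
have P0 : 0 < l `^ (a - 1) by rewrite powR_gt0.
have first_term z : z <= 12 / (l^-1 + `|u|) -> z <= c * ((l^-1 + `|u|)^-1 +
     \1_(`[- (c * l `^ (a - 1) * b), c * l `^ (a - 1) * b]%classic) u *
       (Num.sqrt l / Num.sqrt (l^-1 + `|u|))).
  move=> h; apply: (le_trans h); rewrite mulrDr -[leLHS]addr0 lerD//.
    by rewrite ler_wpM2r ?invr_ge0 1?ltW// /c; lra.
  by rewrite mulr_ge0// ltW.
have [ul|ul] := leP `|u| l^-1.
  apply: first_term; apply: le_trans (osc_kernel_le _ _ _ l0) _.
  rewrite ler_pdivlMr//; have : l * l^-1 = 1 by rewrite mulfV// gt_eqF.
  nra.
have u0 : 0 < `|u| := lt_trans i0 ul.
have un0 : u != 0 by rewrite -normr_gt0.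
have [h|h] := leP (`|v| * (D * l `^ (a - 1))) `|u|.
  apply: first_term; apply: le_trans (osc_kernel_far a0 a1 l0 un0 h) _.
  rewrite ler_pdivlMr// mulrAC ler_pdivrMr//; lra.
have v0 : 0 < `|v|.
  by rewrite lt_neqAle normr_ge0 andbT; apply: contraTneq h => <-; rewrite mul0r -leNgt ltW.
rewrite indicE mem_set ?mul1r /=; last first.
  rewrite in_itv/= -ler_norml; apply: (le_trans (ltW h)).
  rewrite mulrC ler_pM//; first by rewrite mulr_ge0// ltW.
  by rewrite ler_pM2r// /c; lra.
have vn0 : v != 0 by rewrite -normr_gt0.
apply: le_trans (osc_kernel_near u a0 a1 l0 vn0) _.
apply: (@le_trans _ _ (20 / Num.sqrt k * (Num.sqrt l / Num.sqrt (l^-1 + `|u|)))); last first.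
  rewrite mulrDr -[leLHS]add0r lerD//; first by rewrite mulr_ge0 ?invr_ge0// ltW.
  by rewrite ler_wpM2r ?divr_ge0 ?sqrtr_ge0// /c; lra.
set A := `|v| * _.
have A0 : 0 < A by rewrite /A !mulr_gt0// powR_gt0.
have hA : k * (l^-1 + `|u|) / (4 * l) <= A.
  apply: (@le_trans _ _ (k * `|u| / l)).
    have -> : k * `|u| / l = k * (4 * `|u|) / (4 * l) by field; rewrite gt_eqF.
    rewrite ler_pM2r ?invr_gt0 ?mulr_gt0// ler_pM2l//; lra.
  have -> : A = `|v| * (D * l `^ (a - 1)) * (k / l).
    have E : l `^ (a - 2) = l `^ (a - 1) / l.
      rewrite -[in X in _ / X](powRr1 (ltW l0)) -powRB; first by congr (_ `^ _); lra.
      by apply/implyP => _; rewrite gt_eqF.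
    have n2 := lt0r_neq0 D0; have n3 := lt0r_neq0 l0.
    by rewrite /A E /k; field; rewrite ?n2 ?n3.
  by rewrite mulrAC mulrC (ler_pM2r (divr_gt0 k0 l0)); exact: ltW.
have B0 : 0 < k * (l^-1 + `|u|) / (4 * l).
  by apply: divr_gt0; apply: mulr_gt0.
have hs : Num.sqrt k * Num.sqrt (l^-1 + `|u|) / (2 * Num.sqrt l) <= Num.sqrt A.
  have hk : Num.sqrt k ^+ 2 = k by apply: sqr_sqrtr; exact: ltW.
  have hE : Num.sqrt (l^-1 + `|u|) ^+ 2 = l^-1 + `|u| by apply: sqr_sqrtr; exact: ltW.
  have hl : Num.sqrt l ^+ 2 = l by apply: sqr_sqrtr; exact: ltW.
  apply: le_trans (ler_wsqrtr hA); rewrite -[leLHS]ger0_norm; last first.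
    by apply: divr_ge0; apply: mulr_ge0 => //; exact: sqrtr_ge0.
  rewrite -sqrtr_sqr expr_div_n !exprMn hk hE hl (_ : 2 ^+ 2 = 4)//; ring.
have s0 : 0 < Num.sqrt (l^-1 + `|u|) by rewrite sqrtr_gt0.
have l1 : 0 < Num.sqrt l by rewrite sqrtr_gt0.
have T0 : 0 < Num.sqrt k * Num.sqrt (l^-1 + `|u|) / (2 * Num.sqrt l).
  by apply: divr_gt0; apply: mulr_gt0.
have -> : 20 / Num.sqrt k * (Num.sqrt l / Num.sqrt (l^-1 + `|u|)) =
   10 / (Num.sqrt k * Num.sqrt (l^-1 + `|u|) / (2 * Num.sqrt l)).
  by field; rewrite ?gt_eqF.
by rewrite ler_pM2l// lef_pV2// posrE// sqrtr_gt0.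
Qed.

Lemma Rint_even_itv_le (d : R) (f F : R -> R) : 0 < d ->
  (forall x, 0 <= x <= d -> is_derive x 1 F (f x)) ->
  (forall x, 0 <= x <= d -> {for x, continuous f}) ->
  (forall x, 0 <= x <= d -> 0 <= f x) ->
  measurable_fun setT (fun x => f `|x|) ->
  L1 (fun x => \1_(`[- d, d]%classic) x * f `|x|) /\
  Rint (fun x => \1_(`[- d, d]%classic) x * f `|x|) <= 2 * (F d - F 0).
Proof.
move=> d0 dF cf f0 mf; have L := L1_itv cf; have E := FTC_itv d0 dF cf.
pose h x := \1_(`[0, d]%classic) x * f x + \1_(`[0, d]%classic) (- x) * f (- x).
have Lh : L1 h by apply: L1D => //; exact: (L1_opp L).
have le x : 0 <= \1_(`[- d, d]%classic) x * f `|x| <= h x.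
  have i0 y : 0 <= \1_(`[0, d]%classic) y * f y.
    by rewrite indicE; case: (boolP (y \in _)); rewrite ?mul0r// inE/= in_itv/= mul1r => /f0.
  have [hx|hx] := boolP (x \in `[- d, d]%classic); last first.
    by rewrite indicE (negbTE hx) mul0r lexx addr_ge0.
  rewrite indicE hx mul1r; move: hx; rewrite inE/= in_itv/= => /andP[h1 h2].
  have [x0|x0] := leP 0 x.
    rewrite (ger0_norm x0) f0 ?x0//= /h; apply: (@le_trans _ _ (\1_(`[0, d]%classic) x * f x)).
      by rewrite indicE mem_set ?mul1r//= in_itv/= x0.
    by rewrite lerDl.
  have x1 : 0 <= - x <= d by apply/andP; split; lra.
  rewrite (ltr0_norm x0) f0//= /h; apply: (@le_trans _ _ (\1_(`[0, d]%classic) (- x) * f (- x))).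
    by rewrite indicE mem_set ?mul1r//= in_itv/=.
  by rewrite lerDr.
have LL : L1 (fun x => \1_(`[- d, d]%classic) x * f `|x|).
  apply: L1_le Lh _; first exact: measurable_indicM.
  by move=> x; have /andP[h0 h1] := le x; rewrite ger0_norm.
split => //; apply: le_trans (le_Rint LL Lh (fun x => proj2 (andP (le x)))) _.
rewrite /h RintD//; last exact: (L1_opp L).
by rewrite -(Rint_opp (L1_measurable L)) E; lra.
Qed.

(** The bound of [osc_kernel_bound] restricted to [|u| <= 1], the displacements between points of a
    set of diameter at most 1. *)
Definition schur_kernel a (c l b : R) (u : R) : R :=
  \1_(`[- 1, 1]%classic) u * (c * ((l^-1 + `|u|)^-1 +
     \1_(`[- (c * l `^ (a - 1) * b), c * l `^ (a - 1) * b]%classic) u *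
       (Num.sqrt l / Num.sqrt (l^-1 + `|u|)))).

Lemma measurable_schur_kernel a c l b : 0 < l -> measurable_fun setT (schur_kernel a c l b).
Proof.
move=> l0; have i0 : 0 < l^-1 by rewrite invr_gt0.
have e0 x : 0 < l^-1 + `|x| by rewrite ltr_pwDl.
have cd (x : R) : {for x, continuous (fun x : R => l^-1 + `|x|)}.
  by apply: continuousD; [exact: cst_continuous|exact: norm_continuous].
have ci (x : R) : {for x, continuous (fun x : R => (l^-1 + `|x|)^-1)}.
  by apply: continuousV; [rewrite gt_eqF|exact: cd].
have cs (x : R) : {for x, continuous (fun x : R => (Num.sqrt (l^-1 + `|x|))^-1)}.
  apply: continuousV; first by rewrite gt_eqF// sqrtr_gt0.
  by apply: continuous_comp; [exact: cd|exact: sqrt_continuous].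
apply: measurable_indicM => //; apply: measurable_funM => //; apply: measurable_funD.
  exact: continuous_measurable_fun.
apply: measurable_indicM => //; apply: measurable_funM => //.
exact: continuous_measurable_fun.
Qed.

Lemma schur_kernel_ge0 a c l b u : 0 < l -> 0 < c -> 0 <= schur_kernel a c l b u.
Proof.
move=> l0 c0; rewrite mulr_ge0 ?indic_ge0'// mulr_ge0 ?(ltW c0)// addr_ge0//.
  by rewrite invr_ge0 addr_ge0// invr_ge0 ltW.
Qed.

(** The first term integrates to [2 ln (1 + l)], which [l^s] absorbs because [s > 0]; the second,
    over an interval of half-width [d], to at most [4 sqrt (l d)], a multiple of [sqrt (l^a b)]. *)
Lemma schur_kernel_integral a (s c : R) : 0 < a -> 0 < s -> 0 < c -> exists2 M : R, 0 < M &
  forall l b, 1 <= l -> 0 < b ->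
  L1 (schur_kernel a c l b) /\ Rint (schur_kernel a c l b) <= M * (l `^ s + Num.sqrt (l `^ a * b)).
Proof.
move=> a0 s0 c0; have sc0 : 0 < Num.sqrt c by rewrite sqrtr_gt0.
have p2 : 0 < 2 `^ s :> R by rewrite powR_gt0.
have q0 : 0 < 2 * 2 `^ s / s :> R by rewrite divr_gt0// mulr_gt0.
exists (c * (2 * 2 `^ s / s + 4 * Num.sqrt c)).
  by rewrite mulr_gt0// addr_gt0// mulr_gt0.
move=> l b l1 b0; have l0 : 0 < l := lt_le_trans ltr01 l1.
set d := c * l `^ (a - 1) * b; have d0 : 0 < d by rewrite !mulr_gt0// powR_gt0.
have i0 : 0 < l^-1 by rewrite invr_gt0.
have e0 x : 0 < l^-1 + `|x| by rewrite ltr_pwDl.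
have cd (x : R) : {for x, continuous (fun x : R => l^-1 + `|x|)}.
  by apply: continuousD; [exact: cst_continuous|exact: norm_continuous].
have ci (x : R) : {for x, continuous (fun x : R => (l^-1 + `|x|)^-1)}.
  by apply: continuousV; [rewrite gt_eqF|exact: cd].
have cs (x : R) : {for x, continuous (fun x : R => (Num.sqrt (l^-1 + `|x|))^-1)}.
  apply: continuousV; first by rewrite gt_eqF// sqrtr_gt0.
  by apply: continuous_comp; [exact: cd|exact: sqrt_continuous].
have ca (x : R) : {for x, continuous (fun x : R => l^-1 + x)}.
  by apply: continuousD; [exact: cst_continuous|exact: cvg_id].
have p0 (x : R) : 0 <= x -> 0 < l^-1 + x by move=> x0; rewrite ltr_pwDl.
pose f1 x := (l^-1 + x)^-1; pose f2 x := Num.sqrt l / Num.sqrt (l^-1 + x).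
have d1 x : 0 <= x <= 1 -> is_derive x 1 (fun x : R => ln (l^-1 + x)) (f1 x).
  move=> /andP[x0 _]; have D := is_derive1_ln (p0 _ x0).
  by apply: is_derive_eq; rewrite /GRing.scale /= add0r mulr1.
have c1 (x : R) : 0 <= x <= 1 -> {for x, continuous f1}.
  by move=> /andP[x0 _]; apply: continuousV; [rewrite gt_eqF// p0|exact: ca].
have g1 x : 0 <= x <= 1 -> 0 <= f1 x by move=> /andP[x0 _]; rewrite invr_ge0 ltW// p0.
have d2 x : 0 <= x <= d -> is_derive x 1 (fun x : R => 2 * Num.sqrt l * Num.sqrt (l^-1 + x)) (f2 x).
  move=> /andP[x0 _]; have D := is_derive1_sqrt (p0 _ x0).
  have n0 : Num.sqrt (l^-1 + x) != 0 by rewrite gt_eqF// sqrtr_gt0 p0.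
  by apply: is_derive_eq; rewrite /f2 /GRing.scale /=; field.
have c2 (x : R) : 0 <= x <= d -> {for x, continuous f2}.
  move=> /andP[x0 _]; apply: continuousM; first exact: cst_continuous.
  apply: continuousV; first by rewrite gt_eqF// sqrtr_gt0 p0.
  by apply: continuous_comp; [exact: ca|exact: sqrt_continuous].
have g2 x : 0 <= x <= d -> 0 <= f2 x by move=> _; rewrite divr_ge0 ?sqrtr_ge0.
have m2 : measurable_fun setT (fun x : R => f2 `|x|).
  by apply: measurable_funM => //; exact: continuous_measurable_fun.
have [La Ia] := Rint_even_itv_le ltr01 d1 c1 g1 (continuous_measurable_fun ci).
have [Lb Ib] := Rint_even_itv_le d0 d2 c2 g2 m2.
have LS := L1Z c (L1D La Lb).
have le x : `|schur_kernel a c l b x| <= c * (\1_(`[- 1, 1]%classic) x * (l^-1 + `|x|)^-1 +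
    \1_(`[- d, d]%classic) x * (Num.sqrt l / Num.sqrt (l^-1 + `|x|))).
  rewrite ger0_norm ?schur_kernel_ge0// /schur_kernel -/d mulrCA ler_pM2l// mulrDr lerD2l.
  by rewrite ler_piMl ?indic_le1// mulr_ge0 ?indic_ge0'// divr_ge0 ?sqrtr_ge0.
have L := L1_le (measurable_schur_kernel a c b l0) LS le.
split => //; apply: le_trans (ler_norm _) _.
apply: le_trans (norm_Rint_le (L1_measurable L) LS le) _.
rewrite RintZ; last exact: L1D.
rewrite RintD// -mulrA ler_pM2l//.
have P0 : 0 < l `^ s by rewrite powR_gt0.
have h1 : Rint (fun x => \1_(`[- 1, 1]%classic) x * (l^-1 + `|x|)^-1) <= 2 * 2 `^ s / s * l `^ s.
  apply: (le_trans Ia); rewrite addr0 -ln_div ?posrE ?ltr_pwDl//.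
  have -> : (l^-1 + 1) / l^-1 = 1 + l by rewrite mulrDl mulfV ?gt_eqF// mul1r invrK.
  have -> : 2 * 2 `^ s / s * l `^ s = 2 * ((2 * l) `^ s / s) by rewrite powRM ?ltW//; field; rewrite gt_eqF.
  rewrite ler_pM2l// ler_pdivlMr// mulrC -ln_powR.
  have u0 : 0 < (1 + l) `^ s by rewrite powR_gt0// addr_gt0.
  apply: le_trans (ltW (ln_sublinear u0)) _.
  by rewrite ge0_ler_powR ?nnegrE//; [exact: ltW|rewrite addr_ge0// ltW|rewrite mulr_ge0// ltW|lra].
have h2 : Rint (fun x => \1_(`[- d, d]%classic) x * (Num.sqrt l / Num.sqrt (l^-1 + `|x|))) <=
    4 * Num.sqrt c * Num.sqrt (l `^ a * b).
  apply: (le_trans Ib); rewrite addr0 -mulrBr.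
  have -> : 4 * Num.sqrt c * Num.sqrt (l `^ a * b) = 2 * (2 * Num.sqrt l * Num.sqrt d).
    have -> : 2 * (2 * Num.sqrt l * Num.sqrt d) = 4 * (Num.sqrt l * Num.sqrt d) by ring.
    have -> : l `^ a = l * l `^ (a - 1) by rewrite (mulr_powRB1 (ltW l0) a0).
    by rewrite -mulrA -!sqrtrM ?ltW//; congr (_ * Num.sqrt _); rewrite /d; ring.
  rewrite ler_pM2l// ler_wpM2l ?mulr_ge0 ?sqrtr_ge0// lerBlDl.
  rewrite -(@ler_pXn2r _ 2)// ?nnegrE ?addr_ge0 ?sqrtr_ge0//.
  have s1 := sqrtr_ge0 l^-1; have s2 := sqrtr_ge0 d.
  rewrite sqrrD !sqr_sqrtr ?addr_ge0 ?(ltW i0) ?(ltW d0)//.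
  by rewrite lerD2r lerDl mulrn_wge0// mulr_ge0.
have S0 := sqrtr_ge0 (l `^ a * b).
have k1 : 0 <= 2 * 2 `^ s / s * Num.sqrt (l `^ a * b) by rewrite mulr_ge0// ltW.
have k2 : 0 <= 4 * Num.sqrt c * l `^ s by rewrite !mulr_ge0// ltW.
by rewrite mulrDl !mulrDr; lra.
Qed.

End Kernel_bound.

(** * Maximal inequality *)

Section Block_estimate.
Context {R : realType}.
Local Notation mu := (@lebesgue_measure R).
Implicit Types (a s b l : R) (tau p g f : R -> R) (B : set R).

Definition phase a tau (x xi : R) : R := x * xi + tau x * `|xi| `^ a.

(** Squared modulus at [x] of the evolution at the selected time [tau x], up to the factor
    [(2 pi)^(-2)]. *)
Definition osc_sqr a tau p (x : R) : R :=
  oscc (phase a tau) p x ^+ 2 + oscs (phase a tau) p x ^+ 2.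

Lemma osc_sqr_ge0 a tau p x : 0 <= osc_sqr a tau p x.
Proof. by rewrite addr_ge0// sqr_ge0. Qed.

Lemma measurable_phase2 a tau : measurable_fun setT tau ->
  measurable_fun setT (fun z : R * R => phase a tau z.1 z.2).
Proof.
move=> mt; apply: measurable_funD; first exact: measurable_mulr2.
apply: measurable_funM; first exact: (measurableT_comp mt).
apply: (measurableT_comp (measurable_powR a)).
by apply: measurable_norm; exact: measurable_snd.
Qed.

Lemma measurable_osc_sqr a tau p : measurable_fun setT tau -> L1 p ->
  measurable_fun setT (osc_sqr a tau p).
Proof.
move=> mt p1; have mP := measurable_phase2 a mt.
by apply: measurable_funD; apply: measurable_sqr; [exact: measurable_oscc|exact: measurable_oscs].
Qed.

Lemma osc_sqr_le a tau p x : measurable_fun setT tau -> L1 p ->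
  osc_sqr a tau p x <= 2 * Rint (fun xi => `|p xi|) ^+ 2.
Proof.
move=> mt p1; have mP := measurable_phase2 a mt.
have h1 := oscc_le mP p1 x; have h2 := oscs_le mP p1 x.
have P0 : 0 <= Rint (fun xi => `|p xi|) by apply: Rint_ge0.
by rewrite mulr2n mulrDl mul1r lerD// -[leLHS]real_normK ?num_real// ler_pXn2r ?nnegrE.
Qed.

Lemma diam_le1_measure_le B : measurable B -> diam_le1 B -> (mu B <= 2%:E)%E.
Proof.
move=> mB dB; have [->|/set0P[x Bx]] := eqVneq B set0; first by rewrite measure0 lee_fin.
apply: (@le_trans _ _ (mu `[x - 1, x + 1]%classic)); last first.
  rewrite lebesgue_measure_itv /= lte_fin; case: ifP => [_|]; last by rewrite lee_fin.
  by rewrite -EFinB lee_fin; lra.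
apply: le_measure; rewrite ?inE// => y By /=; rewrite in_itv/=.
by have := dB x y Bx By; rewrite ler_norml => /andP[? ?]; apply/andP; split; lra.
Qed.

Lemma diam_le1_fin_meas B : measurable B -> diam_le1 B -> (mu B < +oo)%E.
Proof. by move=> mB dB; apply: le_lt_trans (diam_le1_measure_le mB dB) (ltry _). Qed.

Lemma L1_reflect f x : L1 f -> L1 (fun y => f (x - y)).
Proof.
move=> Lf; have := @L1_affine R 1 (- x) _ ltr01 (L1_opp Lf).
by under eq_fun do rewrite mul1r opprB.
Qed.

Lemma Rint_reflect f x : L1 f -> Rint (fun y => f (x - y)) = Rint f.
Proof.
move=> Lf; rewrite [RHS](Rint_opp (L1_measurable Lf)).
rewrite [RHS](@Rint_affine R 1 (- x) _ ltr01 (L1_measurable (L1_opp Lf))) mul1r.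
by apply: eq_Rint => y; rewrite mul1r opprB.
Qed.

Lemma L1_shift f x : L1 f -> L1 (fun y => f (y - x)).
Proof.
by move=> Lf; have := @L1_affine R 1 (- x) _ ltr01 Lf; under eq_fun do rewrite mul1r.
Qed.

Lemma Rint_shift f x : L1 f -> Rint (fun y => f (y - x)) = Rint f.
Proof.
move=> Lf; rewrite [RHS](@Rint_affine R 1 (- x) _ ltr01 (L1_measurable Lf)) mul1r.
by apply: eq_Rint => y; rewrite mul1r.
Qed.

Definition shell l : set R := [set x | l <= `|x| <= 2 * l].

Lemma indic_shell l x : 0 < l ->
  \1_(shell l) x = \1_(`[l, 2 * l]%classic) x + \1_(`[l, 2 * l]%classic) (- x) :> R.
Proof.
move=> l0; rewrite !indicE /shell.
have E1 : (x \in [set x | l <= `|x| <= 2 * l]) = (l <= `|x| <= 2 * l).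
  by apply/idP/idP => [/set_mem//|h]; exact/mem_set.
have E2 y : (y \in `[l, 2 * l]%classic) = (l <= y <= 2 * l) by rewrite mem_setE in_itv.
rewrite E1 !E2; have [x0|x0] := leP 0 x.
  have -> : (l <= - x <= 2 * l) = false by apply/negP => /andP[? _]; lra.
  by rewrite (ger0_norm x0) /= addr0.
have -> : (l <= x <= 2 * l) = false by apply/negP => /andP[? _]; lra.
by rewrite (ltr0_norm x0) /= add0r.
Qed.

Lemma measurable_shell l : measurable (shell l).
Proof.
rewrite (_ : shell l = (fun x : R => `|x|) @^-1` `[l, 2 * l]%classic).
  by rewrite -[X in measurable X]setTI; apply: measurable_norm => //; exact: measurable_id.
by apply/seteqP; split => x /=; rewrite in_itv.
Qed.

Lemma L1_shell l : 0 < l -> L1 (\1_(shell l) : R -> R).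
Proof.
move=> l0.
have -> : (\1_(shell l) : R -> R) = (fun x => \1_(`[l, 2 * l]%classic) x + \1_(`[l, 2 * l]%classic) (- x)).
  by apply/funext => x; exact: indic_shell.
have L : L1 (\1_(`[l, 2 * l]%classic) : R -> R).
  by apply: L1_indic => //; rewrite lebesgue_measure_itv; case: ifP => // _; rewrite -EFinB ltry.
by apply: L1D => //; exact: (L1_opp L).
Qed.

(** Reflection turns the negative half of the shell into the positive half with [v] replaced by
    [- v]. *)
Lemma shell_kernel a l u v : 0 < l ->
  `|Rint (fun xi => \1_(shell l) xi * cos (u * xi + v * `|xi| `^ a))| <=
  `|osc_kernel a l u v| + `|osc_kernel a l u (- v)|.
Proof.
move=> l0; set c := fun xi => cos (u * xi + v * `|xi| `^ a).
have mc : measurable_fun setT c.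
  apply: measurable_cos_comp; apply: measurable_funD; first exact: measurable_funM.
  apply: measurable_funM => //; apply: (measurableT_comp (measurable_powR a)).
  exact: measurable_norm.
have Li : L1 (\1_(`[l, 2 * l]%classic) : R -> R).
  by apply: L1_indic => //; rewrite lebesgue_measure_itv; case: ifP => // _; rewrite -EFinB ltry.
have c1 x : `|c x| <= 1 by rewrite ler_norml cos_geN1 cos_le1.
have La : L1 (fun x => \1_(`[l, 2 * l]%classic) x * c x).
  apply: L1_le Li _; first exact: measurable_indicM.
  by move=> x; rewrite normrM ger0_norm ?indic_ge0'// ler_piMr ?indic_ge0'.
have Lb : L1 (fun x => \1_(`[l, 2 * l]%classic) (- x) * c x).
  apply: L1_le (L1_opp Li) _; last first.
    by move=> x; rewrite normrM ger0_norm ?indic_ge0'// ler_piMr ?indic_ge0'.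
  by apply: measurable_funM => //; exact: (L1_measurable (L1_opp Li)).
have -> : Rint (fun xi => \1_(shell l) xi * c xi) =
   Rint (fun x => \1_(`[l, 2 * l]%classic) x * c x) +
   Rint (fun x => \1_(`[l, 2 * l]%classic) (- x) * c x).
  by rewrite -RintD//; apply: eq_Rint => x; rewrite indic_shell// mulrDl.
have -> : Rint (fun x => \1_(`[l, 2 * l]%classic) x * c x) = osc_kernel a l u v.
  apply: eq_Rint => x; rewrite indicE; case: (boolP (x \in _)) => [|_]; last by rewrite !mul0r.
  by rewrite inE/= in_itv/= !mul1r => /andP[lx _]; rewrite /c ger0_norm//; lra.
have -> : Rint (fun x => \1_(`[l, 2 * l]%classic) (- x) * c x) = osc_kernel a l u (- v).
  rewrite (Rint_opp (L1_measurable Lb)) -osc_kernelN opprK.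
  apply: eq_Rint => x; rewrite opprK indicE; case: (boolP (x \in _)) => [|_]; last by rewrite !mul0r.
  rewrite inE/= in_itv/= !mul1r => /andP[lx _]; rewrite /c normrN ger0_norm; last lra.
  by rewrite mulrN mulNr.
exact: ler_normD.
Qed.

(** [TstarT] with space and frequency exchanged: [g] lives on [B], so the kernel is evaluated only
    at points at distance at most 1 whose times differ by at most [b]. The factor 2 counts the two
    halves of the shell. *)
Lemma dual_block_bound a s : 0 < a -> a != 1 -> 0 < s -> exists2 M : R, 0 < M &
  forall l b tau B g, 1 <= l -> 0 < b -> measurable_fun setT tau ->
  (forall x, B x -> 0 <= tau x <= b) -> diam_le1 B ->
  L1 g -> L1 (fun x => g x ^+ 2) -> (forall x, g x != 0 -> B x) ->
  Rint (fun xi => \1_(shell l) xi *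
    (oscc (fun xi x => phase a tau x xi) g xi ^+ 2 + oscs (fun xi x => phase a tau x xi) g xi ^+ 2)) <=
  M * (l `^ s + Num.sqrt (l `^ a * b)) * Rint (fun x => g x ^+ 2).
Proof.
move=> a0 a1 s0; have [c c0 Hc] := osc_kernel_bound a0 a1.
have [M M0 HM] := schur_kernel_integral a0 s0 c0.
exists (2 * M); first by rewrite mulr_gt0.
move=> l b tau B g l1 b0 mt tB dB g1 g2 gB; have l0 : 0 < l := lt_le_trans ltr01 l1.
have mP : measurable_fun setT (fun z : R * R => (fun xi x => phase a tau x xi) z.1 z.2).
  exact: (measurable_swap (measurable_phase2 a mt)).
have [LK IK] := HM l b l1 b0.
have k0 u : 0 <= schur_kernel a c l b u by exact: schur_kernel_ge0.
have ubd z : L1 z -> Rint z = Rint (schur_kernel a c l b) ->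
    (\int[mu]_x (2 * z x)%:E <= (2 * M * (l `^ s + Num.sqrt (l `^ a * b)))%:E)%E.
  move=> Lz Ez; rewrite (RintE (L1Z _ Lz)) RintZ// Ez lee_fin -mulrA ler_pM2l//.
apply: (@TstarT R _ _ g mP (L1_shell l0) (indic_ge0' _) g1 g2
  (fun x y => 2 * schur_kernel a c l b (x - y))).
- apply: measurable_funM => //; apply: (measurableT_comp (measurable_schur_kernel a c b l0)).
  by apply: measurable_funB.
- by move=> x y; rewrite mulr_ge0.
- by move=> x; apply: (ubd (fun y => schur_kernel a c l b (x - y))); [exact: L1_reflect|exact: Rint_reflect].
- by move=> y; apply: (ubd (fun x => schur_kernel a c l b (x - y))); [exact: L1_shift|exact: Rint_shift].
move=> x y gx gy; have Bx := gB _ gx; have By := gB _ gy.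
have E xi : cos (phase a tau x xi - phase a tau y xi) =
    cos ((x - y) * xi + (tau x - tau y) * `|xi| `^ a) by congr cos; rewrite /phase; ring.
under eq_Rint do rewrite E.
apply: le_trans (shell_kernel _ _ _ l0) _.
have hv : `|tau x - tau y| <= b.
  have /andP[t1 t2] := tB _ Bx; have /andP[t3 t4] := tB _ By.
  by rewrite ler_norml; apply/andP; split; lra.
have h1 := Hc l b (x - y) (tau x - tau y) l0 hv.
have h2 := Hc l b (x - y) (- (tau x - tau y)) l0 (_ : _ <= b).
have h : `|x - y| <= 1 by exact: dB.
rewrite /schur_kernel indicE mem_set ?mul1r; last by rewrite /= in_itv/= -ler_norml.
by rewrite [leRHS]mulrDl mul1r; apply: lerD => //; apply: h2; rewrite normrN.
Qed.

(** Duality: the left side [N] is the pairing of [p] with [h], obtained by applying the adjoint to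
    the output cut to [B]. Cauchy-Schwarz and the dual bound give [N^2 <= 2 K N] times the energy of
    [p], and one divides by [N]. *)
Lemma block_bound a s : 0 < a -> a != 1 -> 0 < s -> exists2 M : R, 0 < M &
  forall l b tau B p, 1 <= l -> 0 < b -> measurable_fun setT tau -> measurable B ->
  (forall x, B x -> 0 <= tau x <= b) -> diam_le1 B ->
  L1 p -> L2 p -> (forall xi, p xi != 0 -> shell l xi) ->
  Rint (fun x => \1_B x * osc_sqr a tau p x) <=
  M * (l `^ s + Num.sqrt (l `^ a * b)) * Rint (fun xi => p xi ^+ 2).
Proof.
move=> a0 a1 s0; have [M M0 HM] := dual_block_bound a0 a1 s0.
exists (2 * M); first by rewrite mulr_gt0.
move=> l b tau B p l1 b0 mt mB tB dB p1 p2 pS; have l0 : 0 < l := lt_le_trans ltr01 l1.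
set K := M * (l `^ s + Num.sqrt (l `^ a * b)).
have K0 : 0 <= K by rewrite mulr_ge0 ?(ltW M0)// addr_ge0 ?powR_ge0.
have mP := measurable_phase2 a mt; pose Psi xi x := phase a tau x xi.
have mP' : measurable_fun setT (fun z : R * R => Psi z.1 z.2) by exact: (measurable_swap mP).
set P := Rint (fun xi => `|p xi|); have P0 : 0 <= P by exact: Rint_ge0.
have Lb : L1 (\1_B : R -> R) by apply: L1_indic => //; exact: diam_le1_fin_meas.
set Vc := oscc (phase a tau) p; set Vs := oscs (phase a tau) p.
have mVc : measurable_fun setT Vc by exact: measurable_oscc.
have mVs : measurable_fun setT Vs by exact: measurable_oscs.
have bVc x : `|Vc x| <= P by exact: oscc_le.
have bVs x : `|Vs x| <= P by exact: oscs_le.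
(* Collects what the dual bound asks of a bounded function restricted to [B]. *)
have cut g : measurable_fun setT g -> (forall x, `|g x| <= P) ->
    [/\ L1 (fun x => \1_B x * g x), L1 (fun x => (\1_B x * g x) ^+ 2),
     forall x, \1_B x * g x != 0 -> B x & forall x, `|\1_B x * g x| <= \1_B x * P].
  move=> mg bg; have mb := measurable_indicM mB mg.
  have bb x : `|\1_B x * g x| <= \1_B x * P.
    by rewrite normrM ger0_norm ?indic_ge0'// ler_wpM2l ?indic_ge0'.
  split => //; first by apply: L1_le (L1Zr P Lb) _.
    apply: L1_le (L1Zr (P ^+ 2) Lb) _; first exact: measurable_sqr.
    move=> x; rewrite exprMn indic_sqr normrM ger0_norm ?indic_ge0'// ler_wpM2l ?indic_ge0'//.
    by rewrite ger0_norm ?sqr_ge0// -[leLHS]real_normK ?num_real// ler_pXn2r ?nnegrE.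
  by move=> x; rewrite indicE; case: (boolP (x \in B)) => [/set_mem//|_]; rewrite mul0r eqxx.
have [c1 c2 c3 c4] := cut _ mVc bVc; have [s1 s2 s3 s4] := cut _ mVs bVs.
set gc := (fun x => \1_B x * Vc x) in c1 c2 c3 c4.
set gs := (fun x => \1_B x * Vs x) in s1 s2 s3 s4.
set N := Rint _.
have EN : N = Rint (fun x => gc x ^+ 2) + Rint (fun x => gs x ^+ 2).
  by rewrite -RintD//; apply: eq_Rint => x; rewrite /gc /gs !exprMn indic_sqr -mulrDr.
have N0 : 0 <= N by rewrite EN addr_ge0// Rint_ge0// => x; exact: sqr_ge0.
pose Pc := oscc Psi gc.
pose Ps := oscs Psi gs.
have mPc : measurable_fun setT Pc by exact: (measurable_oscc mP').
have mPs : measurable_fun setT Ps by exact: (measurable_oscs mP').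
(* Only the cosine part of the adjoint of [gc] and the sine part of that of [gs] pair with [p]. *)
pose h xi := \1_(shell l) xi * (Pc xi + Ps xi).
have dN : N = Rint (fun xi => p xi * h xi).
  pose F x xi := gc x * (cos (phase a tau x xi) * p xi) + gs x * (sin (phase a tau x xi) * p xi).
  have E1 : N = Rint (fun x => Rint (F x)).
    apply: eq_Rint => x; rewrite /F RintD; last 2 first.
    - by apply: L1Z; exact: L1_oscc.
    - by apply: L1Z; exact: L1_oscs.
    rewrite !RintZ; [|exact: L1_oscs|exact: L1_oscc].
    rewrite -[LHS]/(\1_B x * (Vc x ^+ 2 + Vs x ^+ 2)).
    by rewrite -[RHS]/(\1_B x * Vc x * Vc x + \1_B x * Vs x * Vs x); ring.
  rewrite E1 (@swap_Rint _ F (fun x => \1_B x * P + \1_B x * P) (fun xi => `|p xi|)).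
  - apply: eq_Rint => xi; have [p0|p0] := eqVneq (p xi) 0.
      by rewrite p0 mul0r -[RHS](@Rint0 R); apply: eq_Rint => x; rewrite /F p0 !mulr0 addr0.
    rewrite /h indicE mem_set ?mul1r; last exact: pS.
    rewrite /Pc /Ps /oscc /oscs mulrDr -!RintZ; last 2 first.
    - exact: (L1_oscs mP' s1).
    - exact: (L1_oscc mP' c1).
    rewrite -RintD; last 2 first.
    - by apply: L1Z; exact: (L1_oscc mP' c1).
    - by apply: L1Z; exact: (L1_oscs mP' s1).
    by apply: eq_Rint => x; rewrite /F; ring.
  - have mp := L1_measurable p1.
    apply: measurable_funD; apply: measurable_funM.
    + exact: (measurableT_comp (L1_measurable c1)).
    + by apply: measurable_funM; [exact: measurable_cos_comp|exact: (measurableT_comp mp)].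
    + exact: (measurableT_comp (L1_measurable s1)).
    + by apply: measurable_funM; [exact: measurable_sin_comp|exact: (measurableT_comp mp)].
  - by apply: L1D; exact: L1Zr.
  - exact: L1_norm.
  - move=> x xi; apply: le_trans (ler_normD _ _) _; rewrite mulrDl; apply: lerD; rewrite normrM.
      by apply: ler_pM => //; [exact: c4|rewrite normrM ler_piMl// ler_norml cos_geN1 cos_le1].
    by apply: ler_pM => //; [exact: s4|rewrite normrM ler_piMl// ler_norml sin_geN1 sin_le1].
(* The two remaining parts enter because the dual bound controls complete squares. *)
pose Pc' := oscs Psi gc; pose Ps' := oscc Psi gs.
have Lc : L1 (fun xi => \1_(shell l) xi * (Pc xi ^+ 2 + Pc' xi ^+ 2)) :=
  L1_osc_sqr mP' (L1_shell l0) (@indic_ge0' _ (shell l)) c1.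
have Ls : L1 (fun xi => \1_(shell l) xi * (Ps' xi ^+ 2 + Ps xi ^+ 2)) :=
  L1_osc_sqr mP' (L1_shell l0) (@indic_ge0' _ (shell l)) s1.
have Ic : Rint (fun xi => \1_(shell l) xi * (Pc xi ^+ 2 + Pc' xi ^+ 2)) <=
    K * Rint (fun x => gc x ^+ 2) := HM l b tau B gc l1 b0 mt tB dB c1 c2 c3.
have Is : Rint (fun xi => \1_(shell l) xi * (Ps' xi ^+ 2 + Ps xi ^+ 2)) <=
    K * Rint (fun x => gs x ^+ 2) := HM l b tau B gs l1 b0 mt tB dB s1 s2 s3.
have mh : measurable_fun setT h := measurable_indicM (measurable_shell l) (measurable_funD mPc mPs).
clearbody N Pc Pc' Ps Ps' gc gs.
have hle xi : h xi ^+ 2 <= 2 * (\1_(shell l) xi * (Pc xi ^+ 2 + Pc' xi ^+ 2) +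
   \1_(shell l) xi * (Ps' xi ^+ 2 + Ps xi ^+ 2)).
  rewrite /h exprMn indic_sqr -mulrDr [leRHS]mulrCA; apply: ler_wpM2l; first exact: indic_ge0'.
  have := sqr_ge0 (Pc xi - Ps xi); have := sqr_ge0 (Pc' xi); have := sqr_ge0 (Ps' xi).
  rewrite sqrrB sqrrD; move: (Pc xi) (Ps xi) (Pc' xi ^+ 2) (Ps' xi ^+ 2) => A C D E; lra.
clearbody h.
have Lh : L2 h.
  split; first exact: mh.
  apply: L1_le (L1Z 2 (L1D Lc Ls)) _; first exact: measurable_sqr.
  by move=> xi; rewrite ger0_norm ?sqr_ge0.
have I : Rint (fun xi => h xi ^+ 2) <= 2 * K * N.
  apply: le_trans (le_Rint Lh.2 (L1Z 2 (L1D Lc Ls)) hle) _.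
  by rewrite RintZ ?RintD//; [rewrite -mulrA ler_pM2l// EN mulrDr; exact: lerD|exact: L1D].
have := cauchy_schwarz p2 Lh; rewrite -dN => cs.
set p22 := Rint (fun xi => p xi ^+ 2) in cs *.
have q0 : 0 <= p22 by apply: Rint_ge0 => x; exact: sqr_ge0.
have {}cs : N ^+ 2 <= p22 * (2 * K * N) by apply: le_trans cs _; rewrite ler_wpM2l.
have -> : 2 * M * (l `^ s + Num.sqrt (l `^ a * b)) = 2 * K by rewrite /K mulrA.
have [->|Nn0] := eqVneq N 0; first by apply: mulr_ge0 => //; exact: mulr_ge0.
have Np : 0 < N by rewrite lt_neqAle eq_sym Nn0.
rewrite -(ler_pM2r Np) -expr2; apply: le_trans cs _.
by rewrite mulrA (mulrC p22).
Qed.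

End Block_estimate.

(** * Geometric sums and sums of inverse square roots *)

Section Sums.
Context {R : realType}.
Implicit Types (q z y X G E : R).

Lemma sum_geometric_le q n : 0 <= q < 1 -> \sum_(j < n) q ^+ j <= (1 - q)^-1.
Proof.
move=> /andP[q0 q1]; have d0 : 0 < 1 - q by rewrite subr_gt0.
rewrite -[leRHS]mul1r ler_pdivlMr//.
suff -> : (\sum_(j < n) q ^+ j) * (1 - q) = 1 - q ^+ n by rewrite gerBl exprn_ge0.
elim: n => [|n IH]; first by rewrite big_ord0 mul0r expr0 subrr.
by rewrite big_ord_recr/= mulrDl IH exprS; ring.
Qed.

Lemma sum_geometric_ge G n : 1 < G -> \sum_(j < n.+1) G ^+ j <= G ^+ n / (1 - G^-1).
Proof.
move=> G1; have G0 : 0 < G := lt_trans ltr01 G1.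
have d0 : 0 < 1 - G^-1 by rewrite subr_gt0 invf_lt1.
elim: n => [|n IH]; first by rewrite big_ord1 expr0 mul1r invf_ge1// lerBlDr lerDl invr_ge0 ltW.
rewrite big_ord_recr/=; apply: (le_trans (lerD IH (lexx _))).
rewrite le_eqVlt; apply/orP; left; apply/eqP.
have n1 := lt0r_neq0 d0; have n2 := lt0r_neq0 G0.
rewrite exprS; move: (G ^+ n) => g; field; rewrite n2 /=.
by rewrite subr_eq0 gt_eqF.
Qed.

(** Only terms at most 1 count, so the bound is free of [z]; the induction carries the sharper
    [min z 1 / (1 - q)]. *)
Lemma sum_truncated_geometric z q K : 0 <= z -> 0 < q < 1 ->
  \sum_(k < K) (if z * q ^+ k <= 1 then z * q ^+ k else 0) <= (1 - q)^-1.
Proof.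
move=> z0 /andP[q0 q1]; have d0 : 0 < 1 - q by rewrite subr_gt0.
suff : \sum_(k < K) (if z * q ^+ k <= 1 then z * q ^+ k else 0) <= Num.min z 1 / (1 - q).
  move=> /le_trans; apply; rewrite -[leRHS]mul1r; apply: ler_wpM2r; first by rewrite invr_ge0 ltW.
  by rewrite ge_min lexx orbT.
elim: K z z0 => [|K IH] z z0.
  by rewrite big_ord0 divr_ge0 ?(ltW d0)// le_min z0 ler01.
rewrite big_ord_recl /= expr0 mulr1.
under eq_bigr => k _ do rewrite exprS mulrA.
have zq : 0 <= z * q by rewrite mulr_ge0// ltW.
have := IH _ zq; set S := \sum_(k < K) _ => h.
have [z1|z1] := leP z 1.
  have e : Num.min (z * q) 1 <= z * q by rewrite ge_min lexx.
  have h' : S <= z * q / (1 - q) by apply: (le_trans h); rewrite ler_pM2r ?invr_gt0.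
  have -> : z / (1 - q) = z + z * q / (1 - q) by field; rewrite gt_eqF.
  by rewrite lerD2l.
rewrite add0r.
by apply: (le_trans h); rewrite ler_pM2r ?invr_gt0// ge_min lexx orbT.
Qed.

(** Reversing the order of summation gives a truncated decreasing progression. *)
Lemma sum_truncated_growing y E K : 0 <= y -> 1 < E ->
  \sum_(k < K) (if y * E ^+ k <= 1 then y * E ^+ k else 0) <= (1 - E^-1)^-1.
Proof.
move=> y0 E1; have E0 : 0 < E := lt_trans ltr01 E1.
case: K => [|K]; first by rewrite big_ord0 invr_ge0 subr_ge0 invf_le1// ltW.
rewrite (reindex_inj rev_ord_inj) /=.
rewrite (eq_bigr (fun k : 'I_K.+1 => if (y * E ^+ K) * E^-1 ^+ k <= 1 then (y * E ^+ K) * E^-1 ^+ k else 0)).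
  apply: sum_truncated_geometric; first by rewrite mulr_ge0// exprn_ge0// ltW.
  by rewrite invr_gt0 E0 invf_lt1.
move=> k _; have kK : (k <= K)%N by rewrite -ltnS.
rewrite subSS; have -> : y * E ^+ K * E^-1 ^+ k = y * E ^+ (K - k).
  by rewrite -mulrA exprVn -expfB_cond// gt_eqF.
by [].
Qed.

(** Telescoping: [1 / sqrt (n + 1) <= 2 (sqrt (n + 1) - sqrt n)]. *)
Lemma sum_inv_sqrt_le N : \sum_(n < N) (Num.sqrt n.+1%:R)^-1 <= 2 * Num.sqrt N%:R :> R.
Proof.
elim: N => [|N IH]; first by rewrite big_ord0 sqrtr0 mulr0.
rewrite big_ord_recr/=; apply: (le_trans (lerD IH (lexx _))).
set u := Num.sqrt N%:R; set v := Num.sqrt N.+1%:R.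
have v0 : 0 < v by rewrite sqrtr_gt0 ltr0n.
have u0 : 0 <= u by exact: sqrtr_ge0.
have uu : u ^+ 2 = N%:R by rewrite sqr_sqrtr.
have vv : v ^+ 2 = N%:R + 1 by rewrite sqr_sqrtr// -natr1.
rewrite -(ler_pM2r v0) mulrDl mulVf ?gt_eqF//; nra.
Qed.

Lemma sum_inv_sqrt_filter N X : 0 <= X ->
  \sum_(n < N | n.+1%:R <= X) (Num.sqrt n.+1%:R)^-1 <= 2 * Num.sqrt X.
Proof.
move=> X0; elim: N => [|N IH]; first by rewrite big_ord0 mulr_ge0// sqrtr_ge0.
have [h|h] := leP N.+1%:R X.
  apply: (@le_trans _ _ (\sum_(n < N.+1) (Num.sqrt n.+1%:R)^-1)).
    rewrite [leRHS](bigID (fun n : 'I_N.+1 => n.+1%:R <= X)) /= lerDl.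
    by apply: sumr_ge0 => n _; rewrite invr_ge0 sqrtr_ge0.
  by apply: le_trans (sum_inv_sqrt_le _) _; rewrite ler_pM2l// ler_wsqrtr.
by rewrite big_mkcond big_ord_recr/= (lt_geF h) addr0 -big_mkcond.
Qed.

End Sums.

(** * The evolution at a fixed time *)

Section Constant_time.
Context {R : realType}.
Local Notation mu := (@lebesgue_measure R).
Implicit Types (a t : R) (p : R -> R).

(** At a fixed time the phase of the propagator can be put into the amplitude, which leaves
    Plancherel's inequality; the additional factor 2 comes from treating its cosine and sine parts
    separately. *)
Lemma osc_sqr_const a t p : L1 p -> L2 p ->
  L1 (osc_sqr a (fun=> t) p) /\
  Rint (osc_sqr a (fun=> t) p) <= 4 * pi * Rint (fun xi => p xi ^+ 2).
Proof.
move=> p1 p2; pose th (xi : R) := t * `|xi| `^ a.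
have mth : measurable_fun setT th.
  apply: measurable_funM => //; apply: (measurableT_comp (measurable_powR a)).
  exact: measurable_norm.
have mp := L1_measurable p1.
pose qc xi := cos (th xi) * p xi; pose qs xi := sin (th xi) * p xi.
have mqc : measurable_fun setT qc by apply: measurable_funM => //; exact: measurable_cos_comp.
have mqs : measurable_fun setT qs by apply: measurable_funM => //; exact: measurable_sin_comp.
have lc xi : `|qc xi| <= `|p xi| by rewrite normrM ler_piMl// ler_norml cos_geN1 cos_le1.
have ls xi : `|qs xi| <= `|p xi| by rewrite normrM ler_piMl// ler_norml sin_geN1 sin_le1.
have c1 : L1 qc := L1_le mqc (L1_norm p1) lc.
have s1 : L1 qs := L1_le mqs (L1_norm p1) ls.
have c2 : L2 qc := L2_le mqc p2 lc.
have s2 : L2 qs := L2_le mqs p2 ls.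
have E1 x : oscc (phase a (fun=> t)) p x = cosT qc x - sinT qs x.
  rewrite /cosT /sinT /oscc /oscs -RintB; [|exact: L1_cosT|exact: L1_sinT].
  by apply: eq_Rint => xi; rewrite /qc /qs /phase -/(th xi) cosD; ring.
have E2 x : oscs (phase a (fun=> t)) p x = sinT qc x + cosT qs x.
  rewrite /cosT /sinT /oscc /oscs -RintD; [|exact: L1_sinT|exact: L1_cosT].
  by apply: eq_Rint => xi; rewrite /qc /qs /phase -/(th xi) sinD; ring.
have P (q : R -> R) : L1 q -> L2 q -> L1 (fun x => cosT q x ^+ 2 + sinT q x ^+ 2) /\
    Rint (fun x => cosT q x ^+ 2 + sinT q x ^+ 2) <= 2 * pi * Rint (fun x => q x ^+ 2).
  move=> q1 q2; have [A B] := cosT_L2 q1 q2; have [C D] := sinT_L2 q1 q2.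
  have L : L1 (fun x => cosT q x ^+ 2 + sinT q x ^+ 2) by apply: L1D; [exact: A.2|exact: C.2].
  by split => //; rewrite -lee_fin -RintE//; exact: plancherel_le q2.2.
have [Lc Ic] := P _ c1 c2; have [Ls Is] := P _ s1 s2.
have le x : osc_sqr a (fun=> t) p x <= 2 * ((cosT qc x ^+ 2 + sinT qc x ^+ 2) + (cosT qs x ^+ 2 + sinT qs x ^+ 2)).
  rewrite /osc_sqr E1 E2; move: (cosT qc x) (sinT qc x) (cosT qs x) (sinT qs x) => A B C D.
  have := sqr_ge0 (A + D); have := sqr_ge0 (B - C); nra.
have LD := L1Z 2 (L1D Lc Ls).
have m : measurable_fun setT (osc_sqr a (fun=> t) p) by apply: measurable_osc_sqr.
have L : L1 (osc_sqr a (fun=> t) p).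
  by apply: L1_le LD _ => // x; rewrite ger0_norm ?osc_sqr_ge0.
split => //; apply: le_trans (le_Rint L LD le) _.
have E : Rint (fun x => qc x ^+ 2) + Rint (fun x => qs x ^+ 2) = Rint (fun x => p x ^+ 2).
  rewrite -RintD; [|exact: c2.2|exact: s2.2].
  by apply: eq_Rint => x; rewrite /qc /qs !exprMn -mulrDl cos2Dsin2 mul1r.
rewrite RintZ; last exact: L1D.
rewrite RintD// -E (_ : 4 * pi * _ = 2 * (2 * pi * Rint (fun x => qc x ^+ 2) +
  2 * pi * Rint (fun x => qs x ^+ 2))); last by ring.
by rewrite ler_pM2l// lerD.
Qed.

End Constant_time.

Section Sums_of_integrals.
Context {R : realType}.

Lemma Rint_sum (I : Type) (l : seq I) (P : pred I) (F : I -> R -> R) :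
  (forall i, P i -> L1 (F i)) ->
  L1 (fun x => \sum_(i <- l | P i) F i x) /\
  Rint (fun x => \sum_(i <- l | P i) F i x) = \sum_(i <- l | P i) Rint (F i).
Proof.
move=> LF; elim: l => [|i l [IH1 IH2]].
  rewrite big_nil (_ : (fun x => _) = (fun=> 0)); last by apply/funext => x; rewrite big_nil.
  by rewrite Rint0; split => //; exact: L10.
rewrite big_cons; have [Pi|Pi] := boolP (P i); last first.
  rewrite (_ : (fun x => _) = (fun x => \sum_(i <- l | P i) F i x))//.
  by apply/funext => x; rewrite big_cons (negbTE Pi).
rewrite (_ : (fun x => _) = (fun x => F i x + \sum_(i <- l | P i) F i x)); last first.
  by apply/funext => x; rewrite big_cons Pi.
by rewrite RintD ?LF// IH2; split => //; apply: L1D => //; exact: LF.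
Qed.

End Sums_of_integrals.

(** * Summation over the dyadic shells *)

Section Maximal_bound.
Context {R : realType}.
Local Notation mu := (@lebesgue_measure R).
Implicit Types (p f g : R -> R) (x y z u : R) (k j K : nat).

Section Linearity.
Variables (Phi : R -> R -> R).
Hypothesis mPhi : measurable_fun setT (fun z : R * R => Phi z.1 z.2).

Lemma osccD f g x : L1 f -> L1 g ->
  oscc Phi (fun xi => f xi + g xi) x = oscc Phi f x + oscc Phi g x.
Proof.
move=> Lf Lg; rewrite /oscc -RintD; [|exact: L1_oscc|exact: L1_oscc].
by apply: eq_Rint => xi; rewrite mulrDr.
Qed.

Lemma oscsD f g x : L1 f -> L1 g ->
  oscs Phi (fun xi => f xi + g xi) x = oscs Phi f x + oscs Phi g x.
Proof.
move=> Lf Lg; rewrite /oscs -RintD; [|exact: L1_oscs|exact: L1_oscs].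
by apply: eq_Rint => xi; rewrite mulrDr.
Qed.
End Linearity.

Definition dball K : set R := [set x | `|x| < 2 ^+ K].
Definition dshell K : set R := [set x | 2 ^+ K <= `|x| < 2 ^+ K.+1].

Lemma measurable_dball K : measurable (dball K).
Proof.
rewrite (_ : dball K = (fun x : R => `|x|) @^-1` `]-oo, 2 ^+ K[%classic).
  by rewrite -[X in measurable X]setTI; apply: measurable_norm => //; exact: measurable_id.
by apply/seteqP; split => x /=; rewrite in_itv.
Qed.

Lemma measurable_dshell K : measurable (dshell K).
Proof.
rewrite (_ : dshell K = (fun x : R => `|x|) @^-1` `[2 ^+ K, 2 ^+ K.+1[%classic).
  by rewrite -[X in measurable X]setTI; apply: measurable_norm => //; exact: measurable_id.
by apply/seteqP; split => x /=; rewrite in_itv.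
Qed.

Lemma indic_dball K x : \1_(dball K) x = (if `|x| < 2 ^+ K then 1 else 0) :> R.
Proof.
rewrite indicE (_ : (x \in dball K) = (`|x| < 2 ^+ K)); first by case: ifP.
by apply/idP/idP => [/set_mem//|h]; exact/mem_set.
Qed.

Lemma indic_dshell K x :
  \1_(dshell K) x = (if 2 ^+ K <= `|x| < 2 ^+ K.+1 then 1 else 0) :> R.
Proof.
rewrite indicE (_ : (x \in dshell K) = (2 ^+ K <= `|x| < 2 ^+ K.+1)); first by case: ifP.
by apply/idP/idP => [/set_mem//|h]; exact/mem_set.
Qed.

Lemma dyadic_step u k : u <= 1 -> 2^-1 ^+ k < u ->
  exists j, [/\ (j < k)%N, u <= 2^-1 ^+ j & 2^-1 ^+ j.+1 < u].
Proof.
move=> u1; elim: k => [|k IH] uk; first by rewrite expr0 ltNge u1 in uk.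
have [h|h] := leP u (2^-1 ^+ k); first by exists k; split.
by have [j [? ? ?]] := IH h; exists j; split => //; exact: ltnW.
Qed.

Lemma indic_dballS K x : \1_(dball K.+1) x = \1_(dball K) x + \1_(dshell K) x :> R.
Proof.
rewrite !indic_dball indic_dshell; have h : 2 ^+ K <= 2 ^+ K.+1 :> R by rewrite ler_eXn2l// ltr1n.
have [h1|h1] := ltP `|x| (2 ^+ K) => /=; last by rewrite add0r.
by rewrite (lt_le_trans h1 h) addr0.
Qed.

Lemma dball_itv K x : \1_(dball K) x = \1_(dball K) x * \1_(`[- 2 ^+ K, 2 ^+ K]%classic) x :> R.
Proof.
rewrite indic_dball indicE; have [h|h] := ltP `|x| (2 ^+ K); last by rewrite mul0r.
by rewrite mem_set ?mulr1//= in_itv/= -ler_norml ltW.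
Qed.

Lemma L1_dball K p : L2 p -> L1 (fun xi => \1_(dball K) xi * p xi).
Proof.
move=> p2; have := L1_indicM (measurable_dball K) (L2_L1_indic (- 2 ^+ K) (2 ^+ K) p2).
by under eq_fun do rewrite mulrA -dball_itv.
Qed.

Lemma L1_dshell K p : L2 p -> L1 (fun xi => \1_(dshell K) xi * p xi).
Proof.
move=> p2; have := L1B (L1_dball K.+1 p2) (L1_dball K p2).
by under eq_fun do rewrite indic_dballS mulrDl addrC addKr.
Qed.

Lemma Rint_sqr_indic_dballS K p (w : R -> R) :
  L1 (fun x => \1_(dball K.+1) x * (w x * p x ^+ 2)) ->
  measurable_fun setT (fun x => w x * p x ^+ 2) ->
  Rint (fun x => \1_(dball K.+1) x * (w x * p x ^+ 2)) =
  Rint (fun x => \1_(dball K) x * (w x * p x ^+ 2)) +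
  Rint (fun x => \1_(dshell K) x * (w x * p x ^+ 2)).
Proof.
move=> L mw; rewrite -RintD; first by apply: eq_Rint => x; rewrite indic_dballS mulrDl.
  apply: L1_le (L1_norm L) _; first exact: measurable_indicM (measurable_dball K) mw.
  move=> x; rewrite !normrM ler_wpM2r// !ger0_norm ?indic_ge0'// indic_dballS lerDl.
  exact: indic_ge0'.
apply: L1_le (L1_norm L) _; first exact: measurable_indicM (measurable_dshell K) mw.
move=> x; rewrite !normrM ler_wpM2r// !ger0_norm ?indic_ge0'// indic_dballS lerDr.
exact: indic_ge0'.
Qed.

Variables (a s : R).
Hypotheses (a0 : 0 < a) (a1 : a != 1) (s0 : 0 < s) (sa : s < a / 4) (s4 : s < 1 / 4).
Let r := 2 * s / (a - 4 * s).
(** [(G ^+ 2) ^+ k] is the Sobolev weight of the shell of index [k], and [D ^+ k] the reciprocal of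
    its critical time; [D^r = G^2] links them through [r]. *)
Let G : R := 2 `^ s.
Let D : R := 2 `^ (a - 4 * s).

Let as0 : 0 < a - 4 * s. Proof. by move: sa; rewrite ltr_pdivlMr//; lra. Qed.
Let r0 : 0 < r. Proof. by rewrite divr_gt0// mulr_gt0. Qed.

Let powR2_gt1 (e : R) : 0 < e -> 1 < 2 `^ e :> R.
Proof.
move=> e0; have h : (1 : R) `^ e < 2 `^ e by apply: gt0_ltr_powR; rewrite ?nnegrE// ltr1n.
by move: h; rewrite powR1.
Qed.

Let G1 : 1 < G. Proof. exact: powR2_gt1. Qed.
Let D1 : 1 < D. Proof. exact: powR2_gt1. Qed.
Let G0 : 0 < G. Proof. exact: lt_trans G1. Qed.
Let D0 : 0 < D. Proof. exact: lt_trans D1. Qed.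

Let powRX (e x : R) k : 0 <= x -> (x ^+ k) `^ e = (x `^ e) ^+ k.
Proof. by move=> x_ge0; rewrite -powR_mulrn// -powRrM mulrC powRrM powR_mulrn// powR_ge0. Qed.

Let Dr : D `^ r = G ^+ 2.
Proof.
rewrite /D -powRrM -powR_mulrn ?powR_ge0// -powRrM; congr (_ `^ _); rewrite /r; field.
by rewrite gt_eqF.
Qed.

Let Dr2 : D `^ (r / 2) = G.
Proof.
by rewrite /D -powRrM; congr (_ `^ _); rewrite /r; field; rewrite gt_eqF.
Qed.

(** Cauchy-Schwarz weight of the shell [k] at the time [u D^(-k)]. For [u > 1] its growth is matched
    to the weak [ell^r] bound. For [u <= 1] it is comparable to the smaller of [u^(-s)] and [G^k],
    written as a sum of indicators because each of these restricts the times to a shorter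
    interval. *)
Definition bweight k u : R := (if 1 < u then u `^ (r / 2) else 0) +
  \sum_(j < k.+1) (if u <= 2^-1 ^+ j then G ^+ j else 0).

Let half_term_ge0 u j : 0 <= (if u <= 2^-1 ^+ j then G ^+ j else 0) :> R.
Proof. by case: ifP => // _; rewrite exprn_ge0// ltW. Qed.

Lemma bweight_ge1 k u : 1 <= bweight k u.
Proof.
rewrite /bweight; have [u1|u1] := ltP 1 u.
  apply: (@le_trans _ _ (u `^ (r / 2))); last by rewrite lerDl; apply: sumr_ge0 => j _; exact: half_term_ge0.
  rewrite -[leLHS](powRr0 u) ler_powR//; first exact: ltW.
  by rewrite divr_ge0// ltW.
by rewrite add0r big_ord_recl /= !expr0 u1 lerDl; apply: sumr_ge0 => j _; exact: half_term_ge0.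
Qed.

Let bweight_term_le k u j : (j <= k)%N -> u <= 2^-1 ^+ j -> G ^+ j <= bweight k u.
Proof.
move=> jk uj; have jk' : (j < k.+1)%N by rewrite ltnS.
rewrite /bweight (bigD1 (Ordinal jk')) //= uj.
have h1 : 0 <= (if 1 < u then u `^ (r / 2) else 0) by case: ifP => // _; exact: powR_ge0.
have h2 : 0 <= \sum_(i < k.+1 | i != Ordinal jk') (if u <= 2^-1 ^+ i then G ^+ i else 0).
  by apply: sumr_ge0 => i _; exact: half_term_ge0.
by rewrite addrCA lerDl addr_ge0.
Qed.

(** Three cases: [u > 1], where [D^(r/2) = G] separates the time from the shell; [u <= 2^(-k)],
    which costs [G^(-k)]; and [2^(-j-1) < u <= 2^(-j)], where [G^(-j) <= G u^s]. The truncations at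
    1 keep each progression summable over all shells. *)
Lemma inv_bweight_le k y : 0 <= y -> (bweight k (y * D ^+ k))^-1 <=
  (if y `^ (- (r / 2)) * G^-1 ^+ k <= 1 then y `^ (- (r / 2)) * G^-1 ^+ k else 0) +
  (G^-1 ^+ k + G * (if y `^ s * (D `^ s) ^+ k <= 1 then y `^ s * (D `^ s) ^+ k else 0)).
Proof.
move=> y0; set u := y * D ^+ k; have w1 := bweight_ge1 k u.
have w0 : 0 < bweight k u := lt_le_trans ltr01 w1.
have Dk : 0 < D ^+ k by rewrite exprn_gt0.
have g0 : 0 <= G^-1 ^+ k by rewrite exprn_ge0// invr_ge0 ltW.
have t1 : 0 <= (if y `^ (- (r / 2)) * G^-1 ^+ k <= 1 then y `^ (- (r / 2)) * G^-1 ^+ k else 0).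
  by case: ifP => // _; rewrite mulr_ge0// powR_ge0.
have us : y `^ s * (D `^ s) ^+ k = u `^ s by rewrite -powRX ?ltW// -powRM// ltW.
have t2 : 0 <= (if y `^ s * (D `^ s) ^+ k <= 1 then y `^ s * (D `^ s) ^+ k else 0).
  by rewrite us; case: ifP => // _; exact: powR_ge0.
have t2' : 0 <= G * (if y `^ s * (D `^ s) ^+ k <= 1 then y `^ s * (D `^ s) ^+ k else 0).
  by apply: mulr_ge0 => //; exact: ltW.
have [u1|u1] := ltP 1 u.
  have u0 : 0 < u := lt_trans ltr01 u1.
  have E : y `^ (- (r / 2)) * G^-1 ^+ k = (u `^ (r / 2))^-1.
    by rewrite /u powRM// ?(ltW Dk)// powRX ?(ltW D0)// Dr2 invfM powRN exprVn.
  have v1 : 1 <= u `^ (r / 2).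
    rewrite -[leLHS](powRr0 u) ler_powR//; first exact: ltW.
    by rewrite divr_ge0// ltW.
  have v0 := lt_le_trans ltr01 v1.
  rewrite E invf_le1// v1; apply: (@le_trans _ _ (u `^ (r / 2))^-1).
    rewrite lef_pV2 ?posrE// /bweight u1 lerDl; apply: sumr_ge0 => j _; exact: half_term_ge0.
  by rewrite lerDl addr_ge0.
have u0 : 0 <= u by rewrite mulr_ge0// ltW.
have us1 : u `^ s <= 1.
  have : u `^ s <= 1 `^ s by apply: ge0_ler_powR; rewrite ?nnegrE// ltW.
  by rewrite powR1.
rewrite us us1.
have [uk|uk] := leP u (2^-1 ^+ k).
  apply: (@le_trans _ _ (G^-1 ^+ k)).
    by rewrite exprVn lef_pV2 ?posrE ?exprn_gt0//; exact: bweight_term_le.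
  rewrite us us1 in t2'; lra.
have [j [jk uj ujS]] := dyadic_step u1 uk.
apply: (@le_trans _ _ (G * u `^ s)); last by lra.
have Gj : G ^+ j <= bweight k u by apply: bweight_term_le => //; exact: ltnW.
have Gj0 : 0 < G ^+ j by rewrite exprn_gt0.
apply: (@le_trans _ _ (G ^+ j)^-1); first by rewrite lef_pV2.
have : (2^-1 ^+ j.+1) `^ s <= u `^ s.
  by apply: ge0_ler_powR; rewrite ?nnegrE ?exprn_ge0// ltW.
have -> : (2^-1 ^+ j.+1) `^ s = G^-1 * (G ^+ j)^-1.
  rewrite powRX// -exprVn -exprS; congr (_ ^+ _).
  by rewrite -powR_inv1// powRAC powR_inv1// powR_ge0.
by rewrite -(ler_pM2l G0) mulrA mulfV ?gt_eqF// mul1r.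
Qed.

(** [A] must not depend on [y], since the selected time varies with the point. *)
Lemma sum_inv_bweight : exists2 A : R, 0 < A & forall K y, 0 <= y ->
  \sum_(k < K) (bweight k (y * D ^+ k))^-1 <= A.
Proof.
have E1 : 1 < D `^ s by rewrite /D -powRrM; apply: powR2_gt1; exact: mulr_gt0.
have Gi : 0 < G^-1 < 1 by rewrite invr_gt0 G0 invf_lt1.
have Gi' : 0 <= G^-1 < 1 by case/andP: Gi => /ltW -> ->.
exists ((1 - G^-1)^-1 + ((1 - G^-1)^-1 + G * (1 - (D `^ s)^-1)^-1)).
  have h1 : 0 < (1 - G^-1)^-1 by rewrite invr_gt0 subr_gt0; case/andP: Gi.
  have h2 : 0 < (1 - (D `^ s)^-1)^-1 by rewrite invr_gt0 subr_gt0 invf_lt1// (lt_trans ltr01 E1).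
  by rewrite !addr_gt0// mulr_gt0.
move=> K y y0; apply: le_trans; first by apply: ler_sum => k _; exact: inv_bweight_le.
rewrite !big_split /= -mulr_sumr; apply: lerD; last apply: lerD.
- by apply: sum_truncated_geometric => //; exact: powR_ge0.
- exact: sum_geometric_le.
- by rewrite ler_pM2l//; apply: sum_truncated_growing => //; exact: powR_ge0.
Qed.

(** * Shell estimates at selected times *)

Section Selected_times.
Variables (t : nat -> R) (c : R) (N : nat) (tau : R -> R) (B : set R).
Hypotheses (t0 : forall n, 0 <= t n) (tw : forall n, n.+1%:R * t n `^ r <= c) (c0 : 0 < c).
Hypotheses (mt : measurable_fun setT tau)
  (tauN : forall x, exists2 n, (n <= N)%N & tau x = t n).
Hypotheses (mB : measurable B) (dB : diam_le1 B).

Let tau0 x : 0 <= tau x. Proof. by have [n _ ->] := tauN x. Qed.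

Let LB : L1 (\1_B : R -> R). Proof. by apply: L1_indic => //; exact: diam_le1_fin_meas. Qed.

Let L1_bounded f (C : R) : measurable_fun setT f -> (forall x, `|f x| <= C) ->
  L1 (fun x => \1_B x * f x).
Proof.
move=> mf fC; apply: L1_le (L1Zr C LB) _; first exact: measurable_indicM mB mf.
by move=> x; rewrite normrM ger0_norm ?indic_ge0'// ler_wpM2l ?indic_ge0'.
Qed.

Let L1_osc_sqr p : L1 p -> L1 (fun x => \1_B x * osc_sqr a tau p x).
Proof.
move=> p1; apply: (@L1_bounded _ (2 * Rint (fun xi => `|p xi|) ^+ 2)).
  exact: measurable_osc_sqr.
by move=> x; rewrite ger0_norm ?osc_sqr_ge0//; exact: osc_sqr_le.
Qed.

(** From [(n + 1) t_n^r <= c] and [D^r = G^2] one gets [(n + 1) u^r <= c G^(2k)]. As [u > 1], this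
    limits the number of late times; its square root bounds the weight. *)
Let far_coefficient n k : 1 < t n * D ^+ k ->
  n.+1%:R <= c * (G ^+ 2) ^+ k /\
  (t n * D ^+ k) `^ (r / 2) <= Num.sqrt (c * (G ^+ 2) ^+ k) * (Num.sqrt n.+1%:R)^-1.
Proof.
set u := t n * D ^+ k => u1; have u0 : 0 < u := lt_trans ltr01 u1.
have n0 : 0 < n.+1%:R :> R by rewrite ltr0n.
have Dk : 0 < D ^+ k by rewrite exprn_gt0.
have E : n.+1%:R * u `^ r <= c * (G ^+ 2) ^+ k.
  rewrite /u powRM ?(ltW Dk)// powRX ?(ltW D0)// Dr mulrA ler_wpM2r//.
  by rewrite exprn_ge0// exprn_ge0// ltW.
have v1 : 1 <= u `^ r.
  by rewrite -[leLHS](powRr0 u) ler_powR//; exact: ltW.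
split; first by apply: le_trans E; rewrite ler_peMr// ltW.
have -> : u `^ (r / 2) = Num.sqrt (u `^ r) by rewrite powRrM powR12_sqrt// powR_ge0.
rewrite ler_pdivlMr ?sqrtr_gt0// -sqrtrM ?powR_ge0// ler_wsqrtr// mulrC.
exact: E.
Qed.

Let far_weight k x := if 1 < tau x * D ^+ k then (tau x * D ^+ k) `^ (r / 2) else 0.

Let measurable_far_weight k : measurable_fun setT (far_weight k).
Proof.
have m : measurable_fun setT (fun x => tau x * D ^+ k) by exact: measurable_funM.
apply: measurable_fun_ifT => //; first exact: measurable_fun_ltr.
exact: (measurableT_comp (measurable_powR (r / 2)) m).
Qed.

Let far_weight_ge0 k x : 0 <= far_weight k x.
Proof. by rewrite /far_weight; case: ifP => // _; exact: powR_ge0. Qed.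

(** The selected late time is replaced by the sum over all late times, each estimated by Plancherel.
    With [X = c G^(2k)] the coefficients [sqrt X / sqrt (n + 1)], for [n + 1 <= X], add up to at
    most [2 X]; with [u^r] in place of [u^(r/2)] a harmonic sum would appear. *)
Let block_far k p : L1 p -> L2 p ->
  L1 (fun x => \1_B x * (far_weight k x * osc_sqr a tau p x)) /\
  Rint (fun x => \1_B x * (far_weight k x * osc_sqr a tau p x)) <=
    8 * pi * c * (G ^+ 2) ^+ k * Rint (fun xi => p xi ^+ 2).
Proof.
move=> p1 p2; set X := c * (G ^+ 2) ^+ k.
have X0 : 0 <= X by rewrite mulr_ge0 ?(ltW c0)// exprn_ge0// exprn_ge0// ltW.
pose h x := \sum_(n < N.+1 | n.+1%:R <= X)
  Num.sqrt X * (Num.sqrt n.+1%:R)^-1 * osc_sqr a (fun=> t n) p x.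
have P n : L1 (osc_sqr a (fun=> t n) p) /\
  Rint (osc_sqr a (fun=> t n) p) <= 4 * pi * Rint (fun xi => p xi ^+ 2) := osc_sqr_const a (t n) p1 p2.
have hL : L1 h /\ Rint h <= (\sum_(n < N.+1 | n.+1%:R <= X) Num.sqrt X * (Num.sqrt n.+1%:R)^-1) *
    (4 * pi * Rint (fun xi => p xi ^+ 2)).
  have [|L ->] := @Rint_sum R _ (index_enum 'I_N.+1) (fun n : 'I_N.+1 => n.+1%:R <= X)
    (fun n x => Num.sqrt X * (Num.sqrt n.+1%:R)^-1 * osc_sqr a (fun=> t n) p x).
    by move=> n _; apply: L1Z; exact: (P n).1.
  split => //; rewrite mulr_suml; apply: ler_sum => n _; rewrite RintZ; last exact: (P n).1.
  by apply: ler_wpM2l; [rewrite mulr_ge0 ?invr_ge0 ?sqrtr_ge0|exact: (P n).2].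
have le x : `|\1_B x * (far_weight k x * osc_sqr a tau p x)| <= h x.
  rewrite normrM ger0_norm ?indic_ge0'// ger0_norm ?mulr_ge0 ?osc_sqr_ge0//.
  have hx0 : 0 <= h x.
    by apply: sumr_ge0 => n _; rewrite !mulr_ge0 ?osc_sqr_ge0 ?invr_ge0 ?sqrtr_ge0.
  apply: (@le_trans _ _ (far_weight k x * osc_sqr a tau p x)).
    by rewrite ler_piMl ?indic_le1// mulr_ge0 ?osc_sqr_ge0.
  have [n nN tn] := tauN x; rewrite /far_weight.
  have -> : osc_sqr a tau p x = osc_sqr a (fun=> tau x) p x by [].
  rewrite tn; case: ifPn => [h1|_]; last by rewrite mul0r.
  have [nX co] := far_coefficient h1; have nN' : (n < N.+1)%N by rewrite ltnS.
  rewrite /h (bigD1 (Ordinal nN')) //=.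
  apply: (@le_trans _ _ (Num.sqrt X * (Num.sqrt n.+1%:R)^-1 * osc_sqr a (fun=> t n) p x)).
    by rewrite ler_wpM2r ?osc_sqr_ge0.
  rewrite lerDl; apply: sumr_ge0 => i _.
  by rewrite !mulr_ge0 ?osc_sqr_ge0 ?invr_ge0 ?sqrtr_ge0.
have m : measurable_fun setT (fun x => \1_B x * (far_weight k x * osc_sqr a tau p x)).
  by apply: measurable_indicM => //; apply: measurable_funM => //; exact: measurable_osc_sqr.
split; first exact: L1_le m hL.1 le.
apply: le_trans (ler_norm _) _; apply: le_trans (norm_Rint_le m hL.1 le) _.
apply: (le_trans hL.2); rewrite -mulr_sumr.
have P0 : 0 <= 4 * pi * Rint (fun xi => p xi ^+ 2).
  rewrite !mulr_ge0 ?pi_ge0//; apply: Rint_ge0 => x; exact: sqr_ge0.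
apply: (@le_trans _ _ (Num.sqrt X * (2 * Num.sqrt X) * (4 * pi * Rint (fun xi => p xi ^+ 2)))).
  by rewrite ler_wpM2r// ler_wpM2l ?sqrtr_ge0//; exact: sum_inv_sqrt_filter.
have sX : Num.sqrt X * Num.sqrt X = X by rewrite -expr2 sqr_sqrtr.
set I := Rint _; rewrite (_ : _ * _ * _ = 2 * (Num.sqrt X * Num.sqrt X) * (4 * pi * I)); last by ring.
by rewrite sX /X le_eqVlt; apply/orP; left; apply/eqP; ring.
Qed.

Let near_weight k x := \sum_(j < k.+1) (if tau x * D ^+ k <= 2^-1 ^+ j then G ^+ j else 0).

Variable M : R.
Hypotheses (M0 : 0 < M) (HM : forall l b B p, 1 <= l -> 0 < b -> measurable B ->
  (forall x, B x -> 0 <= tau x <= b) -> diam_le1 B ->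
  L1 p -> L2 p -> (forall xi, p xi != 0 -> shell l xi) ->
  Rint (fun x => \1_B x * osc_sqr a tau p x) <=
  M * (l `^ s + Num.sqrt (l `^ a * b)) * Rint (fun xi => p xi ^+ 2)).

(** Halving the time interval multiplies the term [sqrt (l^a b)] of the block bound by [q];
    [G q < 1] says that this beats the growth [G] of the weight. *)
Let q : R := Num.sqrt 2^-1.

Let Gq : 0 < G * q < 1.
Proof.
have q0 : 0 < q by rewrite sqrtr_gt0 invr_gt0.
rewrite mulr_gt0//= -(@ltr_pXn2r _ 2)// ?nnegrE ?mulr_ge0 ?(ltW G0) ?(ltW q0)//.
rewrite exprMn expr1n sqr_sqrtr ?invr_ge0// ltr_pdivrMr// mul1r.
have -> : G ^+ 2 = 2 `^ (2 * s) by rewrite -powR_mulrn ?powR_ge0// /G -powRrM mulrC.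
rewrite -[ltRHS]powRr1//; apply: lt_le_trans (_ : 2 `^ (1 / 2) <= _).
  rewrite -(subrK (2 * s) (1 / 2)) powRD; last by apply/implyP => _; rewrite pnatr_eq0.
  rewrite ltr_pMl ?powR_gt0//; apply: powR2_gt1; move: s4; rewrite ltr_pdivlMr//; lra.
by rewrite ler_powR ?ler1n//; lra.
Qed.

(** The indicator restricts the times to [[0, b]] with [b = 2^(-j) D^(-k)]; there the block bound
    with [l = 2^k] reads [G^k + G^(2k) q^j], because [2^a / D = G^4]. *)
Let block_near_j k j p : L1 p -> L2 p -> (forall xi, p xi != 0 -> shell (2 ^+ k) xi) ->
  L1 (fun x => \1_B x * ((if tau x * D ^+ k <= 2^-1 ^+ j then G ^+ j else 0) * osc_sqr a tau p x)) /\
  Rint (fun x => \1_B x * ((if tau x * D ^+ k <= 2^-1 ^+ j then G ^+ j else 0) * osc_sqr a tau p x)) <=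
  G ^+ j * (M * (G ^+ k + (G ^+ 2) ^+ k * q ^+ j)) * Rint (fun xi => p xi ^+ 2).
Proof.
move=> p1 p2 pS; have Dk : 0 < D ^+ k by rewrite exprn_gt0.
pose b : R := 2^-1 ^+ j / D ^+ k.
have b0 : 0 < b by rewrite divr_gt0// exprn_gt0// invr_gt0.
pose A := [set x | tau x <= b]; have mA : measurable A.
  rewrite (_ : A = tau @^-1` `]-oo, b]%classic).
    by rewrite -[X in measurable X]setTI; exact: mt.
  by apply/seteqP; split => x /=; rewrite in_itv.
have mBA : measurable (B `&` A) by exact: measurableI.
have E : (fun x => \1_B x * ((if tau x * D ^+ k <= 2^-1 ^+ j then G ^+ j else 0) * osc_sqr a tau p x)) =
    (fun x => G ^+ j * (\1_(B `&` A) x * osc_sqr a tau p x)).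
  apply/funext => x; rewrite indicI /= -ler_pdivlMr// -/b [\1_A x]indicE.
  rewrite (_ : (x \in A) = (tau x <= b)); last by apply/idP/idP => [/set_mem//|h]; exact/mem_set.
  by case: ifP => _; rewrite ?mulr1 ?mulr0 ?mul0r ?mulr0//; rewrite mulrCA.
have L : L1 (fun x => \1_(B `&` A) x * osc_sqr a tau p x).
  have := L1_indicM mA (L1_osc_sqr p1); apply: eq_ind; congr L1; apply/funext => x.
  by rewrite indicI /= mulrA; congr (_ * _); rewrite mulrC.
rewrite E; split; first exact: L1Z.
rewrite RintZ// -mulrA; apply: ler_wpM2l; first by rewrite exprn_ge0// ltW.
have := @HM (2 ^+ k) b (B `&` A) p _ b0 mBA _ _ p1 p2 pS.
have -> : (2 ^+ k) `^ s = G ^+ k :> R by rewrite powRX.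
have -> : Num.sqrt ((2 ^+ k) `^ a * b) = (G ^+ 2) ^+ k * q ^+ j.
  have -> : (2 ^+ k) `^ a * b = ((G ^+ 2) ^+ k * q ^+ j) ^+ 2.
    rewrite powRX// /b mulrCA [RHS]exprMn -[(q ^+ j) ^+ 2]exprAC sqr_sqrtr ?invr_ge0//.
    rewrite [RHS]mulrC; congr (_ * _); rewrite [((G ^+ 2) ^+ k) ^+ 2]exprAC -expr_div_n; congr (_ ^+ _).
    have -> : (G ^+ 2) ^+ 2 = 2 `^ (4 * s).
      by rewrite -exprM -powR_mulrn ?powR_ge0// /G -powRrM mulrC.
    rewrite /D -powRB; first by congr (_ `^ _); lra.
    by apply/implyP => _; rewrite pnatr_eq0.
  by rewrite sqrtr_sqr ger0_norm// mulr_ge0// ?exprn_ge0 ?sqrtr_ge0// ltW.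
apply => //.
- by rewrite exprn_ege1// ler1n.
- by move=> x [_ ?]; rewrite tau0.
- by move=> x y [? _] [? _]; exact: dB.
Qed.

Let Cnear := M * ((1 - G^-1)^-1 + (1 - G * q)^-1).

(** The first term of the block bound is largest at [j = k], where it reaches [G^(2k)]; the second
    is summable in [j]. *)
Let block_near k p : L1 p -> L2 p -> (forall xi, p xi != 0 -> shell (2 ^+ k) xi) ->
  L1 (fun x => \1_B x * (near_weight k x * osc_sqr a tau p x)) /\
  Rint (fun x => \1_B x * (near_weight k x * osc_sqr a tau p x)) <=
    Cnear * (G ^+ 2) ^+ k * Rint (fun xi => p xi ^+ 2).
Proof.
move=> p1 p2 pS; set I := Rint (fun xi => p xi ^+ 2).
have I0 : 0 <= I by apply: Rint_ge0 => x; exact: sqr_ge0.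
have E : (fun x => \1_B x * (near_weight k x * osc_sqr a tau p x)) = (fun x => \sum_(j < k.+1)
    \1_B x * ((if tau x * D ^+ k <= 2^-1 ^+ j then G ^+ j else 0) * osc_sqr a tau p x)).
  by apply/funext => x; rewrite /near_weight mulr_suml mulr_sumr.
have [|L EI] := @Rint_sum R _ (index_enum 'I_k.+1) xpredT (fun (j : 'I_k.+1) x =>
    \1_B x * ((if tau x * D ^+ k <= 2^-1 ^+ j then G ^+ j else 0) * osc_sqr a tau p x)).
  by move=> j _; exact: (block_near_j j p1 p2 pS).1.
rewrite E; split => //; rewrite EI.
apply: le_trans; first by apply: ler_sum => j _; exact: (block_near_j j p1 p2 pS).2.
rewrite -mulr_suml ler_wpM2r//.
have -> : \sum_(j < k.+1) G ^+ j * (M * (G ^+ k + (G ^+ 2) ^+ k * q ^+ j)) =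
   M * (G ^+ k * \sum_(j < k.+1) G ^+ j + (G ^+ 2) ^+ k * \sum_(j < k.+1) (G * q) ^+ j).
  rewrite (eq_bigr (fun j : 'I_k.+1 => M * G ^+ k * G ^+ j + M * (G ^+ 2) ^+ k * (G * q) ^+ j)).
    by rewrite big_split /= -!mulr_sumr mulrDr !mulrA.
  move=> j _; rewrite [(G * q) ^+ j]exprMn.
  by move: (G ^+ j) (G ^+ k) ((G ^+ 2) ^+ k) (q ^+ j) => *; ring.
rewrite /Cnear -mulrA ler_pM2l// mulrDl; apply: lerD.
  have h := sum_geometric_ge k G1.
  apply: (@le_trans _ _ (G ^+ k * (G ^+ k / (1 - G^-1)))).
    by rewrite ler_pM2l// exprn_gt0.
  by rewrite mulrA -expr2 exprAC mulrC.
rewrite mulrC ler_pM2r; last by rewrite exprn_gt0// exprn_gt0.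
by apply: sum_geometric_le; case/andP: Gq => /ltW -> ->.
Qed.

(** [8 = 4 * 2]: on frequencies below 1, Cauchy-Schwarz gives a pointwise bound with constant 4, and
    [B] has measure at most 2. *)
Let low_bound p : L2 p ->
  Rint (fun x => \1_B x * osc_sqr a tau (fun xi => \1_(dball 0) xi * p xi) x) <=
  8 * Rint (fun xi => \1_(dball 0) xi * p xi ^+ 2).
Proof.
move=> p2; set g := fun xi => \1_(dball 0) xi * p xi; have g1 : L1 g by exact: L1_dball.
have g2 : L2 g by apply: L2_indicM => //; exact: measurable_dball.
have Lu : L1 (\1_(`[- 1, 1]%classic) : R -> R).
  by apply: L1_indic => //; rewrite lebesgue_measure_itv; case: ifP => // _; rewrite -EFinB ltry.
have u2 : L2 (\1_(`[- 1, 1]%classic) : R -> R).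
  split; first exact: L1_measurable.
  by under eq_fun do rewrite indic_sqr.
have Iu : Rint (fun x => (\1_(`[- 1, 1]%classic) x : R) ^+ 2) = 2.
  under eq_Rint do rewrite indic_sqr.
  by rewrite Rint_indic1// lebesgue_measure_itv /= lte_fin gtrN//; rewrite -EFinB /= opprK.
have n2 : L2 (fun xi => `|g xi|).
  by apply: L2_le g2 _ => [|x]; [apply: measurable_norm; exact: L1_measurable|rewrite normr_id].
have cs : Rint (fun xi => `|g xi|) ^+ 2 <= 2 * Rint (fun xi => g xi ^+ 2).
  have := cauchy_schwarz n2 u2; rewrite Iu mulrC.
  have -> : Rint (fun xi => `|g xi| * \1_(`[- 1, 1]%classic) xi) = Rint (fun xi => `|g xi|).
    apply: eq_Rint => xi; rewrite /g normrM (ger0_norm (indic_ge0' _ _)) dball_itv expr0.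
    by rewrite mulrAC -(mulrA (\1_(dball 0) xi)) -expr2 indic_sqr.
  have -> : Rint (fun xi => `|g xi| ^+ 2) = Rint (fun xi => g xi ^+ 2).
    by apply: eq_Rint => xi; rewrite real_normK// num_real.
  by [].
have -> : Rint (fun xi => \1_(dball 0) xi * p xi ^+ 2) = Rint (fun xi => g xi ^+ 2).
  by apply: eq_Rint => xi; rewrite /g exprMn indic_sqr.
have LL := L1_osc_sqr g1.
have le x : \1_B x * osc_sqr a tau g x <= \1_B x * (4 * Rint (fun xi => g xi ^+ 2)).
  apply: ler_wpM2l; first exact: indic_ge0'.
  apply: le_trans (osc_sqr_le a x mt g1) _; lra.
apply: le_trans (le_Rint LL (L1Zr _ LB) le) _; rewrite RintZr// Rint_indic1//.
have I0 : 0 <= Rint (fun xi => g xi ^+ 2) by apply: Rint_ge0 => x; exact: sqr_ge0.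
have b2 : fine (mu B) <= 2.
  by rewrite -lee_fin fineK ?diam_le1_measure_le// ge0_fin_numE//; exact: diam_le1_fin_meas.
have -> : 8 * Rint (fun xi => g xi ^+ 2) = 2 * (4 * Rint (fun xi => g xi ^+ 2)) by ring.
by rewrite ler_wpM2r// mulr_ge0.
Qed.

Variable A : R.
Hypotheses (A0 : 0 < A) (HA : forall K y, 0 <= y ->
  \sum_(k < K) (bweight k (y * D ^+ k))^-1 <= A).

Let piece p k xi := \1_(dshell k) xi * p xi.

Let osc_pieces p K x : L2 p ->
  oscc (phase a tau) (fun xi => \1_(dball K) xi * p xi) x =
    oscc (phase a tau) (fun xi => \1_(dball 0) xi * p xi) x +
    \sum_(k < K) oscc (phase a tau) (piece p k) x /\
  oscs (phase a tau) (fun xi => \1_(dball K) xi * p xi) x =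
    oscs (phase a tau) (fun xi => \1_(dball 0) xi * p xi) x +
    \sum_(k < K) oscs (phase a tau) (piece p k) x.
Proof.
move=> p2; have mP := measurable_phase2 a mt.
elim: K => [|K [IH1 IH2]]; first by rewrite !big_ord0 !addr0.
have E : (fun xi => \1_(dball K.+1) xi * p xi) =
    (fun xi => \1_(dball K) xi * p xi + piece p K xi).
  by apply/funext => xi; rewrite indic_dballS mulrDl.
have L := L1_dball K p2; have L' := L1_dshell K p2.
by rewrite E (osccD mP x L L') (oscsD mP x L L') IH1 IH2 !big_ord_recr /= !addrA.
Qed.

(** Weighted Cauchy-Schwarz at the point [x], with weights taken at the selected time [tau x]; [A]
    bounds the sum of their reciprocals. *)
Let osc_sqr_pieces p K x : L2 p ->
  osc_sqr a tau (fun xi => \1_(dball K) xi * p xi) x <=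
  2 * osc_sqr a tau (fun xi => \1_(dball 0) xi * p xi) x +
  2 * A * \sum_(k < K) (far_weight k x * osc_sqr a tau (piece p k) x +
    near_weight k x * osc_sqr a tau (piece p k) x).
Proof.
move=> p2; have [E1 E2] := osc_pieces K x p2; rewrite {1}/osc_sqr E1 E2.
pose w (k : 'I_K) := bweight k (tau x * D ^+ k).
have w0 (k : 'I_K) : 0 < w k by apply: lt_le_trans (bweight_ge1 _ _).
have cs (v : 'I_K -> R) : (\sum_(k < K) v k) ^+ 2 <= A * \sum_(k < K) w k * v k ^+ 2.
  have := @weighted_cauchy_schwarz R _ (index_enum 'I_K) xpredT w v (fun (k : 'I_K) _ => w0 k).
  move=> /le_trans; apply; apply: ler_wpM2r; last by apply: HA.
  by apply: sumr_ge0 => k _; rewrite mulr_ge0 ?sqr_ge0// ltW.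
have c1 := cs (fun k : 'I_K => oscc (phase a tau) (piece p k) x).
have c2 := cs (fun k : 'I_K => oscs (phase a tau) (piece p k) x).
have ES : \sum_(k < K) (far_weight k x * osc_sqr a tau (piece p k) x +
    near_weight k x * osc_sqr a tau (piece p k) x) =
    \sum_(k < K) w k * oscc (phase a tau) (piece p k) x ^+ 2 +
    \sum_(k < K) w k * oscs (phase a tau) (piece p k) x ^+ 2.
  rewrite -big_split /=; apply: eq_bigr => k _.
  by rewrite -mulrDl -mulrDr.
rewrite ES /osc_sqr.
move: c1 c2; set S1 := \sum_(k < K) _; set S2 := \sum_(k < K) _; set S3 := \sum_(k < K) _.
set S4 := \sum_(k < K) _; move: (oscc _ _ x) (oscs _ _ x) S1 S2 S3 S4 => u v U W V Z c1 c2.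
have := sqr_ge0 (u - U); have := sqr_ge0 (v - V); have := sqr_ge0 (v - Z); have := sqr_ge0 (v - W); nra.
Qed.

Lemma maximal_bound_selected p K : L2 p ->
  L1 (fun xi => \1_(dball K) xi * (sweight s xi * p xi ^+ 2)) ->
  Rint (fun x => \1_B x * osc_sqr a tau (fun xi => \1_(dball K) xi * p xi) x) <=
  (16 + 2 * A * (8 * pi * c + Cnear)) *
    Rint (fun xi => \1_(dball K) xi * (sweight s xi * p xi ^+ 2)).
Proof.
move=> p2 Lw; have mp := p2.1.
have q1 k : L1 (piece p k) by exact: L1_dshell.
have q2 k : L2 (piece p k) by apply: L2_indicM => //; exact: measurable_dshell.
have qS k xi : piece p k xi != 0 -> shell (2 ^+ k) xi.
  rewrite /piece indic_dshell /shell /=; case: ifP => [/andP[h1 h2] _|_]; last by rewrite mul0r eqxx.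
  by rewrite h1 -exprS ltW.
pose Ik k := Rint (fun xi => piece p k xi ^+ 2).
have Ik0 k : 0 <= Ik k by apply: Rint_ge0 => x; exact: sqr_ge0.
have far k := block_far k (q1 k) (q2 k); have near k := block_near (q1 k) (q2 k) (@qS k).
pose Cp := 8 * pi * c + Cnear.
have Lk k : L1 (fun x => \1_B x * (far_weight k x * osc_sqr a tau (piece p k) x) +
    \1_B x * (near_weight k x * osc_sqr a tau (piece p k) x)).
  by apply: L1D; [exact: (far k).1|exact: (near k).1].
have Bk k : Rint (fun x => \1_B x * (far_weight k x * osc_sqr a tau (piece p k) x) +
    \1_B x * (near_weight k x * osc_sqr a tau (piece p k) x)) <= Cp * ((G ^+ 2) ^+ k * Ik k).
  rewrite RintD; [|exact: (far k).1|exact: (near k).1].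
  by rewrite mulrA /Cp mulrDl mulrDl; apply: lerD; [exact: (far k).2|exact: (near k).2].
have [|LS ES] := @Rint_sum R _ (index_enum 'I_K) xpredT (fun (k : 'I_K) x =>
    \1_B x * (far_weight k x * osc_sqr a tau (piece p k) x) +
    \1_B x * (near_weight k x * osc_sqr a tau (piece p k) x)).
  by move=> k _; exact: Lk.
have LK := L1_osc_sqr (L1_dball K p2); have L0 := L1_osc_sqr (L1_dball 0 p2).
have LR := L1D (L1Z 2 L0) (L1Z (2 * A) LS).
apply: le_trans (le_Rint LK LR _) _.
  move=> x; apply: le_trans (ler_wpM2l (indic_ge0' B x) (osc_sqr_pieces K x p2)) _.
  rewrite le_eqVlt; apply/orP; left; apply/eqP; rewrite mulrDr mulrCA; congr (_ + _).
  by rewrite mulrCA mulr_sumr; congr (_ * _); apply: eq_bigr => k _; rewrite mulrDr.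
rewrite RintD; [|exact: L1Z|exact: L1Z].
rewrite !RintZ// ES.
have low := low_bound p2.
have sum_le : \sum_(k < K) Rint (fun x => \1_B x * (far_weight k x * osc_sqr a tau (piece p k) x) +
    \1_B x * (near_weight k x * osc_sqr a tau (piece p k) x)) <=
    Cp * \sum_(k < K) (G ^+ 2) ^+ k * Ik k.
  by rewrite mulr_sumr; apply: ler_sum => k _; exact: Bk.
pose I0 := Rint (fun xi => \1_(dball 0) xi * p xi ^+ 2).
have I00 : 0 <= I0 by apply: Rint_ge0 => x; rewrite mulr_ge0 ?indic_ge0' ?sqr_ge0.
(* On each shell [(G ^+ 2) ^+ k] is at most the Sobolev weight, and the shells are disjoint. *)
have main : I0 + \sum_(k < K) (G ^+ 2) ^+ k * Ik k <=
    Rint (fun xi => \1_(dball K) xi * (sweight s xi * p xi ^+ 2)).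
  have mw : measurable_fun setT (fun x => sweight s x * p x ^+ 2).
    by apply: measurable_funM; [exact: measurable_sweight|exact: measurable_sqr].
  have w1 x : 1 <= sweight s x by apply: sweight_ge1; exact: ltW.
  have Lsub j : (j <= K)%N -> L1 (fun xi => \1_(dball j) xi * (sweight s xi * p xi ^+ 2)).
    move=> jK; apply: L1_le (L1_norm Lw) _; first exact: measurable_indicM (measurable_dball j) mw.
    move=> x; rewrite !normrM ler_wpM2r// !ger0_norm ?indic_ge0'// !indic_dball.
    case: ifP => [h|_]; last by case: ifP.
    by rewrite (lt_le_trans h)// ler_eXn2l// ltr1n.
  have : forall j, (j <= K)%N -> I0 + \sum_(k < j) (G ^+ 2) ^+ k * Ik k <=
    Rint (fun xi => \1_(dball j) xi * (sweight s xi * p xi ^+ 2)); last by apply.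
  elim=> [|j IH] jK.
    rewrite big_ord0 addr0; apply: le_Rint; [|exact: Lsub|].
      have := L1_indicM (measurable_dball 0) p2.2; exact.
    by move=> x; apply: ler_wpM2l; [exact: indic_ge0'|rewrite ler_peMl ?sqr_ge0].
  rewrite Rint_sqr_indic_dballS//; last exact: Lsub.
  rewrite big_ord_recr addrA; apply: lerD; first by apply: IH; exact: ltnW.
  rewrite -RintZ; last exact: (q2 j).2.
  apply: le_Rint; [exact: L1Z (q2 j).2| |].
    have := L1B (Lsub _ jK) (Lsub _ (ltnW jK)).
    by under eq_fun do rewrite indic_dballS mulrDl addrC addKr.
  move=> x /=; have -> : piece p j x ^+ 2 = \1_(dshell j) x * p x ^+ 2.
    by rewrite /piece exprMn indic_sqr.
  rewrite mulrCA indic_dshell.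
  case: ifP => [/andP[h _]|_]; last by rewrite !mul0r.
  rewrite !mul1r; apply: ler_wpM2r; first exact: sqr_ge0.
  have -> : (G ^+ 2) ^+ j = ((2 ^+ j) ^+ 2) `^ s by rewrite powRX ?exprn_ge0// powRX// exprAC.
  have h2 : (2 ^+ j) ^+ 2 <= 1 + `|x| ^+ 2.
    by rewrite -[leLHS]add0r lerD// ler_pXn2r ?nnegrE ?exprn_ge0.
  apply: ge0_ler_powR; rewrite ?nnegrE//;
    solve [exact: ltW | exact: sqr_ge0 | exact: le_trans (sqr_ge0 _) h2].
set T := Rint (fun xi => \1_(dball K) xi * _) in main *.
set S := \sum_(k < K) (G ^+ 2) ^+ k * Ik k in sum_le main *.
have S0 : 0 <= S by apply: sumr_ge0 => k _; rewrite mulr_ge0// exprn_ge0// sqr_ge0.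
have AC : 0 <= 2 * A * Cp.
  rewrite mulr_ge0 ?(ltW A0)// ?mulr_ge0 ?(ltW A0)//.
  case/andP: Gq => _ Gq1; have h1 : 0 <= 1 - G^-1 by rewrite subr_ge0 invf_le1// ltW.
  rewrite addr_ge0// ?mulr_ge0 ?pi_ge0 ?(ltW c0) ?(ltW M0)// addr_ge0 ?invr_ge0//.
  by rewrite subr_ge0 ltW.
rewrite -/Cp; apply: (@le_trans _ _ (2 * (8 * I0) + 2 * A * (Cp * S))).
  apply: lerD; first by rewrite ler_pM2l.
  by apply: ler_wpM2l => //; rewrite mulr_ge0// ltW.
apply: (@le_trans _ _ ((16 + 2 * A * Cp) * (I0 + S))); last first.
  by apply: ler_wpM2l => //; rewrite addr_ge0.
move: AC; rewrite mulrA (mulrA (2 * A)); move: (2 * A * Cp) => Z Z0.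
have := mulr_ge0 Z0 I00; rewrite mulrDl !mulrDr; lra.
Qed.

End Selected_times.

End Maximal_bound.

(** * Running maxima and measurable selection of times *)

Section Running_maximum.
Local Open Scope complex_scope.
Context {R : realType}.
Implicit Types (u : nat -> R) (t : nat -> R) (p : R -> R).

Fixpoint running_max u N : R :=
  if N is M.+1 then Num.max (running_max u M) (u N) else u 0.

Lemma running_max_ge u N n : (n <= N)%N -> u n <= running_max u N.
Proof.
elim: N => [|N IH] /=; first by rewrite leqn0 => /eqP ->.
rewrite leq_eqVlt ltnS => /predU1P[->|/IH h]; rewrite le_max ?lexx ?orbT//.
by rewrite h.
Qed.

Lemma running_max_attained u N : exists2 n, (n <= N)%N & running_max u N = u n.
Proof.
elim: N => [|N [n nN E]] /=; first by exists 0.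
have [h|h] := leP (running_max u N) (u N.+1); first by exists N.+1.
by exists n => //; exact: leqW.
Qed.

Lemma running_maxS u N : running_max u N <= running_max u N.+1.
Proof. by rewrite /= le_max lexx. Qed.

Lemma measurable_running_max d (T : measurableType d) (f : nat -> T -> R) N :
  (forall n, measurable_fun setT (f n)) ->
  measurable_fun setT (fun x => running_max (f ^~ x) N).
Proof.
by move=> mf; elim: N => [|N IH] //=; exact: (measurable_maxr IH (mf N.+1)).
Qed.

(** A measurable choice of the time at which the modulus is largest among the first [N + 1]; it
    linearises the supremum. *)
Fixpoint best_time a t p N (x : R) : R :=
  if N is M.+1 then
    if osc_sqr a (fun=> best_time a t p M x) p x < osc_sqr a (fun=> t N) p x then t N
    else best_time a t p M x
  else t 0.

Lemma measurable_best_time a t p N : L1 p -> measurable_fun setT (best_time a t p N).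
Proof.
move=> p1; elim: N => [|N IH] /=; first exact: measurable_cst.
apply: measurable_fun_ifT => //; apply: measurable_fun_ltr.
  exact: (@measurable_osc_sqr R a (best_time a t p N) p IH p1).
exact: measurable_osc_sqr.
Qed.

Lemma best_time_range a t p N x : exists2 n, (n <= N)%N & best_time a t p N x = t n.
Proof.
elim: N => [|N [n nN E]] /=; first by exists 0.
by case: ifP => _; [exists N.+1|exists n => //; exact: leqW].
Qed.

Lemma best_time_max a t p N n x : (n <= N)%N ->
  osc_sqr a (fun=> t n) p x <= osc_sqr a (best_time a t p N) p x.
Proof.
have E K : osc_sqr a (best_time a t p K) p x = osc_sqr a (fun=> best_time a t p K x) p x by [].
rewrite E; elim: N => [|N IH] /=; first by rewrite leqn0 => /eqP ->.
rewrite leq_eqVlt ltnS => /predU1P[->|/IH h].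
  by case: ltP => // h; exact: lexx.
by case: ltP => // h'; exact: le_trans h (ltW h').
Qed.

End Running_maximum.

(** * From linearised real amplitudes to complex data *)

Section Maximal_inequality.
Local Open Scope complex_scope.
Context {R : realType}.
Local Notation mu := (@lebesgue_measure R).
Local Notation C := R[i].
Local Notation Re := (@complex.Re R).
Local Notation Im := (@complex.Im R).
Local Notation normc := (@Normc.normc R).
Implicit Types (G H : R -> C) (p q : R -> R) (B : set R) (K N n : nat).

Lemma maximal_bound (a s c : R) (t : nat -> R) :
  0 < a -> a != 1 -> 0 < s -> s < a / 4 -> s < 1 / 4 ->
  (forall n, 0 <= t n) -> (forall n, n.+1%:R * t n `^ (2 * s / (a - 4 * s)) <= c) -> 0 < c ->
  exists2 Cm : R, 0 <= Cm & forall N tau B p K, measurable_fun setT tau ->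
    (forall x, exists2 n, (n <= N)%N & tau x = t n) -> measurable B -> diam_le1 B ->
    L2 p -> L1 (fun xi => sweight s xi * p xi ^+ 2) ->
    Rint (fun x => \1_B x * osc_sqr a tau (fun xi => \1_(dball K) xi * p xi) x) <=
    Cm * Rint (fun xi => sweight s xi * p xi ^+ 2).
Proof.
move=> a0 a1 s0 sa s4 t0 tw c0.
have [M M0 HM] := block_bound a0 a1 s0.
have [A A0 HA] := sum_inv_bweight s0 sa.
pose Cm := 16 + 2 * A * (8 * pi * c + M * ((1 - (2 `^ s)^-1)^-1 + (1 - 2 `^ s * Num.sqrt 2^-1)^-1)).
(* The absolute value makes the constant nonnegative without looking into its formula. *)
exists `|Cm| => // N tau B p K mt tN mB dB p2 Lw.
have mw : measurable_fun setT (fun xi => sweight s xi * p xi ^+ 2) by exact: L1_measurable.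
have LK : L1 (fun xi => \1_(dball K) xi * (sweight s xi * p xi ^+ 2)).
  by apply: L1_indicM => //; exact: measurable_dball.
have w0 xi : 0 <= sweight s xi * p xi ^+ 2 by rewrite mulr_ge0 ?powR_ge0 ?sqr_ge0.
have HM' : forall l b B p, 1 <= l -> 0 < b -> measurable B ->
  (forall x, B x -> 0 <= tau x <= b) -> diam_le1 B ->
  L1 p -> L2 p -> (forall xi, p xi != 0 -> shell l xi) ->
  Rint (fun x => \1_B x * osc_sqr a tau p x) <=
  M * (l `^ s + Num.sqrt (l `^ a * b)) * Rint (fun xi => p xi ^+ 2).
  by move=> l b B' p' l1 b0 mB' h1 h2 h3 h4 h5; exact: HM.
have := maximal_bound_selected s0 sa s4 t0 tw c0 mt tN mB dB M0 HM' A0 HA p2 LK.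
rewrite -/Cm => /le_trans; apply.
have I0 : 0 <= Rint (fun xi => \1_(dball K) xi * (sweight s xi * p xi ^+ 2)).
  by apply: Rint_ge0 => x; rewrite mulr_ge0 ?indic_ge0'.
apply: le_trans (ler_wpM2r I0 (ler_norm _)) _.
apply: ler_wpM2l => //; apply: le_Rint => // x.
by rewrite ler_piMl ?indic_le1.
Qed.

(** Below frequency [2^K] the evolution is an absolutely convergent integral, to which the
    linearised bound applies; the remainder [tail] is small in L2. *)
Definition truncate K G : R -> C := fun xi =>
  (\1_(dball K) xi * Re (G xi)) +i* (\1_(dball K) xi * Im (G xi)).
Definition tail K G : R -> C := fun xi =>
  ((1 - \1_(dball K) xi) * Re (G xi)) +i* ((1 - \1_(dball K) xi) * Im (G xi)).

Lemma truncate_tail K G xi : truncate K G xi + tail K G xi = G xi.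
Proof. by apply: complex_ext => /=; ring. Qed.

Lemma cL1_truncate K G : cL2 G -> cL1 (truncate K G).
Proof. by move=> [G1 G2]; split; exact: L1_dball. Qed.

Lemma cL2_truncate K G : cL2 G -> cL2 (truncate K G).
Proof. by move=> [G1 G2]; split; apply: L2_indicM => //; exact: measurable_dball. Qed.

Lemma L2_tail K p : L2 p -> L2 (fun xi => (1 - \1_(dball K) xi) * p xi).
Proof.
move=> p2; have := L2B p2 (L2_indicM (measurable_dball K) p2).
by under eq_fun do rewrite -[X in X - _]mul1r -mulrBl.
Qed.

Lemma cL2_tail K G : cL2 G -> cL2 (tail K G).
Proof. by move=> [G1 G2]; split; exact: L2_tail. Qed.

(** The dyadic ball contains [[-K, K]] since [2^K > K], so [tail_cvg0] controls its complement. *)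
Lemma tail_energy_small p (e : R) : L1 p -> (forall x, 0 <= p x) -> 0 < e ->
  exists K0, forall K, (K0 <= K)%N -> Rint (fun x => (1 - \1_(dball K) x) * p x) <= e.
Proof.
move=> p1 p0 e0; have /cvgrPdist_lt/(_ _ e0) [K0 _ HK] := tail_cvg0 p1.
exists K0 => K KK; have := HK K KK; rewrite sub0r normrN => h.
apply: (@le_trans _ _ (Rint (fun x => (1 - \1_(`[- K%:R, K%:R]%classic) x) * p x))); last first.
  exact: le_trans (ler_norm _) (ltW h).
have E (A : set R) : (fun x => (1 - \1_A x) * p x) = (fun x => p x - \1_A x * p x).
  by apply/funext => x; rewrite mulrBl mul1r.
apply: le_Rint.
- by rewrite E; apply: L1B => //; apply: L1_indicM => //; exact: measurable_dball.
- by rewrite E; apply: L1B => //; exact: L1_indicM.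
move=> x; apply: ler_wpM2r => //; rewrite lerD2l lerN2 indicE.
case: (boolP (x \in _)) => [|_]; last exact: indic_ge0'.
rewrite inE/= in_itv/= -ler_norml => xK; rewrite indic_dball ifT//.
by rewrite (le_lt_trans xK)// -natrX ltr_nat ltn_expl.
Qed.

Lemma tail_energy G (e : R) : cL2 G -> 0 < e ->
  exists K0, forall K, (K0 <= K)%N -> energy (tail K G) <= e.
Proof.
move=> [G1 G2] e0; have e2 : 0 < e / 2 by rewrite divr_gt0.
have [K1 H1] := tail_energy_small G1.2 (fun x => sqr_ge0 _) e2.
have [K2 H2] := tail_energy_small G2.2 (fun x => sqr_ge0 _) e2.
exists (maxn K1 K2) => K; rewrite geq_max => /andP[k1 k2].
have sq (x : R) : (1 - \1_(dball K) x) ^+ 2 = 1 - \1_(dball K) x :> R.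
  by rewrite indic_dball; case: ifP => _; rewrite ?subrr ?subr0 ?expr0n ?expr1n.
rewrite /energy /= [leRHS](splitr e); apply: lerD.
  by under eq_Rint do rewrite exprMn sq; exact: H1.
by under eq_Rint do rewrite exprMn sq; exact: H2.
Qed.

Lemma normc_ifourier_evolve (a t : R) G x : cL1 G ->
  let P := phase a (fun=> t) in
  normc (ifourier (evolve a t G) x) ^+ 2 = (2 * pi)^-1 ^+ 2 *
   ((oscc P (fun xi => Re (G xi)) x - oscs P (fun xi => Im (G xi)) x) ^+ 2 +
    (oscs P (fun xi => Re (G xi)) x + oscc P (fun xi => Im (G xi)) x) ^+ 2).
Proof.
move=> cG P; have [G1 G2] := cG; have [E1 E2] := cL1_evolve a t cG.
rewrite ifourierE// normc_sqr /=.
pose th (xi : R) := t * `|xi| `^ a.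
have mP := @measurable_phase2 R a (fun=> t) (measurable_cst _); rewrite -/P in mP.
have e1 : cosT (fun y => Re (evolve a t G y)) x - sinT (fun y => Im (evolve a t G y)) x =
    oscc P (fun xi => Re (G xi)) x - oscs P (fun xi => Im (G xi)) x.
  rewrite /cosT /sinT /oscc /oscs -!RintB; first last.
  - exact: L1_sinT.
  - exact: L1_cosT.
  - exact: (L1_oscs mP G2).
  - exact: (L1_oscc mP G1).
  by apply: eq_Rint => xi; rewrite cReM cImM /= /P /phase -/(th xi) cosD sinD; ring.
have e2 : sinT (fun y => Re (evolve a t G y)) x + cosT (fun y => Im (evolve a t G y)) x =
    oscs P (fun xi => Re (G xi)) x + oscc P (fun xi => Im (G xi)) x.
  rewrite /cosT /sinT /oscc /oscs -!RintD; first last.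
  - exact: L1_cosT.
  - exact: L1_sinT.
  - exact: (L1_oscc mP G2).
  - exact: (L1_oscs mP G1).
  by apply: eq_Rint => xi; rewrite cReM cImM /= /P /phase -/(th xi) cosD sinD; ring.
by rewrite e1 e2 !exprMn -mulrDr.
Qed.

(** [(2 pi)^(-2) <= 1/2] absorbs the factor 2 from the squares of the two sums. *)
Lemma normc_ifourier_evolve_le (a t : R) G x : cL1 G ->
  normc (ifourier (evolve a t G) x) ^+ 2 <=
  osc_sqr a (fun=> t) (fun xi => Re (G xi)) x + osc_sqr a (fun=> t) (fun xi => Im (G xi)) x.
Proof.
move=> cG; rewrite normc_ifourier_evolve// /osc_sqr.
have pi2 := pi_ge2 R; have i0 : (0 : R) <= (2 * (pi : R))^-1 ^+ 2 <= 2^-1.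
  rewrite sqr_ge0 /= exprVn lef_pV2 ?posrE ?exprn_gt0 ?mulr_gt0//; last exact: lt_le_trans pi2.
  nra.
move: (oscc _ _ x) (oscs _ _ x) (oscc _ _ x) (oscs _ _ x) ((2 * pi)^-1 ^+ 2) i0 => u v w z k /andP[k0 k1].
have := sqr_ge0 (w + z); have := sqr_ge0 (v - u); have := sqr_ge0 (w - z); have := sqr_ge0 (v + u).
move=> h1 h2 h3 h4; apply: (@le_trans _ _ (2^-1 * ((w - z) ^+ 2 + (v + u) ^+ 2))).
  by apply: ler_wpM2r => //; rewrite addr_ge0.
nra.
Qed.

Lemma normc_sqrD_le (z w : C) : normc (z + w) ^+ 2 <= 2 * normc z ^+ 2 + 2 * normc w ^+ 2.
Proof.
rewrite !normc_sqr cReD cImD.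
by have := sqr_ge0 (Re z - Re w); have := sqr_ge0 (Im z - Im w); nra.
Qed.

Lemma ae_le_Rint p q : L1 p -> L1 q -> {ae mu, forall x, p x <= q x} -> Rint p <= Rint q.
Proof.
move=> Lp Lq pq; have mp := L1_measurable Lp; have mq := L1_measurable Lq.
have mm : measurable_fun setT (fun x => Num.max (p x) (q x)) by exact: measurable_maxr.
have -> : Rint q = Rint (fun x => Num.max (p x) (q x)).
  by apply: ae_eq_Rint => //; apply: ae_imp pq => x h; rewrite max_r.
apply: le_Rint => // [|x]; last by rewrite le_max lexx.
apply: L1_le (L1D (L1_norm Lp) (L1_norm Lq)) _ => // x.
by have [_|_] := leP (p x) (q x); [rewrite lerDr|rewrite lerDl].
Qed.

Lemma senergyE s G : sL2 s G ->
  [/\ L1 (fun x => sweight s x * Re (G x) ^+ 2), L1 (fun x => sweight s x * Im (G x) ^+ 2) &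
   Rint (fun x => sweight s x * Re (G x) ^+ 2) + Rint (fun x => sweight s x * Im (G x) ^+ 2) =
   senergy s G].
Proof.
move=> [[m1 m2] L]; have ms := @measurable_sweight R s.
have w0 x : 0 <= sweight s x :> R by exact: powR_ge0.
have L1' : L1 (fun x => sweight s x * Re (G x) ^+ 2).
  apply: L1_le L _; first by apply: measurable_funM => //; exact: measurable_sqr.
  move=> x; rewrite ger0_norm; last by rewrite mulr_ge0// sqr_ge0.
  by apply: ler_wpM2l => //; rewrite normc_sqr lerDl sqr_ge0.
have L2' : L1 (fun x => sweight s x * Im (G x) ^+ 2).
  apply: L1_le L _; first by apply: measurable_funM => //; exact: measurable_sqr.
  move=> x; rewrite ger0_norm; last by rewrite mulr_ge0// sqr_ge0.
  by apply: ler_wpM2l => //; rewrite normc_sqr lerDr sqr_ge0.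
split => //; rewrite -RintD//; apply: eq_Rint => x.
by rewrite normc_sqr mulrDr.
Qed.

Definition schr_sqr a (t : nat -> R) G n x := normc (ifourier2 (evolve a (t n) G) x) ^+ 2.

Lemma L1_schr_sqr a t G n : cL2 G -> L1 (schr_sqr a t G n) /\ Rint (schr_sqr a t G n) <= energy G.
Proof.
move=> LG; have [LI EI _] := ifourier2_L2 (cL2_evolve a (t n) LG).
by have [L <-] := energy_normc LI; split => //; rewrite -(energy_evolve a (t n) LG).
Qed.

(** The constant is independent of [N] although the tail is bounded by summing over all [N + 1]
    times, because the cut-off [K] may depend on [N]. The real and the imaginary part of the data
    have their times selected separately. *)
Lemma finite_maximal_bound (a s c : R) (t : nat -> R) :
  0 < a -> a != 1 -> 0 < s -> s < a / 4 -> s < 1 / 4 ->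
  (forall n, 0 <= t n) -> (forall n, n.+1%:R * t n `^ (2 * s / (a - 4 * s)) <= c) -> 0 < c ->
  exists2 Cm : R, 0 <= Cm & forall N B G, measurable B -> diam_le1 B -> sL2 s G ->
    L1 (fun x => \1_B x * running_max (fun n => schr_sqr a t G n x) N) /\
    Rint (fun x => \1_B x * running_max (fun n => schr_sqr a t G n x) N) <= Cm * senergy s G.
Proof.
move=> a0 a1 s0 sa s4 t0 tw c0.
have [Cm Cm0 HC] := maximal_bound a0 a1 s0 sa s4 t0 tw c0.
exists (2 * Cm); first by rewrite mulr_ge0.
move=> N B G mB dB LG; have cG := sL2_cL2 (ltW s0) LG.
have U n := L1_schr_sqr a t n cG.
have u0 n x : 0 <= schr_sqr a t G n x by exact: sqr_ge0.
set F := fun x => \1_B x * running_max (fun n => schr_sqr a t G n x) N.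
have mF : measurable_fun setT F.
  apply: measurable_indicM => //; apply: (@measurable_running_max R _ _ (schr_sqr a t G)) => n.
  exact: L1_measurable (U n).1.
have r0 x : 0 <= running_max (fun n => schr_sqr a t G n x) N.
  by have [n _ ->] := running_max_attained (fun n => schr_sqr a t G n x) N.
have F0 x : 0 <= F x by rewrite mulr_ge0 ?indic_ge0'.
have [|LS _] := @Rint_sum R _ (index_enum 'I_N.+1) xpredT (fun n : 'I_N.+1 => schr_sqr a t G n).
  by move=> n _; exact: (U n).1.
have LF : L1 F.
  apply: L1_le LS _ => // x; rewrite ger0_norm//.
  apply: le_trans (_ : running_max (fun n => schr_sqr a t G n x) N <= _); first by rewrite ler_piMl ?indic_le1.
  have [n nN ->] := running_max_attained (fun n => schr_sqr a t G n x) N.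
  have nN' : (n < N.+1)%N by rewrite ltnS.
  by rewrite (bigD1 (Ordinal nN')) //= lerDl; apply: sumr_ge0.
split => //; apply/ler_addgt0Pr => e e0.
(* The tail enters once for each time, and with a factor 2 from the square of a sum. *)
have e1 : 0 < e / (2 * N.+1%:R) by rewrite divr_gt0// mulr_gt0// ltr0n.
have [K HK] := tail_energy cG e1; have {HK} HK := HK K (leqnn K).
have cT := cL2_tail K cG; have c1T := cL1_truncate K cG; have c2T := cL2_truncate K cG.
have [Lp Lq ET] := senergyE LG.
pose p xi := Re (G xi); pose q xi := Im (G xi).
pose pK xi := \1_(dball K) xi * p xi; pose qK xi := \1_(dball K) xi * q xi.
have p1 : L1 pK := c1T.1; have q1 : L1 qK := c1T.2.
pose tp := best_time a t pK N; pose tq := best_time a t qK N.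
have mtp : measurable_fun setT tp by exact: measurable_best_time.
have mtq : measurable_fun setT tq by exact: measurable_best_time.
have V n := L1_schr_sqr a t n cT.
have [|LV EV] := @Rint_sum R _ (index_enum 'I_N.+1) xpredT (fun n : 'I_N.+1 => schr_sqr a t (tail K G) n).
  by move=> n _; exact: (V n).1.
have bnd u tau : L1 u -> measurable_fun setT tau -> L1 (fun x => \1_B x * osc_sqr a tau u x).
  move=> u1 mt; have LB : L1 (\1_B : R -> R) by apply: L1_indic => //; exact: diam_le1_fin_meas.
  apply: L1_le (L1Zr (2 * Rint (fun xi => `|u xi|) ^+ 2) LB) _.
    by apply: measurable_indicM => //; exact: measurable_osc_sqr.
  move=> x; rewrite ger0_norm ?mulr_ge0 ?indic_ge0' ?osc_sqr_ge0//.
  by apply: ler_wpM2l; [exact: indic_ge0'|exact: osc_sqr_le].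
have LP := bnd _ _ p1 mtp; have LQ := bnd _ _ q1 mtq.
have LR := L1D (L1Z 2 (L1D LP LQ)) (L1Z 2 LV).
have split_ae n : {ae mu, forall x, schr_sqr a t G n x <=
    2 * (osc_sqr a (fun=> t n) pK x + osc_sqr a (fun=> t n) qK x) + 2 * schr_sqr a t (tail K G) n x}.
  have E : evolve a (t n) G = fun xi => evolve a (t n) (truncate K G) xi + evolve a (t n) (tail K G) xi.
    by apply/funext => xi; rewrite /evolve -mulrDr truncate_tail.
  have h1 := ifourier2D (cL2_evolve a (t n) c2T) (cL2_evolve a (t n) cT); rewrite -E in h1.
  have h2 := ifourier2_ifourier (cL1_evolve a (t n) c1T) (cL2_evolve a (t n) c2T).
  apply: ae_imp (ae_and h1 h2) => x [e3 e4]; rewrite /schr_sqr e3 e4.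
  apply: le_trans (normc_sqrD_le _ _) _; rewrite lerD2r ler_pM2l//.
  exact: normc_ifourier_evolve_le.
have main : Rint F <= Rint (fun x => 2 * (\1_B x * osc_sqr a tp pK x + \1_B x * osc_sqr a tq qK x) +
    2 * \sum_(n < N.+1) schr_sqr a t (tail K G) n x).
  apply: ae_le_Rint => //; apply: ae_imp (ae_forall split_ae) => x hx.
  have [n nN E] := running_max_attained (fun n => schr_sqr a t G n x) N.
  rewrite /F E; have nN' : (n < N.+1)%N by rewrite ltnS.
  have S0 : schr_sqr a t (tail K G) n x <= \sum_(n < N.+1) schr_sqr a t (tail K G) n x.
    by rewrite (bigD1 (Ordinal nN')) //= lerDl; apply: sumr_ge0 => i _; exact: sqr_ge0.
  have P1 := @best_time_max R a t pK N n x nN; have P2 := @best_time_max R a t qK N n x nN.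
  rewrite -/tp in P1; rewrite -/tq in P2; have h := hx n.
  apply: (@le_trans _ _ (\1_B x * (2 * (osc_sqr a tp pK x + osc_sqr a tq qK x) +
      2 * \sum_(n < N.+1) schr_sqr a t (tail K G) n x))).
    apply: ler_wpM2l; first exact: indic_ge0'.
    move: h P1 P2 S0; set z1 := schr_sqr _ _ _ _ _; set z2 := schr_sqr _ _ _ _ _.
    move: z1 z2 (osc_sqr _ _ _ _) (osc_sqr _ _ _ _) (osc_sqr _ _ _ _) (osc_sqr _ _ _ _).
    by move: (\sum_(n < N.+1) _) => *; lra.
  rewrite mulrDr mulrCA mulrDr lerD2l ler_piMl ?indic_le1// mulr_ge0//.
  by apply: sumr_ge0 => i _; exact: sqr_ge0.
apply: (le_trans main); rewrite RintD; [|by apply: L1Z; exact: L1D|exact: L1Z].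
rewrite !RintZ//; [|exact: L1D]; rewrite RintD// EV.
have b1 := HC N tp B p K mtp (fun x => best_time_range a t pK N x) mB dB cG.1 Lp.
have b2 := HC N tq B q K mtq (fun x => best_time_range a t qK N x) mB dB cG.2 Lq.
have b3 : \sum_(n < N.+1) Rint (schr_sqr a t (tail K G) n) <= N.+1%:R * (e / (2 * N.+1%:R)).
  apply: (@le_trans _ _ (\sum_(n < N.+1) (e / (2 * N.+1%:R)))).
    by apply: ler_sum => n _; exact: le_trans (V n).2 HK.
  by rewrite big_const_ord iter_addr_0 [leRHS]mulr_natl.
have b4 : N.+1%:R * (e / (2 * N.+1%:R)) = e / 2.
  have n0 : N.+1%:R != 0 :> R by rewrite pnatr_eq0.
  by move: (N.+1%:R) n0 => z z0; field.
rewrite b4 in b3; rewrite -ET.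
apply: (@le_trans _ _ (2 * (Cm * Rint (fun x => sweight s x * p x ^+ 2) +
   Cm * Rint (fun x => sweight s x * q x ^+ 2)) + 2 * (e / 2))).
  by apply: lerD; rewrite ler_pM2l//; exact: lerD.
rewrite /p /q; clear; move: (Rint _) (Rint _) => P Q; lra.
Qed.

End Maximal_inequality.

(** * Weak sequence spaces, strong and weak type bounds *)

Section Strong_type.
Local Open Scope complex_scope.
Context {R : realType}.
Local Notation mu := (@lebesgue_measure R).
Implicit Types (f : distribution_on R) (B : set R) (t : nat -> R) (a s : R).

(** The complement of [B] is null for the restricted measure, which agrees with Lebesgue measure
    inside [B]. *)
Lemma integral_mrestr B (mB : measurable B) (h : R -> \bar R) :
  measurable_fun setT h -> (forall x, 0 <= h x)%E ->
  (\int[mrestr mu mB]_x h x = \int[mu]_(x in B) h x)%E.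
Proof.
move=> mh h0; rewrite -[in LHS](setUv B).
rewrite (@ge0_integral_setU _ _ _ (mrestr mu mB) B (~` B) mB (measurableC mB) h); last 3 first.
- by rewrite setUv.
- by [].
- by rewrite disj_set2E setICr.
rewrite [X in (_ + X)%E](_ : _ = 0%E) ?adde0; last first.
  apply: null_set_integral; first exact: measurableC.
    exact: measurable_funTS.
  by rewrite -[LHS]/(mu (~` B `&` B)) setICl measure0.
by apply: eq_measure_integral => A mA AB; rewrite -[LHS]/(mu (A `&` B)) setIidl.
Qed.

(** For a decreasing sequence the level sets are initial segments, so counting them amounts to
    bounding single terms. *)
Lemma weak_ellP (r : R) t : 0 < r -> (forall n, 0 <= t n) ->
  (forall m n, (m <= n)%N -> t n <= t m) ->
  weak_ell r t <-> exists2 c : R, 0 < c & forall n, n.+1%:R * t n `^ r <= c.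
Proof.
move=> r0 t0 td; have countII n : counting `I_n = n%:R%:E :> \bar R.
  by rewrite /counting asboolT ?finite_II// (@card_fset_set _ _ n (card_eqxx _)).
split.
  rewrite /weak_ell; set S := ereal_sup _ => Sfin.
  have ub b : 0 < b -> ((b `^ r)%:E * counting [set n : nat | (b < `|t n|)%R] <= S)%E.
    by move=> b0; apply: ereal_sup_ubound; exists b.
  have S0 : (0 <= S)%E.
    by apply: le_trans (ub 1 ltr01); apply: mule_ge0 => //; rewrite lee_fin powR_ge0.
  have Sf : S \is a fin_num by rewrite ge0_fin_numE.
  have fS : 0 <= fine S by exact: fine_ge0.
  exists (fine S * 2 `^ r + 1); first by rewrite ltr_wpDl// mulr_ge0 ?powR_ge0.
  move=> n; have [tn|tn] := eqVneq (t n) 0.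
    by rewrite tn powR0 ?gt_eqF// mulr0 addr_ge0// mulr_ge0 ?powR_ge0.
  have tn0 : 0 < t n by rewrite lt_neqAle eq_sym tn t0.
  (* Half of [t n] makes the inequality strict for all indices up to [n]; the price is the factor
     [2^r]. *)
  have b0 : 0 < t n / 2 by rewrite divr_gt0.
  have cnt : (n.+1%:R%:E <= counting [set k : nat | (t n / 2 < `|t k|)%R] :> \bar R)%E.
    rewrite -countII; apply: le_measure; rewrite ?inE// => k /=; rewrite ltnS => kn.
    by rewrite ger0_norm//; apply: lt_le_trans (td _ _ kn); rewrite ltr_pdivrMr// ltr_pMr// ltr1n.
  have p0 : (0 <= ((t n / 2) `^ r)%:E)%E by rewrite lee_fin powR_ge0.
  have := le_trans (lee_wpmul2l p0 cnt) (ub _ b0).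
  rewrite -(fineK Sf) -EFinM lee_fin powRM ?invr_ge0// -powR_inv1// powRAC powR_inv1 ?powR_ge0//.
  rewrite mulrAC ler_pdivrMr ?powR_gt0// mulrC => h; apply: (le_trans h).
  by rewrite lerDl.
move=> [c c0 Hc]; apply: (@le_lt_trans _ _ c%:E); last exact: ltry.
apply: ge_ereal_sup => _ [b b0 <-]; have br : 0 < b `^ r by rewrite powR_gt0.
have sub : [set n : nat | (b < `|t n|)%R] `<=` `I_(Num.truncn (c / b `^ r)).
  move=> n /=; rewrite ger0_norm// => bt; have h := Hc n.
  rewrite Num.Theory.truncn_ge_nat; last by rewrite divr_ge0// ltW.
  rewrite ler_pdivlMr//; apply: le_trans h; rewrite ler_pM2l ?ltr0n//.
  by apply: ge0_ler_powR; rewrite ?nnegrE//; exact: ltW.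
have h : (counting [set n : nat | (b < `|t n|)%R] <= (c / b `^ r)%:E :> \bar R)%E.
  apply: (@le_trans _ _ (counting `I_(Num.truncn (c / b `^ r)))).
    by apply: le_measure; rewrite ?inE.
  by rewrite countII lee_fin Num.Theory.truncn_le// divr_ge0// ltW.
apply: (le_trans (lee_wpmul2l _ h)); first by rewrite lee_fin ltW.
by rewrite -EFinM lee_fin mulrC divfK// gt_eqF.
Qed.

Lemma schrodinger_maxE a t f x : schrodinger_max a t f x =
  ereal_sup (range (fun n => (Normc.normc (ifourier2 (evolve a (t n) (fhat f)) x))%:E)).
Proof. by []. Qed.

Lemma ereal_sup_running_max (u : nat -> R) :
  ereal_sup (range (fun N => (running_max u N)%:E)) = ereal_sup (range (fun n => (u n)%:E)).
Proof.
apply/eqP; rewrite eq_le; apply/andP; split; apply: ge_ereal_sup => _ [N _ <-].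
  by have [n _ ->] := running_max_attained u N; apply: ereal_sup_ubound; exists n.
apply: le_trans (_ : ((running_max u N)%:E <= _)%E); first by rewrite lee_fin running_max_ge.
by apply: ereal_sup_ubound; exists N.
Qed.

Lemma cvg_running_max (u : nat -> R) :
  (running_max u N)%:E @[N --> \oo] --> ereal_sup (range (fun n => (u n)%:E)).
Proof.
rewrite -ereal_sup_running_max; apply: ereal_nondecreasing_cvgn.
apply/nondecreasing_seqP => N; rewrite lee_fin; exact: running_maxS.
Qed.

(** The powers with exponents 2 and 1/2 are increasing and inverse to each other on nonnegative
    extended reals. *)
Lemma ereal_sup_sqr (u : nat -> R) : (forall n, 0 <= u n) ->
  (ereal_sup (range (fun n => (u n)%:E)) `^ 2 = ereal_sup (range (fun n => (u n ^+ 2)%:E)))%E.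
Proof.
move=> u0; have sq n : ((u n ^+ 2)%:E = (u n)%:E `^ 2)%E by rewrite poweR_EFin powR_mulrn.
set S := ereal_sup _; set T := ereal_sup _.
have S0 : (0 <= S)%E by apply: (@le_trans _ _ (u 0)%:E); rewrite ?lee_fin//; apply: ereal_sup_ubound; exists 0.
have T0 : (0 <= T)%E.
  by apply: (@le_trans _ _ (u 0 ^+ 2)%:E); rewrite ?lee_fin ?sqr_ge0//; apply: ereal_sup_ubound; exists 0.
apply/eqP; rewrite eq_le; apply/andP; split; last first.
  apply: ge_ereal_sup => _ [n _ <-]; rewrite sq; apply: gt0_ler_poweR => //.
  - by rewrite in_itv/= lee_fin u0 leey.
  - by rewrite in_itv/= S0 leey.
  - by apply: ereal_sup_ubound; exists n.
have h : (S <= T `^ 2^-1)%E.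
  apply: ge_ereal_sup => _ [n _ <-].
  have -> : ((u n)%:E = (u n ^+ 2)%:E `^ 2^-1)%E.
    by rewrite poweR_EFin powR12_sqrt ?sqr_ge0// sqrtr_sqr ger0_norm.
  apply: gt0_ler_poweR => //.
  - by rewrite in_itv/= lee_fin sqr_ge0 leey.
  - by rewrite in_itv/= T0 leey.
  - by apply: ereal_sup_ubound; exists n.
apply: (@le_trans _ _ ((T `^ 2^-1) `^ 2)%E).
  apply: gt0_ler_poweR => //.
  - by rewrite in_itv/= S0 leey.
  - by rewrite in_itv/= poweR_ge0 leey.
by rewrite -poweRrM mulVf// poweRe1.
Qed.

(** Monotone convergence in the number of times, the finite bound being uniform. *)
Lemma maximal_inequality a s (c : R) t :
  0 < a -> a != 1 -> 0 < s -> s < a / 4 -> s < 1 / 4 ->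
  (forall n, 0 <= t n) -> (forall n, n.+1%:R * t n `^ (2 * s / (a - 4 * s)) <= c) -> 0 < c ->
  exists2 Cm : R, 0 <= Cm & forall f B, sobolev s f -> measurable B -> diam_le1 B ->
    (\int[mu]_(x in B) (schrodinger_max a t f x `^ 2) <= (Cm * senergy s (fhat f))%:E)%E.
Proof.
move=> a0 a1 s0 sa s4 t0 tw c0.
have [Cm Cm0 HC] := finite_maximal_bound a0 a1 s0 sa s4 t0 tw c0.
exists Cm => // f B Sf mB dB; have [LG _ _] := sobolevP (ltW s0) Sf.
have cG := sL2_cL2 (ltW s0) LG.
pose g N x := (running_max (fun n => schr_sqr a t (fhat f) n x) N)%:E.
have g0 N x : (0 <= g N x)%E.
  by rewrite lee_fin; have [n _ ->] := running_max_attained (fun n => schr_sqr a t (fhat f) n x) N; exact: sqr_ge0.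
have mg N : measurable_fun setT (g N).
  apply: measurable_EFin; apply: (@measurable_running_max R _ _ (schr_sqr a t (fhat f))) => n.
  exact: L1_measurable (L1_schr_sqr a t n cG).1.
have nd x : {homo g ^~ x : n m / (n <= m)%N >-> (n <= m)%E}.
  by apply/nondecreasing_seqP => N; rewrite lee_fin; exact: running_maxS.
have E x : (schrodinger_max a t f x `^ 2 = limn (g ^~ x))%E.
  rewrite schrodinger_maxE ereal_sup_sqr; last by move=> n; exact: normc_ge0.
  transitivity (ereal_sup (range (fun n => (schr_sqr a t (fhat f) n x)%:E))) => //.
  by apply/esym; apply: (cvg_lim (@ereal_hausdorff R)); exact: cvg_running_max.
under eq_integral do rewrite E.
have -> := @monotone_convergence _ _ R mu B mB g (fun N => measurable_funTS (mg N))
  (fun N x _ => g0 N x) (fun x _ => nd x).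
apply: lime_le.
  apply: ereal_nondecreasing_is_cvgn => m n mn; apply: ge0_le_integral => //.
  - exact: (measurable_funTS (mg m)).
  - exact: (measurable_funTS (mg n)).
  - by move=> x _; exact: nd.
apply: nearW => N; have [LF IF] := HC N B (fhat f) mB dB LG.
rewrite integral_mkcond.
apply: le_trans (_ : ((Rint (fun x => \1_B x * running_max (fun n => schr_sqr a t (fhat f) n x) N))%:E <= _)%E);
  last by rewrite lee_fin.
rewrite -(RintE LF) le_eqVlt; apply/orP; left; apply/eqP; apply: eq_integral => x _.
by rewrite patchE indicE; case: ifP => _; rewrite ?mul1r ?mul0r.
Qed.

Lemma strong_of_integral a s t (Cm : R) f B (mB : measurable B) : 0 <= s -> 0 <= Cm ->
  sobolev s f -> measurable_fun setT (fun x => schrodinger_max a t f x `^ 2)%E ->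
  (\int[mu]_(x in B) (schrodinger_max a t f x `^ 2) <= (Cm * senergy s (fhat f))%:E)%E ->
  ('N[mrestr mu mB]_2%:E[schrodinger_max a t f] <= (Num.sqrt Cm)%:E * sobolev_norm s f)%E.
Proof.
move=> s0 Cm0 Sf mS I; have [LG _ nE] := sobolevP s0 Sf.
have p0 x : (0 <= schrodinger_max a t f x)%E.
  apply: (@le_trans _ _ (Normc.normc (schrodinger a f x (t 0)))%:E); first by rewrite lee_fin normc_ge0.
  by apply: ereal_sup_ubound; exists 0.
rewrite nE -EFinM -sqrtrM// -powR12_sqrt ?mulr_ge0 ?senergy_ge0// -poweR_EFin.
rewrite unlock; apply: gt0_ler_poweR => //.
- by rewrite in_itv/= leey andbT; apply: integral_ge0 => x _; exact: poweR_ge0.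
- by rewrite in_itv/= leey andbT lee_fin mulr_ge0// senergy_ge0.
under eq_integral do rewrite gee0_abs//.
by rewrite integral_mrestr// => x; exact: poweR_ge0.
Qed.

Lemma measurable_schrodinger_max a s t f : 0 <= s -> sobolev s f ->
  measurable_fun setT (schrodinger_max a t f) /\
  measurable_fun setT (fun x => schrodinger_max a t f x `^ 2)%E.
Proof.
move=> s0 Sf; have [LG _ _] := sobolevP s0 Sf; have cG := sL2_cL2 s0 LG.
have mU n : measurable_fun setT (fun x => Normc.normc (ifourier2 (evolve a (t n) (fhat f)) x)).
  have [LI _ _] := ifourier2_L2 (cL2_evolve a (t n) cG).
  by apply: cmeasurable_normc; exact: cL2_measurable.
split.
  apply: (@emeasurable_fun_cvg _ _ _ setT (fun N x =>
    (running_max (fun n => Normc.normc (ifourier2 (evolve a (t n) (fhat f)) x)) N)%:E)).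
    by move=> N; apply: measurable_EFin;
      exact: (@measurable_running_max R _ _ (fun n x => Normc.normc (ifourier2 (evolve a (t n) (fhat f)) x))).
  by move=> x _; rewrite schrodinger_maxE; exact: cvg_running_max.
apply: (@emeasurable_fun_cvg _ _ _ setT (fun N x =>
    (running_max (fun n => schr_sqr a t (fhat f) n x) N)%:E)).
  move=> N; apply: measurable_EFin; apply: (@measurable_running_max R _ _ (schr_sqr a t (fhat f))) => n.
  exact: measurable_sqr.
move=> x _; rewrite schrodinger_maxE ereal_sup_sqr; last by move=> n; exact: normc_ge0.
rewrite -[X in _ --> X]/(ereal_sup (range (fun n => (schr_sqr a t (fhat f) n x)%:E))).
exact: cvg_running_max.
Qed.

Lemma weak_of_strong a s t (C1 : R) f B (alpha : R) (mB : measurable B) : 0 <= s ->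
  sobolev s f -> 0 < alpha ->
  ('N[mrestr mu mB]_2%:E[schrodinger_max a t f] <= C1%:E * sobolev_norm s f)%E ->
  (mu (B `&` [set x | alpha%:E < schrodinger_max a t f x])
    <= (C1 ^+ 2 * alpha ^- 2)%:E * sobolev_norm s f ^+ 2)%E.
Proof.
move=> s0 Sf al0 strong; have [LG _ nE] := sobolevP s0 Sf.
have [mS mS2] := measurable_schrodinger_max a t s0 Sf.
have p0 x : (0 <= schrodinger_max a t f x)%E.
  apply: (@le_trans _ _ (Normc.normc (schrodinger a f x (t 0)))%:E); first by rewrite lee_fin normc_ge0.
  by apply: ereal_sup_ubound; exists 0.
set n := Num.sqrt (senergy s (fhat f)) in nE.
have n0 : 0 <= n by exact: sqrtr_ge0.
rewrite nE in strong *.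
have N0 := @Lnorm_ge0 _ _ R (mrestr mu mB) 2%:E (schrodinger_max a t f).
have I : (\int[mu]_(x in B) (schrodinger_max a t f x `^ 2) <= (C1 ^+ 2 * n ^+ 2)%:E)%E.
  rewrite -(integral_mrestr mB mS2); last by move=> x; exact: poweR_ge0.
  have <- : ('N[mrestr mu mB]_2%:E[schrodinger_max a t f] `^ 2 =
     \int[mrestr mu mB]_x (schrodinger_max a t f x `^ 2))%E.
    by rewrite poweR_Lnorm//; apply: eq_integral => x _; rewrite gee0_abs.
  (* The sign of [C1] is unknown; its product with the norm dominates a nonnegative quantity. *)
  have h : (0 <= C1 * n) by rewrite -lee_fin EFinM; exact: le_trans N0 strong.
  rewrite -exprMn -powR_mulrn// -poweR_EFin; apply: gt0_ler_poweR => //.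
  - by rewrite in_itv/= leey andbT.
  - by rewrite in_itv/= leey andbT lee_fin.
set A := B `&` _.
have mA : measurable A.
  by apply: emeasurable_fun_o_infty => //; exact: measurable_funTS.
have : ((alpha ^+ 2)%:E * mu A <= (C1 ^+ 2 * n ^+ 2)%:E)%E.
  apply: le_trans I; rewrite -integral_cst//.
  apply: (@le_trans _ _ (\int[mu]_(x in A) (schrodinger_max a t f x `^ 2))%E).
    apply: ge0_le_integral => //.
    - by move=> x _; rewrite lee_fin sqr_ge0.
    - exact: measurable_funTS.
    - move=> x [_ /= ax]; rewrite -powR_mulrn ?(ltW al0)// -poweR_EFin; apply: gt0_ler_poweR => //.
      + by rewrite in_itv/= leey andbT lee_fin ltW.
      + by rewrite in_itv/= leey andbT.
      + exact: ltW.
  apply: ge0_subset_integral => //.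
  - exact: measurable_funTS.
  - by move=> x _; exact: poweR_ge0.
  - by move=> x [].
have a2 : 0 < alpha ^+ 2 by rewrite exprn_gt0.
rewrite -EFin_expe -EFinM -lee_pdivlMl//.
move=> /le_trans; apply; rewrite -EFinM lee_fin mulrA ler_wpM2r ?sqr_ge0//.
by rewrite mulrC.
Qed.

End Strong_type.

(** * Pointwise convergence *)

Section Pointwise_convergence.
Local Open Scope complex_scope.
Context {R : realType}.
Local Notation mu := (@lebesgue_measure R).
Local Notation C := R[i].
Local Notation Re := (@complex.Re R).
Local Notation Im := (@complex.Im R).
Local Notation normc := (@Normc.normc R).
Implicit Types (f : distribution_on R) (B : set R) (t : nat -> R) (a s : R) (G H : R -> C).

Lemma normcD_le (z w : C) : normc (z + w) <= normc z + normc w.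
Proof.
have : (normc (z + w))%:C <= (normc z)%:C + (normc w)%:C := ler_normD z w.
by rewrite lecE /= => /andP[_].
Qed.

Lemma normcN (z : C) : normc (- z) = normc z.
Proof. by case: z => x y /=; rewrite !sqrrN. Qed.

Lemma normc_normr (z : C) : `|z| = (normc z)%:C.
Proof. by []. Qed.

Lemma cvg_complex (u : nat -> C) (l : C) : normc (u n - l) @[n --> \oo] --> (0 : R) ->
  (u n : C^o) @[n --> \oo] --> (l : C^o).
Proof.
move=> h; apply/cvgrPdist_lt => e e0; have [e1 e2] : 0 < Re e /\ Im e = 0.
  by move: e0; rewrite ltcE /= => /andP[/eqP -> ->].
move/cvgrPdist_lt: h => /(_ _ e1); apply: filterS => n.
rewrite sub0r normrN ger0_norm ?normc_ge0// => hn.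
rewrite normc_normr -normcN opprB ltcE /= hn andbT.
by rewrite e2.
Qed.

(** Dominated convergence, with [e] standing for the cosine or the sine in the inverse transform. *)
Lemma cvg_osc_evolve a t G (e : R -> R) x : measurable_fun setT e -> (forall y, `|e y| <= 1) ->
  t n @[n --> \oo] --> (0 : R) -> cL1 G ->
  Rint (fun xi => e (x * xi) * Re (evolve a (t n) G xi)) @[n --> \oo] -->
    Rint (fun xi => e (x * xi) * Re (G xi)) /\
  Rint (fun xi => e (x * xi) * Im (evolve a (t n) G xi)) @[n --> \oo] -->
    Rint (fun xi => e (x * xi) * Im (G xi)).
Proof.
move=> me e1 t0 [G1 G2]; have mG : cmeasurable G by split; exact: L1_measurable.
have mex : measurable_fun setT (fun xi => e (x * xi)).
  by apply: (measurableT_comp me); exact: measurable_funM.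
have dom n xi : normc (evolve a (t n) G xi) <= `|Re (G xi)| + `|Im (G xi)|.
  by rewrite normc_expiM; exact: normc_le.
have Lg := L1D (L1_norm G1) (L1_norm G2).
have th xi : t n * `|xi| `^ a @[n --> \oo] --> (0 : R).
  by rewrite -[X in _ --> X](mul0r (`|xi| `^ a)); apply: cvgMl.
have cth xi : cos (t n * `|xi| `^ a) @[n --> \oo] --> (1 : R).
  by rewrite -cos0; apply: continuous_cvg; [exact: continuous_cos|exact: th].
have sth xi : sin (t n * `|xi| `^ a) @[n --> \oo] --> (0 : R).
  by rewrite -sin0; apply: continuous_cvg; [exact: continuous_sin|exact: th].
have bd n xi (z : R) : `|z| <= normc (evolve a (t n) G xi) ->
    `|e (x * xi) * z| <= `|Re (G xi)| + `|Im (G xi)|.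
  move=> h; rewrite normrM; apply: le_trans (dom n xi); apply: le_trans h.
  by rewrite ler_piMl.
split.
  apply: (dominated_Rint _ Lg _ _ _).2.
  - by move=> n; apply: measurable_funM => //; exact: (cmeasurable_evolve a (t n) mG).1.
  - by move=> n xi; apply: (bd n); exact: Re_le_normc.
  - apply: ae_all => xi; apply: cvgM; first exact: cvg_cst.
    rewrite [X in _ --> X](_ : _ = 1 * Re (G xi) - 0 * Im (G xi)); last by ring.
    under eq_fun do rewrite cReM.
    by apply: cvgB; apply: cvgM; [exact: cth|exact: cvg_cst|exact: sth|exact: cvg_cst].
  - by apply: measurable_funM => //; exact: mG.1.
apply: (dominated_Rint _ Lg _ _ _).2.
- by move=> n; apply: measurable_funM => //; exact: (cmeasurable_evolve a (t n) mG).2.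
- by move=> n xi; apply: (bd n); exact: Im_le_normc.
- apply: ae_all => xi; apply: cvgM; first exact: cvg_cst.
  rewrite [X in _ --> X](_ : _ = 1 * Im (G xi) + 0 * Re (G xi)); last by ring.
  under eq_fun do rewrite cImM.
  by apply: cvgD; apply: cvgM; [exact: cth|exact: cvg_cst|exact: sth|exact: cvg_cst].
- by apply: measurable_funM => //; exact: mG.2.
Qed.

Lemma cvg_ifourier_evolve a t G x : t n @[n --> \oo] --> (0 : R) -> cL1 G ->
  normc (ifourier (evolve a (t n) G) x - ifourier G x) @[n --> \oo] --> (0 : R).
Proof.
move=> t0 cG.
have mc : measurable_fun setT (@cos R) by apply: continuous_measurable_fun; exact: continuous_cos.
have ms : measurable_fun setT (@sin R) by apply: continuous_measurable_fun; exact: continuous_sin.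
have c1 (y : R) : `|cos y| <= 1 by rewrite ler_norml cos_geN1 cos_le1.
have s1 (y : R) : `|sin y| <= 1 by rewrite ler_norml sin_geN1 sin_le1.
have [a1 a2] := cvg_osc_evolve a x mc c1 t0 cG.
have [a3 a4] := cvg_osc_evolve a x ms s1 t0 cG.
pose u n := (2 * pi)^-1 *
  (cosT (fun y => Re (evolve a (t n) G y)) x - sinT (fun y => Im (evolve a (t n) G y)) x).
pose v n := (2 * pi)^-1 *
  (sinT (fun y => Re (evolve a (t n) G y)) x + cosT (fun y => Im (evolve a (t n) G y)) x).
set r := (2 * pi)^-1 * (cosT (fun y => Re (G y)) x - sinT (fun y => Im (G y)) x).
set i := (2 * pi)^-1 * (sinT (fun y => Re (G y)) x + cosT (fun y => Im (G y)) x).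
have hR : u n @[n --> \oo] --> r by apply: cvgM; [exact: cvg_cst|exact: cvgB a1 a4].
have hI : v n @[n --> \oo] --> i by apply: cvgM; [exact: cvg_cst|exact: cvgD a3 a2].
have z0 : `|r - r| + `|i - i| = 0 by rewrite !subrr normr0 addr0.
have H := cvgD (cvg_norm (cvgB hR (cvg_cst r))) (cvg_norm (cvgB hI (cvg_cst i))).
rewrite z0 in H.
apply: (@squeeze_cvgr _ _ _ _ (cst 0) (fun n => `|u n - r| + `|v n - i|)); [|exact: cvg_cst|exact: H].
apply: nearW => n; apply/andP; split; first exact: normc_ge0.
apply: le_trans (normc_le _) _.
by rewrite !ifourierE//; exact: cL1_evolve.
Qed.

Lemma senergy_tail_small s G (e : R) : sL2 s G -> 0 < e ->
  exists K, sL2 s (tail K G) /\ senergy s (tail K G) <= e.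
Proof.
move=> [mG LG] e0.
have [K HK] := tail_energy_small LG (fun x => mulr_ge0 (powR_ge0 _ _) (sqr_ge0 _)) e0.
exists K; have E : (fun x => sweight s x * normc (tail K G x) ^+ 2) =
    (fun x => (1 - \1_(dball K) x) * (sweight s x * normc (G x) ^+ 2)).
  apply/funext => x; rewrite !normc_sqr /= indic_dball.
  by case: ifP => _; rewrite ?subrr ?subr0 ?mul0r ?mul1r ?expr0n ?addr0 ?mulr0.
have cm : cmeasurable (tail K G).
  have mi : measurable_fun setT (fun x : R => (1 : R) - \1_(dball K) x).
    by apply: measurable_funB => //; apply: measurable_indic; exact: measurable_dball.
  by split; apply: measurable_funM => //; [exact: mG.1|exact: mG.2].
split; last by rewrite /senergy E; exact: HK.
split => //; rewrite E.
have := L1B LG (L1_indicM (measurable_dball K) LG).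
by under eq_fun do rewrite -[X in X - _]mul1r -mulrBl.
Qed.

Lemma markov_normc (H : R -> C) (al : R) : cL2 H -> 0 < al ->
  measurable [set x | al < normc (H x)] /\
  (mu [set x | (al < normc (H x))%R] <= (energy H / al ^+ 2)%:E)%E.
Proof.
move=> LH al0; have mn := cmeasurable_normc (cL2_measurable LH).
have [L ->] := energy_normc LH; set A := [set x | _].
have mA : measurable A.
  rewrite (_ : A = (fun x => normc (H x)) @^-1` `]al, +oo[%classic).
    by rewrite -[X in measurable X]setTI; exact: mn.
  by apply/seteqP; split => x /=; rewrite in_itv/= ?andbT.
split => //; have a2 : 0 < al ^+ 2 by rewrite exprn_gt0.
have := RintE L.
have h : (\int[mu]_(x in A) (al ^+ 2)%:E <= \int[mu]_x (normc (H x) ^+ 2)%:E)%E.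
  apply: (@le_trans _ _ (\int[mu]_(x in A) (normc (H x) ^+ 2)%:E)%E).
    apply: ge0_le_integral => //.
    - by move=> x _; rewrite lee_fin sqr_ge0.
    - by apply: measurable_funTS; apply: measurable_EFin; exact: measurable_sqr.
    - by move=> x /= h; rewrite lee_fin ler_pXn2r ?nnegrE ?normc_ge0 ?ltW.
  apply: ge0_subset_integral => //; first by apply: measurable_EFin; exact: measurable_sqr.
  by move=> x _; rewrite lee_fin sqr_ge0.
move=> E; rewrite E integral_cst// in h.
by rewrite mulrC EFinM lee_pdivlMl.
Qed.

Lemma null_bigcap (A : nat -> set R) : (forall K, measurable (A K)) ->
  (forall e : R, 0 < e -> exists K, (mu (A K) <= e%:E)%E) -> mu (\bigcap_K A K) = 0%E.
Proof.
move=> mA sm; apply/eqP; rewrite eq_le measure_ge0 andbT; apply/lee_addgt0Pr => e e0.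
have [K HK] := sm _ e0; rewrite add0e; apply: le_trans HK.
apply: le_measure; rewrite ?inE//; [exact: bigcapT_measurable|exact: mA|exact: bigcap_inf].
Qed.

(** Differences of natural numbers enumerate the integers, so countably many sets of diameter 1
    cover the line. *)
Definition unit_cell (m n : nat) : set R := `[m%:R - n%:R, m%:R - n%:R + 1]%classic.

Lemma unit_cell_diam m n : diam_le1 (unit_cell m n).
Proof.
move=> x y; rewrite /unit_cell /= !in_itv/= => /andP[? ?] /andP[? ?].
by rewrite ler_norml; apply/andP; split; lra.
Qed.

Lemma unit_cell_cover (x : R) : exists m n, unit_cell m n x.
Proof.
pose n := (Num.truncn `|x|).+1; have nx : `|x| < n%:R by exact: Num.Theory.truncnS_gt.
have x0 : 0 <= x + n%:R by move: nx; rewrite ltr_norml => /andP[? ?]; lra.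
have /andP[h1 h2] := Num.Theory.truncn_itv x0.
exists (Num.truncn (x + n%:R)), n; rewrite /unit_cell /= in_itv/=.
by move: h2; rewrite -natr1 => h2; apply/andP; split; lra.
Qed.

(** Split the data at frequency [2^K]. The low part converges everywhere. Off a set whose measure is
    controlled by the energy of the tail, the tail is small at all times at once by the weak type
    bound, and at time 0 by Markov's inequality. Unit cells are used because the weak bound is
    local. *)
Lemma pointwise_of_weak a s (C2 : R) t f : 0 <= s ->
  t n @[n --> \oo] --> (0 : R) ->
  (forall (g : distribution_on R) (B : set R) (alpha : R),
      sobolev s g -> measurable B -> diam_le1 B -> 0 < alpha ->
      (mu (B `&` [set x | alpha%:E < schrodinger_max a t g x])
         <= (C2 * alpha ^- 2)%:E * sobolev_norm s g ^+ 2)%E) ->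
  sobolev s f ->
  {ae mu, forall x : R, (schrodinger a f x (t n) : C^o) @[n --> \oo] --> (fun_of_dist f x : C^o)}.
Proof.
move=> s0 t0 weak Sf; have [LG fE _] := sobolevP s0 Sf; set G := fhat f in LG fE.
have cG := sL2_cL2 s0 LG.
pose Tn K n := ifourier2 (evolve a (t n) (tail K G)); pose T K := ifourier2 (tail K G).
have cT K := cL2_tail K cG; have c1 K := cL1_truncate K cG; have c2 K := cL2_truncate K cG.
have dec : {ae mu, forall x, forall K,
    (forall n, ifourier2 (evolve a (t n) G) x = ifourier (evolve a (t n) (truncate K G)) x + Tn K n x) /\
    ifourier2 G x = ifourier (truncate K G) x + T K x}.
  apply: ae_forall => K; apply: ae_and.
    apply: ae_forall => n.
    have E : evolve a (t n) G = fun xi => evolve a (t n) (truncate K G) xi + evolve a (t n) (tail K G) xi.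
      by apply/funext => xi; rewrite /evolve -mulrDr truncate_tail.
    have h1 := ifourier2D (cL2_evolve a (t n) (c2 K)) (cL2_evolve a (t n) (cT K)); rewrite -E in h1.
    have h2 := ifourier2_ifourier (cL1_evolve a (t n) (c1 K)) (cL2_evolve a (t n) (c2 K)).
    by apply: ae_imp (ae_and h1 h2) => x [-> ->].
  have E : G = fun xi => truncate K G xi + tail K G xi.
    by apply/funext => xi; rewrite truncate_tail.
  have h1 := ifourier2D (c2 K) (cT K); rewrite -E in h1.
  by apply: ae_imp (ae_and h1 (ifourier2_ifourier (c1 K) (c2 K))) => x [-> ->].
have small j m n : {ae mu, forall x, unit_cell m n x -> exists K,
    (forall i, normc (Tn K i x) <= j.+1%:R^-1) /\ normc (T K x) <= j.+1%:R^-1}.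
  set al : R := j.+1%:R^-1; have al0 : 0 < al by rewrite invr_gt0 ltr0n.
  pose g K := dist_ifourier (dist_of_fun (tail K G)).
  (* The default [setT] disposes of cut-offs whose tail is not known to have finite weighted
     energy. *)
  pose A K := if `[< sL2 s (tail K G) >] then (unit_cell m n `&` [set x | (al%:E < schrodinger_max a t (g K) x)%E]) `|`
    [set x | al < normc (T K x)] else setT.
  have mA K : measurable (A K).
    rewrite /A; case: ifPn => [/asboolP LK|_]; last exact: measurableT.
    have [Sg _ _] := sobolev_of_fhat s0 LK.
    have [LT _ _] := ifourier2_L2 (cT K).
    apply: measurableU; last exact: (markov_normc LT al0).1.
    apply: emeasurable_fun_o_infty; first exact: measurable_itv.
    exact: measurable_funTS (measurable_schrodinger_max a t s0 Sg).1.
  have A0 : mu (\bigcap_K A K) = 0%E.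
    apply: null_bigcap => // e e0.
    (* Total of the constants of the two bounds; the sign of [C2] is unknown, whence the absolute
       value. *)
    pose q := `|C2| * al ^- 2 + al ^- 2.
    have al2 : 0 < al ^- 2 by rewrite invr_gt0 exprn_gt0.
    have q0 : 0 < q by rewrite ltr_wpDl// mulr_ge0// ltW.
    have [K [LK EK]] := senergy_tail_small LG (divr_gt0 e0 q0).
    have [Sg ae mf] := sobolev_of_fhat s0 LK.
    exists K; rewrite /A asboolT//.
    have [LT ET _] := ifourier2_L2 (cT K).
    have [m1 h1] := markov_normc LT al0.
    have h2 := weak (g K) (unit_cell m n) al Sg (measurable_itv _) (@unit_cell_diam m n) al0.
    have [_ _ nE] := sobolevP s0 Sg.
    have eE : senergy s (fhat (g K)) = senergy s (tail K G).
      apply: ae_eq_Rint.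
      - apply: measurable_funM; first exact: measurable_sweight.
        by apply: measurable_sqr; exact: cmeasurable_normc.
      - exact: L1_measurable LK.2.
      - by apply: ae_imp ae => x ->.
    rewrite nE eE -EFin_expe sqr_sqrtr ?senergy_ge0// -EFinM in h2.
    apply: le_trans (measureU2 _ _ _) _ => //.
      apply: emeasurable_fun_o_infty; first exact: measurable_itv.
      exact: measurable_funTS (measurable_schrodinger_max a t s0 Sg).1.
    apply: le_trans (leeD h2 h1) _; rewrite -EFinD lee_fin.
    have SE := energy_le_senergy s0 LK; have S0 := senergy_ge0 s (tail K G).
    apply: (@le_trans _ _ (q * senergy s (tail K G))); last by rewrite mulrC -ler_pdivlMr.
    have -> : q * senergy s (tail K G) = `|C2| * al ^- 2 * senergy s (tail K G) + al ^- 2 * senergy s (tail K G).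
      by rewrite /q mulrDl.
    apply: lerD.
      by apply: ler_wpM2r => //; apply: ler_wpM2r; [exact: ltW|exact: ler_norm].
    by rewrite mulrC; apply: ler_wpM2l; [exact: ltW|exact: le_trans ET SE].
  exists (\bigcap_K A K); split => //; first exact: bigcapT_measurable.
  move=> x /= nx K _; rewrite /A; case: ifPn => // /asboolP LK.
  apply: contrapT => nA; apply: nx => ux; exists K; split.
    move=> i; rewrite leNgt; apply/negP => hi; apply: nA; left; split => //=.
    have E := schrodinger_of_fhat a (t i) s0 LK.
    apply: (@lt_le_trans _ _ (normc (Tn K i x))%:E); first by rewrite lte_fin.
    apply: ereal_sup_ubound; exists i => //=.
    by have := congr1 (fun h => h x) E => /= ->.
  by rewrite leNgt; apply/negP => hi; apply: nA; right.
have small' : {ae mu, forall x, forall j m n, unit_cell m n x -> exists K,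
    (forall i, normc (Tn K i x) <= j.+1%:R^-1) /\ normc (T K x) <= j.+1%:R^-1}.
  by apply: ae_forall => j; apply: ae_forall => m; apply: ae_forall => n; exact: small.
apply: ae_imp (ae_and dec small') => x [dx sx].
apply: cvg_complex; apply/cvgr0Pnorm_lt => e e0.
have e3 : 0 < e / 3 by rewrite divr_gt0.
have [j je] : exists j : nat, j.+1%:R^-1 < e / 3.
  exists (Num.truncn (e / 3)^-1); rewrite invf_plt ?posrE ?ltr0n//.
  exact: Num.Theory.truncnS_gt.
have [m [n ux]] := unit_cell_cover x; have [K [h1 h2]] := sx j m n ux.
have [d1 d2] := dx K.
have /cvgr0Pnorm_lt/(_ _ e3) := cvg_ifourier_evolve a x t0 (c1 K).
apply: filterS => i; rewrite !ger0_norm ?normc_ge0// => hi.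
rewrite schrodingerE -/G fE d1 d2 opprD addrACA.
apply: le_lt_trans (normcD_le _ _) _; apply: (@lt_le_trans _ _ (e / 3 + (e / 3 + e / 3))); last lra.
apply: ltrD => //; apply: le_lt_trans (normcD_le _ _) _; rewrite normcN.
by apply: ltrD; [exact: le_lt_trans (h1 i) je|exact: le_lt_trans h2 je].
Qed.

End Pointwise_convergence.

(** * Focusing and gliding hump *)

Section Small_gaps.
Context {R : realType}.
Implicit Types (t : nat -> R) (r x y z : R).

(** Tangent line inequality for the convex power [x^(-r)], from [ln z <= z - 1] and
    [exp z >= 1 + z]. *)
Lemma powR_convex_le r x y : 0 < r -> 0 < y -> y <= x ->
  r * x `^ (- r - 1) * (x - y) <= y `^ (- r) - x `^ (- r).
Proof.
move=> r0 y0 yx; have x0 : 0 < x := lt_le_trans y0 yx.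
have z0 : 0 < y / x by rewrite divr_gt0.
have E : y `^ (- r) = (y / x) `^ (- r) * x `^ (- r).
  by rewrite -powRM ?divfK ?gt_eqF ?ltW.
have X0 : 0 < x `^ (- r) by rewrite powR_gt0.
have -> : x `^ (- r - 1) = x `^ (- r) / x.
  by rewrite powRB ?powRr1 ?ltW//; apply/implyP => _; rewrite gt_eqF.
have h : 1 + r * (1 - y / x) <= (y / x) `^ (- r).
  rewrite /powR gt_eqF//; apply: le_trans (expR_ge1Dx _); rewrite lerD2l.
  have : ln (y / x) <= y / x - 1.
    by have := @le_ln1Dx R (y / x - 1); rewrite (_ : 1 + (y / x - 1) = y / x); [apply; lra|ring].
  by rewrite mulNr -mulrN ler_pM2l// => h; lra.
rewrite E -[X in _ <= _ - X]mul1r -mulrBl.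
have -> : r * (x `^ (- r) / x) * (x - y) = r * (1 - y / x) * x `^ (- r) by field; rewrite gt_eqF.
by rewrite ler_pM2r// lerBrDl.
Qed.

(** If all late gaps exceeded [t_n^(1+r) / A], convexity would make [t_n^(-r)] grow by at least
    [r / A] at each step, hence linearly, and this is the weak [ell^r] bound. *)
Lemma ex_small_gap r t : 0 < r -> (forall n, 0 <= t n) ->
  (forall m n, (m <= n)%N -> t n <= t m) ->
  ~ (exists2 c : R, 0 < c & forall n, n.+1%:R * t n `^ r <= c) ->
  (forall n, 0 < t n) /\
  forall (A : R) n0, 0 < A -> exists2 n, (n0 <= n)%N & t n - t n.+1 <= t n `^ (1 + r) / A.
Proof.
move=> r0 t0 td nw.
have bounded_tail (c : R) n1 : 0 <= c -> (forall n, (n1 <= n)%N -> n.+1%:R * t n `^ r <= c) ->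
    exists2 c : R, 0 < c & forall n, n.+1%:R * t n `^ r <= c.
  move=> c0 H; exists (c + n1.+1%:R * t 0 `^ r + 1).
    by rewrite ltr_wpDl// addr_ge0// mulr_ge0// powR_ge0.
  move=> n; have h0 : 0 <= n1.+1%:R * t 0 `^ r by rewrite mulr_ge0// powR_ge0.
  have [h|h] := leqP n1 n; first by have := H n h; lra.
  apply: (@le_trans _ _ (n1.+1%:R * t 0 `^ r)); last lra.
  apply: ler_pM => //; first exact: powR_ge0.
    by rewrite ler_nat ltnS ltnW.
  apply: ge0_ler_powR; rewrite ?nnegrE //; [exact: ltW|exact: td].
have tp n : 0 < t n.
  (* A vanishing term makes all later ones vanish, and the excluded bound would hold. *)
  rewrite lt_neqAle t0 andbT; apply/eqP => tn; apply: nw.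
  apply: (@bounded_tail 0 n) => // k nk.
  have -> : t k = 0 by apply/eqP; rewrite eq_le t0 andbT tn td.
  by rewrite powR0 ?mulr0// gt_eqF.
split => // A n0 A0; apply: contrapT => ng; apply: nw.
have gap n : (n0 <= n)%N -> t n `^ (1 + r) / A <= t n - t n.+1.
  by move=> h; apply/ltW; rewrite ltNge; apply/negP => h'; apply: ng; exists n.
have step n : (n0 <= n)%N -> r / A <= t n.+1 `^ (- r) - t n `^ (- r).
  move=> h; apply: le_trans (powR_convex_le r0 (tp n.+1) (td _ _ (leqnSn n))).
  have P0 : 0 < t n `^ (- r - 1) by rewrite powR_gt0.
  apply: (@le_trans _ _ (r * t n `^ (- r - 1) * (t n `^ (1 + r) / A))).
    have -> : r * t n `^ (- r - 1) * (t n `^ (1 + r) / A) = (t n `^ (- r - 1) * t n `^ (1 + r)) * (r / A) by ring.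
    rewrite -powRD; last by apply/implyP => _; rewrite gt_eqF.
    by rewrite (_ : - r - 1 + (1 + r) = 0) ?powRr0 ?mul1r//; ring.
  by rewrite ler_pM2l ?mulr_gt0// gap.
have tele k : k%:R * (r / A) <= t (n0 + k)%N `^ (- r).
  elim: k => [|k IH]; first by rewrite mul0r powR_ge0.
  have := step (n0 + k)%N (leq_addr _ _); rewrite -natr1 mulrDl mul1r addnS; lra.
apply: (@bounded_tail ((n0.+1%:R + 1) * (A / r)) n0.+1).
  by rewrite mulr_ge0 ?addr_ge0// divr_ge0//; exact: ltW.
move=> n hn; have := tele (n - n0)%N; rewrite subnKC ?(ltnW hn)// powRN.
set k := (n - n0)%N; have k0 : (0 < k)%N by rewrite subn_gt0.
have T0 : 0 < t n `^ r by rewrite powR_gt0.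
move=> h; have {}h : t n `^ r * k%:R <= A / r.
  have rA : 0 < r / A by rewrite divr_gt0.
  have : k%:R * (r / A) * t n `^ r <= 1 by rewrite -ler_pdivlMr// mul1r.
  move=> h'; rewrite -(ler_pM2r rA) (_ : A / r * (r / A) = 1); last by field; rewrite !gt_eqF.
  by rewrite (_ : t n `^ r * k%:R * (r / A) = k%:R * (r / A) * t n `^ r)//; ring.
apply: (@le_trans _ _ ((n0.+1%:R + 1) * (t n `^ r * k%:R))); last by rewrite ler_wpM2l ?addr_ge0.
rewrite mulrCA mulrC ler_pM2l//.
have -> : n.+1 = (n0 + k).+1 by rewrite subnKC// ltnW.
have k1 : 1 <= k%:R :> R by rewrite ler1n.
rewrite -!natr1 natrD; have := ler0n R n0; nra.
Qed.

End Small_gaps.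

(** * Elementary inequalities for phases and times *)

Section Elementary_bounds.
Context {R : realType}.
Implicit Types (x y z a l : R).

Lemma norm_sin_le x : `|sin x| <= `|x|.
Proof.
have [->|x0] := eqVneq x 0; first by rewrite sin0 normr0.
wlog xp : x x0 / 0 < x.
  move=> H; have [h|h] := ltP 0 x; first exact: H.
  by rewrite -normrN -sinN -(normrN x); apply: H; rewrite ?oppr_eq0// oppr_gt0 lt_neqAle x0.
have [|c _] := @MVT R sin cos 0 x xp.
  by apply: continuous_subspaceT => y; exact: continuous_sin.
by rewrite sin0 !subr0 => ->; rewrite normrM ler_piMl// ler_norml cos_geN1 cos_le1.
Qed.

Lemma cos_ge_half x : `|x| <= 1 -> 2^-1 <= cos x.
Proof.
move=> x1; have -> : x = (x / 2) + (x / 2) by lra.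
have E := cos2Dsin2 (x / 2); rewrite cosD -!expr2.
have h := norm_sin_le (x / 2); have x2 : `|x / 2| <= 2^-1.
  by rewrite normrM normfV (ger0_norm (_ : 0 <= 2))// ler_pdivrMr// mulVf.
have h2 : sin (x / 2) ^+ 2 <= 2^-1 ^+ 2.
  by rewrite -[leLHS]real_normK ?num_real// ler_pXn2r ?nnegrE//; exact: le_trans h x2.
rewrite expr2 in h2; nra.
Qed.

(** Mean value theorem twice; both intermediate points stay in [[l, 2 l]]. *)
Lemma powR_taylor2 a : 0 < a -> exists2 C : R, 0 < C & forall l z, 0 < l -> 0 <= z <= l ->
  `|(l + z) `^ a - l `^ a - a * l `^ (a - 1) * z| <= C * l `^ (a - 2) * z ^+ 2.
Proof.
move=> a0; exists (a * (`|a - 1| + 1) * 2 `^ `|a - 2|).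
  by rewrite !mulr_gt0 ?powR_gt0// ltr_pwDr.
move=> l z l0 /andP[z0 zl]; have [->|zn] := eqVneq z 0.
  by rewrite addr0 subrr mulr0 subr0 normr0 mulr_ge0 ?sqr_ge0// !mulr_ge0 ?powR_ge0// ltW.
have zp : 0 < z by rewrite lt_neqAle eq_sym zn.
have mvt p (u v : R) : 0 < u -> u < v -> exists2 c, u < c < v &
    v `^ p - u `^ p = p * c `^ (p - 1) * (v - u).
  move=> u0 uv; have [||c hc E] := @MVT R (fun x => x `^ p) (fun x => p * x `^ (p - 1)) u v uv.
  - by move=> y /[!in_itv]/= /andP[uy _]; apply: is_derive1_powR; exact: lt_trans uy.
  - apply: within_itv_continuous => y /andP[uy _].
    exact: is_derive_continuous (is_derive1_powR p (lt_le_trans u0 uy)).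
  by exists c => //; move: hc; rewrite in_itv.
have llz : l < l + z by rewrite ltrDl.
have [c1 /andP[lc1 c1z] E1] := mvt a l (l + z) l0 llz.
have [c2 /andP[lc2 c2c] E2] := mvt (a - 1) l c1 l0 lc1.
have hc2 : l <= c2 <= 2 * l by apply/andP; split; lra.
have /andP[_ up] := powR_dyadic (a - 1 - 1) l0 hc2.
have e2 : a - 1 - 1 = a - 2 by ring.
rewrite e2 in up E2.
have -> : (l + z) `^ a - l `^ a - a * l `^ (a - 1) * z = a * (c1 `^ (a - 1) - l `^ (a - 1)) * z.
  by rewrite E1; ring.
rewrite E2 !normrM (gtr0_norm a0) (gtr0_norm zp) (ger0_norm (powR_ge0 _ _)).
rewrite (gtr0_norm (_ : 0 < c1 - l)) ?subr_gt0//.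
have cz : c1 - l <= z by lra.
have n0 := normr_ge0 (a - 1).
have -> : a * (`|a - 1| + 1) * 2 `^ `|a - 2| * l `^ (a - 2) * z ^+ 2 =
   a * ((`|a - 1| + 1) * (l `^ (a - 2) * 2 `^ `|a - 2|) * z) * z by ring.
rewrite ler_pM2r// ler_pM2l//; apply: ler_pM => //.
- by rewrite mulr_ge0// powR_ge0.
- by rewrite subr_ge0 ltW.
- by apply: ler_pM => //; [exact: powR_ge0|lra].
Qed.

(** The first time not exceeding [y] is within one gap of it. *)
Lemma ex_close_time (t : nat -> R) n N y g : (n <= N)%N -> t N <= y -> y <= t n ->
  (forall k, (n <= k)%N -> t k - t k.+1 <= g) -> 0 <= g ->
  exists m, [/\ (n <= m)%N, (m <= N)%N, t m <= y & y - t m <= g].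
Proof.
move=> nN tNy ytn gap g0; elim: N nN tNy => [|N IH].
  rewrite leqn0 => /eqP n0 h; exists 0; split => //; first by rewrite n0.
  by rewrite n0 in ytn; lra.
rewrite leq_eqVlt => /predU1P[n0 h|]; first by exists n; rewrite n0; split => //; rewrite n0 in ytn; lra.
rewrite ltnS => nN h; have [h'|h'] := leP (t N) y.
  by have [m [? ? ? ?]] := IH nN h'; exists m; split => //; exact: leqW.
exists N.+1; split => //; first exact: leqW.
have := gap N nN; lra.
Qed.

End Elementary_bounds.

(** * Focusing of resonant frequencies *)

Section Focusing.
Context {R : realType}.
Local Notation mu := (@lebesgue_measure R).
Local Notation Re := complex.Re.
Local Notation Im := complex.Im.
Implicit Types (a s l x y z : R) (t : nat -> R) (g : R -> R).

(** The component of the oscillatory integral in the direction [th] is at least half the mass of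
    [g], the cosine being at least 1/2 on the support. *)
Lemma osc_sqr_lower a (tau : R) g x (th : R) : L1 g -> (forall xi, 0 <= g xi) ->
  (forall xi, g xi != 0 -> 2^-1 <= cos (phase a (fun=> tau) x xi - th)) ->
  (Rint g / 2) ^+ 2 <= osc_sqr a (fun=> tau) g x.
Proof.
move=> Lg g0 hc; have mP := @measurable_phase2 R a (fun=> tau) (measurable_cst _).
set P := phase a (fun=> tau) in mP hc *.
have Lc := L1_oscc mP Lg x; have Ls := L1_oscs mP Lg x.
have E : Rint (fun xi => cos (P x xi - th) * g xi) = cos th * oscc P g x + sin th * oscs P g x.
  rewrite /oscc /oscs -!RintZ// -RintD; [|exact: L1Z|exact: L1Z].
  by apply: eq_Rint => xi; rewrite cosB; ring.
have LE : L1 (fun xi => cos (P x xi - th) * g xi).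
  have := L1D (L1Z (cos th) Lc) (L1Z (sin th) Ls).
  by congr L1; apply/funext => xi; rewrite cosB; ring.
have low : Rint g / 2 <= Rint (fun xi => cos (P x xi - th) * g xi).
  rewrite -RintZr//; apply: le_Rint => //; first exact: L1Zr.
  move=> xi; have [->|/hc h] := eqVneq (g xi) 0; first by rewrite mul0r mulr0.
  by rewrite mulrC ler_wpM2r.
have I0 : 0 <= Rint g / 2 by rewrite divr_ge0// Rint_ge0.
apply: (@le_trans _ _ ((cos th * oscc P g x + sin th * oscs P g x) ^+ 2)).
  by rewrite ler_pXn2r ?nnegrE// -?E// (le_trans I0).
rewrite /osc_sqr -/P; have := cos2Dsin2 th; move: (oscc _ _ x) (oscs _ _ x) => u v.
move: (cos th) (sin th) => c d e.
have -> : u ^+ 2 + v ^+ 2 = (c ^+ 2 + d ^+ 2) * (u ^+ 2 + v ^+ 2) by rewrite e mul1r.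
by have := sqr_ge0 (c * v - d * u); nra.
Qed.

Definition comb l (sg de : R) n (xi : R) : R :=
  \sum_(p < n) \1_(`[l + p%:R * sg, l + p%:R * sg + de]%classic) xi.

Lemma comb_support l (sg de : R) n xi : comb l sg de n xi != 0 ->
  exists2 p, (p < n)%N & l + p%:R * sg <= xi <= l + p%:R * sg + de.
Proof.
move=> h; apply: contrapT => H; move/eqP: h; apply; rewrite /comb big1// => p _.
rewrite indicE memNset//= in_itv/= => h; apply: H.
by exists p.
Qed.

Lemma comb_01 l (sg de : R) n xi : 0 < de -> de < sg -> comb l sg de n xi = 0 \/ comb l sg de n xi = 1.
Proof.
move=> d0 ds; have [->|/comb_support[p pn hp]] := eqVneq (comb l sg de n xi) 0; [by left|right].
rewrite /comb (bigD1 (Ordinal pn))//= indicE mem_set ?in_itv//= big1 ?addr0// => q.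
rewrite -(inj_eq val_inj)/= => qp; rewrite indicE memNset//= in_itv/= => hq.
move/andP: hp => [hp1 hp2]; move/andP: hq => [hq1 hq2].
have s0 : 0 < sg by exact: lt_trans ds.
have dist (i j : nat) : (i < j)%N -> i%:R * sg + sg <= j%:R * sg.
  by move=> ij; rewrite -[X in _ + X <= _]mul1r -mulrDl ler_pM2r// natr1 ler_nat.
by move: qp; rewrite neq_ltn => /orP[/dist|/dist]; lra.
Qed.

Lemma L1_comb l (sg de : R) n : 0 < de -> L1 (comb l sg de n) /\ Rint (comb l sg de n) = n%:R * de.
Proof.
move=> d0; have [|L E] := @Rint_sum R _ (index_enum 'I_n) xpredT
    (fun p : 'I_n => \1_(`[l + p%:R * sg, l + p%:R * sg + de]%classic) : R -> R).
  by move=> p _; apply: L1_indic => //=; rewrite lebesgue_measure_itv/=; case: ifP => _; rewrite ?ltry// -EFinB ltry.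
split => //; rewrite E (eq_bigr (fun=> de)) ?sumr_const ?card_ord ?mulr_natl// => p _.
by rewrite Rint_indic1// lebesgue_measure_itv/= lte_fin ltrDl d0 -EFinB addrAC subrr add0r.
Qed.

(* Relative to the phase at [l], the phase at [l + p sg + w] is [2 pi k p] up to the three errors
   coming from [w], from the time [tau] not being exactly [y], and from the curvature of [xi ^ a]. *)
Lemma phase_error a (C l b y tau ga x sg de w : R) (k p P : nat) : 0 < a -> 0 < b ->
  (forall z, 0 <= z <= l -> `|(l + z) `^ a - l `^ a - a * l `^ (a - 1) * z| <= C * l `^ (a - 2) * z ^+ 2) ->
  0 < l -> b * l `^ (a - 1) <= 1 -> 0 < C -> 0 <= x <= 1 ->
  sg = 4 * pi / (a * b * l `^ (a - 1)) ->
  sg * (x + a * y * l `^ (a - 1)) = 2 * pi * k%:R -> 0 <= tau -> tau <= y -> y <= b -> y - tau <= ga ->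
  (p < P)%N -> 0 <= w <= de -> de <= sg -> 0 < de -> de * (3 * (1 + a)) = 1 -> P%:R * sg <= l ->
  48 * pi ^+ 2 * C * P%:R ^+ 2 <= a ^+ 2 * (b * l `^ a) ->
  12 * pi * P%:R * ga <= b ->
  `|phase a (fun=> tau) x (l + p%:R * sg + w) - (x * l + tau * l `^ a) - pi *+ 2 *+ (k * p)| <= 1.
Proof.
move=> a0 b0 Ta l0 bl C0 /andP[x0 x1] sgE yE tau0 tauy yb yga pP /andP[w0 wd] ds d0 dE Psl curv gam.
have pi0 := pi_gt0 R.
set m := l `^ (a - 1) in sgE yE bl Ta *; have m0 : 0 < m by rewrite powR_gt0.
have s0 : 0 < sg by rewrite sgE divr_gt0 ?mulr_gt0.
set z := p%:R * sg + w.
have z0 : 0 <= z by rewrite addr_ge0// mulr_ge0// ltW.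
have zP : z <= P%:R * sg.
  have : p%:R * sg + sg <= P%:R * sg by rewrite -[X in _ + X <= _]mul1r -mulrDl ler_pM2r// natr1 ler_nat.
  rewrite /z; lra.
have /Ta rem : 0 <= z <= l by rewrite z0 (le_trans zP).
have lE : l `^ a = l `^ (a - 2) * l ^+ 2.
  rewrite -powR_mulrn ?ltW// -powRD; last by apply/implyP => _; rewrite gt_eqF.
  by congr (l `^ _); ring.
have mE : m = l `^ (a - 2) * l.
  rewrite -[X in _ = _ * X]powRr1 ?ltW// -powRD; last by apply/implyP => _; rewrite gt_eqF.
  by congr (l `^ _); ring.
have q0 : 0 < l `^ (a - 2) by rewrite powR_gt0.
have -> : phase a (fun=> tau) x (l + p%:R * sg + w) - (x * l + tau * l `^ a) - pi *+ 2 *+ (k * p) =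
    w * (x + a * y * m) + tau * ((l + z) `^ a - l `^ a - a * m * z) - z * a * m * (y - tau).
  have -> : l + p%:R * sg + w = l + z by rewrite /z addrA.
  have lz : 0 <= l + z by rewrite addr_ge0// ltW.
  rewrite /phase (ger0_norm lz).
  have e1 : z * (x + a * y * m) = p%:R * (2 * pi * k%:R) + w * (x + a * y * m) by rewrite /z mulrDl -mulrA yE.
  have -> : pi *+ 2 *+ (k * p) = p%:R * (2 * pi * k%:R) :> R by rewrite -[LHS]mulr_natr natrM -[pi *+ 2]mulr_natl; ring.
  by move: e1; clear; move: ((l + z) `^ a) (l `^ a) => u v; lra.
(* Each of the three errors is at most [1/3]: this one by the width [de], the next two by [gam] and
   [curv]. *)
have e1 : `|w * (x + a * y * m)| <= 3^-1.
  have h : 0 <= x + a * y * m <= 1 + a.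
    have y0 : 0 <= y by exact: le_trans tauy.
    have : 0 <= a * (y * m) by rewrite !mulr_ge0// ltW.
    have : a * (y * m) <= a * 1.
      by rewrite ler_pM2l//; apply: le_trans bl; rewrite ler_pM2r.
    rewrite mulrA; lra.
  move/andP: h => [h1 h2]; rewrite ger0_norm ?mulr_ge0//.
  apply: le_trans (_ : de * (1 + a) <= _); first exact: ler_pM.
  lra.
have e2 : `|z * a * m * (y - tau)| <= 3^-1.
  have yt : 0 <= y - tau by lra.
  rewrite ger0_norm ?mulr_ge0 ?(ltW a0) ?(ltW m0)//.
  apply: le_trans (_ : (P%:R * sg) * a * m * ga <= _).
    by apply: ler_pM => //; rewrite ?mulr_ge0 ?(ltW a0) ?(ltW m0)// !ler_pM2r.
  have -> : P%:R * sg * a * m * ga = 12 * pi * P%:R * ga / b / 3.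
    by rewrite sgE; field; rewrite !gt_eqF.
  by rewrite ler_pdivrMr// mulVf// ler_pdivrMr// mul1r.
have e3 : `|tau * ((l + z) `^ a - l `^ a - a * m * z)| <= 3^-1.
  rewrite normrM ger0_norm//.
  apply: le_trans (_ : b * (C * l `^ (a - 2) * (P%:R * sg) ^+ 2) <= _).
    apply: ler_pM => //; first by lra.
    apply: (le_trans rem); rewrite ler_pM2l ?mulr_gt0// ler_pXn2r ?nnegrE// (le_trans z0 zP) //.
  have -> : b * (C * l `^ (a - 2) * (P%:R * sg) ^+ 2) =
      48 * pi ^+ 2 * C * P%:R ^+ 2 / (a ^+ 2 * (b * l `^ a)) / 3.
    by rewrite sgE lE mE; field; rewrite !gt_eqF.
  rewrite ler_pdivrMr// mulVf// ler_pdivrMr ?mul1r// mulr_gt0 ?exprn_gt0// mulr_gt0//.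
  exact: powR_gt0.
move: e1 e2 e3; rewrite !ler_norml; move: (w * _) (tau * _) (z * _ * _ * _) => u v r.
by move=> /andP[? ?] /andP[? ?] /andP[? ?]; apply/andP; split; lra.
Qed.

(** Resonance asks that [sg (x + a y l^(a-1))] be a multiple of [2 pi]. By the choice of [sg] this
    quantity covers a full period as [y] runs through [[b/2, b]], so a suitable [y] exists for every
    [x]. *)
Lemma comb_osc_ge a (C l b sg de ga ka x : R) (P n N : nat) t : 0 < a -> 0 < b ->
  (forall z, 0 <= z <= l -> `|(l + z) `^ a - l `^ a - a * l `^ (a - 1) * z| <= C * l `^ (a - 2) * z ^+ 2) ->
  0 < l -> b * l `^ (a - 1) <= 1 -> 0 < C -> 0 <= x <= 1 ->
  sg = 4 * pi / (a * b * l `^ (a - 1)) -> de * (3 * (1 + a)) = 1 -> P%:R * sg <= l ->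
  48 * pi ^+ 2 * C * P%:R ^+ 2 <= a ^+ 2 * (b * l `^ a) ->
  12 * pi * P%:R * ga <= b ->
  (forall n, 0 <= t n) -> (n <= N)%N -> t n = b -> t N <= b / 2 ->
  (forall k, (n <= k)%N -> t k - t k.+1 <= ga) -> 0 <= ga -> 0 <= ka ->
  exists2 m, (m <= N)%N & (ka * (P%:R * de) / 2) ^+ 2 <=
    osc_sqr a (fun=> t m) (fun xi => ka * comb l sg de P xi) x.
Proof.
move=> a0 b0 Ta l0 bl C0 x01 sgE dE Psl curv gam t0 nN tn tN gap ga0 ka0.
have /andP[x0 x1] := x01; have pi0 := pi_gt0 R.
have m0 : 0 < l `^ (a - 1) by rewrite powR_gt0.
have s0 : 0 < sg by rewrite sgE divr_gt0 ?mulr_gt0.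
have E : sg * (a * (b * l `^ (a - 1))) = 4 * pi by rewrite sgE; field; rewrite !gt_eqF.
have d0 : 0 < de by rewrite -(pmulr_lgt0 de (_ : 0 < 3 * (1 + a))) ?dE// mulr_gt0// addr_gt0.
have ds : de < sg.
  rewrite -(ltr_pM2r a0); have : sg * (a * (b * l `^ (a - 1))) <= sg * a.
    by rewrite ler_pM2l// ler_piMr// ltW.
  have := pi_ge2 R; rewrite E; lra.
set m := l `^ (a - 1) in E bl m0 sgE.
have u0 : 0 <= sg * x / (2 * pi) by rewrite divr_ge0// mulr_ge0// ltW.
have /andP[k1 k2] := trunc_itv u0.
move: (Num.trunc _) k1 k2 => k0 k1 k2.
rewrite ler_pdivlMr ?mulr_gt0// in k1; rewrite ltr_pdivrMr ?mulr_gt0// in k2.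
(* As [2 pi k0 <= sg x < 2 pi (k0 + 1)], the shift by 2 puts [2 pi k - sg x] in []2 pi, 4 pi]], that
   is [y] in []b/2, b]]. *)
pose k := k0.+2; pose y := (2 * pi * k%:R / sg - x) / (a * m).
have yE : sg * (x + a * y * m) = 2 * pi * k%:R by rewrite /y; field; rewrite !gt_eqF.
have kE : k%:R = k0%:R + 2 :> R by rewrite /k -addn2 natrD.
have sam : 0 < sg * (a * m) by rewrite !mulr_gt0.
have yE' : y * (sg * (a * m)) = 2 * pi * k%:R - sg * x by rewrite -yE; ring.
have bE : b * (sg * (a * m)) = 4 * pi by rewrite -E; ring.
have yb : y <= b by rewrite -(ler_pM2r sam) bE yE' kE; lra.
have by2 : b / 2 <= y.
  by rewrite -(ler_pM2r sam) mulrAC bE yE' kE; rewrite -natr1 in k2; lra.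
have [j [nj jN tjy yj]] := ex_close_time nN (le_trans tN by2) (eq_ind_r (fun z => y <= z) yb tn) gap ga0.
exists j => //; have [Lc Rc] := @L1_comb l sg de P d0.
rewrite -Rc -RintZ//; apply: (@osc_sqr_lower _ _ _ _ (x * l + t j * l `^ a)).
- exact: L1Z.
- by move=> xi; rewrite mulr_ge0//; have [->|->] := @comb_01 l sg de P xi d0 ds.
move=> xi; rewrite mulf_eq0 negb_or => /andP[_ /comb_support[p pP /andP[h1 h2]]].
have := @phase_error a C l b y (t j) ga x sg de (xi - (l + p%:R * sg)) k p P
  a0 b0 Ta l0 bl C0 x01 sgE yE (t0 j) tjy yb yj pP.
have -> : l + p%:R * sg + (xi - (l + p%:R * sg)) = xi by rewrite addrC subrK.
move=> /(_ _ (ltW ds) d0 dE Psl curv gam) h.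
have {}h := h ltac:(by apply/andP; split; lra).
rewrite -[X in cos X](subrK (pi *+ 2 *+ (k * p))) (periodicn (@cosD2pi R)).
exact: cos_ge_half.
Qed.

(** The frequency solves [l^(a - 4 s) = L / b], so [b l^a = L l^(4 s)], and [P] is [K l^(2 s)]
    rounded up. Then [P <= 2 K l^(2 s)] and [L = 4 K^2 / e] give the bound on [P^2], and the gap
    condition closes because [l^(2 s) b^r = L^r]. *)
Lemma scale_choice a s (K e : R) : 0 < s -> s < a / 4 -> s < 1 / 4 -> 1 <= K -> 0 < e ->
  exists b0 A : R, [/\ 0 < b0, 0 < A & forall b ga : R, 0 < b -> b <= b0 ->
    ga <= b `^ (1 + 2 * s / (a - 4 * s)) / A -> exists l (P : nat), [/\ 1 <= l,
      b * l `^ (a - 1) <= 1, K * l `^ (2 * s) <= P%:R, P%:R ^+ 2 <= e * (b * l `^ a) &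
      12 * pi * P%:R * ga <= b]].
Proof.
move=> s0 sa s4 K1 e0; have pi0 := pi_gt0 R.
have K0 : 0 < K by exact: lt_le_trans K1.
pose q := a - 4 * s; have q0 : 0 < q by rewrite /q; lra.
pose L := 4 * K ^+ 2 / e; have L0 : 0 < L by rewrite divr_gt0// mulr_gt0// exprn_gt0.
have s1 : 0 < 1 - 4 * s by lra.
(* [l >= M], which [b <= b0] guarantees, ensures both [l >= 1] and
   [b l^(a-1) = L l^(4 s - 1) <= 1]. *)
pose M := 1 + L `^ (1 - 4 * s)^-1; have LM : 0 <= L `^ (1 - 4 * s)^-1 := powR_ge0 _ _.
have M1 : 1 <= M by rewrite lerDl.
have M0 : 0 < M by exact: lt_le_trans M1.
pose r := 2 * s / q; have Lr : 0 < L `^ r by rewrite powR_gt0.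
exists (L / M `^ q), (24 * pi * K * L `^ r); split; rewrite ?divr_gt0 ?powR_gt0 ?mulr_gt0// => b ga b0 bM hga.
have Mb : M `^ q <= L / b by rewrite ler_pdivlMr// mulrC -ler_pdivlMr// powR_gt0.
have Lb : 0 < L / b by rewrite divr_gt0.
pose l := (L / b) `^ q^-1; have l0 : 0 < l by rewrite powR_gt0.
have lq : l `^ q = L / b by rewrite -powRrM mulVf ?gt_eqF// powRr1// ltW.
have Ml : M <= l.
  have -> : M = (M `^ q) `^ q^-1 by rewrite -powRrM mulfV ?gt_eqF// powRr1// ltW.
  apply: ge0_ler_powR; rewrite ?nnegrE ?invr_ge0 ?powR_ge0//; exact: ltW.
have l1 : 1 <= l by exact: le_trans Ml.
have splitp (u v : R) : l `^ (u + v) = l `^ u * l `^ v.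
  by rewrite powRD//; apply/implyP => _; rewrite gt_eqF.
set X := l `^ (2 * s); have X1 : 1 <= X.
  by rewrite -(powRr0 l) /X; apply: ler_powR => //; rewrite mulr_ge0// ltW.
have KX1 : 1 <= K * X by rewrite (le_trans K1)// ler_peMr// ltW.
have X0 : 0 < X by exact: lt_le_trans X1.
have /andP[P1 P2] := trunc_itv (le_trans ler01 KX1).
have bla : b * l `^ a = L * X ^+ 2.
  have -> : a = q + (2 * s + 2 * s) by rewrite /q; ring.
  by rewrite splitp (splitp (2 * s)) lq -/X; field; rewrite gt_eqF.
have Xb : X * b `^ r = L `^ r.
  rewrite /X /l -powRrM (_ : q^-1 * (2 * s) = r) -?powRM ?divfK ?gt_eqF ?ltW//.
  by rewrite /r mulrC.
have Pup : (Num.trunc (K * X)).+1%:R <= 2 * (K * X).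
  by rewrite -natr1; lra.
exists l, (Num.trunc (K * X)).+1; split => //.
- have -> : a - 1 = q + - (1 - 4 * s) by rewrite /q; ring.
  rewrite splitp lq powRN mulrA mulrCA mulfV ?gt_eqF// mulr1 ler_pdivrMr ?powR_gt0// mul1r.
  have {1}-> : L = (L `^ (1 - 4 * s)^-1) `^ (1 - 4 * s) by rewrite -powRrM mulVf ?gt_eqF// powRr1// ltW.
  apply: ge0_ler_powR; rewrite ?nnegrE//; [exact: ltW|exact: ltW|].
  by apply: le_trans Ml; rewrite lerDr.
- exact: ltW.
- have -> : e * (b * l `^ a) = (2 * (K * X)) ^+ 2 by rewrite bla /L; field; rewrite gt_eqF.
  by rewrite ler_pXn2r ?nnegrE// ?ler0n// ltW// mulr_gt0// mulr_gt0.
set P := _.+1 in Pup *.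
have br : b `^ (1 + r) = b * b `^ r.
  by rewrite powRD ?powRr1 ?ltW//; apply/implyP => _; rewrite gt_eqF.
rewrite -/q -/r br in hga.
have B0 : 0 <= b * b `^ r / (24 * pi * K * L `^ r).
  by rewrite divr_ge0 ?mulr_ge0 ?powR_ge0// ltW.
apply: (@le_trans _ _ (12 * pi * P%:R * (b * b `^ r / (24 * pi * K * L `^ r)))).
  by rewrite ler_pM2l// mulr_gt0// mulr_gt0.
apply: (@le_trans _ _ (12 * pi * (2 * (K * X)) * (b * b `^ r / (24 * pi * K * L `^ r)))).
  by rewrite ler_wpM2r// ler_pM2l// mulr_gt0.
have br0 : 0 < b `^ r by rewrite powR_gt0.
rewrite -Xb le_eqVlt; apply/orP; left; apply/eqP.
move: (pi : R) pi0 (b `^ r) br0 => u u0 v v0; field.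
by rewrite !gt_eqF.
Qed.

End Focusing.

(** * Focusing functions of unit Sobolev energy *)

Section Single_scale.
Local Open Scope complex_scope.
Context {R : realType}.
Local Notation mu := (@lebesgue_measure R).
Local Notation Re := complex.Re.
Local Notation Im := complex.Im.
Local Notation normc := Normc.normc.
Implicit Types (a s x y z : R) (t : nat -> R) (g : R -> R).

(** The comb lives in [[l, 2 l]], where [1 + xi^2 <= 5 l^2], and [5^s <= 5]. *)
Lemma sweight_comb_le s l (sg de ka : R) n : 0 < s -> s <= 1 -> 1 <= l -> 0 < de -> de < sg ->
  n%:R * sg <= l -> let g xi := ka * comb l sg de n xi in
  L1 (fun xi => sweight s xi * g xi ^+ 2) /\
  Rint (fun xi => sweight s xi * g xi ^+ 2) <= 5 * l `^ (2 * s) * ka ^+ 2 * (n%:R * de).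
Proof.
move=> s0 s1 l1 d0 ds nl g; have [Lc Rc] := @L1_comb R l sg de n d0.
have l0 : 0 < l by exact: lt_le_trans l1.
have sg0 : 0 < sg by exact: lt_trans ds.
have c2 xi : comb l sg de n xi ^+ 2 = comb l sg de n xi.
  by have [->|->] := @comb_01 R l sg de n xi d0 ds; rewrite ?expr0n ?expr1n.
have c0 xi : 0 <= comb l sg de n xi by have [->|->] := @comb_01 R l sg de n xi d0 ds.
have W xi : sweight s xi * g xi ^+ 2 <= 5 * l `^ (2 * s) * ka ^+ 2 * comb l sg de n xi.
  rewrite exprMn c2 mulrA; have [->|/comb_support[p pn /andP[h1 h2]]] := eqVneq (comb l sg de n xi) 0.
    by rewrite !mulr0.
  apply: ler_wpM2r => //; apply: ler_wpM2r; first exact: sqr_ge0.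
  have xi0 : 0 <= xi by apply: le_trans h1; rewrite addr_ge0 ?mulr_ge0 ?(ltW l0) ?(ltW sg0).
  have xi2 : xi <= 2 * l.
    have : p%:R * sg + sg <= n%:R * sg by rewrite -[X in _ + X <= _]mul1r -mulrDl ler_pM2r// natr1 ler_nat.
    lra.
  apply: (@le_trans _ _ ((5 * l ^+ 2) `^ s)).
    rewrite /sweight ger0_norm//; apply: ge0_ler_powR;
      rewrite ?nnegrE ?addr_ge0 ?mulr_ge0 ?sqr_ge0 ?(ltW s0) ?(ltW l0)//.
    have : xi ^+ 2 <= (2 * l) ^+ 2 by rewrite ler_pXn2r ?nnegrE// mulr_ge0// ltW.
    have : 1 <= l ^+ 2 by rewrite expr_ge1// ltW.
    rewrite exprMn; lra.
  rewrite powRM ?sqr_ge0// -powR_mulrn ?(ltW l0)// -powRrM; apply: ler_wpM2r; first exact: powR_ge0.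
  by rewrite -[leRHS]powRr1//; apply: ler_powR => //; lra.
have mg : measurable_fun setT (fun xi => sweight s xi * g xi ^+ 2).
  apply: measurable_funM; first exact: measurable_sweight.
  by apply: measurable_funX; apply: measurable_funM => //; exact: L1_measurable Lc.
have LW : L1 (fun xi => 5 * l `^ (2 * s) * ka ^+ 2 * comb l sg de n xi) by exact: L1Z.
have Lg : L1 (fun xi => sweight s xi * g xi ^+ 2).
  by apply: L1_le LW _ => // xi; rewrite ger0_norm ?W// mulr_ge0 ?sqr_ge0// powR_ge0.
by split => //; rewrite -Rc -RintZ//; exact: le_Rint.
Qed.

Lemma normc_ifourier_evolve_real a (tau : R) g x : L1 g ->
  normc (ifourier (evolve a tau (fun xi => g xi +i* 0)) x) ^+ 2 =
  (2 * pi)^-1 ^+ 2 * osc_sqr a (fun=> tau) g x.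
Proof.
move=> Lg; rewrite normc_ifourier_evolve; last by split => //; exact: L10.
congr (_ * _); rewrite /osc_sqr /oscc /oscs /=.
have E (e : R -> R) : Rint (fun xi => e (phase a (fun=> tau) x xi) * (0 : R)) = 0.
  by rewrite -[RHS]Rint0; apply: eq_Rint => xi; rewrite mulr0.
by rewrite (E sin) (E cos) subr0 addr0.
Qed.

(* Frequencies [l + p sg] are resonant: for every [x] in the unit interval the waves they carry are
   in phase at some time [y] in [[b / 2, b]], and some [t m] is close enough to [y]. *)
Lemma focusing a s t M : 0 < a -> 0 < s -> s < a / 4 -> s < 1 / 4 ->
  (forall n, 0 <= t n) -> (forall m n, (m <= n)%N -> t n <= t m) ->
  t n @[n --> \oo] --> (0 : R) ->
  (forall m n, (m <= n)%N -> t n - t n.+1 <= t m - t m.+1) ->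
  ~ (exists2 c : R, 0 < c & forall n, n.+1%:R * t n `^ (2 * s / (a - 4 * s)) <= c) ->
  exists g N, [/\ L1 g, L1 (fun xi => sweight s xi * g xi ^+ 2),
    Rint (fun xi => sweight s xi * g xi ^+ 2) <= 1 &
    forall x, 0 <= x <= 1 -> exists2 n, (n <= N)%N &
      M <= normc (ifourier (evolve a (t n) (fun xi => g xi +i* 0)) x)].
Proof.
move=> a0 s0 sa s4 t0 td tc gd nw; have pi0 := pi_gt0 R.
set r := 2 * s / (a - 4 * s) in nw *.
have r0 : 0 < r by rewrite divr_gt0 ?mulr_gt0//; lra.
have [tp small] := ex_small_gap r0 t0 td nw.
have [C C0 Ta] := powR_taylor2 a0.
pose de : R := (3 * (1 + a))^-1; have dE : de * (3 * (1 + a)) = 1.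
  by rewrite /de mulVf// gt_eqF// mulr_gt0// addr_gt0.
have d0 : 0 < de by rewrite invr_gt0 mulr_gt0// addr_gt0.
(* Tuned to the final count: the squared modulus is at least [P de / (80 pi^2 l^(2 s))], to be
   compared with [M^2]. *)
pose K : R := 1 + 80 * pi ^+ 2 * M ^+ 2 / de.
have K1 : 1 <= K by rewrite lerDl divr_ge0 ?(ltW d0)// mulr_ge0 ?sqr_ge0// mulr_ge0 ?sqr_ge0.
(* The first bound makes the comb fit into [[l, 2 l]], the second tames the curvature of the
   phase. *)
pose e : R := Num.min (a / (4 * pi)) (a ^+ 2 / (48 * pi ^+ 2 * C)).
have e0 : 0 < e by rewrite lt_min !divr_gt0// !mulr_gt0 ?exprn_gt0.
have [b0 [A [b00 A0 H]]] := scale_choice s0 sa s4 K1 e0; rewrite -/r in H.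
have [n0 Hn0] : exists n0, forall n, (n0 <= n)%N -> t n <= b0.
  have /cvgrPdist_le/(_ b0 b00)[n0 _ h] := tc; exists n0 => n hn.
  by have := h n hn; rewrite sub0r normrN ger0_norm.
have [n nn gap] := small A n0 A0.
have [N1 HN1] : exists N1, forall k, (N1 <= k)%N -> t k <= t n / 2.
  have tn2 : 0 < t n / 2 by rewrite divr_gt0.
  have /cvgrPdist_le/(_ _ tn2)[N1 _ h] := tc; exists N1 => k hk.
  by have := h k hk; rewrite sub0r normrN ger0_norm.
have [l [P [l1 bl KP Pe Pg]]] := H (t n) (t n - t n.+1) (tp n) (Hn0 n nn) gap.
have l0 : 0 < l by exact: lt_le_trans l1.
have X0 : 0 < l `^ (2 * s) by rewrite powR_gt0.
have P0 : 0 < P%:R :> R by apply: lt_le_trans KP; rewrite mulr_gt0// (lt_le_trans _ K1).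
have P1 : 1 <= P%:R :> R by move: P0; rewrite ltr0n ler1n.
have m0 : 0 < l `^ (a - 1) by rewrite powR_gt0.
have bla0 : 0 < t n * l `^ a by rewrite mulr_gt0// powR_gt0.
pose sg := 4 * pi / (a * t n * l `^ (a - 1)).
have sg0 : 0 < sg by rewrite divr_gt0 ?mulr_gt0.
have lE : l `^ a = l `^ (a - 1) * l.
  rewrite -[X in _ = _ * X]powRr1 ?(ltW l0)// -powRD; last by apply/implyP => _; rewrite gt_eqF.
  by rewrite subrK.
have Psl : P%:R * sg <= l.
  have : P%:R <= a / (4 * pi) * (t n * l `^ a).
    apply: le_trans (_ : P%:R ^+ 2 <= _); first by rewrite expr2 ler_peMl// ltW.
    by apply: (le_trans Pe); rewrite ler_pM2r// ge_min lexx.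
  rewrite lE => h; have -> : l = a / (4 * pi) * (t n * (l `^ (a - 1) * l)) * sg.
    by rewrite /sg; move: (pi : R) pi0 (l `^ _) m0 => u u0 v v0; field; rewrite !gt_eqF.
  by rewrite ler_pM2r.
have curv : 48 * pi ^+ 2 * C * P%:R ^+ 2 <= a ^+ 2 * (t n * l `^ a).
  have q0 : 0 < 48 * pi ^+ 2 * C by rewrite !mulr_gt0// exprn_gt0.
  rewrite -ler_pdivlMl//; set Y := t n * _ in Pe bla0 *.
  rewrite [leRHS]mulrA [_^-1 * _]mulrC; apply: (le_trans Pe).
  by rewrite ler_pM2r// ge_min lexx orbT.
have ds : de < sg.
  have E : sg * (a * (t n * l `^ (a - 1))) = 4 * pi.
    by rewrite /sg; move: (pi : R) (l `^ _) m0 => u v v0; field; rewrite !gt_eqF ?tp.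
  rewrite -(ltr_pM2r a0); have : sg * (a * (t n * l `^ (a - 1))) <= sg * a.
    by rewrite ler_pM2l// ler_piMr// ltW.
  have := pi_ge2 R; rewrite E; lra.
have Pd : 0 < P%:R * de by rewrite mulr_gt0.
(* Normalises the Sobolev energy of the comb to at most 1. *)
pose ka := Num.sqrt (5 * l `^ (2 * s) * (P%:R * de))^-1.
have q0 : 0 < 5 * l `^ (2 * s) * (P%:R * de) by rewrite !mulr_gt0.
have ka2 : ka ^+ 2 = (5 * l `^ (2 * s) * (P%:R * de))^-1 by rewrite sqr_sqrtr// invr_ge0 ltW.
have s1 : s <= 1 by lra.
have [Lw Rw] := @sweight_comb_le s l sg de ka P s0 s1 l1 d0 ds Psl.
have [Lc _] := @L1_comb R l sg de P d0.
exists (fun xi => ka * comb l sg de P xi), (maxn n N1); split => //.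
- exact: L1Z.
- apply: (le_trans Rw); rewrite ka2 le_eqVlt; apply/orP; left; apply/eqP.
  by field; rewrite !gt_eqF.
move=> x x01; have g0 : 0 <= t n - t n.+1 by rewrite subr_ge0 td.
have [m mN hm] := @comb_osc_ge R a C l (t n) sg de (t n - t n.+1) ka x P n (maxn n N1) t a0 (tp n)
   (fun z => Ta l z l0) l0 bl C0 x01 erefl dE Psl curv Pg t0 (leq_maxl _ _) erefl
   (HN1 _ (leq_maxr _ _)) (fun k nk => gd n k nk) g0 (sqrtr_ge0 _).
exists m => //; have [M0|/ltW M0] := leP 0 M; last by apply: (le_trans M0); exact: normc_ge0.
rewrite -(@ler_pXn2r _ 2)// ?nnegrE ?normc_ge0// normc_ifourier_evolve_real; last exact: L1Z.
apply: le_trans (_ : (2 * pi)^-1 ^+ 2 * (ka * (P%:R * de) / 2) ^+ 2 <= _); last first.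
  by rewrite ler_pM2l// exprn_gt0// invr_gt0 mulr_gt0.
have -> : (2 * pi)^-1 ^+ 2 * (ka * (P%:R * de) / 2) ^+ 2 = P%:R * de / (80 * pi ^+ 2 * l `^ (2 * s)).
  rewrite -[in RHS]mulrA; have : (2 * pi)^-1 ^+ 2 * (ka * (P%:R * de) / 2) ^+ 2 =
    (2 * pi)^-1 ^+ 2 * (ka ^+ 2 * (P%:R * de / 2) ^+ 2) by ring.
  by move=> ->; rewrite ka2; move: (pi : R) pi0 => u u0; field; rewrite !gt_eqF.
rewrite ler_pdivlMr ?mulr_gt0 ?exprn_gt0//.
apply: le_trans (_ : K * l `^ (2 * s) * de <= _); last by rewrite ler_pM2r.
have -> : K * l `^ (2 * s) * de = l `^ (2 * s) * de + M ^+ 2 * (80 * pi ^+ 2 * l `^ (2 * s)).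
  by rewrite /K; move: (pi : R) (l `^ _) => u v; field; rewrite gt_eqF.
by rewrite lerDr mulr_ge0// ltW.
Qed.

End Single_scale.

(** * Unbounded means from a gliding hump *)

Section Gliding_hump.
Local Open Scope complex_scope.
Context {R : realType}.
Local Notation mu := (@lebesgue_measure R).
Local Notation C := (R[i]).
Local Notation Re := complex.Re.
Local Notation Im := complex.Im.
Local Notation normc := Normc.normc.
Implicit Types (a s x : R) (t : nat -> R) (g : R -> R) (f : nat -> R -> R) (c : nat -> R).

(** The remainder after step [J] has to be compared with [c J ^+ 2] itself, which may be far below
    [4^(-J)]. So [fast_cauchy_L2] is applied, for each [J], to the tail of the sequence divided by
    [c J], and the limits are identified almost everywhere. *)
Lemma geometric_cauchy_L2 f c : (forall j, L2 (f j)) -> (forall j, 0 < c j) ->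
  (forall j, c j.+1 <= c j / 2) ->
  (forall j, Rint (fun x => (f j.+1 x - f j x) ^+ 2) <= c j ^+ 2) ->
  exists2 F : R -> R, L2 F & forall j, Rint (fun x => (F x - f j x) ^+ 2) <= 4 * c j ^+ 2.
Proof.
move=> Lf c0 ch Hf.
have cJ J k : c (J + k)%N <= c J * 2^-1 ^+ k.
  elim: k => [|k IH]; first by rewrite addn0 mulr1.
  by rewrite addnS exprSr mulrA; apply: (le_trans (ch _)); rewrite ler_pM2r.
have lim J : exists F : R -> R, [/\ measurable_fun setT F,
    {ae mu, forall x, (c J)^-1 * f (J + j)%N x @[j --> \oo] --> F x},
    L2 (fun x => F x - (c J)^-1 * f J x) &
    Rint (fun x => (F x - (c J)^-1 * f J x) ^+ 2) <= 4].
  have [||F [mF cF HF]] := @fast_cauchy_L2 R (fun j x => (c J)^-1 * f (J + j)%N x).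
  - by move=> j; exact: L2Z.
  - move=> j; rewrite (@eq_Rint _ _ (fun x => (c J)^-1 ^+ 2 * (f (J + j).+1 x - f (J + j)%N x) ^+ 2)).
      rewrite RintZ; last by case: (L2B (Lf (J + j).+1) (Lf (J + j)%N)).
      apply: le_trans (_ : (c J)^-1 ^+ 2 * (c J * 2^-1 ^+ j) ^+ 2 <= _).
        rewrite ler_pM2l ?exprn_gt0 ?invr_gt0//; apply: (le_trans (Hf _)).
        rewrite ler_pXn2r ?nnegrE ?cJ//; first exact: ltW.
        by rewrite mulr_ge0 ?exprn_ge0// ltW.
      rewrite exprMn mulrA -exprMn mulVf ?gt_eqF// expr1n mul1r -exprM mulnC exprM.
      by rewrite (_ : 2^-1 ^+ 2 = 4^-1 :> R)// exprVn; congr (_^-1); rewrite -natrX.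
    by move=> x; rewrite addnS; ring.
  by exists F; have [] := HF 0; rewrite addn0 expr0 mulr1.
have [F [mF cF LF _]] := lim 0.
exists (fun x => c 0 * F x).
  have -> : (fun x => c 0 * F x) = fun x => c 0 * (F x - (c 0)^-1 * f 0 x) + f 0 x.
    by apply/funext => x; rewrite mulrBr mulrA mulfV ?gt_eqF// mul1r subrK.
  by apply: L2D => //; exact: L2Z.
move=> J; have [FJ [mFJ cFJ LFJ HFJ]] := lim J.
have E : {ae mu, forall x, c 0 * F x = c J * FJ x}.
  apply: ae_imp (ae_and cF cFJ) => x [h h'].
  have {}h : f j x @[j --> \oo] --> c 0 * F x.
    rewrite (_ : (fun j => f j x) = (fun j => c 0 * ((c 0)^-1 * f (0 + j)%N x))).
      by apply: cvgM h; exact: cvg_cst.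
    by apply/funext => j; rewrite mulrA mulfV ?gt_eqF// mul1r.
  have {}h' : f (J + j)%N x @[j --> \oo] --> c J * FJ x.
    rewrite (_ : (fun j => f (J + j)%N x) = (fun j => c J * ((c J)^-1 * f (J + j)%N x))).
      by apply: cvgM h'; exact: cvg_cst.
    by apply/funext => j; rewrite mulrA mulfV ?gt_eqF// mul1r.
  apply: cvg_unique _ h' => //.
  rewrite (_ : (fun j => f (J + j)%N x) = (fun j => f (j + J)%N x)); last by apply/funext => j; rewrite addnC.
  have : [sequence f (j + J)%N x]_j @ \oo --> c 0 * F x by rewrite (cvg_shiftn J (fun j => f j x)).
  by [].
have mfJ : measurable_fun setT (f J) by case: (Lf J).
rewrite (@ae_eq_Rint _ _ (fun x => c J ^+ 2 * (FJ x - (c J)^-1 * f J x) ^+ 2)).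
- by rewrite RintZ ?LFJ.2// mulrC ler_pM2r ?exprn_gt0.
- by apply: measurable_funX; apply: measurable_funB => //; exact: measurable_funM.
- by apply: measurable_funM => //; apply: measurable_funX; apply: measurable_funB => //; exact: measurable_funM.
by apply: ae_imp E => x ->; rewrite -exprMn mulrBr [in RHS]mulrA mulfV ?gt_eqF// mul1r.
Qed.

Lemma sL2_real s g : measurable_fun setT g -> L1 (fun xi => sweight s xi * g xi ^+ 2) ->
  sL2 s (fun xi => g xi +i* 0) /\
  senergy s (fun xi => g xi +i* 0) = Rint (fun xi => sweight s xi * g xi ^+ 2).
Proof.
move=> mg Lg; have E : (fun xi => sweight s xi * normc (g xi +i* 0) ^+ 2) = fun xi => sweight s xi * g xi ^+ 2.
  by apply/funext => xi; rewrite normc_sqr expr0n addr0.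
by rewrite /sL2 /senergy E.
Qed.

(* One adds up multiples of focusing functions; the sum before step [j] is dominated by the [j]-th
   multiple, and the multiples after it are so small that the energy bound, applied at the finitely
   many times up to [Ns (M j)], makes them harmless off a small set. *)
Lemma gliding_hump a s t (gs : R -> R -> R) (Ns : R -> nat) : 0 <= s ->
  (forall M, [/\ L1 (gs M), L1 (fun xi => sweight s xi * gs M xi ^+ 2),
    Rint (fun xi => sweight s xi * gs M xi ^+ 2) <= 1 &
    forall x, 0 <= x <= 1 -> exists2 n, (n <= Ns M)%N &
      M <= normc (ifourier (evolve a (t n) (fun xi => gs M xi +i* 0)) x)]) ->
  exists G, sL2 s G /\ {ae mu, forall x, 0 <= x <= 1 -> forall B : R,
    exists n, B < normc (ifourier2 (evolve a (t n) G) x)}.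
Proof.
move=> s0 H.
(* Chosen so that [c j * M j] equals [j + 2] plus the L1 norm of the partial sum: the hump then
   exceeds that partial sum, and a remainder of size 1, by [j + 1]. *)
pose height (j : nat) (u : (R -> R) * R) : R := (j%:R + 2 + Rint (fun xi => `|u.1 xi|)) / u.2.
(* The next coefficient is divided by twice the number of times in play, so that the exceptional
   sets of all these times together stay small. *)
pose step j (u : (R -> R) * R) : (R -> R) * R :=
  (fun xi => u.2 * gs (height j u) xi + u.1 xi, u.2 / (2 * (Ns (height j u)).+1%:R)).
pose st := fix st j := if j is i.+1 then step i (st i) else (fun=> 0 : R, 1 : R).
pose F j := (st j).1; pose c j := (st j).2; pose M j := height j (st j).
have FS j xi : F j.+1 xi = c j * gs (M j) xi + F j xi by [].
have cS j : c j.+1 = c j / (2 * (Ns (M j)).+1%:R) by [].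
have c0 j : 0 < c j by elim: j => // j IH; rewrite cS divr_gt0// mulr_gt0// ltr0n.
have ch j : c j.+1 <= c j / 2.
  rewrite cS ler_pM2l// lef_pV2 ?posrE ?mulr_gt0 ?ltr0n//.
  by rewrite ler_peMr// ler1n.
have c4 j : c j ^+ 2 <= 4^-1 ^+ j.
  elim: j => [|j IH]; first by rewrite expr0 expr1n.
  apply: (@le_trans _ _ ((c j / 2) ^+ 2)); first by rewrite ler_pXn2r ?nnegrE ?ch ?(ltW (c0 _)) ?divr_ge0 ?(ltW (c0 _)).
  have q : 2^-1 ^+ 2 = 4^-1 :> R by rewrite exprVn -natrX.
  have e4 : 4^-1 ^+ j.+1 = 4^-1 ^+ j * 4^-1 :> R by rewrite exprSr.
  by rewrite e4 exprMn q ler_pM2r.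
(* With the square root of the Sobolev weight as a factor, weighted energies become plain L2
   norms. *)
pose w : R -> R := sweight (s / 2).
have base0 (xi : R) : 0 < 1 + `|xi| ^+ 2 by rewrite ltr_pwDl// sqr_ge0.
have w2 xi : w xi ^+ 2 = sweight s xi by rewrite /w /sweight -powR_mulrn ?powR_ge0// -powRrM divfK.
have w0 xi : 0 < w xi by rewrite powR_gt0.
have mw : measurable_fun setT w by exact: measurable_sweight.
have Lwg m : L2 (fun xi => w xi * gs m xi).
  have [L1g Lw _ _] := H m; split; first by apply: measurable_funM => //; exact: L1_measurable.
  by move: Lw; congr L1; apply/funext => xi; rewrite exprMn w2.
have LF j : L1 (F j) by elim: j => [|j IH]; [exact: L10|apply: L1D => //; apply: L1Z; case: (H (M j))].
have LwF j : L2 (fun xi => w xi * F j xi).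
  elim: j => [|j IH].
    by have := L2Z 0 (Lwg 0); congr L2; apply/funext => xi; rewrite mulr0 mul0r.
  have := L2D (L2Z (c j) (Lwg (M j))) IH; congr L2; apply/funext => xi.
  by rewrite FS mulrDr mulrCA.
have [|Fw LFw HFw] := @geometric_cauchy_L2 (fun j xi => w xi * F j xi) c LwF c0 ch.
  move=> j; have [_ Lw Rw _] := H (M j).
  rewrite (@eq_Rint _ _ (fun xi => c j ^+ 2 * (sweight s xi * gs (M j) xi ^+ 2))).
    by rewrite RintZ// ler_piMr// sqr_ge0.
  by move=> xi; rewrite FS -w2 mulrDr addrK; ring.
pose D j xi := (w xi)^-1 * Fw xi - F j xi.
have mF j : measurable_fun setT (F j) by exact: L1_measurable.
have mV : measurable_fun setT (fun xi => (w xi)^-1).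
  have -> : (fun xi => (w xi)^-1) = sweight (- (s / 2)) by apply/funext => xi; rewrite /w /sweight powRN.
  exact: measurable_sweight.
have mD j : measurable_fun setT (D j).
  by apply: measurable_funB => //; apply: measurable_funM => //; case: LFw.
have DE j xi : sweight s xi * D j xi ^+ 2 = (Fw xi - w xi * F j xi) ^+ 2.
  rewrite /D -w2 -exprMn mulrBr mulrA mulfV ?mul1r// gt_eqF//.
have LD j : L1 (fun xi => sweight s xi * D j xi ^+ 2).
  by have [_] := L2B LFw (LwF j); congr L1; apply/funext => xi; rewrite DE.
pose Fc j xi := F j xi +i* (0 : R); pose Dc j xi := D j xi +i* (0 : R).
have sD j : sL2 s (Dc j) /\ senergy s (Dc j) <= 4 * c j ^+ 2.
  have [LDj ->] := sL2_real (mD j) (LD j); split => //.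
  by rewrite (@eq_Rint _ _ (fun xi => (Fw xi - w xi * F j xi) ^+ 2)).
have cD j := sL2_cL2 s0 (sD j).1.
have cF j : cL2 (Fc j).
  apply: (sL2_cL2 s0); apply: (sL2_real (mF j) _).1.
  by have [_] := LwF j; congr L1; apply/funext => xi; rewrite exprMn w2.
have c1F j : cL1 (Fc j) by split; [exact: LF|exact: L10].
pose G xi := ((w xi)^-1 * Fw xi) +i* (0 : R).
have GE j : G = fun xi => Fc j xi + Dc j xi.
  by apply/funext => xi; apply: complex_ext; rewrite ?cReD ?cImD /= ?addr0// /D addrC subrK.
have sG : sL2 s G.
  have -> : G = Dc 0 by apply/funext => xi; rewrite /G /Dc /D subr0.
  exact: (sD 0).1.
exists G; split => //.
have dec : {ae mu, forall x, forall j n, ifourier2 (evolve a (t n) G) x =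
    ifourier (evolve a (t n) (Fc j)) x + ifourier2 (evolve a (t n) (Dc j)) x}.
  apply: ae_forall => j; apply: ae_forall => n.
  have E : evolve a (t n) G = fun xi => evolve a (t n) (Fc j) xi + evolve a (t n) (Dc j) xi.
    by apply/funext => xi; rewrite (GE j) /evolve -mulrDr.
  have h1 := ifourier2D (cL2_evolve a (t n) (cF j)) (cL2_evolve a (t n) (cD j)); rewrite -E in h1.
  have h2 := ifourier2_ifourier (cL1_evolve a (t n) (c1F j)) (cL2_evolve a (t n) (cF j)).
  by apply: ae_imp (ae_and h1 h2) => x [-> ->].
(* Points where the humps after the [j]-th one add up, at time [t n], to more than 1. *)
pose bad j n := [set x | 1 < normc (ifourier2 (evolve a (t n) (Dc j.+1)) x)].
have bad_small j n : measurable (bad j n) /\ (mu (bad j n) <= (4 * c j.+1 ^+ 2)%:E)%E.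
  have [LI EI _] := ifourier2_L2 (cL2_evolve a (t n) (cD j.+1)).
  have [mB hB] := markov_normc LI ltr01; split => //; apply: (le_trans hB).
  rewrite expr1n divr1 lee_fin; apply: (le_trans EI); rewrite energy_evolve//.
  exact: le_trans (energy_le_senergy s0 (sD j.+1).1) (sD j.+1).2.
pose E j := \big[setU/set0]_(n < (Ns (M j)).+1) bad j n.
have mE j : measurable (E j) by apply: bigsetU_measurable => n _; exact: (bad_small j n).1.
have muE j : (mu (E j) <= (4^-1 ^+ j)%:E)%E.
  apply: le_trans (_ : (\sum_(n < (Ns (M j)).+1) (4 * c j.+1 ^+ 2)%:E)%E <= _)%E.
    apply: le_trans (Boole_inequality _ _) _ => [n _|]; first exact: (bad_small j n).1.
    by apply: lee_sum => n _; exact: (bad_small j n).2.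
  rewrite sumEFin lee_fin; apply: le_trans (c4 j).
  have -> : \sum_(n < (Ns (M j)).+1) 4 * c j.+1 ^+ 2 = 4 * c j.+1 ^+ 2 * (Ns (M j)).+1%:R.
    by rewrite sumr_const card_ord mulr_natr.
  have N1 : 1 <= (Ns (M j)).+1%:R :> R by rewrite ler1n.
  rewrite cS; move: (_.+1%:R) N1 (c j) (c0 j) => u u1 v v0.
  have u0 : 0 < u by exact: lt_le_trans u1.
  have -> : 4 * (v / (2 * u)) ^+ 2 * u = v ^+ 2 / u by field; rewrite gt_eqF.
  by rewrite ler_pdivrMr// ler_peMr// sqr_ge0.
(* The measures of the sets [E j] tend to 0, so almost every [x] avoids [E j] for arbitrarily large
   [j]; a single such [j] serves a given [B]. *)
have null : {ae mu, forall x, forall m, exists j, (m <= j)%N /\ ~ E j x}.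
  apply: ae_forall => m; exists (\bigcap_K E (m + K)%N); split.
  - by apply: bigcapT_measurable => K; exact: mE.
  - apply: null_bigcap => // e e0.
    have q1 : `|4^-1 : R| < 1 by rewrite ger0_norm ?invr_ge0// invf_lt1// ltr1n.
    have /cvgrPdist_lt/(_ e e0)[K _ HK] := cvg_expr q1.
    exists K; apply: (le_trans (muE _)); rewrite lee_fin; apply/ltW.
    have := HK (m + K)%N (leq_addl _ _); rewrite sub0r normrN ger0_norm// exprn_ge0// invr_ge0//.
  - move=> x /= h K _; apply: contrapT => nE; apply: h; exists (m + K)%N; split => //; exact: leq_addr.
apply: ae_imp (ae_and dec null) => x [dx nx] x01 B.
have [j [mj nE]] := nx (Num.trunc `|B|).+1.
have jB : B < j.+1%:R.
  have /andP[_ hB] := trunc_itv (normr_ge0 B).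
  apply: le_lt_trans (ler_norm B) _; apply: (lt_trans hB).
  by rewrite ltr_nat.
have [_ _ _ /(_ x x01)[n nN hn]] := H (M j).
exists n; apply: (lt_le_trans jB); rewrite (dx j.+1 n).
have {}nE : normc (ifourier2 (evolve a (t n) (Dc j.+1)) x) <= 1.
  rewrite leNgt; apply/negP => h; apply: nE; rewrite /E -bigcup_mkord.
  by exists n => //=; rewrite ltnS.
have Fx : ifourier (evolve a (t n) (Fc j.+1)) x =
    (c j)%:C * ifourier (evolve a (t n) (fun xi => gs (M j) xi +i* 0)) x + ifourier (evolve a (t n) (Fc j)) x.
  have [Lg _ _ _] := H (M j).
  have c1g : cL1 (fun xi => gs (M j) xi +i* 0) by split; [exact: Lg|exact: L10].
  have := ifourier_lin (c j)%:C (cL1_evolve a (t n) c1g) (cL1_evolve a (t n) (c1F j)).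
  move=> /(congr1 (fun h => h x)) <-; congr (ifourier _ x); apply/funext => xi.
  rewrite /evolve mulrCA -mulrDr; congr (_ * _).
  by apply: complex_ext; rewrite ?cReD ?cImD ?cReM ?cImM /= ?FS; ring.
have Fsmall : normc (ifourier (evolve a (t n) (Fc j)) x) <= Rint (fun xi => `|F j xi|).
  have I0 : 0 <= Rint (fun xi => `|F j xi|) by exact: Rint_ge0.
  rewrite -(@ler_pXn2r _ 2)// ?nnegrE ?normc_ge0// normc_ifourier_evolve_real//.
  have h := @osc_sqr_le R a (fun=> t n) (F j) x (measurable_cst _) (LF j).
  have p2 : (2 * (pi : R))^-1 ^+ 2 <= 2^-1.
    have := pi_ge2 R => pi2; rewrite exprVn lef_pV2 ?posrE ?exprn_gt0 ?mulr_gt0//; last exact: lt_le_trans pi2.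
    nra.
  apply: le_trans (_ : 2^-1 * (2 * Rint (fun xi => `|F j xi|) ^+ 2) <= _); last by rewrite mulrA mulVf ?mul1r.
  by apply: ler_pM => //; [exact: sqr_ge0|exact: osc_sqr_ge0].
have big : c j * M j <= normc ((c j)%:C * ifourier (evolve a (t n) (fun xi => gs (M j) xi +i* 0)) x).
  have cn : normc (c j)%:C = c j by rewrite /Normc.normc /= expr0n addr0 sqrtr_sqr gtr0_norm.
  by rewrite Normc.normcM cn ler_pM2l.
have cM : c j * M j = j%:R + 2 + Rint (fun xi => `|F j xi|) by rewrite /M /height -/(c j) mulrC divfK ?gt_eqF.
rewrite Fx; move: big Fsmall nE; rewrite cM.
move: ((c j)%:C * _) (ifourier (evolve a (t n) (Fc j)) x) (ifourier2 _ x) (Rint _) => z1 z2 z3 I h1 h2 h3.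
have T (u v : C) : normc u - normc v <= normc (u + v).
  by rewrite lerBlDr -{1}(addrK v u) -(normcN v); exact: normcD_le.
have := T (z1 + z2) z3; have := T z1 z2; rewrite -natr1; lra.
Qed.

Lemma cvg_complex_bounded (u : nat -> C) (z : C) : (u n : C^o) @[n --> \oo] --> (z : C^o) ->
  exists B : R, forall n, normc (u n) <= B.
Proof.
move=> /cvgrPdist_lt/(_ 1 ltr01)[N _ HN].
exists (running_max (fun n => normc (u n)) N + (normc z + 1)) => n.
have r0 : 0 <= running_max (fun n => normc (u n)) N.
  by have [m _ ->] := running_max_attained (fun n => normc (u n)) N; exact: normc_ge0.
have z0 := normc_ge0 z.
have [nN|Nn] := leqP n N.
  by have := @running_max_ge R (fun n => normc (u n)) N n nN => /= h; lra.
have := HN n (ltnW Nn); rewrite normc_normr (_ : 1 = (1%:R)%:C)// ltcR => h.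
have : normc (u n) <= normc z + normc (u n - z) by rewrite -{1}(subrK z (u n)) addrC; exact: normcD_le.
have : normc (z - u n) = normc (u n - z) by rewrite -(normcN (z - u n)) opprB.
lra.
Qed.

(** Were the weak [ell^r] bound to fail, the constructed function would have means that are
    unbounded almost everywhere on [[0, 1]], while convergent sequences are bounded; so [[0, 1]]
    would be null. *)
Lemma weak_of_pointwise a s t : 0 < a -> 0 < s -> s < a / 4 -> s < 1 / 4 ->
  (forall n, 0 <= t n) -> (forall m n, (m <= n)%N -> t n <= t m) ->
  t n @[n --> \oo] --> (0 : R) ->
  (forall m n, (m <= n)%N -> t n - t n.+1 <= t m - t m.+1) ->
  (forall f : distribution_on R, sobolev s f -> {ae mu, forall x : R,
    (schrodinger a f x (t n) : C^o) @[n --> \oo] --> (fun_of_dist f x : C^o)}) ->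
  exists2 c : R, 0 < c & forall n, n.+1%:R * t n `^ (2 * s / (a - 4 * s)) <= c.
Proof.
move=> a0 s0 sa s4 t0 td tc gd pw; apply: contrapT => nw.
have /choice[gN HgN] M : exists gN : (R -> R) * nat,
   [/\ L1 gN.1, L1 (fun xi => sweight s xi * gN.1 xi ^+ 2),
    Rint (fun xi => sweight s xi * gN.1 xi ^+ 2) <= 1 &
    forall x, 0 <= x <= 1 -> exists2 n, (n <= gN.2)%N &
      M <= normc (ifourier (evolve a (t n) (fun xi => gN.1 xi +i* 0)) x)].
  by have [g [N h]] := focusing M a0 s0 sa s4 t0 td tc gd nw; exists (g, N).
have [G [LG unb]] := gliding_hump (ltW s0) HgN.
have [Sf _ _] := sobolev_of_fhat (ltW s0) LG.
have null : {ae mu, forall x, ~ (0 <= x <= 1)}.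
  apply: ae_imp (ae_and unb (pw _ Sf)) => x [h cv] x01.
  have [B HB] := cvg_complex_bounded cv; have [n] := h x01 B.
  have E := congr1 (fun h => h x) (schrodinger_of_fhat a (t n) (ltW s0) LG).
  by rewrite /= in E; rewrite -E ltNge HB.
have : mu `[0, 1]%classic = 0%E.
  apply: measure_negligible => //; apply: negligibleS null => x /=.
  by rewrite in_itv /= => h; apply.
by rewrite lebesgue_measure_itv/= lte_fin ltr01 oppr0 adde0 => /eqP; rewrite eqe oner_eq0.
Qed.

End Gliding_hump.

Theorem theorem1p1 (R : realType) (a s : R) (t : nat -> R)
  (a_gt0 : 0 < a) (a_neq1 : a <> 1)
  (s_gt0 : 0 < s) (s_lt : s < Num.min (a / 4) (1 / 4))
  (t_decr : forall m n : nat, (m <= n)%N -> t n <= t m)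
  (t_cvg0 : t n @[n --> \oo] --> (0 : R))
  (dt_decr : forall m n : nat, (m <= n)%N ->
     t n - t n.+1 <= t m - t m.+1) :
  [<->
    weak_ell (2 * s / (a - 4 * s)) t;

    exists C1 : R, forall (f : distribution_on R) (B : set R)
        (mB : measurable B),
      sobolev s f -> diam_le1 B ->
      ('N[mrestr (@lebesgue_measure R) mB]_2%:E[schrodinger_max a t f]
         <= C1%:E * sobolev_norm s f)%E;

    exists C2 : R, forall (f : distribution_on R) (B : set R) (alpha : R),
      sobolev s f -> measurable B -> diam_le1 B -> 0 < alpha ->
      (@lebesgue_measure R
         (B `&` [set x | alpha%:E < schrodinger_max a t f x])
         <= (C2 * alpha ^- 2)%:E * sobolev_norm s f ^+ 2)%E;

    forall f : distribution_on R, sobolev s f ->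
      {ae @lebesgue_measure R, forall x : R,
        (schrodinger a f x (t n) : R[i]^o) @[n --> \oo]
          --> (fun_of_dist f x : R[i]^o)} ].
Proof.
have a1 : a != 1 by exact/eqP.
have [sa s4] : s < a / 4 /\ s < 1 / 4 by move: s_lt; rewrite lt_min => /andP[].
(* A decreasing sequence stays above its limit. *)
have t0 n : 0 <= t n.
  rewrite leNgt; apply/negP => tn; have tn0 : 0 < - t n by rewrite oppr_gt0.
  have /cvgrPdist_lt/(_ _ tn0)[N _ /(_ (maxn n N) (leq_maxr _ _))] := t_cvg0.
  rewrite /= sub0r normrN ltNge => /negP; apply.
  have h := t_decr n (maxn n N) (leq_maxl _ _).
  by rewrite ler0_norm ?lerN2// (le_trans h)// ltW.
have r0 : 0 < 2 * s / (a - 4 * s) by rewrite divr_gt0 ?mulr_gt0//; lra.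
have s0 := ltW s_gt0.
tfae.
- move=> /(weak_ellP r0 t0 t_decr)[c c0 tc].
  have [Cm Cm0 H] := maximal_inequality a_gt0 a1 s_gt0 sa s4 t0 tc c0.
  exists (Num.sqrt Cm) => f B mB Sf dB.
  have [_ m2] := measurable_schrodinger_max a t s0 Sf.
  exact: (strong_of_integral mB s0 Cm0 Sf m2 (H f B Sf mB dB)).
- move=> [C1 H]; exists (C1 ^+ 2) => f B alpha Sf mB dB al.
  exact: (weak_of_strong s0 Sf al (H f B mB Sf dB)).
- move=> [C2 H] f Sf; exact: (pointwise_of_weak s0 t_cvg0 H Sf).
- move=> H; apply/(weak_ellP r0 t0 t_decr).
  exact: (weak_of_pointwise a_gt0 s_gt0 sa s4 t0 t_decr t_cvg0 dt_decr H).
Qed.
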